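(* Let $r_2,r_4\in\mathbb{Q}$ satisfy $$0\le-2r_2-5r_4<8,\qquad 0\le-r_4<8,\qquad(-2r_2-5r_4)+(-r_4)>8.$$ Let $D\in\mathbb{Z}_{\ge1}$ with $Dr_2,Dr_4\in2\mathbb{Z}$, let $\chi:\widetilde{\Gamma_0(4)}^D\to\mathbb{C}^\times$ be the character of $\eta(\tau)^{-2r_2-4r_4}\eta(2\tau)^{r_2}\eta(4\tau)^{r_4}$, $k=\frac12(-r_2-3r_4)$, and $$E_{I,k}(\tau;r_2,r_4)=\sum_{\gamma\in\langle\widetilde T\rangle\backslash\widetilde{\Gamma_0(4)}^D}\chi(\gamma)^{-1}\cdot(1|_k\gamma)(\tau).$$ Then $$\eta(\tau)^{-2r_2-4r_4}\eta(2\tau)^{r_2}\eta(4\tau)^{r_4}=\frac1{2D}E_{I,k}(\tau;r_2,r_4).$$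
   Context: $e(x)=\exp(2\pi ix)$, $q=e(\tau)$; $z^r=\exp(r\log z)$ with $-\pi<\operatorname{Im}\log z\le\pi$. $\widetilde{\Gamma_0(4)}^D$ is the group of pairs $(\gamma,\varepsilon(c\tau+d)^{1/D})$, $\gamma=\begin{pmatrix}a&b\\c&d\end{pmatrix}\in\Gamma_0(4)$, $\varepsilon^D=1$, with product $(\gamma_1,\phi_1)(\gamma_2,\phi_2)=(\gamma_1\gamma_2,\phi_1(\gamma_2\tau)\phi_2(\tau))$; $\widetilde\gamma=(\gamma,(c\tau+d)^{1/D})$; $T=\begin{pmatrix}1&1\\0&1\end{pmatrix}$; $(f|_k(\gamma,\phi))(\tau)=\phi(\tau)^{-Dk}f(\gamma\tau)$, so $1|_k(\gamma,\phi)=\phi^{-Dk}$. $\eta(\tau)=q^{1/24}\prod(1-q^n)$, $\eta(n\tau)^r=\exp(r\log\eta(n\tau))$ with $\log\eta(\tau)=\log\eta(i)+\int_i^\tau\eta'/\eta$, $\log\eta(i)$ real. Dedekind sum $s(h,c)=\sum_{r\bmod c}((r/c))((hr/c))$, $((x))=x-\lfloor x\rfloor-\frac12$ ($x\notin\mathbb{Z}$), $0$ otherwise; $\Psi\begin{pmatrix}a&b\\c&d\end{pmatrix}=\frac{a+d}c+12s(-d,c)-3$ ($c>0$), $\frac{a+d}c+12s(d,-c)+3$ ($c<0$), $b$ ($c=0,a>0$), $-b-6$ ($c=0,a<0$). Character of $\prod_{n\mid N}\eta(n\tau)^{r_n}$ ($Dr_n\in 2\mathbb{Z}$, $k_0=\frac12\sum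 r_n$): $\chi(\gamma,\varepsilon(c\tau+d)^{1/D})=\varepsilon^{-Dk_0}e\big(\frac1{24}\sum_{n\mid N}r_n\Psi\begin{pmatrix}a&bn\\c/n&d\end{pmatrix}\big)$. *)

(* Defs.v *)
From Stdlib Require Import Reals ZArith QArith Qreals List.
From Coquelicot Require Import Coquelicot.
Open Scope R_scope.

Definition cexp (z : C) : C :=
  (exp (Re z) * cos (Im z), exp (Re z) * sin (Im z)).

(* principal argument in (-pi, pi]  (atan2) *)
Definition carg (z : C) : R :=
  let x := Re z in let y := Im z in
  match Rlt_dec 0 x with
  | left _ => atan (y / x)
  | right _ =>
    match Rlt_dec x 0 with
    | left _ => match Rle_dec 0 y with
                | left _ => atan (y / x) + PI
                | right _ => atan (y / x) - PI
                end
    | right _ =>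
      match Rlt_dec 0 y with
      | left _ => PI / 2
      | right _ => match Rlt_dec y 0 with
                   | left _ => - (PI / 2)
                   | right _ => 0
                   end
      end
    end
  end.

Definition clog (z : C) : C := (ln (Cmod z), carg z).

Definition cpowr (z r : C) : C := cexp (r * clog z)%C.

Definition ee (x : C) : C := cexp (2 * PI * Ci * x)%C.

Definition upper (tau : C) : Prop := 0 < Im tau.

Definition cseries (a : nat -> C) : C :=
  (Series (fun n => Re (a n)), Series (fun n => Im (a n))).

(* log eta(tau) = 2 pi i tau/24 + sum_{n>=1} log(1 - q^n), the branch of
   log eta that is holomorphic on H and real at tau = i *)
Definition logeta (tau : C) : C :=
  (2 * PI * Ci * tau / 24 + cseries (fun n => clog (1 - Cpow (ee tau) (S n))))%C.

Definition etapow (n : R) (r : R) (tau : C) : C :=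
  cexp (RtoC r * logeta (RtoC n * tau))%C.

Definition sawZ (r c : Z) : R :=
  if Z.eqb (r mod c)%Z 0%Z then 0
  else IZR r / IZR c - IZR (r / c)%Z - / 2.

Definition dedekind_sum (h c : Z) : R :=
  fold_right Rplus 0
    (map (fun n : nat => sawZ (Z.of_nat n) c * sawZ (h * Z.of_nat n)%Z c)
         (seq 0 (Z.to_nat c))).

Definition Psi (a b c d : Z) : R :=
  if Z.ltb 0%Z c then IZR (a + d)%Z / IZR c + 12 * dedekind_sum (- d)%Z c - 3
  else if Z.ltb c 0%Z then IZR (a + d)%Z / IZR c + 12 * dedekind_sum d (- c)%Z + 3
  else if Z.ltb 0%Z a then IZR b
  else - IZR b - 6.

(* a pair (gamma, phi) with gamma = [[a b][c d]] and phi a function on H *)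
Record GElt := mkG { ga : Z; gb : Z; gc : Z; gd : Z; gphi : C -> C }.

Definition mobius (a b c d : Z) (tau : C) : C :=
  ((IZR a * tau + IZR b) / (IZR c * tau + IZR d))%C.

Definition gmul (g1 g2 : GElt) : GElt :=
  mkG (ga g1 * ga g2 + gb g1 * gc g2)%Z (ga g1 * gb g2 + gb g1 * gd g2)%Z
      (gc g1 * ga g2 + gd g1 * gc g2)%Z (gc g1 * gb g2 + gd g1 * gd g2)%Z
      (fun tau => (gphi g1 (mobius (ga g2) (gb g2) (gc g2) (gd g2) tau)
                   * gphi g2 tau)%C).

Definition gtilde (D : nat) (a b c d : Z) : GElt :=
  mkG a b c d (fun tau => cpowr (IZR c * tau + IZR d)%C (RtoC (/ INR D))).

(* T~^n = (T^n)~ , T^n = [[1 n][0 1]] *)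
Definition Tpow (D : nat) (n : Z) : GElt := gtilde D 1%Z n 0%Z 1%Z.

Definition inGt (D : nat) (g : GElt) : Prop :=
  (ga g * gd g - gb g * gc g = 1)%Z /\ Z.divide 4 (gc g) /\
  exists eps : C, Cpow eps D = 1%C /\
    forall tau, upper tau ->
      gphi g tau = (eps * cpowr (IZR (gc g) * tau + IZR (gd g))%C (RtoC (/ INR D)))%C.

Definition geq (g h : GElt) : Prop :=
  ga g = ga h /\ gb g = gb h /\ gc g = gc h /\ gd g = gd h /\
  forall tau, upper tau -> gphi g tau = gphi h tau.

Definition same_coset (D : nat) (g h : GElt) : Prop :=
  exists n : Z, geq h (gmul (Tpow D n) g).

Definition coset_reps (D : nat) (S : GElt -> Prop) : Prop :=
  (forall g, S g -> inGt D g) /\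
  (forall g, inGt D g -> exists h, S h /\ same_coset D g h) /\
  (forall g h, S g -> S h -> same_coset D g h -> g = h).

Definition lsum (f : GElt -> C) (L : list GElt) : C :=
  fold_right Cplus 0%C (map f L).

Definition is_usum (S : GElt -> Prop) (f : GElt -> C) (l : C) : Prop :=
  forall eps : R, 0 < eps ->
    exists L0 : list GElt, NoDup L0 /\ (forall g, In g L0 -> S g) /\
      forall L : list GElt, NoDup L -> (forall g, In g L -> S g) ->
        (forall g, In g L0 -> In g L) ->
        Cmod (lsum f L - l)%C < eps.

Definition r1R (r2 r4 : Q) : R := -2 * Q2R r2 - 4 * Q2R r4.

Definition eta_quot (r2 r4 : Q) (tau : C) : C :=
  (etapow 1 (r1R r2 r4) tau * etapow 2 (Q2R r2) tau * etapow 4 (Q2R r4) tau)%C.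

Definition k0R (r2 r4 : Q) : R := / 2 * (r1R r2 r4 + Q2R r2 + Q2R r4).

(* the epsilon of g = (gamma, eps (c tau + d)^(1/D)), read off at tau = i *)
Definition eps_of (D : nat) (g : GElt) : C :=
  (gphi g Ci / cpowr (IZR (gc g) * Ci + IZR (gd g))%C (RtoC (/ INR D)))%C.

Definition chi (D : nat) (r2 r4 : Q) (g : GElt) : C :=
  let a := ga g in let b := gb g in let c := gc g in let d := gd g in
  (cpowr (eps_of D g) (RtoC (- (INR D * k0R r2 r4))) *
   ee (RtoC (/ 24 * (r1R r2 r4 * Psi a b c d
                     + Q2R r2 * Psi a (b * 2)%Z (c / 2)%Z d
                     + Q2R r4 * Psi a (b * 4)%Z (c / 4)%Z d))))%C.

Definition slash1 (D : nat) (k : R) (g : GElt) (tau : C) : C :=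
  cpowr (gphi g tau) (RtoC (- (INR D * k))).

Definition eis_term (D : nat) (r2 r4 : Q) (g : GElt) (tau : C) : C :=
  (/ chi D r2 r4 g * slash1 D (/ 2 * (- Q2R r2 - 3 * Q2R r4)) g tau)%C.

(* Main.v *)
Require Import Defs.
From Stdlib Require Import Reals ZArith QArith Qreals List ListSet Permutation.
From Stdlib Require Import Lra Lia Classical ClassicalEpsilon FunctionalExtensionality.
From Coquelicot Require Import Coquelicot.
Open Scope R_scope.

(* Let [f] be the eta quotient, of weight [k]. By the transformation law of eta, the term of the
   Eisenstein series at [gamma] is [f t / f (gamma t)], so it depends only on the bottom row of
   [gamma], and every row is met [D] times. It remains to see that the sum [P t] of
   [1 / f (gamma t)] over the bottom rows of Gamma0(4) is equal to [2].

   Since [k > 2], the series [P] converges locally uniformly to a holomorphic function, invariant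
   under Gamma0(4). At every cusp the order of [f] in the local parameter is less than [1], so [P]
   grows more slowly than a simple pole there: its singularities at the cusps are removable, and [P]
   is constant by the maximum principle. At infinity [f] tends to [1] and only the rows [(0, 1)] and
   [(0, -1)] contribute to the limit, which is therefore [2].

   The transformation law follows, by Euclid's algorithm on the bottom row, from the reciprocity law
   for Dedekind sums and from the inversion [t -> - 1 / t], which is obtained by integrating the
   quasi-modularity of the Eisenstein series of weight two. *)

(** * Limits of complex functions *)

Lemma im_le_Cmod (z : C) : Rabs (Im z) <= Cmod z.
Proof. eapply Rle_trans; [apply Rmax_r | apply Rmax_Cmod]. Qed.

Lemma re_minus (z w : C) : Re (z - w) = Re z - Re w.
Proof. reflexivity. Qed.

Lemma im_minus (z w : C) : Im (z - w) = Im z - Im w.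
Proof. reflexivity. Qed.

Lemma C_re_im (x y : R) : (x, y) = (RtoC x + Ci * RtoC y)%C.
Proof. apply injective_projections; simpl; ring. Qed.

Lemma Cmod_le_re_im (z : C) : Cmod z <= Rabs (Re z) + Rabs (Im z).
Proof.
  destruct z as [x y]. rewrite C_re_im at 1.
  eapply Rle_trans; [apply Cmod_triangle |]. rewrite Cmod_mult, Cmod_Ci, !Cmod_R. simpl. lra.
Qed.

Lemma Cmod_minus_diag (z : C) : Cmod (z - z) = 0.
Proof. replace (z - z)%C with (RtoC 0) by ring. apply Cmod_0. Qed.

Lemma Cmod_minus_sym (z w : C) : Cmod (z - w) = Cmod (w - z).
Proof. rewrite <- Cmod_opp. f_equal. ring. Qed.

Lemma Cmod_minus_triangle (u v w : C) : Cmod (u - w) <= Cmod (u - v) + Cmod (v - w).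
Proof. replace (u - w)%C with ((u - v) + (v - w))%C by ring. apply Cmod_triangle. Qed.

Lemma Cmod_le_minus (z w : C) : Cmod z <= Cmod w + Cmod (z - w).
Proof. replace z with (w + (z - w))%C at 1 by ring. apply Cmod_triangle. Qed.

Lemma Cmod_minus_le (z w : C) : Cmod (z - w) <= Cmod z + Cmod w.
Proof. unfold Cminus. rewrite <- (Cmod_opp w). apply Cmod_triangle. Qed.

Lemma Rabs_Cmod_minus (z w : C) : Rabs (Cmod z - Cmod w) <= Cmod (z - w).
Proof.
  pose proof (Cmod_le_minus z w) as Hle. pose proof (Cmod_le_minus w z) as Hge.
  rewrite (Cmod_minus_sym w z) in Hge. apply Rabs_le. lra.
Qed.

Lemma Cmod_minus_gt_0 (z w : C) : z <> w -> 0 < Cmod (z - w).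
Proof. intros H. apply Cmod_gt_0, Cminus_eq_contra, H. Qed.

Lemma Cmod_minus_eq_0 (z w : C) : Cmod (z - w) = 0 -> z = w.
Proof. intros H. apply Ceq_minus, Cmod_eq_0, H. Qed.

Lemma Cmod_minus_small_eq (z w : C) : (forall eps, 0 < eps -> Cmod (z - w) < eps) -> z = w.
Proof.
  intros H. apply Cmod_minus_eq_0. destruct (Req_dec (Cmod (z - w)) 0) as [E | E]; auto.
  pose proof (Cmod_ge_0 (z - w)). specialize (H (Cmod (z - w))). lra.
Qed.

Lemma RtoC_neq_0 (x : R) : x <> 0 -> RtoC x <> 0%C.
Proof. intros H E. apply H, RtoC_inj, E. Qed.

Lemma locally_Cmod (z : C) (P : C -> Prop) :
  locally z P <-> exists d, 0 < d /\ forall w, Cmod (w - z) < d -> P w.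
Proof.
  rewrite locally_C. split.
  - intros [d H]. exists d. split; [apply cond_pos | exact H].
  - intros [d [Hd H]]. exists (mkposreal d Hd). exact H.
Qed.

Lemma locally_Im_gt (z : C) (y : R) : y < Im z -> locally z (fun w => y < Im w).
Proof.
  intros H. apply locally_Cmod. exists (Im z - y). split; [lra |]. intros w Hw.
  pose proof (im_le_Cmod (w - z)) as B. rewrite im_minus in B. apply Rabs_le_between in B. lra.
Qed.

Lemma locally_Re_gt (z : C) (x : R) : x < Re z -> locally z (fun w => x < Re w).
Proof.
  intros H. apply locally_Cmod. exists (Re z - x). split; [lra |]. intros w Hw.
  pose proof (re_le_Cmod (w - z)) as B. rewrite re_minus in B. apply Rabs_le_between in B. lra.
Qed.

Lemma locally_neq (z a : C) : z <> a -> locally z (fun w => w <> a).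
Proof.
  intros H. apply locally_Cmod. exists (Cmod (z - a)). split; [apply Cmod_minus_gt_0, H |].
  intros w Hw ->. rewrite Cmod_minus_sym in Hw. lra.
Qed.

Definition Im_infty (P : C -> Prop) : Prop := exists Y, forall w, Y < Im w -> P w.

#[local] Instance Im_infty_filter : ProperFilter Im_infty.
Proof.
  constructor.
  - intros P [Y H]. exists (0, Y + 1). apply H. simpl. lra.
  - constructor.
    + exists 0; auto.
    + intros P Q [Y H1] [Z H2]. exists (Rmax Y Z). intros w Hw.
      pose proof (Rmax_l Y Z); pose proof (Rmax_r Y Z). split; [apply H1 | apply H2]; lra.
    + intros P Q HPQ [Y H1]. exists Y; auto.
Qed.

Create HintDb limits.
#[local] Hint Extern 1 (Filter _) => typeclasses eauto : limits.

Lemma filterlim_locally_C {X : Type} (F : (X -> Prop) -> Prop) (f : X -> C) (l : C) :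
  filterlim f F (locally (T := AbsRing_UniformSpace C_AbsRing) l) <-> filterlim f F (locally l).
Proof. split; intros H P HP; apply H, locally_C, HP. Qed.

Section FilterLimits.
Context {X : Type} (F : (X -> Prop) -> Prop) {FF : Filter F}.
Implicit Types (f g : X -> C) (l m : C).

Lemma filterlim_Cmod f l :
  filterlim f F (locally l) <-> forall eps, 0 < eps -> F (fun x => Cmod (f x - l) < eps).
Proof.
  split.
  - intros H eps Heps. apply (H (fun w => Cmod (w - l) < eps)), locally_Cmod. eauto.
  - intros H P HP. apply locally_Cmod in HP as [d [Hd HP]].
    unfold filtermap. generalize (H d Hd). apply filter_imp; auto.
Qed.

Lemma filterlim_locally_eq f l m : filterlim f F (locally l) -> l = m -> filterlim f F (locally m).
Proof. intros H <-. exact H. Qed.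

Lemma filterlim_Cconst (c : C) : filterlim (fun _ : X => c) F (locally c).
Proof. apply filterlim_const. Qed.

Lemma filterlim_Cplus f g l m : filterlim f F (locally l) -> filterlim g F (locally m) ->
  filterlim (fun x => f x + g x)%C F (locally (l + m)%C).
Proof.
  intros Hf Hg.
  eapply filterlim_comp_2; [exact Hf | exact Hg | apply (filterlim_plus (V := C_NormedModule))].
Qed.

Lemma filterlim_Copp f l :
  filterlim f F (locally l) -> filterlim (fun x => - f x)%C F (locally (- l)%C).
Proof.
  intros Hf. eapply filterlim_comp; [exact Hf | apply (filterlim_opp (V := C_NormedModule))].
Qed.

Lemma filterlim_Cminus f g l m : filterlim f F (locally l) -> filterlim g F (locally m) ->
  filterlim (fun x => f x - g x)%C F (locally (l - m)%C).
Proof. intros Hf Hg. apply filterlim_Cplus, filterlim_Copp; auto. Qed.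

Lemma filterlim_Cmult f g l m : filterlim f F (locally l) -> filterlim g F (locally m) ->
  filterlim (fun x => f x * g x)%C F (locally (l * m)%C).
Proof.
  rewrite <- !filterlim_locally_C. intros Hf Hg.
  eapply filterlim_comp_2; [exact Hf | exact Hg | apply (filterlim_mult (K := C_AbsRing))].
Qed.

Lemma filterlim_Cmod_gt_half f l :
  filterlim f F (locally l) -> l <> 0%C -> F (fun x => Cmod l / 2 < Cmod (f x)).
Proof.
  intros H Hl. apply Cmod_gt_0 in Hl. rewrite filterlim_Cmod in H.
  generalize (H (Cmod l / 2) ltac:(lra)). apply filter_imp.
  intros x Hx. pose proof (Cmod_le_minus l (f x)) as Hle. rewrite Cmod_minus_sym in Hle. lra.
Qed.

Lemma filterlim_Cneq_0 f l : filterlim f F (locally l) -> l <> 0%C -> F (fun x => f x <> 0%C).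
Proof.
  intros H Hl. generalize (filterlim_Cmod_gt_half f l H Hl). apply filter_imp.
  intros x Hx. apply Cmod_gt_0. pose proof (Cmod_ge_0 l). lra.
Qed.

Lemma filterlim_Cinv f l :
  filterlim f F (locally l) -> l <> 0%C -> filterlim (fun x => / f x)%C F (locally (/ l)%C).
Proof.
  intros H Hl. pose proof (filterlim_Cmod_gt_half f l H Hl) as Hhalf.
  rewrite filterlim_Cmod in *. intros eps Heps. apply Cmod_gt_0 in Hl as Hp.
  assert (Heps2 : 0 < eps * (Cmod l * Cmod l / 2)) by (apply Rmult_lt_0_compat; nra).
  generalize (filter_and _ _ Hhalf (H _ Heps2)). apply filter_imp. intros x [Hx Hfx].
  assert (Hfx0 : f x <> 0%C) by (apply Cmod_gt_0; lra).
  replace (/ f x - / l)%C with (- (f x - l) / (f x * l))%C by (field; auto).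
  rewrite Cmod_div, Cmod_opp, Cmod_mult by (apply Cmult_neq_0; auto).
  apply Rlt_div_l; [nra |]. assert (Cmod l / 2 * Cmod l <= Cmod (f x) * Cmod l) by nra. nra.
Qed.

Lemma filterlim_Cmod_bounded f l :
  filterlim f F (locally l) -> F (fun x => Cmod (f x) <= Cmod l + 1).
Proof.
  rewrite filterlim_Cmod. intros H. generalize (H 1 Rlt_0_1). apply filter_imp. intros x Hx.
  pose proof (Cmod_le_minus (f x) l). lra.
Qed.

Lemma filterlim_C_squeeze f (g : X -> R) l :
  F (fun x => Cmod (f x - l) <= g x) -> filterlim g F (locally 0) -> filterlim f F (locally l).
Proof.
  intros Hfg Hg. rewrite filterlim_Cmod. intros eps Heps.
  rewrite filterlim_locally in Hg.
  generalize (filter_and _ _ Hfg (Hg (mkposreal eps Heps))). apply filter_imp.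
  intros x [Hle Hball]. change (Rabs (g x - 0) < eps) in Hball. apply Rabs_lt_between in Hball. lra.
Qed.
End FilterLimits.

#[local] Hint Resolve filterlim_Cconst filterlim_id filterlim_Cplus filterlim_Copp : limits.
#[local] Hint Resolve filterlim_Cminus filterlim_Cmult filterlim_Cinv : limits.

(** * Complex derivatives *)

Lemma is_derive_C_eps (f : C -> C) (z l : C) : is_derive f z l <->
  forall eps, 0 < eps -> locally z (fun w => Cmod (f w - f z - (w - z) * l) <= eps * Cmod (w - z)).
Proof.
  split.
  - intros [_ H] eps Heps. apply locally_C, (H z (fun P HP => HP) (mkposreal eps Heps)).
  - intros H. split; [apply is_linear_scal_l |]. intros x Hx eps.
    rewrite <- (is_filter_lim_locally_unique (V := AbsRing_NormedModule C_AbsRing) z x Hx).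
    apply locally_C, H, cond_pos.
Qed.

Definition slope (f : C -> C) (z l w : C) : C :=
  if excluded_middle_informative (w = z) then l else ((f w - f z) / (w - z))%C.

Lemma slope_diag (f : C -> C) (z l : C) : slope f z l z = l.
Proof. unfold slope. destruct (excluded_middle_informative (z = z)); tauto. Qed.

Lemma slope_neq (f : C -> C) (z l w : C) : w <> z -> slope f z l w = ((f w - f z) / (w - z))%C.
Proof. intros H. unfold slope. destruct (excluded_middle_informative (w = z)); tauto. Qed.

Lemma slope_mult (f : C -> C) (z l w : C) : (slope f z l w * (w - z))%C = (f w - f z)%C.
Proof.
  destruct (excluded_middle_informative (w = z)) as [-> | H]; [ring |].
  rewrite slope_neq by auto. field. apply Cminus_eq_contra, H.
Qed.

Lemma is_derive_Caratheodory (f phi : C -> C) (z l : C) :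
  locally z (fun w => f w = f z + phi w * (w - z))%C ->
  filterlim phi (locally z) (locally l) -> is_derive f z l.
Proof.
  rewrite is_derive_C_eps, filterlim_Cmod by typeclasses eauto. intros Hf Hphi eps Heps.
  generalize (filter_and _ _ Hf (Hphi eps Heps)). apply filter_imp. intros w [E Hw]. rewrite E.
  replace (f z + phi w * (w - z) - f z - (w - z) * l)%C with ((phi w - l) * (w - z))%C by ring.
  rewrite Cmod_mult. apply Rmult_le_compat_r; [apply Cmod_ge_0 | lra].
Qed.

Lemma filterlim_slope (f : C -> C) (z l : C) :
  is_derive f z l -> filterlim (slope f z l) (locally z) (locally l).
Proof.
  rewrite is_derive_C_eps, filterlim_Cmod by typeclasses eauto. intros H eps Heps.
  generalize (H (eps / 2) ltac:(lra)). apply filter_imp. intros w Hw.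
  destruct (classic (w = z)) as [-> | Hn]; [rewrite slope_diag, Cmod_minus_diag; auto |].
  pose proof (Cmod_minus_gt_0 w z Hn). rewrite <- (slope_mult f z l w) in Hw.
  replace (slope f z l w * (w - z) - (w - z) * l)%C with ((slope f z l w - l) * (w - z))%C in Hw
    by ring.
  rewrite Cmod_mult in Hw. apply Rmult_le_reg_r in Hw; lra.
Qed.

Lemma is_derive_C_continuous (f : C -> C) (z l : C) : is_derive f z l -> continuous f z.
Proof.
  intros H. apply filterlim_ext with (fun w => f z + slope f z l w * (w - z))%C.
  - intros w. rewrite slope_mult. ring.
  - apply filterlim_slope in H. apply filterlim_locally_eq with (f z + l * (z - z))%C; [| ring].
    auto 10 with limits.
Qed.

Lemma is_derive_C_unique (f : C -> C) (z l m : C) : is_derive f z l -> is_derive f z m -> l = m.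
Proof. intros Hl Hm. rewrite <- (is_C_derive_unique f z l Hl). apply is_C_derive_unique, Hm. Qed.

Lemma is_derive_eq (f : C -> C) (z l m : C) : is_derive f z l -> l = m -> is_derive f z m.
Proof. intros H <-. exact H. Qed.

Lemma is_derive_C_ext_loc (f g : C -> C) (z l : C) :
  locally z (fun w => f w = g w) -> is_derive f z l -> is_derive g z l.
Proof. intros H. apply is_derive_ext_loc, locally_C, H. Qed.

Lemma is_derive_C_AbsRing (f : C -> C) (z l : C) :
  is_derive f z l -> is_derive (V := AbsRing_NormedModule C_AbsRing) f z l.
Proof. intros [[H1 H2 H3] H4]. split; [split; [exact H1 | exact H2 | exact H3] | exact H4]. Qed.

Lemma is_derive_AbsRing_C (f : C -> C) (z l : C) :
  is_derive (V := AbsRing_NormedModule C_AbsRing) f z l -> is_derive f z l.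
Proof. intros [[H1 H2 H3] H4]. split; [split; [exact H1 | exact H2 | exact H3] | exact H4]. Qed.

Lemma is_derive_Cconst (c z : C) : is_derive (fun _ : C => c) z (RtoC 0).
Proof. apply (is_derive_const (V := C_NormedModule)). Qed.

Lemma is_derive_Cid (z : C) : is_derive (fun w : C => w) z (RtoC 1).
Proof. apply is_derive_AbsRing_C, (is_derive_id (K := C_AbsRing)). Qed.

Lemma is_derive_Cplus (f g : C -> C) (z l m : C) :
  is_derive f z l -> is_derive g z m -> is_derive (fun w => f w + g w)%C z (l + m)%C.
Proof. apply (is_derive_plus (V := C_NormedModule)). Qed.

Lemma is_derive_Copp (f : C -> C) (z l : C) :
  is_derive f z l -> is_derive (fun w => - f w)%C z (- l)%C.
Proof. apply (is_derive_opp (V := C_NormedModule)). Qed.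

Lemma is_derive_Cminus (f g : C -> C) (z l m : C) :
  is_derive f z l -> is_derive g z m -> is_derive (fun w => f w - g w)%C z (l - m)%C.
Proof. apply (is_derive_minus (V := C_NormedModule)). Qed.

Lemma is_derive_Cmult (f g : C -> C) (z l m : C) : is_derive f z l -> is_derive g z m ->
  is_derive (fun w => f w * g w)%C z (l * g z + f z * m)%C.
Proof.
  intros Hf Hg. apply is_derive_AbsRing_C.
  apply (is_derive_mult (K := C_AbsRing) f g); [| | exact Cmult_comm];
    apply is_derive_C_AbsRing; auto.
Qed.

Lemma is_derive_Ccomp (f g : C -> C) (z l m : C) :
  is_derive f (g z) l -> is_derive g z m -> is_derive (fun w => f (g w)) z (l * m)%C.
Proof.
  intros Hf Hg. rewrite Cmult_comm.
  apply (is_derive_comp (V := C_NormedModule)); [exact Hf | apply is_derive_C_AbsRing, Hg].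
Qed.

Lemma is_derive_Cinv (f : C -> C) (z l : C) : is_derive f z l -> f z <> 0%C ->
  is_derive (fun w => / f w)%C z (- l / (f z * f z))%C.
Proof.
  intros Hf Hz. pose proof (is_derive_C_continuous _ _ _ Hf) as Hc. unfold continuous in Hc.
  apply is_derive_Caratheodory with (fun w => - slope f z l w * / (f w * f z))%C.
  - generalize (filterlim_Cneq_0 _ _ _ Hc Hz). apply filter_imp. intros w Hw.
    transitivity (/ f z - (slope f z l w * (w - z)) / (f w * f z))%C; [| field; auto].
    rewrite slope_mult. field; auto.
  - apply filterlim_slope in Hf. unfold Cdiv.
    assert (f z * f z <> 0)%C by (apply Cmult_neq_0; auto). auto 10 with limits.
Qed.

Create HintDb derive.
#[local] Hint Resolve is_derive_Cconst is_derive_Cid is_derive_Cplus is_derive_Copp : derive.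
#[local] Hint Resolve is_derive_Cminus is_derive_Cmult is_derive_Cinv : derive.

Definition holomorphic_on (U : C -> Prop) (f f' : C -> C) : Prop :=
  forall z, U z -> is_derive f z (f' z) /\ continuous f' z.

Lemma holomorphic_on_continuous (U : C -> Prop) (f f' : C -> C) (z : C) :
  holomorphic_on U f f' -> U z -> continuous f z.
Proof. intros H Hz. apply is_derive_C_continuous with (f' z), H, Hz. Qed.

Lemma continuous_Ccomp (f g : C -> C) (z : C) :
  continuous g z -> continuous f (g z) -> continuous (fun w => f (g w)) z.
Proof. intros Hg Hf. apply (continuous_comp g f); auto. Qed.

Lemma holomorphic_on_comp (U V : C -> Prop) (f f' g g' : C -> C) :
  (forall z, U z -> V (g z)) -> holomorphic_on V f f' -> holomorphic_on U g g' ->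
  holomorphic_on U (fun z => f (g z)) (fun z => f' (g z) * g' z)%C.
Proof.
  intros HUV Hf Hg z Hz. destruct (Hf (g z) (HUV z Hz)) as [Df Cf'].
  destruct (Hg z Hz) as [Dg Cg']. split; [apply is_derive_Ccomp; auto |].
  apply filterlim_Cmult; [typeclasses eauto | | exact Cg'].
  apply continuous_Ccomp; [apply is_derive_C_continuous with (g' z) |]; auto.
Qed.

(** * Exponential and logarithm *)

Lemma cexp_plus (z w : C) : cexp (z + w) = (cexp z * cexp w)%C.
Proof.
  unfold cexp. rewrite re_plus, im_plus, exp_plus, cos_plus, sin_plus.
  apply injective_projections; simpl; ring.
Qed.

Lemma cexp_0 : cexp 0 = 1%C.
Proof.
  unfold cexp; simpl. rewrite exp_0, cos_0, sin_0. apply injective_projections; simpl; ring.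
Qed.

Lemma Cmod_cexp (z : C) : Cmod (cexp z) = exp (Re z).
Proof.
  assert (E : Cmod (cexp z) ^ 2 = exp (Re z) ^ 2).
  { rewrite Cmod2_alt. unfold cexp; simpl Re; simpl Im.
    pose proof (sin2_cos2 (Im z)) as H. unfold Rsqr in H.
    rewrite !Rpow_mult_distr, <- Rmult_plus_distr_l.
    replace (cos (Im z) ^ 2 + sin (Im z) ^ 2) with 1 by lra. ring. }
  pose proof (Cmod_ge_0 (cexp z)). pose proof (exp_pos (Re z)). nra.
Qed.

Lemma cexp_neq_0 (z : C) : cexp z <> 0%C.
Proof. apply Cmod_gt_0. rewrite Cmod_cexp. apply exp_pos. Qed.

Lemma cexp_opp (z : C) : cexp (- z) = (/ cexp z)%C.
Proof.
  assert (E : (cexp (- z) * cexp z = 1)%C).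
  { rewrite <- cexp_plus. replace (- z + z)%C with (RtoC 0) by ring. apply cexp_0. }
  transitivity (cexp (- z) * cexp z / cexp z)%C; [| rewrite E]; field; apply cexp_neq_0.
Qed.

Lemma cexp_minus (z w : C) : cexp (z - w) = (cexp z / cexp w)%C.
Proof. unfold Cminus. rewrite cexp_plus, cexp_opp. reflexivity. Qed.

Lemma cexp_mult_INR (z : C) (n : nat) : cexp (INR n * z) = (cexp z ^ n)%C.
Proof.
  induction n as [| n IH].
  - simpl. replace (0 * z)%C with (RtoC 0) by ring. apply cexp_0.
  - rewrite S_INR, RtoC_plus, Cpow_S, <- IH, <- cexp_plus. f_equal. ring.
Qed.

Lemma exp_taylor_1 (x : R) : Rabs x <= 1 / 2 -> Rabs (exp x - 1 - x) <= 2 * x ^ 2.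
Proof.
  intros H. apply Rabs_le_between in H.
  pose proof (exp_ineq1_le x). pose proof (exp_ineq1_le (- x)) as Hneg. pose proof (exp_pos x).
  assert (exp x * (1 - x) <= 1).
  { rewrite exp_Ropp in Hneg. apply Rmult_le_reg_l with (/ exp x); [apply Rinv_0_lt_compat; auto |].
    rewrite <- Rmult_assoc, Rinv_l; lra. }
  apply Rabs_le. split; nra.
Qed.

Lemma Rabs_sin_le (x : R) : Rabs (sin x) <= Rabs x.
Proof.
  destruct (MVT_gen sin 0 x cos) as [c [_ E]].
  - intros t _. apply is_derive_Reals, derivable_pt_lim_sin.
  - intros t _. apply continuity_sin.
  - rewrite sin_0, !Rminus_0_r in E. rewrite E, Rabs_mult.
    pose proof (COS_bound c) as B. apply Rabs_le in B. pose proof (Rabs_pos x). nra.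
Qed.

Lemma cos_taylor_0 (x : R) : Rabs (cos x - 1) <= x ^ 2.
Proof.
  replace x with (2 * (x / 2)) at 1 by field. rewrite cos_2a_sin.
  pose proof (Rabs_sin_le (x / 2)) as H. apply Rsqr_le_abs_1 in H. unfold Rsqr in H.
  apply Rabs_le. split; nra.
Qed.

Lemma sin_taylor_1 (x : R) : Rabs x <= 1 -> Rabs (sin x - x) <= x ^ 2.
Proof.
  intros H. destruct (MVT_gen (fun t => sin t - t) 0 x (fun t => cos t - 1)) as [c [Hc E]].
  - intros t _. auto_derive; auto. ring.
  - intros t _. apply derivable_continuous_pt.
    apply derivable_pt_minus; [apply derivable_pt_sin | apply derivable_pt_id].
  - rewrite sin_0, !Rminus_0_r in E. rewrite E, Rabs_mult.
    assert (c ^ 2 <= x ^ 2).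
    { destruct (Rle_dec 0 x); [rewrite Rmin_left, Rmax_right in Hc by lra; nra |].
      rewrite Rmin_right, Rmax_left in Hc by lra. nra. }
    pose proof (cos_taylor_0 c). pose proof (Rabs_pos x). pose proof (Rabs_pos (cos c - 1)). nra.
Qed.

(* With [u = cos y + i sin y], [cexp z - 1 - z = (exp x - 1 - x) u + (u - 1 - i y) + x (u - 1)]. *)
Lemma cexp_taylor_1 (z : C) : Cmod z <= 1 / 2 -> Cmod (cexp z - 1 - z) <= 3 * Cmod z ^ 2.
Proof.
  intros H. destruct z as [x y].
  pose proof (re_le_Cmod (x, y)) as Hx. pose proof (im_le_Cmod (x, y)) as Hy.
  rewrite Cmod2_alt. simpl Re in *. simpl Im in *. set (u := (cos y, sin y) : C).
  replace (cexp (x, y) - 1 - (x, y))%C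
    with (RtoC (exp x - 1 - x) * u + ((u - 1 - Ci * RtoC y) + RtoC x * (u - 1)))%C
    by (unfold cexp, u; apply injective_projections; simpl; ring).
  assert (Bu : Cmod u = 1).
  { replace u with (cexp (0, y)) by (unfold cexp, u; simpl; rewrite exp_0; f_equal; ring).
    rewrite Cmod_cexp. apply exp_0. }
  pose proof (cos_taylor_0 y). pose proof (sin_taylor_1 y ltac:(lra)). pose proof (Rabs_sin_le y).
  pose proof (pow2_abs x). pose proof (pow2_abs y). pose proof (Rabs_pos x).
  pose proof (Rabs_pos y).
  assert (B1 : Cmod (u - 1) <= 2 * Rabs y).
  { eapply Rle_trans; [apply Cmod_le_re_im |]. unfold u. simpl.
    replace (cos y + - (1)) with (cos y - 1) by ring. replace (sin y + - 0) with (sin y) by ring.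
    nra. }
  assert (B2 : Cmod (u - 1 - Ci * RtoC y) <= 2 * y ^ 2).
  { eapply Rle_trans; [apply Cmod_le_re_im |]. unfold u. simpl Re. simpl Im.
    replace (cos y + - (1) + - (0 * y - 1 * 0)) with (cos y - 1) by ring.
    replace (sin y + - 0 + - (0 * 0 + 1 * y)) with (sin y - y) by ring. lra. }
  pose proof (exp_taylor_1 x ltac:(lra)).
  eapply Rle_trans; [apply Cmod_triangle |].
  eapply Rle_trans; [apply Rplus_le_compat_l, Cmod_triangle |].
  rewrite !Cmod_mult, Bu, !Cmod_R, Rmult_1_r.
  assert (Rabs x * Cmod (u - 1) <= Rabs x * (2 * Rabs y)) by (apply Rmult_le_compat_l; auto).
  pose proof (pow2_ge_0 (Rabs x - Rabs y)). lra.
Qed.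

Lemma is_derive_cexp (f : C -> C) (z l : C) :
  is_derive f z l -> is_derive (fun w => cexp (f w)) z (cexp (f z) * l)%C.
Proof.
  apply (is_derive_Ccomp cexp f). set (a := f z). apply is_derive_C_eps. intros eps Heps.
  pose proof (exp_pos (Re a)) as He. apply locally_Cmod.
  assert (Hq : 0 < eps / (3 * exp (Re a))) by (apply Rdiv_lt_0_compat; lra).
  exists (Rmin (1 / 2) (eps / (3 * exp (Re a)))). split; [apply Rmin_pos; lra |]. intros w Hw.
  pose proof (Rmin_l (1 / 2) (eps / (3 * exp (Re a)))).
  pose proof (Rmin_r (1 / 2) (eps / (3 * exp (Re a)))).
  replace (cexp w) with (cexp a * cexp (w - a))%C by (rewrite <- cexp_plus; f_equal; ring).
  replace (cexp a * cexp (w - a) - cexp a - (w - a) * cexp a)%C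
    with (cexp a * (cexp (w - a) - 1 - (w - a)))%C by ring.
  rewrite Cmod_mult, Cmod_cexp. pose proof (cexp_taylor_1 (w - a) ltac:(lra)).
  pose proof (Cmod_ge_0 (w - a)).
  assert (Hle : Cmod (w - a) * (3 * exp (Re a)) <= eps) by (apply Rle_div_r; lra).
  apply Rle_trans with (exp (Re a) * (3 * Cmod (w - a) ^ 2)); [apply Rmult_le_compat_l; lra |].
  nra.
Qed.
#[local] Hint Resolve is_derive_cexp : derive.

Lemma is_derive_ee (f : C -> C) (z l : C) :
  is_derive f z l -> is_derive (fun w => ee (f w)) z (2 * PI * Ci * ee (f z) * l)%C.
Proof. intros Hf. unfold ee. eapply is_derive_eq; [eauto with derive | simpl; ring]. Qed.
#[local] Hint Resolve is_derive_ee : derive.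

Lemma continuous_cexp (z : C) : continuous cexp z.
Proof. eapply is_derive_C_continuous, (is_derive_cexp (fun w => w)), is_derive_Cid. Qed.

Lemma continuous_ee (z : C) : continuous ee z.
Proof. eapply is_derive_C_continuous, (is_derive_ee (fun w => w)), is_derive_Cid. Qed.

Lemma Ci_sq : (Ci * Ci = -1)%C.
Proof. apply injective_projections; simpl; ring. Qed.

Lemma twoPiCi_neq_0 : (2 * PI * Ci)%C <> 0%C.
Proof.
  pose proof PI_RGT_0. apply Cmult_neq_0; [| apply Ci_nz].
  apply Cmult_neq_0; apply RtoC_neq_0; lra.
Qed.

Lemma ee_plus (z w : C) : ee (z + w) = (ee z * ee w)%C.
Proof. unfold ee. rewrite <- cexp_plus. f_equal. ring. Qed.

Lemma ee_0 : ee 0 = 1%C.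
Proof. unfold ee. replace (2 * PI * Ci * 0)%C with (RtoC 0) by ring. apply cexp_0. Qed.

Lemma ee_minus (z w : C) : ee (z - w) = (ee z / ee w)%C.
Proof. unfold ee. rewrite <- cexp_minus. f_equal. ring. Qed.

Lemma ee_neq_0 (z : C) : ee z <> 0%C.
Proof. apply cexp_neq_0. Qed.

Lemma Cmod_ee (z : C) : Cmod (ee z) = exp (- (2 * PI * Im z)).
Proof. unfold ee. rewrite Cmod_cexp. f_equal. unfold Re, Im. simpl. ring. Qed.

Lemma ee_mult_INR (z : C) (n : nat) : ee (INR n * z) = (ee z ^ n)%C.
Proof. unfold ee. rewrite <- cexp_mult_INR. f_equal. ring. Qed.

Lemma Cmod_ee_mult_INR (n : nat) (t : C) : Cmod (ee (INR n * t)) = Cmod (ee t) ^ n.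
Proof. rewrite ee_mult_INR. apply Cmod_pow. Qed.

Lemma cexp_PI : cexp (Ci * RtoC PI) = (-1)%C.
Proof.
  unfold cexp. rewrite re_scal_r, im_scal_r. simpl.
  rewrite Rmult_0_l, Rmult_1_l, exp_0, cos_PI, sin_PI. apply injective_projections; simpl; ring.
Qed.

Lemma cexp_PI2 : cexp (Ci * RtoC (PI / 2)) = Ci.
Proof.
  unfold cexp. rewrite re_scal_r, im_scal_r. simpl.
  rewrite Rmult_0_l, Rmult_1_l, exp_0, cos_PI2, sin_PI2. apply injective_projections; simpl; ring.
Qed.

Lemma ee_1 : ee 1 = 1%C.
Proof.
  unfold ee. replace (2 * PI * Ci * 1)%C with (Ci * RtoC PI + Ci * RtoC PI)%C by ring.
  rewrite cexp_plus, cexp_PI. ring.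
Qed.

Lemma ee_IZR (n : Z) : ee (IZR n) = 1%C.
Proof.
  assert (E : forall m : nat, ee (INR m) = 1%C).
  { intros m. rewrite <- (Cmult_1_r (INR m)), ee_mult_INR, ee_1. apply Cpow_1_l. }
  destruct (Z_le_gt_dec 0 n).
  - rewrite <- (Z2Nat.id n), <- INR_IZR_INZ by auto. apply E.
  - replace (RtoC (IZR n)) with (0 - RtoC (INR (Z.to_nat (- n))))%C.
    + rewrite ee_minus, ee_0, E. field.
    + rewrite INR_IZR_INZ, Z2Nat.id, opp_IZR, RtoC_opp by lia. ring.
Qed.

Lemma ee_period (z : C) (n : Z) : ee (z + IZR n) = ee z.
Proof. rewrite ee_plus, ee_IZR. ring. Qed.

Lemma ee_half : ee (/ 2)%R = (-1)%C.
Proof.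
  unfold ee. replace (2 * PI * Ci * (/ 2)%R)%C with (Ci * RtoC PI)%C; [apply cexp_PI |].
  rewrite RtoC_inv by lra. field.
Qed.

Lemma Cmod_ee_lt_1 (z : C) : upper z -> Cmod (ee z) < 1.
Proof.
  intros H. unfold upper in H. rewrite Cmod_ee, <- exp_0. apply exp_increasing.
  pose proof PI_RGT_0. nra.
Qed.

Lemma Cneq_1_minus (w : C) : w <> 1%C -> (1 - w)%C <> 0%C.
Proof. intros H. apply Cminus_eq_contra. auto. Qed.

Lemma Cmod_lt_1_neq_1 (w : C) : Cmod w < 1 -> w <> 1%C.
Proof. intros H ->. rewrite Cmod_1 in H. lra. Qed.

Lemma ee_upper_neq_1 (z : C) : upper z -> ee z <> 1%C.
Proof. intros H. apply Cmod_lt_1_neq_1, Cmod_ee_lt_1, H. Qed.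

Lemma filterlim_ee_Im_infty : filterlim ee Im_infty (locally (RtoC 0)).
Proof.
  apply filterlim_Cmod; [typeclasses eauto |]. intros eps Heps.
  exists (- ln eps / (2 * PI)). intros w Hw.
  replace (ee w - 0)%C with (ee w) by ring. rewrite Cmod_ee. pose proof PI_RGT_0.
  rewrite <- (exp_ln eps) by auto. apply exp_increasing. apply Rlt_div_l in Hw; lra.
Qed.

Lemma carg_polar (z : C) : Re z = Cmod z * cos (carg z) /\ Im z = Cmod z * sin (carg z).
Proof.
  assert (Right : forall x y : R, 0 < x ->
    x = Cmod (x, y) * cos (atan (y / x)) /\ y = Cmod (x, y) * sin (atan (y / x))).
  { intros x y Hx. assert (E : Cmod (x, y) = x * sqrt (1 + (y / x)²)).
    { unfold Cmod. simpl fst. simpl snd. rewrite <- (sqrt_pow2 x) at 2 by lra.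
      rewrite <- sqrt_mult by (try apply pow2_ge_0; pose proof (Rle_0_sqr (y / x)); lra).
      f_equal. unfold Rsqr. field. lra. }
    assert (0 < sqrt (1 + (y / x)²)) by (apply sqrt_lt_R0; pose proof (Rle_0_sqr (y / x)); lra).
    rewrite E, cos_atan, sin_atan. split; field; lra. }
  assert (Opp : forall x y : R, Cmod (- x, - y) = Cmod (x, y)) by (intros; apply (Cmod_opp (x, y))).
  destruct z as [x y]. unfold carg. cbn [Re Im fst snd].
  destruct (Rlt_dec 0 x) as [Hx | Hx]; [apply Right, Hx |].
  destruct (Rlt_dec x 0) as [Hx' | Hx'].
  - destruct (Right (- x) (- y)) as [Ex Ey]; [lra |]. rewrite Opp in Ex, Ey.
    replace (- y / - x) with (y / x) in Ex, Ey by (field; lra).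
    destruct (Rle_dec 0 y).
    + rewrite neg_cos, neg_sin. split; lra.
    + replace (atan (y / x) - PI) with (- (PI - atan (y / x))) by ring.
      rewrite cos_neg, sin_neg, sin_PI_x, cos_minus, cos_PI, sin_PI. split; lra.
  - replace x with 0 by lra. assert (E : Cmod (0, y) = Rabs y).
    { rewrite C_re_im. replace (0 + Ci * y)%C with (Ci * y)%C by ring.
      rewrite Cmod_mult, Cmod_Ci, Cmod_R. ring. }
    rewrite E. destruct (Rlt_dec 0 y); [rewrite cos_PI2, sin_PI2, Rabs_right by lra; split; ring |].
    destruct (Rlt_dec y 0).
    + rewrite cos_neg, sin_neg, cos_PI2, sin_PI2, Rabs_left by lra. split; ring.
    + replace y with 0 by lra. rewrite Rabs_R0. split; ring.
Qed.

Lemma carg_bound (z : C) : - PI < carg z <= PI.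
Proof.
  destruct z as [x y]. unfold carg. cbn [Re Im fst snd]. pose proof PI_RGT_0.
  pose proof (atan_bound (y / x)) as B.
  destruct (Rlt_dec 0 x); [lra |]. destruct (Rlt_dec x 0) as [Hx |].
  - assert (Hinv : / x < 0) by (apply Rinv_lt_0_compat; auto). pose proof atan_0.
    destruct (Rle_dec 0 y) as [Hy | Hy].
    + assert (Hle : y / x <= 0) by (unfold Rdiv; nra).
      assert (atan (y / x) <= atan 0); [| lra].
      destruct Hle as [Hlt | ->]; [left; apply atan_increasing, Hlt | apply Rle_refl].
    + assert (0 < y / x) by (unfold Rdiv; nra).
      assert (atan 0 < atan (y / x)) by (apply atan_increasing; auto). lra.
  - destruct (Rlt_dec 0 y); [lra |]. destruct (Rlt_dec y 0); lra.
Qed.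

Lemma cexp_clog (z : C) : z <> 0%C -> cexp (clog z) = z.
Proof.
  intros Hz. destruct (carg_polar z) as [Ex Ey]. unfold cexp, clog. cbn [Re Im fst snd].
  rewrite exp_ln by (apply Cmod_gt_0; auto). rewrite <- Ex, <- Ey. destruct z; reflexivity.
Qed.

Lemma cexp_eq_1 (w : C) : cexp w = 1%C -> exists n : Z, w = (2 * PI * Ci * IZR n)%C.
Proof.
  intros H. assert (E : exp (Re w) = 1) by (rewrite <- Cmod_cexp, H; apply Cmod_1).
  unfold cexp in H. rewrite E in H. injection H as Hc Hs.
  assert (Hr : Re w = 0) by (apply exp_inv; rewrite E, exp_0; auto).
  assert (Hsin : sin (Im w / 2) = 0).
  { assert (Hcos : cos (2 * (Im w / 2)) = 1)
      by (replace (2 * (Im w / 2)) with (Im w) by field; lra).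
    rewrite cos_2a_sin in Hcos. nra. }
  destruct (sin_eq_0_0 _ Hsin) as [n Hn]. exists n.
  destruct w as [x y]; simpl in *. apply injective_projections; simpl; [rewrite Hr; ring |].
  replace y with (2 * (y / 2)) by field. rewrite Hn. ring.
Qed.

Lemma ee_eq_1 (w : C) : ee w = 1%C -> exists n : Z, w = IZR n.
Proof.
  intros H. destruct (cexp_eq_1 _ H) as [n Hn]. exists n. pose proof twoPiCi_neq_0 as Hc.
  apply Ceq_minus. apply Ceq_minus in Hn.
  replace (w - IZR n)%C with ((2 * PI * Ci * w - 2 * PI * Ci * IZR n) / (2 * PI * Ci))%C.
  - rewrite Hn. field. split; intro E; apply Hc; rewrite E; ring.
  - field. split; intro E; apply Hc; rewrite E; ring.
Qed.

Lemma cexp_inj (z w : C) : cexp z = cexp w -> Rabs (Im z - Im w) < 2 * PI -> z = w.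
Proof.
  intros H Him. destruct (cexp_eq_1 (z - w)) as [n Hn].
  { rewrite cexp_minus, H. field. apply cexp_neq_0. }
  assert (E : Im z - Im w = 2 * PI * IZR n) by (rewrite <- im_minus, Hn; simpl; ring).
  pose proof PI_RGT_0. rewrite E, Rabs_mult, Rabs_right in Him by lra.
  assert (Hlt : Rabs (IZR n) < 1) by (apply Rmult_lt_reg_l with (2 * PI); lra).
  rewrite <- abs_IZR in Hlt. apply lt_IZR in Hlt. replace n with 0%Z in Hn by lia.
  apply Ceq_minus. rewrite Hn. ring.
Qed.

Lemma clog_unique (z w : C) : cexp w = z -> - PI < Im w <= PI -> clog z = w.
Proof.
  intros H Him. apply cexp_inj.
  - rewrite cexp_clog; auto. rewrite <- H. apply cexp_neq_0.
  - pose proof (carg_bound z). change (Im (clog z)) with (carg z). apply Rabs_lt_between. lra.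
Qed.

Lemma clog_1 : clog 1 = 0%C.
Proof. apply clog_unique; [apply cexp_0 | simpl; pose proof PI_RGT_0; lra]. Qed.

Lemma upper_neq_0 (z : C) : upper z -> z <> 0%C.
Proof. intros H ->. unfold upper in H; simpl in H; lra. Qed.

Lemma clog_upper (z : C) : upper z -> 0 < Im (clog z) < PI.
Proof.
  intros H. unfold upper in H. destruct (carg_polar z) as [_ E]. pose proof (carg_bound z).
  assert (Hz : 0 < Cmod z) by (apply Cmod_gt_0, upper_neq_0, H).
  change (Im (clog z)) with (carg z). assert (Hs : 0 < sin (carg z)) by nra. split.
  - apply Rnot_le_lt. intros Hle. assert (0 <= sin (- carg z)) by (apply sin_ge_0; lra).
    rewrite sin_neg in *. lra.
  - apply Rnot_le_lt. intros Hge. replace (carg z) with PI in Hs by lra. rewrite sin_PI in Hs. lra.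
Qed.

Lemma clog_mult_opp_Ci (z : C) : upper z -> clog (- Ci * z) = (clog z - Ci * RtoC (PI / 2))%C.
Proof.
  intros H. pose proof (clog_upper z H). pose proof PI_RGT_0. apply clog_unique.
  - rewrite cexp_minus, cexp_clog, cexp_PI2 by (apply upper_neq_0; auto).
    apply injective_projections; simpl; field.
  - rewrite im_minus, im_scal_r. change (Im Ci) with 1. lra.
Qed.

Lemma clog_opp (z : C) : upper z -> clog (- z) = (clog z - Ci * RtoC PI)%C.
Proof.
  intros H. pose proof (clog_upper z H). pose proof PI_RGT_0. apply clog_unique.
  - rewrite cexp_minus, cexp_clog, cexp_PI by (apply upper_neq_0; auto). field.
  - rewrite im_minus, im_scal_r. change (Im Ci) with 1. lra.
Qed.

Lemma Cmod_gt_0_of_Re (z : C) : 0 < Re z -> 0 < Cmod z.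
Proof. intros H. pose proof (re_le_Cmod z) as B. rewrite Rabs_right in B; lra. Qed.

Lemma continuous_Cmod (z : C) : continuous Cmod z.
Proof.
  apply filterlim_locally. intros eps. apply locally_Cmod. exists eps. split; [apply cond_pos |].
  intros w Hw. change (Rabs (Cmod w - Cmod z) < eps).
  eapply Rle_lt_trans; [apply Rabs_Cmod_minus | exact Hw].
Qed.

Lemma continuous_Re (z : C) : continuous Re z.
Proof. destruct z. apply (continuous_fst (U := R_UniformSpace) (V := R_UniformSpace)). Qed.

Lemma continuous_Im (z : C) : continuous Im z.
Proof. destruct z. apply (continuous_snd (U := R_UniformSpace) (V := R_UniformSpace)). Qed.

Lemma continuous_C_pair {U : UniformSpace} (f g : U -> R) (x : U) :
  continuous f x -> continuous g x -> continuous (fun y => (f y, g y) : C) x.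
Proof.
  intros Hf Hg. apply filterlim_locally. intros eps.
  unfold continuous in Hf, Hg. rewrite filterlim_locally in Hf, Hg.
  generalize (filter_and _ _ (Hf eps) (Hg eps)). apply filter_imp. intros y [Bf Bg]. split; auto.
Qed.

Lemma continuous_clog (z : C) : 0 < Re z -> continuous clog z.
Proof.
  intros Hz. pose proof (Cmod_gt_0_of_Re z Hz) as Hm.
  apply continuous_ext_loc with (fun w : C => (ln (Cmod w), atan (Im w * / Re w)) : C).
  - generalize (locally_Re_gt z 0 Hz). apply filter_imp. intros w Hw. unfold clog, carg.
    destruct (Rlt_dec 0 (Re w)); [reflexivity | lra].
  - apply continuous_C_pair.
    + apply (continuous_comp Cmod ln); [apply continuous_Cmod | apply continuous_ln, Hm].
    + apply (continuous_comp (fun w : C => Im w * / Re w) atan).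
      * apply (continuous_mult (K := R_AbsRing)); [apply continuous_Im |].
        apply (continuous_comp Re Rinv); [apply continuous_Re | apply continuous_Rinv; lra].
      * apply (ex_derive_continuous atan). eexists. apply is_derive_Reals, derivable_pt_lim_atan.
Qed.

Lemma is_derive_clog (f : C -> C) (z l : C) : is_derive f z l -> 0 < Re (f z) ->
  is_derive (fun w => clog (f w)) z (/ f z * l)%C.
Proof.
  intros Hf Hre. apply (is_derive_Ccomp clog f); [clear Hf | exact Hf].
  set (a := f z) in *. assert (Ha : a <> 0%C) by (apply Cmod_gt_0, Cmod_gt_0_of_Re, Hre).
  pose proof (continuous_clog a Hre) as Hc.
  set (s := fun w => slope cexp (clog a) a (clog w)).
  assert (Hs : filterlim s (locally a) (locally a)).
  { apply filterlim_comp with (1 := Hc), filterlim_slope.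
    apply is_derive_eq with (cexp (clog a) * 1)%C.
    - apply (is_derive_cexp (fun w => w)), is_derive_Cid.
    - rewrite cexp_clog by auto. apply Cmult_1_r. }
  apply is_derive_Caratheodory with (fun w => / s w)%C; [| auto with limits].
  generalize (filter_and _ _ (locally_neq a 0%C Ha) (filterlim_Cneq_0 _ _ _ Hs Ha)).
  apply filter_imp. intros w [Hw Hsw].
  pose proof (slope_mult cexp (clog a) a (clog w)) as E. fold (s w) in E.
  rewrite !cexp_clog in E by auto. rewrite <- E. field. exact Hsw.
Qed.
#[local] Hint Resolve is_derive_clog : derive.

(** * Mean values of periodic holomorphic functions *)

Lemma Re_mult_le (z w : C) : Rabs (Re (z * w)) <= Cmod z * Cmod w.
Proof. rewrite <- Cmod_mult. apply re_le_Cmod. Qed.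

Lemma Re_conj_mult (z : C) : Re (Cconj z * z) = Cmod z ^ 2.
Proof. rewrite Cmod2_alt. unfold Cconj, Re, Im. simpl. ring. Qed.

Lemma C_eq_of_Re_mult (z w : C) : (forall u, Re (u * z) = Re (u * w)) -> z = w.
Proof.
  intros H. pose proof (H 1%C) as Hre. pose proof (H Ci) as Him. destruct z, w. simpl in *.
  f_equal; lra.
Qed.

Lemma is_derive_Re_line (f : C -> C) (z v l : C) (t : R) :
  is_derive f (z + t * v)%C l -> is_derive (fun s : R => Re (f (z + s * v)%C)) t (Re (v * l)).
Proof.
  rewrite is_derive_C_eps. intros Hf. split; [apply is_linear_scal_l |]. intros x Hx eps.
  rewrite <- (is_filter_lim_locally_unique (V := R_NormedModule) t x Hx). clear x Hx.
  pose proof (Cmod_ge_0 v) as Hv. pose proof (cond_pos eps) as Heps.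
  assert (Hline : filterlim (fun s : R => z + s * v)%C (locally t) (locally (z + t * v)%C)).
  { assert (continuous RtoC t) by (apply continuous_C_pair;
      [apply continuous_id | apply continuous_const]).
    unfold continuous in *. auto with limits. }
  specialize (Hf (eps / (Cmod v + 1)) ltac:(apply Rdiv_lt_0_compat; lra)).
  refine (filter_imp (F := locally t) _ _ _ (Hline _ Hf)). intros s Hs.
  change (Rabs (Re (f (z + s * v)%C) - Re (f (z + t * v)%C) - (s - t) * Re (v * l))
    <= eps * Rabs (s - t)).
  replace (z + s * v - (z + t * v))%C with ((s - t)%R * v)%C in Hs by (rewrite RtoC_minus; ring).
  rewrite <- re_scal_l, <- !re_minus, Cmult_assoc. eapply Rle_trans; [apply re_le_Cmod |].
  eapply Rle_trans; [exact Hs |]. rewrite Cmod_mult, Cmod_R. pose proof (Rabs_pos (s - t)).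
  replace (eps / (Cmod v + 1) * (Rabs (s - t) * Cmod v))
    with (eps * Rabs (s - t) * (Cmod v / (Cmod v + 1))) by (field; lra).
  rewrite <- Rmult_1_r. apply Rmult_le_compat_l; [nra |]. apply Rle_div_l; lra.
Qed.

Lemma continuity_2d_pt_Re (f : C -> C) (x y : R) :
  continuous f (x, y) -> continuity_2d_pt (fun a b => Re (f (a, b))) x y.
Proof.
  intros H. apply continuity_2d_pt_filterlim.
  apply filterlim_ext with (fun p : R * R => Re (f p)); [intros []; reflexivity |].
  apply (continuous_comp f Re); [exact H | apply continuous_Re].
Qed.

Lemma continuous_line (f : C -> C) (x y : R) :
  continuous f (x, y) -> continuous (fun a => f (a, y)) x.
Proof.
  intros H. apply (continuous_comp (fun a : R => (a, y) : C) f); [| exact H].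
  apply continuous_C_pair; [apply continuous_id | apply continuous_const].
Qed.

Lemma continuous_Re_line (f : C -> C) (x y : R) :
  continuous f (x, y) -> continuous (fun a => Re (f (a, y))) x.
Proof.
  intros H. apply (continuous_comp (fun a => f (a, y)) Re);
    [apply continuous_line, H | apply continuous_Re].
Qed.

Lemma ex_RInt_Re_line (f : C -> C) (y a b : R) :
  (forall x, continuous f (x, y)) -> ex_RInt (fun x => Re (f (x, y))) a b.
Proof.
  intros H. apply (ex_RInt_continuous (V := R_CompleteNormedModule)). intros x _.
  apply continuous_Re_line, H.
Qed.

Lemma continuous_Cscal (u : C) (f : C -> C) (z : C) :
  continuous f z -> continuous (fun w => u * f w)%C z.
Proof. unfold continuous. auto with limits. Qed.

Definition horizontal_mean (f : C -> C) (y : R) : C :=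
  (RInt (fun x => Re (f (x, y))) 0 1, RInt (fun x => Re (- Ci * f (x, y))) 0 1).

Lemma Re_mult_horizontal_mean (u : C) (f : C -> C) (y : R) : (forall x, continuous f (x, y)) ->
  Re (u * horizontal_mean f y) = RInt (fun x => Re (u * f (x, y))) 0 1.
Proof.
  intros H. rewrite re_mult. unfold horizontal_mean. cbn [Re Im fst snd].
  assert (E1 : ex_RInt (fun x => Re (f (x, y))) 0 1) by (apply ex_RInt_Re_line, H).
  assert (E2 : ex_RInt (fun x => Re (- Ci * f (x, y))) 0 1).
  { apply (ex_RInt_Re_line (fun w => - Ci * f w)%C). intros x. apply continuous_Cscal, H. }
  transitivity (minus (scal (Re u) (RInt (fun x => Re (f (x, y))) 0 1))
    (scal (Im u) (RInt (fun x => Re (- Ci * f (x, y))) 0 1))); [reflexivity |].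
  rewrite <- !(RInt_scal (V := R_CompleteNormedModule)) by auto.
  rewrite <- (RInt_minus (V := R_CompleteNormedModule))
    by (apply (ex_RInt_scal (V := R_NormedModule)); auto).
  apply RInt_ext. intros x _. destruct u, (f (x, y)).
  unfold minus, plus, opp, scal; simpl. unfold mult; simpl. ring.
Qed.

Lemma Cmod_horizontal_mean_le (f : C -> C) (y B : R) : (forall x, continuous f (x, y)) ->
  (forall x, 0 <= x <= 1 -> Cmod (f (x, y)) <= B) -> Cmod (horizontal_mean f y) <= B.
Proof.
  intros Hc HB. set (m := horizontal_mean f y).
  assert (H : Rabs (Re (Cconj m * m)) <= Cmod m * B).
  { unfold m at 2. rewrite Re_mult_horizontal_mean by auto.
    replace (Cmod m * B) with ((1 - 0) * (Cmod m * B)) by ring.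
    apply abs_RInt_le_const; [lra | |].
    - apply (ex_RInt_Re_line (fun w => Cconj m * f w)%C). intros x. apply continuous_Cscal, Hc.
    - intros x Hx. eapply Rle_trans; [apply Re_mult_le |]. rewrite Cmod_conj.
      apply Rmult_le_compat_l; [apply Cmod_ge_0 | auto]. }
  rewrite Re_conj_mult in H. pose proof (Cmod_ge_0 m). rewrite Rabs_right in H by nra.
  destruct (Req_dec (Cmod m) 0) as [-> | Hm]; [| nra].
  eapply Rle_trans; [apply Cmod_ge_0 | apply (HB 0); lra].
Qed.

Lemma horizontal_mean_minus (f g : C -> C) (y : R) :
  (forall x, continuous f (x, y)) -> (forall x, continuous g (x, y)) ->
  horizontal_mean (fun w => f w - g w)%C y = (horizontal_mean f y - horizontal_mean g y)%C.
Proof.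
  intros Hf Hg. apply C_eq_of_Re_mult. intros u.
  replace (u * (horizontal_mean f y - horizontal_mean g y))%C
    with (u * horizontal_mean f y - u * horizontal_mean g y)%C by ring.
  rewrite re_minus, !Re_mult_horizontal_mean; auto.
  - rewrite <- (RInt_minus (V := R_CompleteNormedModule)).
    + apply RInt_ext. intros x _. unfold minus, plus, opp; simpl. ring.
    + apply (ex_RInt_Re_line (fun w => u * f w)%C). intros x. apply continuous_Cscal, Hf.
    + apply (ex_RInt_Re_line (fun w => u * g w)%C). intros x. apply continuous_Cscal, Hg.
  - intros x. specialize (Hf x). specialize (Hg x). unfold continuous in *. auto with limits.
Qed.

Lemma horizontal_mean_const (c : C) (y : R) : horizontal_mean (fun _ => c) y = c.
Proof.
  apply C_eq_of_Re_mult. intros u.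
  rewrite Re_mult_horizontal_mean by (intros; apply continuous_const).
  rewrite RInt_const. unfold scal; simpl. unfold mult; simpl. ring.
Qed.

Definition periodic (f : C -> C) : Prop := forall z, upper z -> f (z + 1)%C = f z.

Lemma upper_plus_R (z : C) (x : R) : upper z -> upper (z + x).
Proof. unfold upper. rewrite im_plus, im_RtoC. lra. Qed.

Lemma upper_scal (r : R) (z : C) : 0 < r -> upper z -> upper (r * z).
Proof. unfold upper. rewrite im_scal_l. intros. apply Rmult_lt_0_compat; auto. Qed.

Lemma shift_IZR (f : C -> C) (c : C) : (forall z, upper z -> f (z + 1)%C = (f z + c)%C) ->
  forall (n : Z) (z : C), upper z -> f (z + IZR n)%C = (f z + IZR n * c)%C.
Proof.
  intros H.
  assert (Hnat : forall (n : nat) z, upper z -> f (z + INR n)%C = (f z + INR n * c)%C).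
  { induction n as [| n IH]; intros z Hz.
    - simpl INR. rewrite Cplus_0_r. ring.
    - rewrite S_INR, RtoC_plus. replace (z + (INR n + 1))%C with ((z + INR n) + 1)%C by ring.
      rewrite H, IH by (try apply upper_plus_R; auto). ring. }
  intros n z Hz. destruct (Z_le_gt_dec 0 n).
  - rewrite <- (Z2Nat.id n), <- INR_IZR_INZ by auto. auto.
  - pose proof (Hnat (Z.to_nat (- n)) (z + IZR n)%C (upper_plus_R z _ Hz)) as E.
    rewrite INR_IZR_INZ, Z2Nat.id, opp_IZR, RtoC_opp in E by lia.
    replace (z + IZR n + - IZR n)%C with z in E by ring. rewrite E. ring.
Qed.

Lemma periodic_IZR (f : C -> C) : periodic f ->
  forall (n : Z) (z : C), upper z -> f (z + IZR n)%C = f z.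
Proof.
  intros H n z Hz. rewrite (shift_IZR f 0%C); [ring | | exact Hz]. intros w Hw.
  rewrite H by auto. ring.
Qed.

Lemma floor_shift (x : R) : 0 <= x + IZR (1 - up x) < 1.
Proof. destruct (archimed x). rewrite minus_IZR. lra. Qed.

(* [f] may fail to be differentiable at one height [y0]. *)
Section HorizontalMeanConstant.
Variables (f f' : C -> C) (y0 : R).
Hypothesis f_periodic : periodic f.
Hypothesis f_continuous : forall z, upper z -> continuous f z.
Hypothesis f_holomorphic : holomorphic_on (fun z => upper z /\ Im z <> y0) f f'.

Lemma continuous_mean_slice (u : C) (y : R) : 0 < y ->
  continuous (fun b => RInt (fun x => Re (u * f (x, b))) 0 1) y.
Proof.
  intros Hy. apply filterlim_locally. intros eps.
  assert (Heps : 0 < eps / 2) by (pose proof (cond_pos eps); lra).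
  assert (Huf : forall x b, 0 < b -> continuous (fun w => u * f w)%C (x, b)).
  { intros x b Hb. apply continuous_Cscal, f_continuous, Hb. }
  destruct (uniform_continuity_2d_1d (fun a b => Re (u * f (a, b))) 0 1 y)
    with (eps := mkposreal _ Heps) as [d Hd].
  { intros x _. apply (continuity_2d_pt_Re (fun w => u * f w)%C), Huf, Hy. }
  cbn [pos] in Hd.
  assert (Hmin : 0 < Rmin d y) by (apply Rmin_pos; [apply cond_pos | auto]).
  exists (mkposreal _ Hmin). intros b Hb. change (Rabs (b - y) < Rmin d y) in Hb.
  pose proof (Rmin_l d y); pose proof (Rmin_r d y). pose proof (cond_pos d).
  apply Rabs_lt_between in Hb.
  change (Rabs (RInt (fun x => Re (u * f (x, b))) 0 1 - RInt (fun x => Re (u * f (x, y))) 0 1)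
    < eps).
  change Rminus with (@minus R_AbelianGroup).
  assert (Hex : forall h, 0 < h -> ex_RInt (fun x => Re (u * f (x, h))) 0 1).
  { intros h Hh. apply (ex_RInt_Re_line (fun w => u * f w)%C). intros x. apply Huf, Hh. }
  rewrite <- (RInt_minus (V := R_CompleteNormedModule)) by (apply Hex; lra).
  apply Rle_lt_trans with ((1 - 0) * (eps / 2)); [| lra].
  apply abs_RInt_le_const; [lra | apply (ex_RInt_minus (V := R_NormedModule)); apply Hex; lra |].
  intros x Hx. left. apply (Hd x y x b); try lra. rewrite Rminus_diag, Rabs_R0; auto.
Qed.

Lemma is_derive_vertical_slice (u : C) (a b : R) : 0 < b -> b <> y0 ->
  is_derive (fun s => Re (u * f (a, s))) b (Re (Ci * (u * f' (a, b)))).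
Proof.
  intros Hb Hb0. apply is_derive_ext with (fun s : R => Re (u * f (RtoC a + s * Ci)%C)).
  { intros s. do 3 f_equal. apply injective_projections; simpl; ring. }
  apply (is_derive_Re_line (fun w => u * f w)%C).
  replace (RtoC a + b * Ci)%C with ((a, b) : C) by (rewrite C_re_im; ring).
  destruct (f_holomorphic (a, b)) as [D _]; [split; auto |].
  eapply is_derive_eq; [eauto with derive | simpl; ring].
Qed.

Lemma is_derive_horizontal_slice (u : C) (a b : R) : 0 < b -> b <> y0 ->
  is_derive (fun s => Re (u * f (s, b))) a (Re (1 * (u * f' (a, b)))).
Proof.
  intros Hb Hb0. apply is_derive_ext with (fun s : R => Re (u * f (Ci * b + s * 1)%C)).
  { intros s. do 3 f_equal. apply injective_projections; simpl; ring. }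
  apply (is_derive_Re_line (fun w => u * f w)%C).
  replace (Ci * b + a * 1)%C with ((a, b) : C) by (rewrite C_re_im; ring).
  destruct (f_holomorphic (a, b)) as [D _]; [split; auto |].
  eapply is_derive_eq; [eauto with derive | simpl; ring].
Qed.

Lemma RInt_periodic_derivative (u : C) (y : R) : 0 < y -> y <> y0 ->
  RInt (fun a => Re (1 * (u * f' (a, y)))) 0 1 = 0.
Proof.
  intros Hy Hy0. transitivity (minus (Re (u * f (1, y))) (Re (u * f (0, y)))).
  - apply is_RInt_unique.
    apply (is_RInt_derive (V := R_CompleteNormedModule) (fun a => Re (u * f (a, y)))).
    + intros a _. apply is_derive_horizontal_slice; auto.
    + intros a _. apply (continuous_Re_line (fun w => 1 * (u * f' w))%C).
      apply continuous_Cscal, continuous_Cscal, f_holomorphic. split; auto.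
  - rewrite <- (f_periodic (0, y)) by exact Hy.
    replace ((0, y) + 1)%C with ((1, y) : C) by (apply injective_projections; simpl; ring).
    apply Rminus_diag.
Qed.

Lemma is_derive_mean_slice (u : C) (y : R) : 0 < y -> y <> y0 ->
  is_derive (fun b => RInt (fun x => Re (u * f (x, b))) 0 1) y 0.
Proof.
  intros Hy Hy0. assert (Hnear : locally y (fun b => 0 < b /\ b <> y0)).
  { apply filter_and; [apply (open_gt 0 y Hy) |]. apply (open_neq y0 y Hy0). }
  assert (Hmean : RInt (fun a => Derive (fun s => Re (u * f (a, s))) y) 0 1 = 0).
  { etransitivity; [| apply (RInt_periodic_derivative (u * Ci) y Hy Hy0)].
    apply RInt_ext. intros a _.
    erewrite is_derive_unique by (apply is_derive_vertical_slice; auto). f_equal. ring. }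
  cut (is_derive (fun b => RInt (fun x => Re (u * f (x, b))) 0 1) y
    (RInt (fun a => Derive (fun s => Re (u * f (a, s))) y) 0 1)); [rewrite Hmean; auto |].
  apply (is_derive_RInt_param (fun s a => Re (u * f (a, s))) 0 1 y).
  - revert Hnear. apply filter_imp. intros b [Hb Hb0] a _. eexists.
    apply is_derive_vertical_slice; auto.
  - intros a _. apply continuity_2d_pt_ext_loc with (fun b a => Re (Ci * u * f' (a, b))).
    + destruct Hnear as [d Hd]. exists d. intros b c Hb _. destruct (Hd b Hb).
      symmetry. rewrite <- Cmult_assoc. apply is_derive_unique, is_derive_vertical_slice; auto.
    + assert (Hc : continuity_2d_pt (fun a b => Re (Ci * u * f' (a, b))) a y).
      { apply (continuity_2d_pt_Re (fun w => Ci * u * f' w)%C), continuous_Cscal, f_holomorphic.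
        split; auto. }
      intros eps. destruct (Hc eps) as [d Hd]. exists d. auto.
  - revert Hnear. apply filter_imp. intros b [Hb _]. apply (ex_RInt_Re_line (fun w => u * f w)%C).
    intros a. apply continuous_Cscal, f_continuous, Hb.
Qed.

Lemma horizontal_mean_eq (a b : R) : 0 < a -> 0 < b -> horizontal_mean f a = horizontal_mean f b.
Proof.
  assert (OneSide : forall u a b, 0 < a < b -> y0 <= a \/ b <= y0 ->
    RInt (fun x => Re (u * f (x, a))) 0 1 = RInt (fun x => Re (u * f (x, b))) 0 1).
  { intros u a' b' [Ha Hab] Hy.
    destruct (MVT_gen (fun y => RInt (fun x => Re (u * f (x, y))) 0 1) a' b' (fun _ => 0))
      as [c [_ E]].
    - intros x Hx. rewrite Rmin_left, Rmax_right in Hx by lra. apply is_derive_mean_slice; lra.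
    - intros x Hx. rewrite Rmin_left, Rmax_right in Hx by lra.
      apply continuity_pt_filterlim, continuous_mean_slice. lra.
    - lra. }
  assert (Ordered : forall a b, 0 < a < b -> horizontal_mean f a = horizontal_mean f b).
  { intros a' b' H. apply C_eq_of_Re_mult. intros u.
    rewrite !Re_mult_horizontal_mean by (intros; apply f_continuous; unfold upper; simpl; lra).
    destruct (Rle_dec y0 a') as [H1 | H1]; [apply OneSide; auto |].
    destruct (Rle_dec b' y0) as [H2 | H2]; [apply OneSide; auto |].
    rewrite (OneSide u a' y0), (OneSide u y0 b'); auto; lra. }
  intros Ha Hb. destruct (Rtotal_order a b) as [H | [-> | H]]; auto. symmetry; auto.
Qed.

Lemma horizontal_mean_eq_limit (l : C) (y : R) :
  filterlim f Im_infty (locally l) -> 0 < y -> horizontal_mean f y = l.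
Proof.
  rewrite filterlim_Cmod by typeclasses eauto. intros Hl Hy.
  apply Cmod_minus_small_eq. intros eps Heps. destruct (Hl (eps / 2) ltac:(lra)) as [Y HY].
  set (h := Rmax 0 Y + 1). pose proof (Rmax_l 0 Y); pose proof (Rmax_r 0 Y).
  assert (Hh : forall x, continuous f (x, h))
    by (intros; apply f_continuous; unfold upper, h; simpl; lra).
  rewrite (horizontal_mean_eq y h), <- (horizontal_mean_const l h), <- horizontal_mean_minus
    by (auto using continuous_const; unfold h; lra).
  apply Rle_lt_trans with (eps / 2); [| lra]. apply Cmod_horizontal_mean_le.
  - intros x. specialize (Hh x). unfold continuous in *. auto with limits.
  - intros x _. left. apply HY. simpl. unfold h. lra.
Qed.
End HorizontalMeanConstant.

Lemma RInt_nonneg_eq_0 (h : R -> R) (a b : R) : a < b ->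
  (forall x, a <= x <= b -> continuous h x) -> (forall x, a <= x <= b -> 0 <= h x) ->
  RInt h a b = 0 -> forall x, a <= x <= b -> h x = 0.
Proof.
  intros Hab Hc Hnn HI x Hx. destruct (Req_dec (h x) 0) as [E | Hn]; auto. exfalso.
  assert (Hpos : 0 < h x) by (specialize (Hnn x Hx); lra).
  destruct (Hc x Hx _ (open_gt 0 (h x) Hpos)) as [d Hd]. pose proof (cond_pos d).
  set (p := Rmax a (x - d / 2)). set (q := Rmin b (x + d / 2)).
  assert (Hpq : a <= p /\ x - d / 2 <= p /\ p < q /\ q <= b /\ q <= x + d / 2).
  { unfold p, q. repeat split; auto using Rmax_l, Rmax_r, Rmin_l, Rmin_r.
    apply Rmax_lub_lt; apply Rmin_glb_lt; lra. }
  assert (Hex : forall s t, a <= s <= t -> t <= b -> ex_RInt h s t).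
  { intros s t Hs Ht. apply (ex_RInt_continuous (V := R_CompleteNormedModule)).
    intros z Hz. rewrite Rmin_left, Rmax_right in Hz by lra. apply Hc. lra. }
  assert (0 < RInt h p q).
  { apply RInt_gt_0; [lra | | intros; apply Hc; lra].
    intros t Ht. apply Hd. change (Rabs (t - x) < d). apply Rabs_lt_between. lra. }
  assert (0 <= RInt h a p) by (apply RInt_ge_0; [| apply Hex | intros; apply Hnn]; lra).
  assert (0 <= RInt h q b) by (apply RInt_ge_0; [| apply Hex | intros; apply Hnn]; lra).
  pose proof (RInt_Chasles h a p q (Hex a p ltac:(lra) ltac:(lra)) (Hex p q ltac:(lra) ltac:(lra)))
    as C1.
  pose proof (RInt_Chasles h a q b (Hex a q ltac:(lra) ltac:(lra)) (Hex q b ltac:(lra) ltac:(lra)))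
    as C2.
  unfold plus in C1, C2; simpl in C1, C2. lra.
Qed.

Lemma C_eq_of_Re_conj_mult (z w : C) :
  Cmod z <= Cmod w -> Re (Cconj w * z) = Cmod w ^ 2 -> z = w.
Proof.
  intros Hle H. apply Cmod_minus_eq_0.
  assert (E : Cmod (z - w) ^ 2 = Cmod z ^ 2 + Cmod w ^ 2 - 2 * Re (Cconj w * z)).
  { rewrite !Cmod2_alt. unfold Cconj, Re, Im; simpl. ring. }
  pose proof (Cmod_ge_0 z). pose proof (Cmod_ge_0 (z - w)). nra.
Qed.

Lemma holomorphic_on_upper_off (f f' : C -> C) (y0 : R) :
  holomorphic_on upper f f' -> holomorphic_on (fun z => upper z /\ Im z <> y0) f f'.
Proof. intros H z [Hz _]. auto. Qed.

(* At every height, [Cmod l ^ 2 - Re (Cconj l * f)] is nonnegative with integral [0]. *)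
Lemma periodic_maximum_principle (f f' : C -> C) (l : C) :
  periodic f -> holomorphic_on upper f f' -> filterlim f Im_infty (locally l) ->
  (forall z, upper z -> Cmod (f z) <= Cmod l) -> forall z, upper z -> f z = l.
Proof.
  intros Hper Hf Hl HB z Hz.
  assert (Hc : forall w, upper w -> continuous f w)
    by (intros; apply (holomorphic_on_continuous upper f f'); auto).
  rewrite <- (periodic_IZR f Hper (1 - up (Re z)) z Hz).
  destruct z as [x y]. unfold upper in Hz. simpl in Hz.
  replace ((x, y) + IZR (1 - up (Re (x, y))))%C with ((x + IZR (1 - up x), y) : C)
    by (apply injective_projections; simpl; ring).
  pose proof (floor_shift x) as Hx. set (x' := x + IZR (1 - up x)) in *.
  apply C_eq_of_Re_conj_mult; [apply HB, Hz |].
  set (h := fun t => Cmod l ^ 2 - Re (Cconj l * f (t, y))).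
  assert (Hcont : forall t, continuous (fun w => Cconj l * f w)%C (t, y))
    by (intros; apply continuous_Cscal, Hc, Hz).
  apply Rminus_diag_uniq_sym. change (h x' = 0). apply (RInt_nonneg_eq_0 h 0 1); try lra.
  - intros t _. apply (continuous_minus (V := R_NormedModule)); [apply continuous_const |].
    apply (continuous_Re_line (fun w => Cconj l * f w)%C), Hcont.
  - intros t _. unfold h. pose proof (Re_mult_le (Cconj l) (f (t, y))) as Hle.
    rewrite Cmod_conj in Hle.
    apply Rabs_le_between in Hle. pose proof (HB (t, y) Hz). pose proof (Cmod_ge_0 l). nra.
  - unfold h. rewrite (RInt_minus (V := R_CompleteNormedModule)); [| apply ex_RInt_const |].
    + rewrite RInt_const, <- Re_mult_horizontal_mean by (intros; apply Hc, Hz).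
      rewrite (horizontal_mean_eq_limit f f' (-1) Hper Hc
        (holomorphic_on_upper_off f f' _ Hf) l y Hl Hz).
      rewrite Re_conj_mult. unfold minus, plus, opp, scal; simpl. unfold mult; simpl. ring.
    + apply (ex_RInt_Re_line (fun w => Cconj l * f w)%C), Hcont.
Qed.

(** * Unordered sums *)

Definition Csum {T : Type} (f : T -> C) (L : list T) : C := fold_right Cplus 0%C (map f L).
Definition Rsum {T : Type} (b : T -> R) (L : list T) : R := fold_right Rplus 0 (map b L).

Definition eq_dec {T : Type} (x y : T) : {x = y} + {x <> y} := excluded_middle_informative (x = y).

Definition finite_subsets {T : Type} (P : list T -> Prop) : Prop :=
  exists L0, forall L, NoDup L -> incl L0 L -> P L.

#[local] Instance finite_subsets_filter (T : Type) : ProperFilter (@finite_subsets T).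
Proof.
  constructor.
  - intros P [L0 H]. exists (nodup eq_dec L0). apply H; [apply NoDup_nodup |].
    intros t Ht. apply nodup_In, Ht.
  - constructor.
    + exists nil. auto.
    + intros P Q [L1 H1] [L2 H2]. exists (L1 ++ L2). intros L HL Hincl.
      apply incl_app_inv in Hincl as [I1 I2]. auto.
    + intros P Q HPQ [L0 H]. exists L0. auto.
Qed.

Definition has_sum {T : Type} (f : T -> C) (l : C) : Prop :=
  filterlim (Csum f) finite_subsets (locally l).

Definition summable {T : Type} (b : T -> R) : Prop :=
  (forall t, 0 <= b t) /\ exists B, forall L, NoDup L -> Rsum b L <= B.

Definition usum {T : Type} (f : T -> C) : C := epsilon (inhabits (RtoC 0)) (has_sum f).

Section FiniteSums.
Context {T : Type}.
Implicit Types (f g : T -> C) (b : T -> R) (L : list T).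

Lemma Csum_app f L1 L2 : Csum f (L1 ++ L2) = (Csum f L1 + Csum f L2)%C.
Proof. induction L1 as [| x L1 IH]; unfold Csum in *; simpl; [ring | rewrite IH; ring]. Qed.

Lemma Rsum_app b L1 L2 : Rsum b (L1 ++ L2) = Rsum b L1 + Rsum b L2.
Proof. induction L1 as [| x L1 IH]; unfold Rsum in *; simpl; [ring | rewrite IH; ring]. Qed.

Lemma Csum_perm f L1 L2 : Permutation L1 L2 -> Csum f L1 = Csum f L2.
Proof.
  induction 1 as [| x L1 L2 _ IH | x y L | L1 L2 L3 _ IH1 _ IH2]; unfold Csum in *; simpl;
    [reflexivity | rewrite IH; reflexivity | ring | congruence].
Qed.

Lemma Rsum_perm b L1 L2 : Permutation L1 L2 -> Rsum b L1 = Rsum b L2.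
Proof.
  induction 1 as [| x L1 L2 _ IH | x y L | L1 L2 L3 _ IH1 _ IH2]; unfold Rsum in *; simpl;
    [reflexivity | rewrite IH; reflexivity | ring | congruence].
Qed.

Lemma Csum_map {T'} f (phi : T' -> T) (L : list T') :
  Csum f (map phi L) = Csum (fun t => f (phi t)) L.
Proof. unfold Csum. rewrite map_map. reflexivity. Qed.

Lemma Rsum_map {T'} b (phi : T' -> T) (L : list T') :
  Rsum b (map phi L) = Rsum (fun t => b (phi t)) L.
Proof. unfold Rsum. rewrite map_map. reflexivity. Qed.

Lemma Csum_ext_in f g L : (forall t, In t L -> f t = g t) -> Csum f L = Csum g L.
Proof. intros H. unfold Csum. f_equal. apply map_ext_in, H. Qed.

Lemma Csum_eq_0 f L : (forall t, In t L -> f t = 0%C) -> Csum f L = 0%C.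
Proof.
  intros H. induction L as [| x L IH]; [reflexivity |]. unfold Csum in *. simpl.
  rewrite IH, H by (intros; try apply H; simpl; auto). ring.
Qed.

Lemma Csum_plus f g L : Csum (fun t => f t + g t)%C L = (Csum f L + Csum g L)%C.
Proof. induction L as [| x L IH]; unfold Csum in *; simpl; [ring | rewrite IH; ring]. Qed.

Lemma Csum_scal (c : C) f L : Csum (fun t => c * f t)%C L = (c * Csum f L)%C.
Proof. induction L as [| x L IH]; unfold Csum in *; simpl; [ring | rewrite IH; ring]. Qed.

Lemma Csum_RtoC b L : Csum (fun t => RtoC (b t)) L = RtoC (Rsum b L).
Proof.
  induction L as [| x L IH]; unfold Csum, Rsum in *; simpl; [| rewrite IH, RtoC_plus]; reflexivity.
Qed.

Lemma Rsum_plus b b' L : Rsum (fun t => b t + b' t) L = Rsum b L + Rsum b' L.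
Proof. induction L as [| x L IH]; unfold Rsum in *; simpl; [ring | rewrite IH; ring]. Qed.

Lemma Rsum_scal (c : R) b L : Rsum (fun t => c * b t) L = c * Rsum b L.
Proof. induction L as [| x L IH]; unfold Rsum in *; simpl; [ring | rewrite IH; ring]. Qed.

Lemma Rsum_ext_in b b' L : (forall t, In t L -> b t = b' t) -> Rsum b L = Rsum b' L.
Proof. intros H. unfold Rsum. f_equal. apply map_ext_in, H. Qed.

Lemma Rsum_le b b' L : (forall t, In t L -> b t <= b' t) -> Rsum b L <= Rsum b' L.
Proof.
  induction L as [| x L IH]; intros H; unfold Rsum in *; simpl; [lra |].
  apply Rplus_le_compat; [apply H | apply IH; intros; apply H]; simpl; auto.
Qed.

Lemma Rsum_nonneg b L : (forall t, 0 <= b t) -> 0 <= Rsum b L.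
Proof.
  intros H. induction L as [| x L IH]; unfold Rsum in *; simpl; [lra |]. specialize (H x). lra.
Qed.

Lemma Cmod_Csum_le f b L : (forall t, Cmod (f t) <= b t) -> Cmod (Csum f L) <= Rsum b L.
Proof.
  intros H. induction L as [| x L IH]; unfold Csum, Rsum in *; simpl; [rewrite Cmod_0; lra |].
  eapply Rle_trans; [apply Cmod_triangle |]. apply Rplus_le_compat; auto.
Qed.

Lemma Permutation_incl_app L0 L : NoDup L -> NoDup L0 -> incl L0 L ->
  exists L', Permutation L (L0 ++ L') /\ NoDup L' /\ forall t, In t L' -> ~ In t L0.
Proof.
  intros HL HL0 Hincl.
  exists (set_diff eq_dec L L0). split; [| split; [apply set_diff_nodup, HL |]].
  - apply NoDup_Permutation; [auto | |].
    + apply NoDup_app; [auto | apply set_diff_nodup, HL |]. intros t Ht Hd.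
      apply set_diff_iff in Hd. tauto.
    + intros t. rewrite in_app_iff, set_diff_iff. destruct (in_dec eq_dec t L0); firstorder.
  - intros t Ht. apply set_diff_iff in Ht. tauto.
Qed.

Lemma Rsum_incl b L L' : (forall t, 0 <= b t) -> NoDup L -> incl L L' -> Rsum b L <= Rsum b L'.
Proof.
  intros Hb HL Hincl.
  assert (Hnodup : Rsum b (nodup eq_dec L') <= Rsum b L').
  { clear - Hb. induction L' as [| x L' IH]; simpl; [lra |].
    destruct (in_dec eq_dec x L'); unfold Rsum in *; simpl; specialize (Hb x); lra. }
  destruct (Permutation_incl_app L (nodup eq_dec L')) as [M [HP _]]; auto using NoDup_nodup.
  { intros t Ht. apply nodup_In; auto. }
  rewrite (Rsum_perm _ _ _ HP), Rsum_app in Hnodup. pose proof (Rsum_nonneg b M Hb). lra.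
Qed.
End FiniteSums.

Lemma nat_list_bound (L : list nat) : exists N, forall n, In n L -> (n < N)%nat.
Proof.
  exists (S (list_max L)). intros n Hn.
  pose proof (proj1 (list_max_le L (list_max L)) (Nat.le_refl _)) as H.
  rewrite Forall_forall in H. specialize (H n Hn). lia.
Qed.

Section Summable.
Context {T : Type}.
Implicit Types (f g : T -> C) (b : T -> R) (L : list T).

Lemma summable_le b b' : (forall t, 0 <= b t <= b' t) -> summable b' -> summable b.
Proof.
  intros H [_ [B HB]]. split; [intros; apply H |]. exists B. intros L HL.
  eapply Rle_trans; [apply Rsum_le; intros; apply H | auto].
Qed.

Lemma summable_scal (c : R) b : 0 <= c -> summable b -> summable (fun t => c * b t).
Proof.
  intros Hc [Hb [B HB]]. split; [intros; apply Rmult_le_pos; auto |].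
  exists (c * B). intros L HL. rewrite Rsum_scal. apply Rmult_le_compat_l; auto.
Qed.

Lemma summable_supremum b : summable b -> exists S, (forall L, NoDup L -> Rsum b L <= S) /\
  forall eps, 0 < eps -> exists L0, NoDup L0 /\ S - eps < Rsum b L0.
Proof.
  intros [Hb [B HB]].
  destruct (completeness (fun s => exists L, NoDup L /\ s = Rsum b L)) as [S [Hub Hlub]].
  { exists B. intros s [L [HL ->]]; auto. }
  { exists (Rsum b nil), nil. split; [constructor | auto]. }
  exists S. split; [intros L HL; apply Hub; eauto |].
  intros eps Heps. apply NNPP. intros Hn. assert (S <= S - eps); [| lra].
  apply Hlub. intros s [L [HL ->]]. apply Rnot_lt_le. intros Hlt. apply Hn. eauto.
Qed.

Lemma summable_tail b : summable b -> forall eps, 0 < eps -> exists L0, NoDup L0 /\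
  forall L, NoDup L -> (forall t, In t L -> ~ In t L0) -> Rsum b L < eps.
Proof.
  intros Hb eps Heps. destruct (summable_supremum b Hb) as [S [Hub Happrox]].
  destruct (Happrox eps Heps) as [L0 [HL0 Hlt]]. exists L0. split; auto. intros L HL Hdisj.
  assert (Hle : Rsum b (L0 ++ L) <= S) by (apply Hub, NoDup_app; firstorder).
  rewrite Rsum_app in Hle. lra.
Qed.

Lemma has_sum_unique f l m : has_sum f l -> has_sum f m -> l = m.
Proof. apply (filterlim_locally_unique (V := C_NormedModule)). Qed.

Lemma has_sum_ext f g l : (forall t, f t = g t) -> has_sum f l -> has_sum g l.
Proof. intros H. apply filterlim_ext. intros L. apply Csum_ext_in. auto. Qed.

Lemma has_sum_plus f g l m :
  has_sum f l -> has_sum g m -> has_sum (fun t => f t + g t)%C (l + m)%C.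
Proof.
  intros Hf Hg. apply filterlim_ext with (fun L => Csum f L + Csum g L)%C.
  - intros L. symmetry. apply Csum_plus.
  - apply filterlim_Cplus; auto. typeclasses eauto.
Qed.

Lemma has_sum_scal (c : C) f l : has_sum f l -> has_sum (fun t => c * f t)%C (c * l)%C.
Proof.
  intros Hf. apply filterlim_ext with (fun L => c * Csum f L)%C.
  - intros L. symmetry. apply Csum_scal.
  - unfold has_sum in Hf. auto with limits.
Qed.

Lemma has_sum_minus f g l m :
  has_sum f l -> has_sum g m -> has_sum (fun t => f t - g t)%C (l - m)%C.
Proof.
  intros Hf Hg. apply has_sum_ext with (fun t => f t + (-1) * g t)%C; [intros; ring |].
  replace (l - m)%C with (l + (-1) * m)%C by ring. apply has_sum_plus, has_sum_scal; auto.
Qed.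

Lemma has_sum_finite f L : NoDup L -> (forall t, ~ In t L -> f t = 0%C) -> has_sum f (Csum f L).
Proof.
  intros HL Hf. apply filterlim_Cmod; [typeclasses eauto |]. intros eps Heps.
  exists L. intros M HM Hincl.
  destruct (Permutation_incl_app L M HM HL Hincl) as [L' [HP [_ Hdisj]]].
  rewrite (Csum_perm _ _ _ HP), Csum_app, (Csum_eq_0 f L') by auto.
  rewrite Cplus_0_r, Cmod_minus_diag. exact Heps.
Qed.

Lemma has_sum_0 : has_sum (fun _ : T => RtoC 0) 0%C.
Proof. apply (has_sum_finite (fun _ : T => RtoC 0) nil); [constructor | auto]. Qed.

Lemma has_sum_nonneg b : summable b -> exists l, has_sum (fun t => RtoC (b t)) l.
Proof.
  intros Hb. destruct (summable_supremum b Hb) as [S [Hub Happrox]].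
  exists (RtoC S). apply filterlim_Cmod; [typeclasses eauto |]. intros eps Heps.
  destruct (Happrox eps Heps) as [L0 [HL0 Hlt]]. exists L0. intros L HL Hincl.
  rewrite Csum_RtoC, <- RtoC_minus, Cmod_R. pose proof (Hub L HL).
  pose proof (Rsum_incl b L0 L (proj1 Hb) HL0 Hincl). apply Rabs_lt_between. lra.
Qed.

Lemma has_sum_exists f b : summable b -> (forall t, Cmod (f t) <= b t) -> exists l, has_sum f l.
Proof.
  intros Hb Hf.
  assert (Hreal : forall h : T -> R, (forall t, Rabs (h t) <= b t) ->
    exists l, has_sum (fun t => RtoC (h t)) l).
  { intros h Hh. destruct (has_sum_nonneg (fun t => b t + h t)) as [l1 H1].
    { apply summable_le with (fun t => 2 * b t); [| apply summable_scal; auto; lra].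
      intros t. specialize (Hh t). apply Rabs_le_between in Hh. lra. }
    destruct (has_sum_nonneg b Hb) as [l2 H2]. exists (l1 - l2)%C.
    apply has_sum_ext with (fun t => RtoC (b t + h t) - RtoC (b t))%C.
    - intros t. rewrite RtoC_plus. ring.
    - apply has_sum_minus; auto. }
  destruct (Hreal (fun t => Re (f t))) as [l1 H1].
  { intros t. eapply Rle_trans; [apply re_le_Cmod | auto]. }
  destruct (Hreal (fun t => Im (f t))) as [l2 H2].
  { intros t. eapply Rle_trans; [apply im_le_Cmod | auto]. }
  exists (l1 + Ci * l2)%C.
  apply has_sum_ext with (fun t => RtoC (Re (f t)) + Ci * RtoC (Im (f t)))%C.
  - intros t. destruct (f t). symmetry. apply C_re_im.
  - apply has_sum_plus, has_sum_scal; auto.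
Qed.

Lemma has_sum_usum f b : summable b -> (forall t, Cmod (f t) <= b t) -> has_sum f (usum f).
Proof.
  intros Hb Hf.
  exact (epsilon_spec (inhabits (RtoC 0)) (has_sum f) (has_sum_exists f b Hb Hf)).
Qed.

Lemma usum_eq f l : has_sum f l -> usum f = l.
Proof.
  intros H. apply has_sum_unique with f; [| exact H].
  exact (epsilon_spec (inhabits (RtoC 0)) (has_sum f) (ex_intro _ l H)).
Qed.

Lemma usum_ext f g : (forall t, f t = g t) -> usum f = usum g.
Proof. intros H. f_equal. apply functional_extensionality, H. Qed.

Lemma has_sum_tail_le f b l L0 eps : (forall t, Cmod (f t) <= b t) -> has_sum f l -> NoDup L0 ->
  (forall L, NoDup L -> (forall t, In t L -> ~ In t L0) -> Rsum b L < eps) ->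
  Cmod (Csum f L0 - l) <= eps.
Proof.
  intros Hf Hl HL0 Htail. apply Rle_plus_epsilon. intros e He.
  unfold has_sum in Hl. rewrite filterlim_Cmod in Hl by typeclasses eauto.
  destruct (Hl e He) as [L1 H1]. set (L := nodup eq_dec (L0 ++ L1)).
  assert (HL : NoDup L) by apply NoDup_nodup.
  assert (Hin : forall t, In t L0 \/ In t L1 -> In t L)
    by (intros; apply nodup_In, in_app_iff; auto).
  destruct (Permutation_incl_app L0 L) as [L' [HP [HL' Hdisj]]];
    [auto | auto | intros t Ht; auto |].
  specialize (H1 L HL ltac:(intros t Ht; auto)).
  rewrite (Csum_perm _ _ _ HP), Csum_app in H1. pose proof (Cmod_Csum_le f b L' Hf).
  specialize (Htail L' HL' Hdisj).
  replace (Csum f L0 - l)%C with ((Csum f L0 + Csum f L' - l) - Csum f L')%C by ring.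
  eapply Rle_trans; [apply Cmod_minus_le |]. lra.
Qed.

Lemma Cmod_has_sum_le f b l B : (forall t, Cmod (f t) <= b t) ->
  (forall L, NoDup L -> Rsum b L <= B) -> has_sum f l -> Cmod l <= B.
Proof.
  intros Hf HB Hl. apply Rle_plus_epsilon. intros e He.
  unfold has_sum in Hl. rewrite filterlim_Cmod in Hl by typeclasses eauto.
  destruct (Hl e He) as [L0 H]. specialize (H (nodup eq_dec L0) (NoDup_nodup _ _)).
  specialize (H ltac:(intros t Ht; apply nodup_In, Ht)).
  pose proof (Cmod_Csum_le f b (nodup eq_dec L0) Hf). specialize (HB _ (NoDup_nodup eq_dec L0)).
  pose proof (Cmod_le_minus l (Csum f (nodup eq_dec L0))) as Hl0.
  rewrite Cmod_minus_sym in Hl0. lra.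
Qed.

Lemma filterlim_Csum {X : Type} (F : (X -> Prop) -> Prop) {FF : Filter F}
  (f : X -> T -> C) (g : T -> C) L : (forall t, filterlim (fun x => f x t) F (locally (g t))) ->
  filterlim (fun x => Csum (f x) L) F (locally (Csum g L)).
Proof.
  intros H. induction L as [| t L IH]; [apply (filterlim_Cconst F 0%C) |].
  unfold Csum in *; simpl. apply filterlim_Cplus; auto.
Qed.

(* Tannery's theorem *)
Lemma filterlim_usum {X : Type} (F : (X -> Prop) -> Prop) {FF : ProperFilter F}
  (f : X -> T -> C) (g : T -> C) b :
  summable b -> F (fun x => forall t, Cmod (f x t) <= b t) ->
  (forall t, filterlim (fun x => f x t) F (locally (g t))) ->
  filterlim (fun x => usum (f x)) F (locally (usum g)).
Proof.
  intros Hb Hdom Hlim.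
  assert (Hg : forall t, Cmod (g t) <= b t).
  { intros t. apply Rle_plus_epsilon. intros e He.
    destruct (filter_ex _ (filter_and _ _ Hdom (proj1 (filterlim_Cmod F _ _) (Hlim t) e He)))
      as [x [Hx Hxt]].
    pose proof (Cmod_le_minus (g t) (f x t)). rewrite Cmod_minus_sym in Hxt.
    specialize (Hx t). lra. }
  apply filterlim_Cmod; [typeclasses eauto |]. intros eps Heps.
  destruct (summable_tail b Hb (eps / 3) ltac:(lra)) as [L0 [HL0 Htail]].
  pose proof (proj1 (filterlim_Cmod F _ _) (filterlim_Csum F f g L0 Hlim) (eps / 3) ltac:(lra))
    as HL.
  generalize (filter_and _ _ Hdom HL). apply filter_imp. intros x [Hx HxL].
  pose proof (has_sum_tail_le (f x) b _ L0 _ Hx (has_sum_usum _ b Hb Hx) HL0 Htail) as Tf.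
  pose proof (has_sum_tail_le g b _ L0 _ Hg (has_sum_usum _ b Hb Hg) HL0 Htail) as Tg.
  pose proof (Cmod_minus_triangle (usum (f x)) (Csum (f x) L0) (usum g)).
  pose proof (Cmod_minus_triangle (Csum (f x) L0) (Csum g L0) (usum g)).
  rewrite Cmod_minus_sym in Tf. lra.
Qed.
End Summable.

Lemma summable_inj {T T' : Type} (b : T -> R) (phi : T' -> T) :
  (forall x y, phi x = phi y -> x = y) -> summable b -> summable (fun t => b (phi t)).
Proof.
  intros Hinj [Hb [B HB]]. split; auto. exists B. intros L HL.
  rewrite <- Rsum_map. apply HB, NoDup_map_NoDup_ForallPairs; [intros x y _ _; apply Hinj | auto].
Qed.

Lemma has_sum_list {A T : Type} (f : A -> T -> C) (g : A -> C) (L : list A) :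
  (forall a, has_sum (f a) (g a)) -> has_sum (fun t => Csum (fun a => f a t) L) (Csum g L).
Proof.
  intros H. induction L as [| a L IH]; [apply has_sum_0 |].
  apply (has_sum_plus (f a) (fun t => Csum (fun a => f a t) L)); auto.
Qed.

Lemma list_preimage {T T' : Type} (phi : T' -> T) (L : list T) :
  (forall x y, phi x = phi y -> x = y) -> exists L', forall x, In x L' <-> In (phi x) L.
Proof.
  intros Hinj. induction L as [| t L [L' IH]]; [exists nil; simpl; tauto |].
  destruct (classic (exists x, phi x = t)) as [[x <-] | Hn].
  - exists (x :: L'). intros y. simpl. rewrite IH. split; (intros [H | H]; [left | right; exact H]).
    + congruence.
    + auto.
  - exists L'. intros y. simpl. rewrite IH. split; [auto | intros [H | H]; [| exact H]].
    exfalso. eauto.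
Qed.

Lemma has_sum_injection {T T' : Type} (f : T -> C) (l : C) (phi : T' -> T) :
  (forall x y, phi x = phi y -> x = y) -> (forall t, f t <> 0%C -> exists x, phi x = t) ->
  has_sum f l -> has_sum (fun x => f (phi x)) l.
Proof.
  intros Hinj Hsupp H P HP. destruct (H P HP) as [L0 HL0].
  destruct (list_preimage phi L0 Hinj) as [L0' HL0']. exists L0'. intros L HL Hincl.
  set (N := set_diff eq_dec (nodup eq_dec L0) (map phi L)).
  assert (HN : forall t, In t N <-> In t L0 /\ ~ In t (map phi L))
    by (intros t; unfold N; rewrite set_diff_iff, nodup_In; reflexivity).
  replace (Csum (fun x => f (phi x)) L) with (Csum f (map phi L ++ N)).
  - apply HL0.
    + apply NoDup_app; [| apply set_diff_nodup, NoDup_nodup |].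
      * apply NoDup_map_NoDup_ForallPairs; [intros x y _ _; apply Hinj | exact HL].
      * intros t Ht HtN. apply HN in HtN. tauto.
    + intros t Ht. apply in_app_iff. rewrite HN. destruct (in_dec eq_dec t (map phi L)); auto.
  - rewrite Csum_app, Csum_map, (Csum_eq_0 f N); [apply Cplus_0_r |].
    intros t Ht. apply HN in Ht as [Ht Hn]. apply NNPP. intros Hf.
    destruct (Hsupp t Hf) as [x <-]. apply Hn, in_map, Hincl, HL0', Ht.
Qed.

Lemma has_sum_reindex {T T' : Type} (f : T -> C) (l : C) (phi : T' -> T) (psi : T -> T') :
  (forall x, psi (phi x) = x) -> (forall y, phi (psi y) = y) ->
  has_sum f l -> has_sum (fun t => f (phi t)) l.
Proof.
  intros H1 H2. apply has_sum_injection; [| intros t _; exists (psi t); apply H2].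
  intros x y E. rewrite <- (H1 x), E. apply H1.
Qed.

Lemma has_sum_swap {A B : Type} (f : A * B -> C) (l : C) :
  has_sum f l -> has_sum (fun p : B * A => f (snd p, fst p)) l.
Proof.
  apply (has_sum_reindex f l (fun p : B * A => (snd p, fst p)) (fun p => (snd p, fst p)));
    intros []; reflexivity.
Qed.

Lemma Csum_fibers {A B : Type} (f : A * B -> C) (g : A -> C) (L0 : list (A * B)) (d : R) :
  (forall a, has_sum (fun b => f (a, b)) (g a)) -> 0 < d -> forall M, NoDup M ->
  exists P, NoDup P /\ (forall p, In p P -> In (fst p) M) /\
    (forall p, In p L0 -> In (fst p) M -> In p P) /\
    Cmod (Csum f P - Csum g M) <= INR (length M) * d.
Proof.
  intros Hg Hd M. induction M as [| a M IH]; intros HM.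
  - exists nil. split; [constructor |]. split; [simpl; tauto |]. split; [simpl; tauto |].
    unfold Csum; simpl. rewrite Cmod_minus_diag. lra.
  - apply NoDup_cons_iff in HM as [Ha HM]. destruct (IH HM) as [P [HP [Hfst [Hcover Hsum]]]].
    destruct (proj1 (filterlim_Cmod _ _ _) (Hg a) d Hd) as [N HN].
    set (N' := nodup eq_dec (N ++ map snd L0)).
    specialize (HN N' (NoDup_nodup _ _) ltac:(intros t Ht; apply nodup_In, in_app_iff; auto)).
    exists (map (fun b => (a, b)) N' ++ P). split; [| split; [| split]].
    + apply NoDup_app; [| exact HP |].
      { apply NoDup_map_NoDup_ForallPairs; [congruence | apply NoDup_nodup]. }
      intros p Hp HpP. apply in_map_iff in Hp as [b [<- _]]. apply Hfst in HpP. auto.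
    + intros p Hp. apply in_app_iff in Hp as [Hp | Hp]; [| simpl; auto].
      apply in_map_iff in Hp as [b [<- _]]. simpl; auto.
    + intros p Hp Hq. apply in_app_iff. destruct Hq as [Hq | Hq]; [left | right; auto].
      apply in_map_iff. exists (snd p). split; [rewrite Hq; destruct p; auto |].
      apply nodup_In, in_app_iff. right. apply in_map, Hp.
    + rewrite Csum_app, Csum_map. change (Csum g (a :: M)) with (g a + Csum g M)%C.
      replace (Csum (fun t => f (a, t)) N' + Csum f P - (g a + Csum g M))%C
        with ((Csum (fun t => f (a, t)) N' - g a) + (Csum f P - Csum g M))%C by ring.
      eapply Rle_trans; [apply Cmod_triangle |]. cbn [length]. rewrite S_INR. lra.
Qed.

Lemma has_sum_fubini {A B : Type} (f : A * B -> C) (l : C) (g : A -> C) :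
  has_sum f l -> (forall a, has_sum (fun b => f (a, b)) (g a)) -> has_sum g l.
Proof.
  intros Hf Hg. apply filterlim_Cmod; [typeclasses eauto |]. intros eps Heps.
  destruct (proj1 (filterlim_Cmod _ _ _) Hf (eps / 2) ltac:(lra)) as [L0 H0].
  exists (map fst L0). intros L HL Hincl. pose proof (pos_INR (length L)) as Hlen.
  destruct (Csum_fibers f g L0 (eps / (2 * (INR (length L) + 1))) Hg) with (M := L)
    as [P [HP [_ [Hcover Hsum]]]]; [apply Rdiv_lt_0_compat; lra | exact HL |].
  specialize (H0 P HP ltac:(intros p Hp; apply Hcover, Hincl, in_map, Hp; exact Hp)).
  pose proof (Cmod_minus_triangle (Csum g L) (Csum f P) l) as Tri.
  rewrite (Cmod_minus_sym (Csum g L) (Csum f P)) in Tri.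
  assert (INR (length L) * (eps / (2 * (INR (length L) + 1))) <= eps / 2); [| lra].
  replace (INR (length L) * (eps / (2 * (INR (length L) + 1))))
    with (eps / 2 * (INR (length L) / (INR (length L) + 1))) by (field; lra).
  rewrite <- (Rmult_1_r (eps / 2)) at 2. apply Rmult_le_compat_l; [lra |]. apply Rle_div_l; lra.
Qed.

Lemma summable_prod {A B : Type} (b1 : A -> R) (b2 : B -> R) :
  summable b1 -> summable b2 -> summable (fun p => b1 (fst p) * b2 (snd p)).
Proof.
  intros [H1 [B1 HB1]] [H2 [B2 HB2]]. split; [intros; apply Rmult_le_pos; auto |].
  exists (B1 * B2). intros L HL.
  set (LA := nodup eq_dec (map fst L)). set (LB := nodup eq_dec (map snd L)).
  apply Rle_trans with (Rsum (fun p => b1 (fst p) * b2 (snd p)) (list_prod LA LB)).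
  - apply Rsum_incl; auto; [intros; apply Rmult_le_pos; auto |].
    intros [x y] Hp. apply in_prod; apply nodup_In;
      [apply (in_map fst) in Hp | apply (in_map snd) in Hp]; auto.
  - assert (E : forall M,
      Rsum (fun p => b1 (fst p) * b2 (snd p)) (list_prod M LB) = Rsum b1 M * Rsum b2 LB).
    { induction M as [| x M IH]; [unfold Rsum; simpl; ring |].
      simpl. rewrite Rsum_app, IH, Rsum_map. simpl. rewrite Rsum_scal. unfold Rsum; simpl. ring. }
    rewrite E. apply Rmult_le_compat; try (apply Rsum_nonneg; auto);
      [apply HB1 | apply HB2]; apply NoDup_nodup.
Qed.

Lemma has_sum_prod {A B : Type} (f : A -> C) (g : B -> C) (l m : C) (b1 : A -> R) (b2 : B -> R) :
  summable b1 -> summable b2 -> (forall a, Cmod (f a) <= b1 a) -> (forall b, Cmod (g b) <= b2 b) ->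
  has_sum f l -> has_sum g m -> has_sum (fun p => f (fst p) * g (snd p))%C (l * m)%C.
Proof.
  intros Hb1 Hb2 Bf Bg Hf Hg. set (h := fun p : A * B => (f (fst p) * g (snd p))%C).
  assert (Hh : has_sum h (usum h)).
  { apply has_sum_usum with (fun p => b1 (fst p) * b2 (snd p)); [apply summable_prod; auto |].
    intros p. unfold h. rewrite Cmod_mult. apply Rmult_le_compat; auto using Cmod_ge_0. }
  replace (l * m)%C with (usum h); [exact Hh |].
  apply (has_sum_unique (fun a => m * f a)%C).
  - apply has_sum_fubini with h; [exact Hh |]. intros a. rewrite Cmult_comm.
    apply (has_sum_scal (f a)), Hg.
  - rewrite Cmult_comm. apply has_sum_scal, Hf.
Qed.

Lemma has_sum_pair_bool {A : Type} (f : A * bool -> C) (l : C) :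
  has_sum f l -> has_sum (fun a => f (a, true) + f (a, false))%C l.
Proof.
  intros H. apply has_sum_fubini with (1 := H). intros a.
  replace (f (a, true) + f (a, false))%C with (Csum (fun b => f (a, b)) (true :: false :: nil))
    by (unfold Csum; simpl; ring).
  apply has_sum_finite; [repeat constructor; simpl; intuition discriminate |].
  intros [|] Hb; exfalso; apply Hb; simpl; auto.
Qed.

Definition indicator {T : Type} (L : list T) (t : T) : R := if in_dec eq_dec t L then 1 else 0.

Lemma indicator_in {T : Type} (L : list T) (t : T) : In t L -> indicator L t = 1.
Proof. unfold indicator. destruct (in_dec eq_dec t L); tauto. Qed.

Lemma indicator_not_in {T : Type} (L : list T) (t : T) : ~ In t L -> indicator L t = 0.
Proof. unfold indicator. destruct (in_dec eq_dec t L); tauto. Qed.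

Lemma indicator_bounds {T : Type} (L : list T) (t : T) : 0 <= indicator L t <= 1.
Proof. unfold indicator. destruct (in_dec eq_dec t L); lra. Qed.

Lemma Csum_indicator {T : Type} (L : list T) :
  Csum (fun t => RtoC (indicator L t)) L = RtoC (INR (length L)).
Proof.
  rewrite (Csum_ext_in _ (fun _ => 1%C)) by (intros t Ht; rewrite indicator_in; auto).
  induction L as [| t L IH]; [reflexivity |].
  unfold Csum in *. cbn [map fold_right length]. rewrite IH, S_INR, RtoC_plus. ring.
Qed.

Lemma has_sum_indicator {T : Type} (L : list T) : NoDup L ->
  has_sum (fun t => RtoC (indicator L t)) (INR (length L)).
Proof.
  intros HL. rewrite <- Csum_indicator. apply has_sum_finite; auto.
  intros t Ht. rewrite indicator_not_in; auto.
Qed.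

Lemma summable_indicator {T : Type} (L : list T) : summable (indicator L).
Proof.
  split; [apply indicator_bounds |]. exists (Rsum (indicator L) L). intros M HM.
  set (M' := set_diff eq_dec M L).
  apply Rle_trans with (Rsum (indicator L) (L ++ M')).
  - apply Rsum_incl; [apply indicator_bounds | exact HM |].
    intros t Ht. apply in_app_iff. unfold M'. rewrite set_diff_iff.
    destruct (in_dec eq_dec t L); tauto.
  - rewrite Rsum_app. assert (Hzero : Rsum (indicator L) M' = 0); [| lra].
    rewrite (Rsum_ext_in _ (fun _ => 0))
      by (intros t Ht; apply indicator_not_in; apply set_diff_iff in Ht; tauto).
    clear. induction M' as [| t M' IH]; unfold Rsum in *; simpl; lra.
Qed.

Lemma has_sum_mult_indicator {A B : Type} (f : A -> C) (l : C) (b : A -> R) (L : list B) :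
  summable b -> (forall a, Cmod (f a) <= b a) -> has_sum f l -> NoDup L ->
  has_sum (fun p => f (fst p) * RtoC (indicator L (snd p)))%C (l * INR (length L))%C.
Proof.
  intros Hb Hf Hl HL.
  apply (has_sum_prod f (fun t => RtoC (indicator L t)) l _ b (indicator L)); auto.
  - apply summable_indicator.
  - intros t. rewrite Cmod_R, Rabs_right; [lra |]. apply Rle_ge, indicator_bounds.
  - apply has_sum_indicator, HL.
Qed.

(** * Sums over the natural numbers and the integers *)

Lemma filterlim_seq_finite_subsets : filterlim (seq 0) eventually finite_subsets.
Proof.
  intros P [L0 HP]. destruct (nat_list_bound L0) as [N HN]. exists N. intros n Hn.
  apply HP; [apply seq_NoDup |]. intros t Ht. apply in_seq. specialize (HN t Ht). lia.
Qed.

Lemma filterlim_Csum_seq (f : nat -> C) (l : C) :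
  has_sum f l -> filterlim (fun N => Csum f (seq 0 N)) eventually (locally l).
Proof. apply filterlim_comp, filterlim_seq_finite_subsets. Qed.

Lemma filterlim_eventually_S {U : UniformSpace} (u : nat -> U) (l : U) :
  filterlim u eventually (locally l) -> filterlim (fun n => u (S n)) eventually (locally l).
Proof. apply filterlim_comp. intros P [N HP]. exists N. intros n Hn. apply HP. lia. Qed.

Lemma Csum_seq_S (f : nat -> C) (N : nat) : Csum f (seq 0 (S N)) = (Csum f (seq 0 N) + f N)%C.
Proof. rewrite seq_S, Csum_app. unfold Csum; simpl. ring. Qed.

Lemma Rsum_seq_S (b : nat -> R) (N : nat) : Rsum b (seq 0 (S N)) = Rsum b (seq 0 N) + b N.
Proof. rewrite seq_S, Rsum_app. unfold Rsum; simpl. ring. Qed.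

Lemma has_sum_term_to_0 (f : nat -> C) (l : C) :
  has_sum f l -> filterlim f eventually (locally (RtoC 0)).
Proof.
  intros H. pose proof (filterlim_Csum_seq f l H) as HN.
  apply filterlim_ext with (fun N => Csum f (seq 0 (S N)) - Csum f (seq 0 N))%C.
  - intros N. rewrite Csum_seq_S. ring.
  - apply filterlim_locally_eq with (l - l)%C; [| ring].
    apply filterlim_Cminus; [typeclasses eauto | apply (filterlim_eventually_S _ _ HN) | exact HN].
Qed.

Lemma has_sum_telescope (u : nat -> C) (l m : C) :
  has_sum (fun n => u n - u (S n))%C l -> filterlim u eventually (locally m) -> l = (u 0%nat - m)%C.
Proof.
  intros H Hu. apply (filterlim_locally_unique (V := C_NormedModule)
    (fun N => Csum (fun n => u n - u (S n))%C (seq 0 N)) _ _ (filterlim_Csum_seq _ _ H)).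
  apply filterlim_ext with (fun N => u 0%nat - u N)%C; [| auto with limits].
  induction x as [| N IH]; [unfold Csum; simpl; ring |]. rewrite Csum_seq_S, <- IH. ring.
Qed.

Lemma cseries_has_sum (f : nat -> C) (l : C) : has_sum f l -> cseries f = l.
Proof.
  intros H. apply filterlim_Csum_seq in H. apply filterlim_eventually_S in H.
  assert (E : forall n,
    Csum f (seq 0 (S n)) = (sum_n (fun k => Re (f k)) n, sum_n (fun k => Im (f k)) n)).
  { induction n as [| n IH].
    - rewrite !sum_O. unfold Csum; simpl. destruct (f 0%nat).
      apply injective_projections; simpl; ring.
    - rewrite Csum_seq_S, IH, !sum_Sn. reflexivity. }
  unfold cseries. destruct l as [x y]. f_equal; apply is_series_unique.
  - apply filterlim_ext with (fun n => Re (Csum f (seq 0 (S n))));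
      [intros n; rewrite E; reflexivity |].
    eapply filterlim_comp; [exact H | apply (continuous_Re (x, y))].
  - apply filterlim_ext with (fun n => Im (Csum f (seq 0 (S n))));
      [intros n; rewrite E; reflexivity |].
    eapply filterlim_comp; [exact H | apply (continuous_Im (x, y))].
Qed.

Lemma summable_nat (b : nat -> R) (B : R) : (forall n, 0 <= b n) ->
  (forall N, Rsum b (seq 0 N) <= B) -> summable b.
Proof.
  intros Hb HB. split; auto. exists B. intros L HL. destruct (nat_list_bound L) as [N HN].
  eapply Rle_trans; [| apply (HB N)]. apply Rsum_incl; auto.
  intros n Hn. apply in_seq. specialize (HN n Hn). lia.
Qed.

Lemma summable_geom (r : R) : 0 <= r < 1 -> summable (fun n => r ^ n).
Proof.
  intros Hr. apply summable_nat with (/ (1 - r)); [intros; apply pow_le; lra |]. intros N.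
  assert (E : (1 - r) * Rsum (fun n => r ^ n) (seq 0 N) = 1 - r ^ N).
  { induction N as [| N IH]; [unfold Rsum; simpl; ring |].
    rewrite Rsum_seq_S, Rmult_plus_distr_l, IH. simpl. ring. }
  assert (0 <= r ^ N) by (apply pow_le; lra).
  apply Rmult_le_reg_l with (1 - r); [lra |]. rewrite E, Rinv_r; lra.
Qed.

Lemma summable_arith_geom (r : R) : 0 <= r < 1 -> summable (fun n => (INR n + 1) * r ^ n).
Proof.
  intros Hr. apply summable_nat with (/ (1 - r) ^ 2).
  { intros n. apply Rmult_le_pos; [pose proof (pos_INR n); lra | apply pow_le; lra]. }
  intros N.
  assert (E : (1 - r) ^ 2 * Rsum (fun n => (INR n + 1) * r ^ n) (seq 0 N) =
    1 - r ^ N * (1 + INR N * (1 - r))).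
  { induction N as [| N IH]; [unfold Rsum; simpl; ring |].
    rewrite Rsum_seq_S, Rmult_plus_distr_l, IH, S_INR. simpl. ring. }
  assert (0 <= r ^ N) by (apply pow_le; lra). pose proof (pos_INR N).
  assert (0 <= r ^ N * (1 + INR N * (1 - r))) by (apply Rmult_le_pos; nra).
  assert (0 < (1 - r) ^ 2) by (apply pow_lt; lra).
  apply Rmult_le_reg_l with ((1 - r) ^ 2); [auto |]. rewrite E, Rinv_r; lra.
Qed.

Lemma has_sum_geom (w : C) : Cmod w < 1 -> has_sum (fun n => w ^ n)%C (/ (1 - w))%C.
Proof.
  intros Hw. pose proof (Cmod_ge_0 w) as Hw0.
  pose proof (Cneq_1_minus w (Cmod_lt_1_neq_1 w Hw)) as Hn. set (s := usum (fun n => w ^ n)%C).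
  assert (Hs : has_sum (fun n => w ^ n)%C s).
  { apply has_sum_usum with (fun n => Cmod w ^ n); [apply summable_geom; lra |].
    intros n. rewrite Cmod_pow. lra. }
  assert (Htel : has_sum (fun n => w ^ n - w ^ S n)%C ((1 - w) * s)%C).
  { apply has_sum_ext with (fun n => (1 - w) * w ^ n)%C; [intros n; rewrite Cpow_S; ring |].
    apply has_sum_scal, Hs. }
  apply has_sum_telescope with (m := RtoC 0) in Htel; [| exact (has_sum_term_to_0 _ _ Hs)].
  replace (/ (1 - w))%C with s; [exact Hs |].
  transitivity ((1 - w) * s / (1 - w))%C; [| rewrite Htel; simpl]; field; auto.
Qed.

Lemma has_sum_arith_geom (w : C) : Cmod w < 1 ->
  has_sum (fun n => INR (S n) * w ^ n)%C (/ ((1 - w) * (1 - w)))%C.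
Proof.
  intros Hw. pose proof (Cmod_ge_0 w) as Hw0.
  pose proof (Cneq_1_minus w (Cmod_lt_1_neq_1 w Hw)) as Hn.
  set (s := usum (fun n => INR (S n) * w ^ n)%C).
  assert (Hs : has_sum (fun n => INR (S n) * w ^ n)%C s).
  { apply has_sum_usum with (fun n => (INR n + 1) * Cmod w ^ n); [apply summable_arith_geom; lra |].
    intros n. rewrite Cmod_mult, Cmod_pow, Cmod_R, Rabs_right, S_INR by (apply Rle_ge, pos_INR).
    lra. }
  pose proof (has_sum_geom w Hw) as Hg.
  assert (Htel : has_sum (fun n => INR n * w ^ n - INR (S n) * w ^ S n)%C
    ((1 - w) * s - / (1 - w))%C).
  { apply has_sum_ext with (fun n => (1 - w) * (INR (S n) * w ^ n) - w ^ n)%C.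
    - intros n. rewrite S_INR, RtoC_plus, Cpow_S. ring.
    - apply has_sum_minus; [apply has_sum_scal |]; auto. }
  apply has_sum_telescope with (u := fun n => (INR n * w ^ n)%C) (m := RtoC 0) in Htel.
  - replace (/ ((1 - w) * (1 - w)))%C with s; [exact Hs |]. simpl in Htel.
    transitivity (((1 - w) * s - / (1 - w) + / (1 - w)) / (1 - w))%C; [| rewrite Htel]; field; auto.
  - apply filterlim_ext with (fun n => INR (S n) * w ^ n - w ^ n)%C.
    + intros n. rewrite S_INR, RtoC_plus. ring.
    + apply filterlim_locally_eq with (0 - 0)%C; [| ring].
      apply filterlim_Cminus; [typeclasses eauto | |]; eapply has_sum_term_to_0; eauto.
Qed.

Lemma Rpower_pos (x y : R) : 0 < Rpower x y.
Proof. apply exp_pos. Qed.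

Lemma Rpower_decrement (p x : R) : 1 < p -> 0 < x ->
  (p - 1) * Rpower (x + 1) (- p) <= Rpower x (1 - p) - Rpower (x + 1) (1 - p).
Proof.
  intros Hp Hx.
  destruct (MVT_gen (fun y => Rpower y (1 - p)) x (x + 1) (fun y => (1 - p) * Rpower y (- p)))
    as [c [Hc E]].
  - intros y Hy. rewrite Rmin_left, Rmax_right in Hy by lra. apply is_derive_Reals.
    replace (- p) with (1 - p - 1) by ring. apply derivable_pt_lim_power. lra.
  - intros y Hy. rewrite Rmin_left, Rmax_right in Hy by lra. apply derivable_continuous_pt.
    eexists. apply derivable_pt_lim_power. lra.
  - rewrite Rmin_left, Rmax_right in Hc by lra.
    assert (Rpower (x + 1) (- p) <= Rpower c (- p)); [| nra].
    rewrite !Rpower_Ropp. apply Rinv_le_contravar; [apply Rpower_pos | apply Rle_Rpower_l; lra].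
Qed.

Lemma summable_pseries (p : R) : 1 < p -> summable (fun n => Rpower (INR n + 1) (- p)).
Proof.
  intros Hp. apply summable_nat with (p / (p - 1)); [intros n; left; apply Rpower_pos |].
  assert (Htel : forall N,
    (p - 1) * Rsum (fun n => Rpower (INR n + 1) (- p)) (seq 0 (S N))
    <= p - Rpower (INR N + 1) (1 - p)).
  { induction N as [| N IH].
    - unfold Rsum; simpl. rewrite !Rplus_0_l. unfold Rpower. rewrite ln_1, !Rmult_0_r, exp_0. lra.
    - rewrite Rsum_seq_S, S_INR.
      pose proof (Rpower_decrement p (INR N + 1) Hp ltac:(pose proof (pos_INR N); lra)). lra. }
  intros [| N]; [unfold Rsum; simpl; apply Rdiv_le_0_compat; lra |].
  specialize (Htel N). pose proof (Rpower_pos (INR N + 1) (1 - p)). apply Rle_div_r; lra.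
Qed.

Lemma summable_inv_sq : summable (fun n : nat => / (INR n + 1) ^ 2).
Proof.
  apply summable_le with (fun n => Rpower (INR n + 1) (Ropp 2));
    [| apply (summable_pseries 2); lra].
  intros n. pose proof (pos_INR n). assert (0 < (INR n + 1) ^ 2) by (apply pow_lt; lra). split.
  - left. apply Rinv_0_lt_compat; auto.
  - rewrite Rpower_Ropp. right. f_equal. rewrite <- (Rpower_pow 2) by lra. f_equal; simpl; ring.
Qed.

Lemma summable_Z_abs (b : nat -> R) : summable b -> summable (fun z : Z => b (Z.abs_nat z)).
Proof.
  intros [Hb [B HB]]. split; auto. exists (B + B). intros L HL.
  assert (Hsplit : forall M, Rsum (fun z => b (Z.abs_nat z)) M =
    Rsum (fun z => b (Z.abs_nat z)) (filter (Z.leb 0) M)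
    + Rsum (fun z => b (Z.abs_nat z)) (filter (fun z => negb (Z.leb 0 z)) M)).
  { induction M as [| x M IH]; [unfold Rsum; simpl; ring |].
    simpl. destruct (Z.leb 0 x); simpl; unfold Rsum in *; simpl; rewrite IH; ring. }
  rewrite Hsplit. apply Rplus_le_compat; rewrite <- Rsum_map; apply HB;
    (apply NoDup_map_NoDup_ForallPairs; [| apply NoDup_filter, HL]); intros x y Hx Hy E;
    apply filter_In in Hx as [_ Hx], Hy as [_ Hy].
  - apply Z.leb_le in Hx, Hy. lia.
  - apply Bool.negb_true_iff, Z.leb_gt in Hx, Hy. lia.
Qed.

Lemma INR_abs_nat (k : Z) : INR (Z.abs_nat k) = Rabs (IZR k).
Proof. rewrite INR_IZR_INZ, Zabs2Nat.id_abs. apply abs_IZR. Qed.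

Lemma summable_inv_sq_Z : summable (fun k : Z => / (Rabs (IZR k) + 1) ^ 2).
Proof.
  apply summable_le with (fun k => / (INR (Z.abs_nat k) + 1) ^ 2).
  - intros k. rewrite INR_abs_nat. pose proof (Rabs_pos (IZR k)).
    split; [| lra]. left. apply Rinv_0_lt_compat, pow_lt. lra.
  - apply (summable_Z_abs (fun n => / (INR n + 1) ^ 2)), summable_inv_sq.
Qed.

Definition Zrange (N : nat) : list Z :=
  map (fun k => (Z.of_nat k - Z.of_nat N)%Z) (seq 0 (2 * N)).

Lemma in_Zrange (N : nat) (z : Z) : In z (Zrange N) <-> (- Z.of_nat N <= z < Z.of_nat N)%Z.
Proof.
  unfold Zrange. rewrite in_map_iff. split.
  - intros [k [<- Hk]]. apply in_seq in Hk. lia.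
  - intros Hz. exists (Z.to_nat (z + Z.of_nat N)). split; [lia |]. apply in_seq. lia.
Qed.

Lemma NoDup_Zrange (N : nat) : NoDup (Zrange N).
Proof. apply NoDup_map_NoDup_ForallPairs; [intros x y _ _ E; lia | apply seq_NoDup]. Qed.

Lemma filterlim_Csum_Zrange (f : Z -> C) (l : C) :
  has_sum f l -> filterlim (fun N => Csum f (Zrange N)) eventually (locally l).
Proof.
  apply filterlim_comp. intros P [L0 HP]. destruct (nat_list_bound (map Z.abs_nat L0)) as [N HN].
  exists N. intros n Hn. apply HP; [apply NoDup_Zrange |]. intros t Ht. apply in_Zrange.
  specialize (HN _ (in_map _ _ _ Ht)). lia.
Qed.

Lemma Csum_Zrange_S (f : Z -> C) (N : nat) :
  Csum f (Zrange (S N)) = (f (- Z.of_nat (S N))%Z + (f (Z.of_nat N) + Csum f (Zrange N)))%C.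
Proof.
  rewrite (Csum_perm f (Zrange (S N)) ((- Z.of_nat (S N))%Z :: Z.of_nat N :: Zrange N));
    [reflexivity |].
  apply NoDup_Permutation; [apply NoDup_Zrange | |].
  - constructor; [| constructor; [| apply NoDup_Zrange]]; simpl; rewrite ?in_Zrange; lia.
  - intros z. cbn [In]. rewrite !in_Zrange. lia.
Qed.

Lemma Csum_Zrange_telescope (u : Z -> C) (N : nat) :
  Csum (fun k => u k - u (k + 1)%Z)%C (Zrange N) = (u (- Z.of_nat N)%Z - u (Z.of_nat N))%C.
Proof.
  induction N as [| N IH]; [unfold Csum; simpl; ring |].
  rewrite Csum_Zrange_S, IH. replace (- Z.of_nat (S N) + 1)%Z with (- Z.of_nat N)%Z by lia.
  replace (Z.of_nat N + 1)%Z with (Z.of_nat (S N)) by lia. ring.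
Qed.

Lemma has_sum_Z_telescope (u : Z -> C) (l m m' : C) :
  has_sum (fun k => u k - u (k + 1)%Z)%C l ->
  filterlim (fun N => u (- Z.of_nat N)%Z) eventually (locally m) ->
  filterlim (fun N => u (Z.of_nat N)) eventually (locally m') -> l = (m - m')%C.
Proof.
  intros H Hm Hm'. apply (filterlim_locally_unique (V := C_NormedModule)
    (fun N => Csum (fun k => u k - u (k + 1)%Z)%C (Zrange N)) _ _ (filterlim_Csum_Zrange _ _ H)).
  apply filterlim_ext with (fun N => u (- Z.of_nat N)%Z - u (Z.of_nat N))%C; [| auto with limits].
  intros N. symmetry. apply Csum_Zrange_telescope.
Qed.

Lemma has_sum_Z_pairs (f : Z -> C) (l : C) :
  has_sum f l -> has_sum (fun n : nat => f (Z.of_nat n) + f (- Z.of_nat (S n))%Z)%C l.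
Proof.
  intros H. apply (has_sum_injection f l
    (fun p : nat * bool => if snd p then Z.of_nat (fst p) else (- Z.of_nat (S (fst p)))%Z)) in H.
  - apply has_sum_pair_bool in H. exact H.
  - intros [n [|]] [m [|]]; cbn [fst snd]; intros E; try lia; f_equal; lia.
  - intros z _.
    destruct (Z_le_gt_dec 0 z); [exists (Z.to_nat z, true) | exists (Z.to_nat (- z - 1), false)];
      cbn [fst snd]; lia.
Qed.

Lemma has_sum_Z_symmetric (f : Z -> C) (l : C) : has_sum f l ->
  has_sum (fun n : nat => f (Z.of_nat (S n)) + f (- Z.of_nat (S n))%Z)%C (l - f 0%Z)%C.
Proof.
  intros Hf. set (at0 := fun k : Z => if Z.eq_dec k 0 then f 0%Z else RtoC 0).
  assert (H0 : has_sum at0 (f 0%Z)).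
  { replace (f 0%Z) with (Csum at0 (0%Z :: nil)) by (unfold Csum, at0; simpl; ring).
    apply has_sum_finite; [repeat constructor; simpl; tauto |].
    intros k Hk. unfold at0.
    destruct (Z.eq_dec k 0) as [-> |]; [simpl in Hk; tauto | reflexivity]. }
  pose proof (has_sum_minus _ _ _ _ Hf H0) as H.
  apply (has_sum_injection _ _
    (fun p : nat * bool => (if snd p then Z.of_nat (S (fst p)) else - Z.of_nat (S (fst p)))%Z))
    in H.
  - apply has_sum_pair_bool in H. revert H. apply has_sum_ext. intros n. unfold at0. cbn [fst snd].
    destruct (Z.eq_dec (Z.of_nat (S n)) 0); [lia |].
    destruct (Z.eq_dec (- Z.of_nat (S n)) 0); [lia | ring].
  - intros [n [|]] [m [|]]; cbn [fst snd]; intros E; try lia; f_equal; lia.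
  - intros k Hk. unfold at0 in Hk. destruct (Z.eq_dec k 0) as [-> | Hk0];
      [exfalso; apply Hk; ring |].
    destruct (Z_le_gt_dec 0 k);
      [exists (Z.to_nat (k - 1), true) | exists (Z.to_nat (- k - 1), false)];
      cbn [fst snd]; lia.
Qed.

(** * Holomorphic functions on discs *)

Definition disc (z0 : C) (rho : R) (w : C) : Prop := Cmod (w - z0) < rho.
Definition punctured_disc (z0 : C) (rho : R) (w : C) : Prop := w <> z0 /\ disc z0 rho w.

(* The universal covering of the punctured disc. *)
Definition disc_param (z0 : C) (rho : R) (s : C) : C := (z0 + rho * ee s)%C.

Lemma disc_center (z0 : C) (rho : R) : 0 < rho -> disc z0 rho z0.
Proof. unfold disc. rewrite Cmod_minus_diag. auto. Qed.

Lemma Cmod_disc_param (z0 : C) (rho : R) (s : C) :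
  0 < rho -> Cmod (disc_param z0 rho s - z0) = rho * Cmod (ee s).
Proof.
  intros Hrho. unfold disc_param. replace (z0 + rho * ee s - z0)%C with (rho * ee s)%C by ring.
  rewrite Cmod_mult, Cmod_R, Rabs_right; lra.
Qed.

Lemma disc_param_punctured (z0 : C) (rho : R) (s : C) :
  0 < rho -> upper s -> punctured_disc z0 rho (disc_param z0 rho s).
Proof.
  intros Hrho Hs. pose proof (Cmod_disc_param z0 rho s Hrho) as E.
  pose proof (Cmod_ee_lt_1 s Hs). assert (0 < Cmod (ee s)) by (apply Cmod_gt_0, ee_neq_0). split.
  - intros Eq. rewrite Eq, Cmod_minus_diag in E. nra.
  - unfold disc. rewrite E. nra.
Qed.

Lemma disc_param_surjective (z0 : C) (rho : R) (w : C) :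
  0 < rho -> punctured_disc z0 rho w -> exists s, upper s /\ disc_param z0 rho s = w.
Proof.
  intros Hrho [Hw Hd]. unfold disc in Hd. pose proof (Cmod_minus_gt_0 w z0 Hw) as Hp.
  pose proof (RtoC_neq_0 rho ltac:(lra)) as Hrho0. pose proof twoPiCi_neq_0 as H2pi.
  pose proof PI_RGT_0. set (q := ((w - z0) / rho)%C).
  assert (Eq : Cmod q = Cmod (w - z0) / rho)
    by (unfold q; rewrite Cmod_div, Cmod_R, Rabs_right; auto; lra).
  assert (Hq : q <> 0%C) by (apply Cmod_gt_0; rewrite Eq; apply Rdiv_lt_0_compat; lra).
  exists (carg q / (2 * PI), - ln (Cmod q) / (2 * PI)). split.
  - unfold upper. simpl. apply Rdiv_lt_0_compat; [| lra].
    assert (ln (Cmod q) < ln 1); [| rewrite ln_1 in *; lra].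
    apply ln_increasing; [apply Cmod_gt_0, Hq |]. rewrite Eq. apply Rlt_div_l; lra.
  - unfold disc_param. replace (ee _) with q.
    + unfold q. field. auto.
    + rewrite <- (cexp_clog q Hq) at 1. unfold ee. f_equal. unfold clog.
      apply injective_projections; simpl; field; lra.
Qed.

Lemma disc_param_periodic (z0 : C) (rho : R) (f : C -> C) :
  periodic (fun s => f (disc_param z0 rho s)).
Proof. intros s _. unfold disc_param. rewrite (ee_period s 1). reflexivity. Qed.

Lemma disc_param_holomorphic (z0 : C) (rho : R) (f f' : C -> C) :
  0 < rho -> holomorphic_on (punctured_disc z0 rho) f f' ->
  holomorphic_on upper (fun s => f (disc_param z0 rho s))
    (fun s => f' (disc_param z0 rho s) * (rho * (2 * PI * Ci * ee s)))%C.
Proof.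
  intros Hrho Hf. apply (holomorphic_on_comp upper (punctured_disc z0 rho)); auto.
  - intros s. apply disc_param_punctured, Hrho.
  - intros s _. split.
    + unfold disc_param. eapply is_derive_eq; [eauto with derive | simpl; ring].
    + pose proof (continuous_ee s). unfold continuous in *. auto 10 with limits.
Qed.

Lemma filterlim_disc_param (z0 : C) (rho : R) : filterlim (disc_param z0 rho) Im_infty (locally z0).
Proof.
  apply filterlim_locally_eq with (z0 + rho * 0)%C; [| ring].
  pose proof filterlim_ee_Im_infty. unfold disc_param. auto with limits.
Qed.

Lemma holomorphic_on_subset (U V : C -> Prop) (f f' : C -> C) :
  (forall z, U z -> V z) -> holomorphic_on V f f' -> holomorphic_on U f f'.
Proof. intros HUV Hf z Hz. auto. Qed.

Lemma disc_maximum_principle (f f' : C -> C) (z0 : C) (rho : R) :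
  holomorphic_on (disc z0 rho) f f' -> (forall w, disc z0 rho w -> Cmod (f w) <= Cmod (f z0)) ->
  forall w, disc z0 rho w -> f w = f z0.
Proof.
  intros Hf HB w Hw. destruct (classic (w = z0)) as [-> | Hn]; auto.
  assert (Hrho : 0 < rho) by (unfold disc in Hw; pose proof (Cmod_ge_0 (w - z0)); lra).
  destruct (disc_param_surjective z0 rho w Hrho (conj Hn Hw)) as [s [Hs <-]].
  assert (Hf0 : holomorphic_on (punctured_disc z0 rho) f f').
  { apply holomorphic_on_subset with (disc z0 rho); [intros z [_ Hz] |]; auto. }
  apply (periodic_maximum_principle (fun s => f (disc_param z0 rho s)) _ (f z0)
    (disc_param_periodic z0 rho f) (disc_param_holomorphic z0 rho f f' Hrho Hf0)); auto.
  - eapply filterlim_comp; [apply filterlim_disc_param |].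
    apply (holomorphic_on_continuous (disc z0 rho) f f'), disc_center; auto.
  - intros t Ht. apply HB, (disc_param_punctured z0 rho t Hrho Ht).
Qed.

Lemma quotient_holomorphic (f f' : C -> C) (z0 c : C) (U : C -> Prop) :
  holomorphic_on U f f' -> (forall z, U z -> z <> z0) ->
  holomorphic_on U (fun z => (f z - c) * / (z - z0))%C
    (fun z => f' z * / (z - z0) + (f z - c) * - / ((z - z0) * (z - z0)))%C.
Proof.
  intros Hf HU z Hz. destruct (Hf z Hz) as [Df Cf'].
  pose proof (Cminus_eq_contra z z0 (HU z Hz)) as Hn. split.
  - eapply is_derive_eq; [eauto 10 with derive |]. simpl. field. exact Hn.
  - pose proof (is_derive_C_continuous _ _ _ Df). unfold continuous in *.
    assert ((z - z0) * (z - z0) <> 0)%C by (apply Cmult_neq_0; auto). auto 15 with limits.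
Qed.

(* The mean of the difference quotient over the circle of radius [rho / 2] is the derivative. *)
Lemma cauchy_estimate (f f' : C -> C) (z0 : C) (rho B : R) : 0 < rho ->
  holomorphic_on (disc z0 rho) f f' -> (forall w, disc z0 rho w -> Cmod (f w) <= B) ->
  Cmod (f' z0) <= 4 * B / rho.
Proof.
  intros Hrho Hf HB. pose proof (disc_center z0 rho Hrho) as Hz0.
  set (q := fun w => ((f w - f z0) * / (w - z0))%C).
  assert (Hf0 : holomorphic_on (punctured_disc z0 rho) f f').
  { apply holomorphic_on_subset with (disc z0 rho); [intros z [_ Hz] |]; auto. }
  pose proof (quotient_holomorphic f f' z0 (f z0) _ Hf0 (fun z Hz => proj1 Hz)) as Hq. fold q in Hq.
  apply disc_param_holomorphic in Hq; [| exact Hrho].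
  assert (Hlim : filterlim (fun s => q (disc_param z0 rho s)) Im_infty (locally (f' z0))).
  { apply filterlim_ext_loc with (fun s => slope f z0 (f' z0) (disc_param z0 rho s)).
    - exists 0. intros s Hs. apply slope_neq, (disc_param_punctured z0 rho s Hrho Hs).
    - eapply filterlim_comp; [apply filterlim_disc_param | apply filterlim_slope, Hf, Hz0]. }
  pose proof PI_RGT_0. assert (Hln : 0 < ln 2) by (rewrite <- ln_1; apply ln_increasing; lra).
  set (y := ln 2 / (2 * PI)). assert (Hy : 0 < y) by (apply Rdiv_lt_0_compat; lra).
  assert (Hc : forall s, upper s -> continuous (fun s => q (disc_param z0 rho s)) s)
    by (intros s Hs; eapply holomorphic_on_continuous; eauto).
  rewrite <- (horizontal_mean_eq_limit _ _ (-1) (disc_param_periodic z0 rho q) Hc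
    (holomorphic_on_upper_off _ _ _ Hq) _ y Hlim Hy).
  apply Cmod_horizontal_mean_le; [intros x; apply Hc, Hy |]. intros x _.
  destruct (disc_param_punctured z0 rho (x, y) Hrho Hy) as [Hne Hin].
  pose proof (Cmod_disc_param z0 rho (x, y) Hrho) as E. rewrite Cmod_ee in E.
  replace (- (2 * PI * Im (x, y))) with (- ln 2) in E by (unfold y; simpl; field; lra).
  rewrite exp_Ropp, exp_ln in E by lra. unfold q.
  rewrite Cmod_mult, Cmod_inv, E by (apply Cminus_eq_contra, Hne).
  replace (4 * B / rho) with (2 * B * / (rho * / 2)) by (field; lra).
  apply Rmult_le_compat_r; [left; apply Rinv_0_lt_compat; lra |].
  eapply Rle_trans; [apply Cmod_minus_le |]. pose proof (HB _ Hin). pose proof (HB _ Hz0). lra.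
Qed.

Lemma mean_value_inequality (f f' : C -> C) (z w : C) (B : R) :
  (forall t : R, 0 <= t <= 1 -> is_derive f (z + t * (w - z))%C (f' (z + t * (w - z))%C)
     /\ Cmod (f' (z + t * (w - z))%C) <= B) ->
  Cmod (f w - f z) <= B * Cmod (w - z).
Proof.
  intros H. set (u := Cconj (f w - f z)). set (p := fun t : R => (z + t * (w - z))%C).
  assert (Hd : forall t : R, 0 <= t <= 1 ->
    is_derive (fun s : R => Re (u * f (p s))) t (Re ((w - z) * (u * f' (p t))))).
  { intros t Ht. destruct (H t Ht) as [D _]. apply (is_derive_Re_line (fun v => u * f v)%C).
    eapply is_derive_eq; [eauto with derive | unfold p; simpl; ring]. }
  destruct (MVT_gen (fun s : R => Re (u * f (p s))) 0 1 (fun t => Re ((w - z) * (u * f' (p t)))))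
    as [c [Hc E]].
  - intros t Ht. rewrite Rmin_left, Rmax_right in Ht by lra. apply Hd. lra.
  - intros t Ht. rewrite Rmin_left, Rmax_right in Ht by lra. apply continuity_pt_filterlim.
    apply (ex_derive_continuous (V := R_NormedModule)). eexists. apply Hd, Ht.
  - rewrite Rmin_left, Rmax_right in Hc by lra. destruct (H c Hc) as [_ Hb].
    replace (p 1) with w in E by (unfold p; ring). replace (p 0) with z in E by (unfold p; ring).
    rewrite <- re_minus, Rminus_0_r, Rmult_1_r in E.
    replace (u * f w - u * f z)%C with (u * (f w - f z))%C in E by ring.
    unfold u at 1 in E. rewrite Re_conj_mult in E.
    pose proof (Re_mult_le (w - z) (u * f' (p c))) as Hle. rewrite <- E, Cmod_mult in Hle.
    unfold u in Hle. rewrite Cmod_conj in Hle.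
    set (X := Cmod (f w - f z)) in *. pose proof (Cmod_ge_0 (f w - f z)) as HX. fold X in HX.
    pose proof (Cmod_ge_0 (w - z)). rewrite Rabs_right in Hle by nra.
    assert (X * Cmod (f' (p c)) * Cmod (w - z) <= X * B * Cmod (w - z)).
    { apply Rmult_le_compat_r; auto. apply Rmult_le_compat_l; auto. }
    destruct (Req_dec X 0) as [-> | HX0]; [| apply Rmult_le_reg_l with X; nra].
    apply Rmult_le_pos; auto. eapply Rle_trans; [apply Cmod_ge_0 | apply Hb].
Qed.

Lemma constant_on_segment (f : C -> C) (z w : C) :
  (forall t : R, 0 <= t <= 1 -> is_derive f (z + t * (w - z))%C (RtoC 0)) -> f w = f z.
Proof.
  intros H. apply Cmod_minus_eq_0, Rle_antisym; [| apply Cmod_ge_0].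
  rewrite <- (Rmult_0_l (Cmod (w - z))). apply (mean_value_inequality f (fun _ => RtoC 0)).
  intros t Ht. rewrite Cmod_0. split; [auto | lra].
Qed.

(* Cauchy's estimate makes the series of derivatives summable as well. *)
Section WeierstrassTheorem.
Context {T : Type}.
Variables (f f' : T -> C -> C) (b : T -> R) (z0 : C) (rho : R).
Hypothesis rho_pos : 0 < rho.
Hypothesis b_summable : summable b.
Hypothesis f_holomorphic : forall t, holomorphic_on (disc z0 rho) (f t) (f' t).
Hypothesis f_le : forall t w, disc z0 rho w -> Cmod (f t w) <= b t.

Lemma weierstrass_derivative_le (t : T) (w : C) :
  disc z0 (rho / 2) w -> Cmod (f' t w) <= 8 / rho * b t.
Proof.
  intros Hw. replace (8 / rho * b t) with (4 * b t / (rho / 2)) by (field; lra).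
  assert (Hsub : forall v, disc w (rho / 2) v -> disc z0 rho v).
  { unfold disc in *. intros v Hv. pose proof (Cmod_minus_triangle v w z0). lra. }
  apply cauchy_estimate with (f t); [lra | | auto].
  apply holomorphic_on_subset with (disc z0 rho); auto.
Qed.

Lemma weierstrass_summable : summable (fun t => 8 / rho * b t).
Proof. apply summable_scal; [apply Rlt_le, Rdiv_lt_0_compat; lra | auto]. Qed.

Lemma weierstrass_has_sum_derivative : has_sum (fun t => f' t z0) (usum (fun t => f' t z0)).
Proof.
  apply has_sum_usum with (1 := weierstrass_summable).
  intros t. apply weierstrass_derivative_le, disc_center. lra.
Qed.

Lemma weierstrass_slope_le (t : T) (w : C) :
  disc z0 (rho / 2) w -> Cmod (slope (f t) z0 (f' t z0) w) <= 8 / rho * b t.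
Proof.
  intros Hw. destruct (classic (w = z0)) as [-> | Hn].
  { rewrite slope_diag. apply weierstrass_derivative_le, Hw. }
  pose proof (Cmod_minus_gt_0 w z0 Hn). apply Rmult_le_reg_r with (Cmod (w - z0)); auto.
  rewrite <- Cmod_mult, slope_mult. apply mean_value_inequality with (f' t). intros s Hs.
  assert (Hd : disc z0 (rho / 2) (z0 + s * (w - z0))%C).
  { unfold disc in *. replace (z0 + s * (w - z0) - z0)%C with (s * (w - z0))%C by ring.
    rewrite Cmod_mult, Cmod_R, Rabs_right by lra. nra. }
  split; [apply f_holomorphic; unfold disc in *; lra | apply weierstrass_derivative_le, Hd].
Qed.

Lemma locally_half_disc : locally z0 (disc z0 (rho / 2)).
Proof. apply locally_Cmod. exists (rho / 2). split; [lra | auto]. Qed.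

Lemma weierstrass_is_derive :
  is_derive (fun w => usum (fun t => f t w)) z0 (usum (fun t => f' t z0)).
Proof.
  apply is_derive_Caratheodory with (fun w => usum (fun t => slope (f t) z0 (f' t z0) w)).
  - generalize locally_half_disc. apply filter_imp. intros w Hw. apply usum_eq.
    apply has_sum_ext with (fun t => f t z0 + (w - z0) * slope (f t) z0 (f' t z0) w)%C.
    { intros t. rewrite Cmult_comm, slope_mult. ring. }
    rewrite (Cmult_comm (usum _)). apply has_sum_plus; [| apply has_sum_scal].
    + apply has_sum_usum with b; auto using disc_center.
    + apply has_sum_usum with (1 := weierstrass_summable). intros t. apply weierstrass_slope_le, Hw.
  - apply (filterlim_usum (locally z0) (fun w t => slope (f t) z0 (f' t z0) w) (fun t => f' t z0)
      (fun t => 8 / rho * b t) weierstrass_summable).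
    + generalize locally_half_disc. apply filter_imp. intros w Hw t. apply weierstrass_slope_le, Hw.
    + intros t. apply filterlim_slope, f_holomorphic, disc_center, rho_pos.
Qed.

Lemma weierstrass_continuous_derivative : continuous (fun w => usum (fun t => f' t w)) z0.
Proof.
  apply (filterlim_usum (locally z0) (fun w t => f' t w) (fun t => f' t z0)
    (fun t => 8 / rho * b t) weierstrass_summable).
  - generalize locally_half_disc. apply filter_imp. intros w Hw t.
    apply weierstrass_derivative_le, Hw.
  - intros t. apply f_holomorphic, disc_center, rho_pos.
Qed.
End WeierstrassTheorem.

(** * Maximum principles on the upper half-plane *)

Lemma continuity_2d_pt_Cmod (f : C -> C) (x y : R) :
  continuous f (x, y) -> continuity_2d_pt (fun a b => Cmod (f (a, b))) x y.
Proof.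
  intros H. apply continuity_2d_pt_filterlim.
  apply filterlim_ext with (fun p : R * R => Cmod (f p)); [intros []; reflexivity |].
  apply (continuous_comp f Cmod); [exact H | apply continuous_Cmod].
Qed.

Lemma continuous_column_maximum (u : R -> R -> R) (c d : R) : c <= d ->
  (forall x y, c <= y <= d -> continuity_2d_pt u x y) ->
  exists Y : R -> R, forall x, c <= Y x <= d /\ forall y, c <= y <= d -> u x y <= u x (Y x).
Proof.
  intros Hcd Hu. apply (choice (fun x m => c <= m <= d /\ forall y, c <= y <= d -> u x y <= u x m)).
  intros x. destruct (continuity_ab_maj (fun b => u x b) c d) as [m [Hm Hi]];
    [lra | | exists m; auto].
  intros b Hb e He. destruct (Hu x b Hb (mkposreal e He)) as [r Hr]. exists r.
  split; [apply cond_pos |]. intros t [_ Ht]. apply Hr; auto.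
  rewrite Rminus_diag_eq, Rabs_R0 by auto. apply cond_pos.
Qed.

Lemma rectangle_maximum (u : R -> R -> R) (a b c d : R) : a <= b -> c <= d ->
  (forall x y, c <= y <= d -> continuity_2d_pt u x y) ->
  exists x y, a <= x <= b /\ c <= y <= d /\
    forall x' y', a <= x' <= b -> c <= y' <= d -> u x' y' <= u x y.
Proof.
  intros Hab Hcd Hu. destruct (continuous_column_maximum u c d Hcd Hu) as [Y HY].
  destruct (continuity_ab_maj (fun x => u x (Y x)) a b) as [m [Hm Hi]]; [lra | |].
  - intros x Hx e He. assert (He2 : 0 < e / 2) by lra.
    destruct (uniform_continuity_2d u (a - 1) (b + 1) c d) with (eps := mkposreal _ He2) as [r Hr].
    { intros; apply Hu; lra. }
    cbn [pos] in Hr. pose proof (cond_pos r).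
    exists (Rmin r 1). split; [apply Rmin_pos; lra |]. intros t [_ Ht].
    change (Rabs (t - x) < Rmin r 1) in Ht. change (Rabs (u t (Y t) - u x (Y x)) < e).
    pose proof (Rmin_l r 1). pose proof (Rmin_r r 1).
    destruct (HY t) as [Ht1 Ht2]. destruct (HY x) as [Hx1 Hx2].
    assert (Htx : Rabs (t - x) < 1) by lra. apply Rabs_lt_between in Htx.
    assert (Hdiag : forall v, Rabs (v - v) < r)
      by (intros; rewrite Rminus_diag_eq, Rabs_R0 by auto; auto).
    pose proof (Hr x (Y x) t (Y x) ltac:(lra) Hx1 ltac:(lra) Hx1 ltac:(lra) (Hdiag _)) as Dx.
    pose proof (Hr x (Y t) t (Y t) ltac:(lra) Ht1 ltac:(lra) Ht1 ltac:(lra) (Hdiag _)) as Dt.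
    apply Rabs_lt_between in Dx. apply Rabs_lt_between in Dt.
    specialize (Ht2 (Y x) Hx1). specialize (Hx2 (Y t) Ht1). apply Rabs_lt_between. lra.
  - exists m, (Y m). split; auto. split; [apply HY |]. intros x' y' Hx' Hy'.
    eapply Rle_trans; [apply (proj2 (HY x') y' Hy') | apply Hm; auto].
Qed.

Lemma periodic_strip_maximum (f : C -> C) (c d : R) : 0 < c -> c <= d -> periodic f ->
  (forall z, upper z -> continuous f z) ->
  exists z, c <= Im z <= d /\ forall w, c <= Im w <= d -> Cmod (f w) <= Cmod (f z).
Proof.
  intros Hc Hcd Hper Hf.
  destruct (rectangle_maximum (fun x y => Cmod (f (x, y))) 0 1 c d) as [x [y [_ [Hy Hmax]]]]; auto;
    [lra | |].
  { intros x y Hy. apply continuity_2d_pt_Cmod, Hf. unfold upper. simpl. lra. }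
  exists (x, y). split; auto. intros w Hw.
  rewrite <- (periodic_IZR f Hper (1 - up (Re w)) w) by (unfold upper; lra).
  replace (w + IZR (1 - up (Re w)))%C with ((Re w + IZR (1 - up (Re w)), Im w) : C)
    by (rewrite minus_IZR; apply injective_projections; simpl; unfold Re, Im; ring).
  apply Hmax; auto. pose proof (floor_shift (Re w)). lra.
Qed.

Lemma list_argmax {T : Type} (h : T -> R) (L : list T) (x0 : T) :
  In x0 L -> exists t, In t L /\ forall x, In x L -> h x <= h t.
Proof.
  revert x0. induction L as [| y L IH]; intros x0 Hx0; [destruct Hx0 |].
  destruct L as [| y' L'].
  - exists y. split; [left; auto |]. intros x [-> | []]. lra.
  - destruct (IH y' (or_introl eq_refl)) as [t [Ht Hmax]].
    destruct (Rle_dec (h y) (h t)).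
    + exists t. split; [right; auto |]. intros x [-> | Hx]; auto.
    + exists y. split; [left; auto |]. intros x [-> | Hx]; [lra |]. specialize (Hmax x Hx). lra.
Qed.

Lemma filter_forall_In {X I : Type} (F : (X -> Prop) -> Prop) {FF : Filter F} (P : I -> X -> Prop)
  (Is : list I) : (forall i, In i Is -> F (P i)) -> F (fun x => forall i, In i Is -> P i x).
Proof.
  induction Is as [| i Is IH]; intros H.
  - apply filter_forall. intros x i [].
  - generalize (filter_and _ _ (H i (or_introl eq_refl)) (IH (fun j Hj => H j (or_intror Hj)))).
    apply filter_imp. intros x [Hi HIs] j [<- | Hj]; auto.
Qed.

Lemma disc_subset_upper (p : C) : forall w, disc p (Im p) w -> upper w.
Proof.
  intros w Hw. unfold disc in Hw. pose proof (im_le_Cmod (w - p)) as H. rewrite im_minus in H.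
  apply Rabs_le_between in H. unfold upper. lra.
Qed.

Lemma exists_disc_above (x y : R) (w : C) : 0 < y -> upper w ->
  exists n, disc (x, y * (3 / 2) ^ n) (y * (3 / 2) ^ n) w.
Proof.
  intros Hy Hw. unfold upper in Hw.
  set (M := ((Re w - x) ^ 2 + Im w ^ 2) / (2 * Im w)).
  destruct (Pow_x_infinity (3 / 2) ltac:(rewrite Rabs_right; lra) (M / y + 1)) as [n Hn].
  exists n. specialize (Hn n (le_n n)). assert (Hp : 0 < (3 / 2) ^ n) by (apply pow_lt; lra).
  rewrite Rabs_right in Hn by lra. set (Y := y * (3 / 2) ^ n).
  assert (HY : 0 < Y) by (apply Rmult_lt_0_compat; auto).
  assert (HM : M < Y).
  { assert (M / y < (3 / 2) ^ n) by lra. unfold Y. rewrite Rmult_comm.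
    apply (proj1 (Rlt_div_l M _ y Hy)); lra. }
  unfold M in HM. apply (proj1 (Rlt_div_l _ Y (2 * Im w) ltac:(lra))) in HM. unfold disc.
  assert (E : Cmod (w - (x, Y)) ^ 2 = (Re w - x) ^ 2 + (Im w - Y) ^ 2)
    by (rewrite Cmod2_alt, re_minus, im_minus; reflexivity).
  pose proof (Cmod_ge_0 (w - (x, Y))). nra.
Qed.

(* The discs of radius [Im p] around the points [p] above [z0] exhaust the half-plane. *)
Lemma upper_maximum_principle (f f' : C -> C) (z0 : C) : upper z0 -> holomorphic_on upper f f' ->
  (forall w, upper w -> Cmod (f w) <= Cmod (f z0)) -> forall w, upper w -> f w = f z0.
Proof.
  intros H0 Hf HB.
  assert (Hdisc : forall p, f p = f z0 -> forall w, disc p (Im p) w -> f w = f z0).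
  { intros p E w Hw. rewrite <- E. apply (disc_maximum_principle f f' p (Im p)); auto.
    - apply holomorphic_on_subset with upper; [apply disc_subset_upper | exact Hf].
    - intros v Hv. rewrite E. apply HB, (disc_subset_upper p), Hv. }
  destruct z0 as [x0 y0]. unfold upper in H0. simpl in H0.
  assert (Hup : forall n : nat, f (x0, y0 * (3 / 2) ^ n) = f (x0, y0)).
  { induction n as [| n IH]; [simpl; rewrite Rmult_1_r; auto |].
    assert (0 < (3 / 2) ^ n) by (apply pow_lt; lra).
    assert (0 < y0 * (3 / 2) ^ n) by (apply Rmult_lt_0_compat; auto).
    apply (Hdisc (x0, y0 * (3 / 2) ^ n)); auto. unfold disc.
    eapply Rle_lt_trans; [apply Cmod_le_re_im |]. rewrite re_minus, im_minus. simpl.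
    replace (x0 - x0) with 0 by ring. rewrite Rabs_R0, Rabs_right; lra. }
  intros w Hw. destruct (exists_disc_above x0 y0 w H0 Hw) as [n Hn].
  apply (Hdisc (x0, y0 * (3 / 2) ^ n)); auto.
Qed.

(* Either the maximum of the family over [c <= Im z <= Y] bounds it everywhere, or the largest of
   the limits [a i] does. *)
Section FiniteFamily.
Context {I : Type}.
Variables (Is : list I) (f f' : I -> C -> C) (a : I -> C) (c : R).
Hypothesis c_pos : 0 < c.
Hypothesis f_holomorphic : forall i, holomorphic_on upper (f i) (f' i).
Hypothesis f_periodic : forall i, periodic (f i).
Hypothesis f_limit : forall i, filterlim (f i) Im_infty (locally (a i)).
Hypothesis f_reduce : forall i z, In i Is -> upper z ->
  exists j w, In j Is /\ c <= Im w /\ f i z = f j w.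

Lemma family_strip_maximum (Y : R) (i0 : I) : In i0 Is -> c <= Y ->
  exists i z, In i Is /\ upper z /\
  forall j w, In j Is -> c <= Im w <= Y -> Cmod (f j w) <= Cmod (f i z).
Proof.
  intros Hi0 HY.
  assert (H : forall i, exists z, c <= Im z <= Y /\ forall w, c <= Im w <= Y ->
    Cmod (f i w) <= Cmod (f i z)).
  { intros i. apply periodic_strip_maximum; auto.
    intros z Hz. apply (holomorphic_on_continuous upper (f i) (f' i)); auto. }
  apply choice in H as [z Hz].
  destruct (list_argmax (fun i => Cmod (f i (z i))) Is i0 Hi0) as [i [Hi Hmax]].
  exists i, (z i). split; [auto | split].
  - unfold upper. pose proof (proj1 (Hz i)). lra.
  - intros j w Hj Hw. eapply Rle_trans; [apply (proj2 (Hz j) w Hw) | apply Hmax, Hj].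
Qed.

Lemma finite_family_constant (i0 : I) : In i0 Is ->
  exists i l, In i Is /\ forall z, upper z -> f i z = l.
Proof.
  intros Hi0. destruct (list_argmax (fun i => Cmod (a i)) Is i0 Hi0) as [m [Hm Hmax]].
  destruct (classic (forall i z, In i Is -> upper z -> Cmod (f i z) <= Cmod (a m))) as [HA | HB].
  { exists m, (a m). split; auto. intros z Hz.
    apply (periodic_maximum_principle (f m) (f' m)); auto. }
  assert (exists i1 z1, In i1 Is /\ upper z1 /\ Cmod (a m) < Cmod (f i1 z1))
    as [i1 [z1 [Hi1 [Hz1 Hlt]]]].
  { apply NNPP. intros Hn. apply HB. intros i z Hi Hz. apply Rnot_lt_le. intros Hlt. apply Hn.
    eauto. }
  assert (Hinf : Im_infty (fun z => forall i, In i Is -> Cmod (f i z) < Cmod (f i1 z1))).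
  { apply (filter_forall_In Im_infty (fun i z => Cmod (f i z) < Cmod (f i1 z1))). intros i Hi.
    assert (Hgap : 0 < Cmod (f i1 z1) - Cmod (a m)) by lra.
    refine (filter_imp _ _ _ (proj1 (filterlim_Cmod _ _ _) (f_limit i) _ Hgap)).
    intros z Hz. pose proof (Cmod_le_minus (f i z) (a i)). specialize (Hmax i Hi). simpl in Hmax.
    lra. }
  destruct Hinf as [Y0 HY0]. set (Y := Rmax c Y0).
  destruct (family_strip_maximum Y i0 Hi0 (Rmax_l c Y0)) as [i [p [Hi [Hp Hstrip]]]].
  assert (Htop : forall j w, In j Is -> Y < Im w -> Cmod (f j w) < Cmod (f i1 z1)).
  { intros j w Hj Hw. apply HY0; auto. pose proof (Rmax_r c Y0). unfold Y in Hw. lra. }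
  assert (Hle : Cmod (f i1 z1) <= Cmod (f i p)).
  { destruct (f_reduce i1 z1 Hi1 Hz1) as [j [w [Hj [Hw E]]]]. rewrite E. apply Hstrip; auto.
    split; auto. apply Rnot_lt_le. intros Hgt. specialize (Htop j w Hj Hgt). rewrite E in Htop.
    lra. }
  exists i, (f i p). split; auto. apply (upper_maximum_principle (f i) (f' i)); auto.
  intros w Hw. destruct (f_reduce i w Hi Hw) as [j [v [Hj [Hv E]]]]. rewrite E.
  destruct (Rle_dec (Im v) Y); [apply Hstrip; auto |]. specialize (Htop j v Hj ltac:(lra)). lra.
Qed.
End FiniteFamily.

(** * Removable singularities at a cusp *)

Definition cauchy_kernel (z s : C) : C := (1 - ee (z - s))%C.

Lemma is_derive_cauchy_kernel (z s : C) :
  is_derive (cauchy_kernel z) s (2 * PI * Ci * ee (z - s))%C.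
Proof. unfold cauchy_kernel. eapply is_derive_eq; [eauto with derive | simpl; ring]. Qed.

Lemma cauchy_kernel_period (z s : C) : cauchy_kernel z (s + 1) = cauchy_kernel z s.
Proof.
  unfold cauchy_kernel. replace (z - (s + 1))%C with (z - s + IZR (-1))%C by (simpl; ring).
  rewrite ee_period. reflexivity.
Qed.

Lemma cauchy_kernel_eq_0 (z s : C) : cauchy_kernel z s = 0%C -> exists n, z = (s + IZR n)%C.
Proof.
  intros H. destruct (ee_eq_1 (z - s)) as [n Hn].
  - replace (ee (z - s)) with (1 - cauchy_kernel z s)%C by (unfold cauchy_kernel; ring).
    rewrite H. ring.
  - exists n. rewrite <- Hn. ring.
Qed.

Lemma cauchy_kernel_neq_0 (z s : C) : Im s <> Im z -> cauchy_kernel z s <> 0%C.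
Proof.
  intros Him H. apply cauchy_kernel_eq_0 in H as [n ->]. apply Him. unfold Im. simpl. ring.
Qed.

Lemma Cmod_cauchy_kernel_ge (z s : C) : 1 - Cmod (ee (z - s)) <= Cmod (cauchy_kernel z s).
Proof.
  pose proof (Cmod_le_minus 1 (cauchy_kernel z s)) as H. rewrite Cmod_1 in H.
  replace (1 - cauchy_kernel z s)%C with (ee (z - s)) in H by (unfold cauchy_kernel; ring). lra.
Qed.

(* Cauchy's integral formula in the coordinate [q = ee s], where [cauchy_kernel z] vanishes to first
   order at the translates of [z]. *)
Section CuspSingularity.
Variables f f' : C -> C.
Hypothesis f_periodic : periodic f.
Hypothesis f_holomorphic : holomorphic_on upper f f'.
Hypothesis f_small : filterlim (fun s => f s * ee s)%C Im_infty (locally (RtoC 0)).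

Lemma periodic_derivative : periodic f'.
Proof.
  intros s Hs. apply is_derive_C_unique with f s; [| apply f_holomorphic, Hs].
  apply is_derive_C_ext_loc with (fun w => f (w + 1)%C).
  - refine (filter_imp (F := locally s) _ _ _ (locally_Im_gt s 0 Hs)). exact f_periodic.
  - eapply is_derive_eq.
    + apply is_derive_Ccomp; [apply f_holomorphic, (upper_plus_R s 1), Hs | eauto with derive].
    + simpl. ring.
Qed.

Definition cauchy_quotient (z s : C) : C :=
  if excluded_middle_informative (cauchy_kernel z s = 0%C) then (f' s * / (2 * PI * Ci))%C
  else ((f s - f z) * / cauchy_kernel z s)%C.

Lemma cauchy_quotient_neq (z s : C) : cauchy_kernel z s <> 0%C ->
  cauchy_quotient z s = ((f s - f z) * / cauchy_kernel z s)%C.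
Proof. intros H. unfold cauchy_quotient. destruct excluded_middle_informative; tauto. Qed.

Lemma cauchy_quotient_periodic (z : C) : periodic (cauchy_quotient z).
Proof.
  intros s Hs. unfold cauchy_quotient.
  rewrite cauchy_kernel_period, f_periodic, periodic_derivative by auto. reflexivity.
Qed.

Definition cauchy_quotient_derivative (z s : C) : C :=
  (f' s * / cauchy_kernel z s
   + (f s - f z) * (- (2 * PI * Ci * ee (z - s)) * / (cauchy_kernel z s * cauchy_kernel z s)))%C.

Lemma cauchy_quotient_holomorphic (z s : C) : upper s -> cauchy_kernel z s <> 0%C ->
  is_derive (cauchy_quotient z) s (cauchy_quotient_derivative z s)
  /\ continuous (cauchy_quotient_derivative z) s.
Proof.
  intros Hs Hk. destruct (f_holomorphic s Hs) as [Df Cf'].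
  pose proof (is_derive_cauchy_kernel z s) as Dk.
  pose proof (is_derive_C_continuous _ _ _ Dk) as Ck. split.
  - apply is_derive_C_ext_loc with (fun w => (f w - f z) * / cauchy_kernel z w)%C.
    + refine (filter_imp (F := locally s) _ _ _ (filterlim_Cneq_0 _ _ _ Ck Hk)).
      intros w Hw. symmetry. apply cauchy_quotient_neq, Hw.
    + eapply is_derive_eq; [eauto with derive |].
      unfold cauchy_quotient_derivative, Cdiv. simpl. ring.
  - pose proof (is_derive_C_continuous _ _ _ Df) as Cf.
    assert (Ce : continuous (fun w => ee (z - w))%C s).
    { apply (continuous_Ccomp ee (fun w => z - w)%C); [| apply continuous_ee].
      eapply is_derive_C_continuous. eauto with derive. }
    assert (cauchy_kernel z s * cauchy_kernel z s <> 0)%C by (apply Cmult_neq_0; auto).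
    unfold cauchy_quotient_derivative, continuous in *. auto 15 with limits.
Qed.

Lemma cauchy_quotient_continuous (z s : C) : upper s -> continuous (cauchy_quotient z) s.
Proof.
  intros Hs. destruct (classic (cauchy_kernel z s = 0%C)) as [Hk | Hk].
  2:{ eapply is_derive_C_continuous, cauchy_quotient_holomorphic; auto. }
  destruct (f_holomorphic s Hs) as [Df _]. pose proof (is_derive_cauchy_kernel z s) as Dk.
  assert (Ez : f z = f s)
    by (destruct (cauchy_kernel_eq_0 z s Hk) as [n ->]; apply periodic_IZR; auto).
  assert (Ee : ee (z - s) = 1%C).
  { replace (ee (z - s)) with (1 - cauchy_kernel z s)%C by (unfold cauchy_kernel; ring).
    rewrite Hk. ring. }
  rewrite Ee, Cmult_1_r in Dk. apply filterlim_slope in Df, Dk.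
  assert (Es : cauchy_quotient z s = (f' s * / (2 * PI * Ci))%C)
    by (unfold cauchy_quotient; destruct excluded_middle_informative; tauto).
  unfold continuous. rewrite Es. pose proof twoPiCi_neq_0 as Hpi.
  apply filterlim_ext_loc with
    (fun w => slope f s (f' s) w * / slope (cauchy_kernel z) s (2 * PI * Ci)%C w)%C;
    [| auto with limits].
  generalize (filterlim_Cneq_0 _ _ _ Dk Hpi). apply filter_imp. intros w Hw.
  destruct (classic (w = s)) as [-> | Hn]; [rewrite !slope_diag, Es; auto |].
  pose proof (slope_mult (cauchy_kernel z) s (2 * PI * Ci)%C w) as Ek.
  pose proof (Cminus_eq_contra w s Hn) as Hws. rewrite Hk in Ek.
  replace (cauchy_kernel z w - 0)%C with (cauchy_kernel z w) in Ek by ring.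
  rewrite cauchy_quotient_neq, Ez, <- Ek, <- (slope_mult f s (f' s) w)
    by (rewrite <- Ek; apply Cmult_neq_0; auto).
  field. auto.
Qed.

Lemma cauchy_quotient_limit (z : C) : filterlim (cauchy_quotient z) Im_infty (locally (RtoC 0)).
Proof.
  assert (Ek : forall s, cauchy_kernel z s = ((ee s - ee z) / ee s)%C).
  { intros s. unfold cauchy_kernel. rewrite ee_minus. field. apply ee_neq_0. }
  apply filterlim_ext_loc with (fun s => (f s * ee s - f z * ee s) * / (ee s - ee z))%C.
  - exists (Im z). intros s Hs.
    assert (Hk : cauchy_kernel z s <> 0%C) by (apply cauchy_kernel_neq_0; lra).
    rewrite cauchy_quotient_neq by auto. rewrite Ek in *. pose proof (ee_neq_0 s).
    assert (ee s - ee z <> 0)%C by (intros E; apply Hk; rewrite E; field; auto). field. auto.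
  - apply filterlim_locally_eq with ((0 - f z * 0) * / (0 - ee z))%C; [| ring].
    assert (0 - ee z <> 0)%C.
    { intros E. apply (ee_neq_0 z). replace (ee z) with (0 - (0 - ee z))%C by ring. rewrite E.
      ring. }
    pose proof filterlim_ee_Im_infty. auto 10 with limits.
Qed.

Lemma f_continuous (s : C) : upper s -> continuous f s.
Proof. apply (holomorphic_on_continuous upper f f'), f_holomorphic. Qed.

Lemma cauchy_formula (z : C) (y : R) : 0 < y ->
  horizontal_mean (fun s => cauchy_quotient z s - (f s - f z))%C y = (f z - horizontal_mean f y)%C.
Proof.
  intros Hy.
  assert (Hup : forall x, upper (x, y)) by (intros; exact Hy).
  assert (Cf : forall x, continuous f (x, y)) by (intros; apply f_continuous, Hup).
  assert (Cc : forall x : R, continuous (fun _ : C => f z) ((x, y) : C))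
    by (intros; apply continuous_const).
  rewrite (horizontal_mean_minus (cauchy_quotient z) (fun s => f s - f z)%C).
  - rewrite (horizontal_mean_minus f (fun _ => f z)), horizontal_mean_const by auto.
    rewrite (horizontal_mean_eq_limit (cauchy_quotient z) (cauchy_quotient_derivative z) (Im z)
      (cauchy_quotient_periodic z) (cauchy_quotient_continuous z)) with (l := RtoC 0).
    + ring.
    + intros s [Hs Hn]. apply cauchy_quotient_holomorphic; auto. apply cauchy_kernel_neq_0, Hn.
    + apply cauchy_quotient_limit.
    + exact Hy.
  - intros x. apply cauchy_quotient_continuous, Hup.
  - intros x. specialize (Cf x). specialize (Cc x). unfold continuous in *. auto with limits.
Qed.

Lemma cusp_deviation_le (z : C) (B : R) : Im z <> 1 -> Cmod (ee (z - Ci)) <= / 4 ->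
  (forall x, 0 <= x <= 1 -> Cmod (f (x, 1)) <= B) ->
  Cmod (f z - horizontal_mean f 1) <= 4 * B * Cmod (ee (z - Ci)).
Proof.
  intros Hz Hsmall HB. set (t := Cmod (ee (z - Ci))) in *. set (A := horizontal_mean f 1).
  assert (Hup : forall x, upper (x, 1)) by (intros; apply Rlt_0_1).
  assert (HA : Cmod A <= B)
    by (apply Cmod_horizontal_mean_le; auto; intros; apply f_continuous, Hup).
  assert (Ht : 0 <= t) by apply Cmod_ge_0. pose proof (Cmod_ge_0 (f z)) as Hfz.
  assert (HB0 : 0 <= B) by (eapply Rle_trans; [apply Cmod_ge_0 | exact HA]).
  assert (Hdev : Cmod (f z - A) <= (B + Cmod (f z)) * (4 / 3 * t)).
  { unfold A. rewrite <- cauchy_formula by lra. apply Cmod_horizontal_mean_le.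
    - intros x. pose proof (cauchy_quotient_continuous z (x, 1) (Hup x)) as Cq.
      pose proof (f_continuous (x, 1) (Hup x)) as Cf. unfold continuous in *. auto with limits.
    - intros x Hx. assert (Hk : cauchy_kernel z (x, 1) <> 0%C)
        by (apply cauchy_kernel_neq_0; simpl; auto).
      rewrite cauchy_quotient_neq by auto.
      replace ((f (x, 1) - f z) * / cauchy_kernel z (x, 1) - (f (x, 1) - f z))%C
        with ((f (x, 1) - f z) * (ee (z - (x, 1)) * / cauchy_kernel z (x, 1)))%C.
      2:{ replace (ee (z - (x, 1))) with (1 - cauchy_kernel z (x, 1))%C
            by (unfold cauchy_kernel; ring).
          field. auto. }
      assert (Et : Cmod (ee (z - (x, 1))) = t) by (unfold t; rewrite !Cmod_ee; reflexivity).
      pose proof (Cmod_cauchy_kernel_ge z (x, 1)) as Hge. rewrite Et in Hge.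
      rewrite !Cmod_mult, Cmod_inv, Et by auto.
      apply Rmult_le_compat; [apply Cmod_ge_0 | | | ].
      + apply Rmult_le_pos; [exact Ht | left; apply Rinv_0_lt_compat; lra].
      + eapply Rle_trans; [apply Cmod_minus_le |]. specialize (HB x Hx). lra.
      + rewrite Rmult_comm. apply Rmult_le_compat_r; [exact Ht |].
        replace (4 / 3) with (/ (3 / 4)) by field. apply Rinv_le_contravar; lra. }
  assert (Hthird : (B + Cmod (f z)) * (4 / 3 * t) <= (B + Cmod (f z)) * / 3)
    by (apply Rmult_le_compat_l; lra).
  pose proof (Cmod_le_minus (f z) A).
  assert ((B + Cmod (f z)) * (4 / 3 * t) <= 3 * B * (4 / 3 * t)) by (apply Rmult_le_compat_r; lra).
  lra.
Qed.

Lemma cusp_limit_exists : exists l, filterlim f Im_infty (locally l).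
Proof.
  destruct (periodic_strip_maximum f 1 1 Rlt_0_1 (Rle_refl 1) f_periodic f_continuous)
    as [p [_ Hp]].
  set (B := Cmod (f p)) in *. exists (horizontal_mean f 1).
  assert (Hshift : filterlim (fun z => z - Ci)%C Im_infty Im_infty).
  { intros P [Y HY]. exists (Y + 1). intros z Hz. apply HY. rewrite im_minus. simpl. lra. }
  assert (Hee : filterlim (fun z => ee (z - Ci))%C Im_infty (locally (RtoC 0)))
    by (eapply filterlim_comp; [exact Hshift | exact filterlim_ee_Im_infty]).
  assert (HeeB : filterlim (fun z => RtoC (4 * B) * ee (z - Ci))%C Im_infty (locally (RtoC 0)))
    by (apply filterlim_locally_eq with (RtoC (4 * B) * 0)%C; [auto with limits | ring]).
  rewrite filterlim_Cmod in Hee, HeeB |- * by typeclasses eauto. intros eps Heps.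
  assert (Hone : Im_infty (fun z => 1 < Im z)) by (exists 1; auto).
  specialize (Hee (/ 4) ltac:(lra)). specialize (HeeB eps Heps).
  generalize (filter_and (F := Im_infty) _ _ Hone (filter_and (F := Im_infty) _ _ Hee HeeB)).
  apply filter_imp. intros z [Hz [Hq Hlt]].
  replace (ee (z - Ci) - 0)%C with (ee (z - Ci)) in Hq by ring.
  replace (RtoC (4 * B) * ee (z - Ci) - 0)%C with (RtoC (4 * B) * ee (z - Ci))%C in Hlt by ring.
  rewrite Cmod_mult, Cmod_R in Hlt. pose proof (Rle_abs (4 * B)).
  pose proof (Cmod_ge_0 (ee (z - Ci))).
  assert (Hle : Cmod (f z - horizontal_mean f 1) <= 4 * B * Cmod (ee (z - Ci))).
  { apply cusp_deviation_le; [lra | lra |]. intros x _. apply Hp. simpl. lra. }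
  nra.
Qed.
End CuspSingularity.

(** * Moebius transformations *)

Definition SL2 (a b c d : Z) : Prop := (a * d - b * c = 1)%Z.
Definition Gamma0 (N a b c d : Z) : Prop := SL2 a b c d /\ (N | c)%Z.
Definition denom (c d : Z) (z : C) : C := (IZR c * z + IZR d)%C.

Lemma Re_denom (c d : Z) (z : C) : Re (denom c d z) = IZR c * Re z + IZR d.
Proof. unfold denom, Re. simpl. ring. Qed.

Lemma Im_denom (c d : Z) (z : C) : Im (denom c d z) = IZR c * Im z.
Proof. unfold denom, Im. simpl. ring. Qed.

Lemma denom_0_1 (z : C) : denom 0 1 z = 1%C.
Proof. unfold denom. ring. Qed.

Lemma denom_opp (c d : Z) (z : C) : denom (- c) (- d) z = (- denom c d z)%C.
Proof. unfold denom. rewrite !opp_IZR, !RtoC_opp. ring. Qed.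

Lemma denom_neq_0 (c d : Z) (z : C) : upper z -> (c <> 0 \/ d <> 0)%Z -> denom c d z <> 0%C.
Proof.
  intros Hz H E. unfold upper in Hz. pose proof (f_equal Im E) as Ei.
  pose proof (f_equal Re E) as Er.
  rewrite Im_denom in Ei. rewrite Re_denom in Er. simpl in Ei, Er.
  apply Rmult_integral in Ei as [Ei | Ei]; [| lra].
  rewrite Ei, Rmult_0_l, Rplus_0_l in Er. apply eq_IZR in Ei, Er. lia.
Qed.

Lemma SL2_row_neq_0 (a b c d : Z) : SL2 a b c d -> (c <> 0 \/ d <> 0)%Z.
Proof. unfold SL2. intros H. destruct (Z.eq_dec c 0) as [-> |]; [right; intros ->; lia | auto]. Qed.

Lemma denom_SL2_neq_0 (a b c d : Z) (z : C) : SL2 a b c d -> upper z -> denom c d z <> 0%C.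
Proof. intros H Hz. apply denom_neq_0; [exact Hz | apply (SL2_row_neq_0 a b), H]. Qed.

Lemma SL2_mul (a b c d a' b' c' d' : Z) : SL2 a b c d -> SL2 a' b' c' d' ->
  SL2 (a * a' + b * c') (a * b' + b * d') (c * a' + d * c') (c * b' + d * d').
Proof.
  unfold SL2. intros H H'. transitivity ((a * d - b * c) * (a' * d' - b' * c'))%Z; [ring |].
  rewrite H, H'. reflexivity.
Qed.

Lemma SL2_inv (a b c d : Z) : SL2 a b c d -> SL2 d (- b) (- c) a.
Proof. unfold SL2. lia. Qed.

Lemma SL2_same_row (a b a' b' c d : Z) : SL2 a b c d -> SL2 a' b' c d ->
  exists n, a' = (a + n * c)%Z /\ b' = (b + n * d)%Z.
Proof.
  unfold SL2. intros H H'. exists (a * b' - b * a')%Z. split.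
  - transitivity (a + a * (a' * d - (a' * d - b' * c)) - a' * (a * d - (a * d - b * c)))%Z;
      [rewrite H, H' |]; ring.
  - transitivity (b + b' * (a * d - b * c + b * c) - b * (a' * d - b' * c + b' * c))%Z;
      [rewrite H, H' |]; ring.
Qed.

Lemma Gamma0_mul (N a b c d a' b' c' d' : Z) : Gamma0 N a b c d -> Gamma0 N a' b' c' d' ->
  Gamma0 N (a * a' + b * c') (a * b' + b * d') (c * a' + d * c') (c * b' + d * d').
Proof.
  intros [H HN] [H' HN']. split; [apply SL2_mul; auto |].
  apply Z.divide_add_r; [apply Z.divide_mul_l | apply Z.divide_mul_r]; auto.
Qed.

Lemma Gamma0_inv (N a b c d : Z) : Gamma0 N a b c d -> Gamma0 N d (- b) (- c) a.
Proof. intros [H HN]. split; [apply SL2_inv, H | apply Z.divide_opp_r, HN]. Qed.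

Lemma SL2_translation (n : Z) : SL2 1 n 0 1.
Proof. unfold SL2. lia. Qed.

Lemma SL2_complete (c d : Z) : Z.gcd c d = 1%Z -> exists a b, SL2 a b c d.
Proof.
  intros H. destruct (Z.gcd_bezout c d 1 H) as [u [v E]]. exists v, (- u)%Z. unfold SL2. lia.
Qed.

Lemma SL2_row_coprime (a b c d : Z) : SL2 a b c d -> Z.gcd c d = 1%Z.
Proof. unfold SL2. intros H. apply Z.bezout_1_gcd. exists (- b)%Z, a. lia. Qed.

Lemma Cmod_denom_sq (c d : Z) (z : C) :
  Cmod (denom c d z) ^ 2 = (IZR c * Re z + IZR d) ^ 2 + (IZR c * Im z) ^ 2.
Proof. rewrite Cmod2_alt, Re_denom, Im_denom. reflexivity. Qed.

Lemma Im_mobius (a b c d : Z) (z : C) : SL2 a b c d -> upper z ->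
  Im (mobius a b c d z) = Im z / Cmod (denom c d z) ^ 2.
Proof.
  intros H Hz. pose proof (denom_SL2_neq_0 a b c d z H Hz) as Hn.
  assert (Hp : 0 < Cmod (denom c d z) ^ 2) by (apply pow_lt, Cmod_gt_0, Hn).
  assert (HZ : IZR a * IZR d - IZR b * IZR c = 1) by (rewrite <- !mult_IZR, <- minus_IZR, H; auto).
  rewrite Cmod_denom_sq in *. unfold mobius. destruct z as [x y].
  unfold Cdiv, Cinv, Im, Re in *. simpl in *.
  transitivity (y * (IZR a * IZR d - IZR b * IZR c) / ((IZR c * x + IZR d) ^ 2 + (IZR c * y) ^ 2));
    [field; lra | rewrite HZ; simpl; field; lra].
Qed.

Lemma upper_mobius (a b c d : Z) (z : C) : SL2 a b c d -> upper z -> upper (mobius a b c d z).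
Proof.
  intros H Hz. unfold upper. rewrite Im_mobius by auto. apply Rdiv_lt_0_compat; [exact Hz |].
  apply pow_lt, Cmod_gt_0, (denom_SL2_neq_0 a b); auto.
Qed.

Lemma denom_mobius (a b c d m n : Z) (z : C) : SL2 a b c d -> upper z ->
  denom m n (mobius a b c d z) = (denom (m * a + n * c) (m * b + n * d) z / denom c d z)%C.
Proof.
  intros H Hz. pose proof (denom_SL2_neq_0 a b c d z H Hz) as Hn. unfold denom, mobius in *.
  rewrite !plus_IZR, !mult_IZR, !RtoC_plus, !RtoC_mult. field. exact Hn.
Qed.

Lemma mobius_denom (a b c d : Z) (z : C) : mobius a b c d z = (denom a b z / denom c d z)%C.
Proof. reflexivity. Qed.

Lemma mobius_comp (a b c d a' b' c' d' : Z) (z : C) : SL2 a b c d -> SL2 a' b' c' d' -> upper z ->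
  mobius a b c d (mobius a' b' c' d' z) =
  mobius (a * a' + b * c') (a * b' + b * d') (c * a' + d * c') (c * b' + d * d') z.
Proof.
  intros H H' Hz. rewrite (mobius_denom a b c d), !denom_mobius, mobius_denom by auto.
  pose proof (denom_SL2_neq_0 _ _ _ _ z H' Hz).
  pose proof (denom_SL2_neq_0 _ _ _ _ z (SL2_mul a b c d a' b' c' d' H H') Hz). field. auto.
Qed.

Lemma mobius_translation (n : Z) (z : C) : mobius 1 n 0 1 z = (z + IZR n)%C.
Proof. unfold mobius. field. Qed.

Lemma mobius_opp (a b c d : Z) (z : C) : denom c d z <> 0%C ->
  mobius (- a) (- b) (- c) (- d) z = mobius a b c d z.
Proof. intros H. rewrite !mobius_denom, !denom_opp. field. exact H. Qed.

Lemma mobius_invK (a b c d : Z) (z : C) : SL2 a b c d -> upper z ->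
  mobius a b c d (mobius d (- b) (- c) a z) = z.
Proof.
  intros H Hz. rewrite mobius_comp by (auto; apply SL2_inv, H). unfold SL2 in H.
  replace (a * d + b * - c)%Z with 1%Z by lia. replace (a * - b + b * a)%Z with 0%Z by lia.
  replace (c * d + d * - c)%Z with 0%Z by lia. replace (c * - b + d * a)%Z with 1%Z by lia.
  rewrite mobius_translation. ring.
Qed.

Lemma mobius_Kinv (a b c d : Z) (z : C) : SL2 a b c d -> upper z ->
  mobius d (- b) (- c) a (mobius a b c d z) = z.
Proof.
  intros H Hz. rewrite <- (mobius_invK d (- b) (- c) a z) at 2 by (auto; apply SL2_inv, H).
  rewrite !Z.opp_involutive. reflexivity.
Qed.

Definition mobius_derivative (c d : Z) (z : C) : C := (/ (denom c d z * denom c d z))%C.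

Lemma is_derive_denom (c d : Z) (z : C) : is_derive (denom c d) z (RtoC (IZR c)).
Proof. unfold denom. eapply is_derive_eq; [eauto with derive | simpl; ring]. Qed.

Lemma holomorphic_mobius (a b c d : Z) : SL2 a b c d ->
  holomorphic_on upper (mobius a b c d) (mobius_derivative c d).
Proof.
  intros H z Hz. pose proof (denom_SL2_neq_0 a b c d z H Hz) as Hn.
  pose proof (is_derive_denom a b z) as Da. pose proof (is_derive_denom c d z) as Dc. split.
  - assert (HZ : (IZR a * IZR d - IZR b * IZR c)%C = 1%C).
    { rewrite <- !RtoC_mult, <- RtoC_minus, <- !mult_IZR, <- minus_IZR, H. reflexivity. }
    apply is_derive_ext with (fun w => denom a b w * / denom c d w)%C; [reflexivity |].
    eapply is_derive_eq; [eauto with derive |]. unfold mobius_derivative.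
    transitivity ((IZR a * IZR d - IZR b * IZR c) * / (denom c d z * denom c d z))%C;
      [| rewrite HZ; ring].
    unfold denom in *. simpl. field. exact Hn.
  - pose proof (is_derive_C_continuous _ _ _ Dc). unfold mobius_derivative, continuous in *.
    assert (denom c d z * denom c d z <> 0)%C by (apply Cmult_neq_0; auto). auto with limits.
Qed.

Lemma lattice_point_bound (z : C) : upper z -> exists N, forall m n : Z,
  Cmod (denom m n z) <= 1 -> In m (Zrange N) /\ In n (Zrange N).
Proof.
  intros Hz. unfold upper in Hz. set (M := 1 + Cmod z / Im z + / Im z).
  destruct (INR_unbounded M) as [N HN]. exists N. intros m n Hle.
  assert (Hm : Rabs (IZR m) <= / Im z).
  { pose proof (im_le_Cmod (denom m n z)) as Hi.
    rewrite Im_denom, Rabs_mult, (Rabs_right (Im z)) in Hi by lra.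
    apply Rmult_le_reg_r with (Im z); auto. rewrite Rinv_l; lra. }
  assert (Hn : Rabs (IZR n) <= 1 + Cmod z / Im z).
  { rewrite <- Cmod_R. replace (RtoC (IZR n)) with (denom m n z - IZR m * z)%C
      by (unfold denom; ring).
    eapply Rle_trans; [apply Cmod_minus_le |]. rewrite Cmod_mult, Cmod_R. unfold Rdiv.
    apply Rplus_le_compat; auto. rewrite Rmult_comm. apply Rmult_le_compat_l; auto.
    apply Cmod_ge_0. }
  assert (0 < / Im z) by (apply Rinv_0_lt_compat; auto).
  assert (0 <= Cmod z / Im z) by (apply Rmult_le_pos; [apply Cmod_ge_0 | lra]).
  rewrite !in_Zrange. rewrite INR_IZR_INZ in HN. unfold M in HN.
  apply Rabs_le_between in Hm. apply Rabs_le_between in Hn.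
  repeat split; apply le_IZR || apply lt_IZR; rewrite ?opp_IZR; lra.
Qed.

Lemma lattice_minimum (z : C) : upper z -> exists c d : Z, (c <> 0 \/ d <> 0)%Z /\
  forall m n : Z, (m <> 0 \/ n <> 0)%Z -> Cmod (denom c d z) <= Cmod (denom m n z).
Proof.
  intros Hz. destruct (lattice_point_bound z Hz) as [N HN].
  set (L := set_diff eq_dec (list_prod (Zrange N) (Zrange N)) ((0, 0)%Z :: nil)).
  assert (HL : forall m n,
    In (m, n) L <-> (In m (Zrange N) /\ In n (Zrange N)) /\ (m <> 0 \/ n <> 0)%Z).
  { intros m n. unfold L. rewrite set_diff_iff, in_prod_iff. simpl.
    split; intros [Hin Hne]; split; auto.
    - destruct (Z.eq_dec m 0) as [-> |]; [| auto]. right. intros ->. apply Hne. left. reflexivity.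
    - intros [[= <- <-] | []]. lia. }
  assert (H01 : In (0, 1)%Z L)
    by (apply HL; split; [apply HN; rewrite denom_0_1, Cmod_1; lra | lia]).
  destruct (list_argmax (fun p => - Cmod (denom (fst p) (snd p) z)) L _ H01) as [[c d] [Hcd Hmin]].
  apply HL in Hcd as [_ Hcd]. exists c, d. split; auto. intros m n Hmn.
  destruct (Rle_dec (Cmod (denom m n z)) 1) as [Hle | Hgt].
  - specialize (Hmin (m, n) (proj2 (HL m n) (conj (HN m n Hle) Hmn))). simpl in Hmin. lra.
  - specialize (Hmin (0, 1)%Z H01). simpl in Hmin. rewrite denom_0_1, Cmod_1 in Hmin. lra.
Qed.

Lemma lattice_minimum_coprime (c d : Z) (z : C) : upper z -> (c <> 0 \/ d <> 0)%Z ->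
  (forall m n : Z, (m <> 0 \/ n <> 0)%Z -> Cmod (denom c d z) <= Cmod (denom m n z)) ->
  Z.gcd c d = 1%Z.
Proof.
  intros Hz Hcd Hmin. set (g := Z.gcd c d). pose proof (Z.gcd_nonneg c d) as Hg. fold g in Hg.
  assert (Hg0 : g <> 0%Z) by (intros E; apply Z.gcd_eq_0 in E; lia).
  destruct (Z.gcd_divide_l c d) as [c' Ec]. destruct (Z.gcd_divide_r c d) as [d' Ed].
  fold g in Ec, Ed.
  assert (H' : (c' <> 0 \/ d' <> 0)%Z).
  { destruct (Z.eq_dec c' 0) as [E |]; [| auto]. right. intros E'.
    rewrite E in Ec. rewrite E' in Ed. lia. }
  specialize (Hmin c' d' H').
  replace (denom c d z) with (RtoC (IZR g) * denom c' d' z)%C in Hmin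
    by (rewrite Ec, Ed; unfold denom; rewrite !mult_IZR, !RtoC_mult; ring).
  rewrite Cmod_mult, Cmod_R, Rabs_right in Hmin by (apply Rle_ge, IZR_le, Hg).
  pose proof (proj1 (Cmod_gt_0 _) (denom_neq_0 c' d' z Hz H')).
  assert (Hle : IZR g <= 1) by nra. apply le_IZR in Hle. lia.
Qed.

Lemma SL2_reduce (z : C) : upper z -> exists a b c d, SL2 a b c d /\ / 2 <= Im (mobius a b c d z).
Proof.
  intros Hz. destruct (lattice_minimum z Hz) as [c [d [Hcd Hmin]]].
  destruct (SL2_complete c d (lattice_minimum_coprime c d z Hz Hcd Hmin)) as [a [b Hdet]].
  exists a, b, c, d. split; auto. set (w := mobius a b c d z).
  assert (Hw : upper w) by (apply upper_mobius; auto). set (n := (1 - up (Re w + / 2))%Z).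
  assert (Hn : Rabs (Re w + IZR n) <= / 2).
  { pose proof (floor_shift (Re w + / 2)) as Hfloor. fold n in Hfloor. apply Rabs_le. lra. }
  assert (Hge : 1 <= Cmod (denom 1 n w)).
  { unfold w. rewrite denom_mobius by auto. pose proof (denom_neq_0 c d z Hz Hcd) as Hn0.
    rewrite Cmod_div by auto. apply Cmod_gt_0 in Hn0. apply Rle_div_r; [exact Hn0 |].
    rewrite Rmult_1_l. apply Hmin. unfold SL2 in Hdet.
    destruct (Z.eq_dec (1 * a + n * c) 0) as [E |]; [right | auto].
    intros E'. assert (E1 : ((1 * a + n * c) * d - (1 * b + n * d) * c = 1)%Z) by lia.
    rewrite E, E' in E1. lia. }
  pose proof (Cmod_denom_sq 1 n w) as E. rewrite !Rmult_1_l, <- (pow2_abs (Re w + IZR n)) in E.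
  pose proof (Rabs_pos (Re w + IZR n)). unfold upper in Hw. nra.
Qed.

(* The growth of a modular form at a cusp is only controlled on a vertical strip. *)
Definition strip : (C -> Prop) -> Prop := within (fun w => 0 <= Re w <= 1) Im_infty.

#[local] Instance strip_filter : ProperFilter strip.
Proof.
  constructor; [| apply within_filter; typeclasses eauto].
  intros P [Y HY]. exists (0, Y + 1). apply HY; simpl; lra.
Qed.

Lemma filterlim_strip {U : UniformSpace} (f : C -> U) (l : U) :
  filterlim f Im_infty (locally l) -> filterlim f strip (locally l).
Proof. apply filterlim_filter_le_1, filter_le_within. Qed.

Lemma filterlim_strip_periodic (f : C -> C) (l : C) : periodic f ->
  filterlim f strip (locally l) -> filterlim f Im_infty (locally l).
Proof.
  intros Hper H P HP. destruct (H P HP) as [Y HY]. exists (Rmax 0 Y). intros w Hw.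
  pose proof (Rmax_l 0 Y). pose proof (Rmax_r 0 Y). pose proof (floor_shift (Re w)).
  rewrite <- (periodic_IZR f Hper (1 - up (Re w)) w) by (unfold upper; lra).
  apply HY; rewrite ?re_plus, ?im_plus; simpl Im; cbn [RtoC Re fst]; lra.
Qed.

(* The maximum principle is applied to the finite family of expansions of [g] at the cusps: up to
   [Gamma0 N], an element of [SL2] is determined by its bottom row modulo [N]. *)
Section Gamma0Invariant.
Variables (N : Z) (g g' : C -> C).
Hypothesis N_pos : (0 < N)%Z.
Hypothesis g_holomorphic : holomorphic_on upper g g'.
Hypothesis g_invariant : forall a b c d z,
  Gamma0 N a b c d -> upper z -> g (mobius a b c d z) = g z.

Record Cusp := mkCusp {
  cusp_a : Z; cusp_b : Z; cusp_c : Z; cusp_d : Z; cusp_width : Z;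
  cusp_SL2 : SL2 cusp_a cusp_b cusp_c cusp_d;
  cusp_width_pos : (0 < cusp_width)%Z;
  cusp_width_le : (cusp_width <= N)%Z;
  cusp_width_dvd : (N | cusp_width * cusp_c ^ 2)%Z }.

Definition cusp_map (i : Cusp) (s : C) : C :=
  mobius (cusp_a i) (cusp_b i) (cusp_c i) (cusp_d i) (IZR (cusp_width i) * s).

Lemma IZR_cusp_width_pos (i : Cusp) : 0 < IZR (cusp_width i).
Proof. apply IZR_lt, cusp_width_pos. Qed.

Lemma upper_cusp_map (i : Cusp) (s : C) : upper s -> upper (cusp_map i s).
Proof.
  intros Hs. apply upper_mobius, upper_scal, Hs; [apply cusp_SL2 | apply IZR_cusp_width_pos].
Qed.

Lemma holomorphic_cusp_map (i : Cusp) : holomorphic_on upper (cusp_map i) (fun s =>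
  mobius_derivative (cusp_c i) (cusp_d i) (IZR (cusp_width i) * s) * IZR (cusp_width i))%C.
Proof.
  apply (holomorphic_on_comp upper upper _ _ (fun s => IZR (cusp_width i) * s)%C
    (fun _ => RtoC (IZR (cusp_width i)))).
  - intros s. apply upper_scal, IZR_cusp_width_pos.
  - apply holomorphic_mobius, cusp_SL2.
  - intros s _. split; [| apply continuous_const].
    eapply is_derive_eq; [eauto with derive | simpl; ring].
Qed.

Lemma cusp_function_periodic (i : Cusp) : periodic (fun s => g (cusp_map i s)).
Proof.
  intros s Hs. destruct i as [a b c d h Hdet Hh HhN Hdvd]. unfold cusp_map. cbn.
  set (w := (IZR h * s)%C).
  assert (Hw : upper w) by (apply upper_scal; [apply IZR_lt, Hh | exact Hs]).
  replace (IZR h * (s + 1))%C with (mobius 1 h 0 1 w)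
    by (rewrite mobius_translation; unfold w; ring).
  assert (HG : Gamma0 N (1 - a * c * h) (a ^ 2 * h) (- (h * c ^ 2)) (1 + a * c * h)).
  { split; [unfold SL2; ring | apply Z.divide_opp_r, Hdvd]. }
  rewrite <- (g_invariant _ _ _ _ (mobius a b c d w) HG) by (apply upper_mobius; auto).
  rewrite !mobius_comp by (auto using SL2_translation; apply HG).
  unfold SL2 in Hdet. assert (E : (a * d = 1 + b * c)%Z) by lia. f_equal. f_equal; ring [E].
Qed.

Lemma cusp_function_congruent (i : Cusp) (a b c d : Z) (z : C) : SL2 a b c d -> upper z ->
  (N | c - cusp_c i)%Z -> (N | d - cusp_d i)%Z ->
  g (mobius a b c d z) = g (cusp_map i (RtoC (/ IZR (cusp_width i)) * z)).
Proof.
  intros Hdet Hz Hc Hd. pose proof (IZR_cusp_width_pos i) as Hh. unfold cusp_map.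
  replace (IZR (cusp_width i) * (RtoC (/ IZR (cusp_width i)) * z))%C with z.
  2:{ rewrite Cmult_assoc, <- RtoC_mult, Rinv_r by lra. ring. }
  destruct i as [a' b' c' d' h Hdet' Hpos HhN Hdvd]. cbn in *.
  assert (HG :
    Gamma0 N (a * d' - b * c') (- a * b' + b * a') (c * d' - d * c') (- c * b' + d * a')).
  { split.
    - pose proof (SL2_mul a b c d _ _ _ _ Hdet (SL2_inv _ _ _ _ Hdet')) as H. unfold SL2 in *. lia.
    - replace (c * d' - d * c')%Z with ((c - c') * d' - (d - d') * c')%Z by ring.
      apply Z.divide_sub_r; apply Z.divide_mul_l; auto. }
  rewrite <- (g_invariant _ _ _ _ (mobius a' b' c' d' z) HG) by (apply upper_mobius; auto).
  rewrite mobius_comp by (auto; apply HG). unfold SL2 in Hdet'.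
  assert (E : (a' * d' = 1 + b' * c')%Z) by lia. f_equal. f_equal; ring [E].
Qed.

Hypothesis g_growth : forall a b c d, SL2 a b c d ->
  exists h : Z, (0 < h <= N)%Z /\ (N | h * c ^ 2)%Z /\
  filterlim (fun s => g (mobius a b c d (IZR h * s)) * ee s)%C strip (locally (RtoC 0)).

Definition moderate_growth (i : Cusp) : Prop :=
  filterlim (fun s => g (cusp_map i s) * ee s)%C strip (locally (RtoC 0)).

Lemma cusp_exists (a b c d : Z) : SL2 a b c d ->
  exists i : {i : Cusp | moderate_growth i}, cusp_c (proj1_sig i) = c /\ cusp_d (proj1_sig i) = d.
Proof.
  intros Hdet. destruct (g_growth a b c d Hdet) as [h [[Hpos Hle] [Hdvd Hlim]]].
  exists (exist _ (mkCusp a b c d h Hdet Hpos Hle Hdvd) Hlim). auto.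
Qed.

Lemma finite_cusps : exists Is : list {i : Cusp | moderate_growth i}, forall a b c d, SL2 a b c d ->
  exists i, In i Is /\ (N | c - cusp_c (proj1_sig i))%Z /\ (N | d - cusp_d (proj1_sig i))%Z.
Proof.
  assert (H : forall p : Z * Z, exists i : {i : Cusp | moderate_growth i},
    forall a b c d, SL2 a b c d -> (c mod N, d mod N)%Z = p ->
    (N | c - cusp_c (proj1_sig i))%Z /\ (N | d - cusp_d (proj1_sig i))%Z).
  { intros p. destruct (classic (exists a b c d, SL2 a b c d /\ (c mod N, d mod N)%Z = p))
      as [[a [b [c [d [Hdet Hp]]]]] | Hno].
    - destruct (cusp_exists a b c d Hdet) as [i [Ec Ed]]. exists i. intros a' b' c' d' _ Hp'.
      rewrite <- Hp in Hp'. injection Hp' as Hc Hd. rewrite Ec, Ed.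
      split; apply Z.mod_divide; try lia; rewrite Zminus_mod, ?Hc, ?Hd, Z.sub_diag; apply Zmod_0_l.
    - destruct (cusp_exists 1 0 0 1 (SL2_translation 0)) as [i _]. exists i. intros a b c d Hdet Hp.
      exfalso. eauto 10. }
  apply choice in H as [r Hr]. set (L := map Z.of_nat (seq 0 (Z.to_nat N))).
  exists (map r (list_prod L L)). intros a b c d Hdet. exists (r (c mod N, d mod N)%Z).
  split; [| apply (Hr _ a b); auto]. apply in_map, in_prod; apply in_map_iff.
  - exists (Z.to_nat (c mod N)). pose proof (Z.mod_pos_bound c N N_pos).
    split; [lia | apply in_seq; lia].
  - exists (Z.to_nat (d mod N)). pose proof (Z.mod_pos_bound d N N_pos).
    split; [lia | apply in_seq; lia].
Qed.

Theorem Gamma0_invariant_constant : exists l, forall z, upper z -> g z = l.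
Proof.
  destruct finite_cusps as [Is HIs].
  set (f := fun (i : {i | moderate_growth i}) s => g (cusp_map (proj1_sig i) s)).
  assert (Hhol : forall i, exists f', holomorphic_on upper (f i) f').
  { intros [i Hi]. eexists. apply (holomorphic_on_comp upper upper g g'); [| exact g_holomorphic |].
    - apply upper_cusp_map.
    - apply holomorphic_cusp_map. }
  apply choice in Hhol as [f' Hf'].
  assert (Hlim : forall i, exists l, filterlim (f i) Im_infty (locally l)).
  { intros i. apply (cusp_limit_exists (f i) (f' i)); [apply cusp_function_periodic | apply Hf' |].
    apply filterlim_strip_periodic; [| exact (proj2_sig i)].
    intros s Hs. rewrite (ee_period s 1). f_equal. apply cusp_function_periodic, Hs. }
  apply choice in Hlim as [a Ha].
  assert (Hred : forall z, upper z -> exists j w, In j Is /\ / (2 * IZR N) <= Im w /\ g z = f j w).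
  { intros z Hz. destruct (SL2_reduce z Hz) as [p [q [r [s [Hdet Him]]]]].
    set (w := mobius p q r s z) in *. assert (Hw : upper w) by (apply upper_mobius; auto).
    destruct (HIs _ _ _ _ (SL2_inv _ _ _ _ Hdet)) as [j [Hj [Hc Hd]]].
    exists j, (RtoC (/ IZR (cusp_width (proj1_sig j))) * w)%C. split; [exact Hj | split].
    - rewrite im_scal_l, Rinv_mult, (Rmult_comm (/ 2)). apply Rmult_le_compat; try lra.
      + apply Rlt_le, Rinv_0_lt_compat, IZR_lt, N_pos.
      + apply Rinv_le_contravar; [apply IZR_cusp_width_pos | apply IZR_le, cusp_width_le].
    - rewrite <- (mobius_Kinv p q r s z Hdet Hz). apply cusp_function_congruent; auto.
      apply SL2_inv, Hdet. }
  destruct (Hred Ci Rlt_0_1) as [i0 [_ [Hi0 _]]].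
  destruct (finite_family_constant Is f f' a (/ (2 * IZR N))) with (i0 := i0) as [i [l [Hi Hl]]];
    auto.
  - apply Rinv_0_lt_compat. pose proof (IZR_lt _ _ N_pos). lra.
  - intros i. apply cusp_function_periodic.
  - intros i z Hi Hz. apply Hred, upper_cusp_map, Hz.
  - exists l. intros z Hz. destruct i as [[p q r s h Hdet Hpos Hle Hdvd] Hgrowth].
    assert (Hh : 0 < IZR h) by (apply IZR_lt, Hpos).
    rewrite <- (Hl (RtoC (/ IZR h) * mobius s (- q) (- r) p z)%C).
    + unfold f, cusp_map. cbn. rewrite Cmult_assoc, <- RtoC_mult, Rinv_r, Cmult_1_l by lra.
      rewrite mobius_invK; auto.
    + apply upper_scal; [apply Rinv_0_lt_compat, Hh | apply upper_mobius; auto using SL2_inv].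
Qed.
End Gamma0Invariant.

(** * Dedekind sums *)

Definition nonzero_residues (k : Z) : list Z := map Z.of_nat (seq 1 (Z.to_nat (k - 1))).

Lemma in_nonzero_residues (k n : Z) : In n (nonzero_residues k) <-> (1 <= n < k)%Z.
Proof.
  unfold nonzero_residues. rewrite in_map_iff. split.
  - intros [i [<- Hi]]. apply in_seq in Hi. lia.
  - intros Hn. exists (Z.to_nat n). split; [lia |]. apply in_seq. lia.
Qed.

Lemma NoDup_nonzero_residues (k : Z) : NoDup (nonzero_residues k).
Proof. apply NoDup_map_NoDup_ForallPairs; [intros x y _ _ E; lia | apply seq_NoDup]. Qed.

Lemma Rsum_residues_telescope (b G : Z -> R) (k : Z) : (0 < k)%Z ->
  (forall n, (1 <= n < k)%Z -> b n = G (n + 1)%Z - G n) ->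
  Rsum b (nonzero_residues k) = G k - G 1%Z.
Proof.
  intros Hk Hb. unfold nonzero_residues. set (m := Z.to_nat (k - 1)).
  assert (Ek : k = (Z.of_nat m + 1)%Z) by lia. clearbody m. subst k. clear Hk. revert Hb.
  induction m as [| m IH]; intros Hb.
  - unfold Rsum. simpl. ring.
  - rewrite seq_S, map_app, Rsum_app, IH by (intros; apply Hb; lia). unfold Rsum.
    cbn [map fold_right]. rewrite Hb by lia.
    replace (Z.of_nat (1 + m)) with (Z.of_nat m + 1)%Z by lia.
    rewrite Nat2Z.inj_succ. unfold Z.succ. ring.
Qed.

Lemma Rsum_residues_id (k : Z) : (0 < k)%Z ->
  Rsum IZR (nonzero_residues k) = (IZR k - 1) * IZR k / 2.
Proof.
  intros Hk. rewrite (Rsum_residues_telescope _ (fun n => (IZR n - 1) * IZR n / 2)); auto;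
    [field |].
  intros n _. rewrite plus_IZR. field.
Qed.

Lemma Rsum_residues_sq (k : Z) : (0 < k)%Z ->
  Rsum (fun n => IZR n ^ 2) (nonzero_residues k) = (IZR k - 1) * IZR k * (2 * IZR k - 1) / 6.
Proof.
  intros Hk.
  rewrite (Rsum_residues_telescope _ (fun n => (IZR n - 1) * IZR n * (2 * IZR n - 1) / 6)); auto;
    [field |].
  intros n _. rewrite plus_IZR. field.
Qed.

Lemma Rsum_residues_le (k t : Z) : (0 <= t < k)%Z ->
  Rsum (fun j => if (j <=? t)%Z then 2 * IZR j else 0) (nonzero_residues k) = IZR t * (IZR t + 1).
Proof.
  intros Ht. rewrite (Rsum_residues_telescope _
    (fun n => IZR (Z.min t (n - 1)) * (IZR (Z.min t (n - 1)) + 1))); [| lia |].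
  - rewrite (Z.min_l t), Z.min_r by lia. simpl. ring.
  - intros n Hn. destruct (Z.leb_spec n t).
    + rewrite !Z.min_r, !minus_IZR, plus_IZR by lia. ring.
    + rewrite !Z.min_l by lia. ring.
Qed.

Lemma Rsum_residues_gt (k t : Z) : (0 <= t < k)%Z ->
  Rsum (fun n => if (t <? n)%Z then 1 else 0) (nonzero_residues k) = IZR k - 1 - IZR t.
Proof.
  intros Ht. rewrite (Rsum_residues_telescope _ (fun n => IZR (n - 1 - Z.min t (n - 1))));
    [| lia |].
  - rewrite (Z.min_l t), Z.min_r, !minus_IZR by lia. simpl. ring.
  - intros n Hn. rewrite <- minus_IZR. destruct (Z.ltb_spec t n); apply f_equal; lia.
Qed.

Lemma Rsum_exchange {S T : Type} (f : S -> T -> R) (L : list S) (M : list T) :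
  Rsum (fun s => Rsum (f s) M) L = Rsum (fun t => Rsum (fun s => f s t) L) M.
Proof.
  induction L as [| s L IH].
  - change (0 = Rsum (fun _ => 0) M). induction M as [| t M IH]; [reflexivity |].
    unfold Rsum in *. simpl. rewrite <- IH. ring.
  - change (Rsum (f s) M + Rsum (fun s => Rsum (f s) M) L =
      Rsum (fun t => f s t + Rsum (fun s => f s t) L) M).
    rewrite Rsum_plus, IH. reflexivity.
Qed.

Lemma coprime_mul_mod_eq_0 (h k n : Z) :
  (0 < k)%Z -> Z.gcd h k = 1%Z -> ((h * n) mod k = 0)%Z -> (k | n)%Z.
Proof.
  intros Hk Hg H. apply Z.mod_divide in H; [| lia]. apply Z.gauss with h; auto.
  rewrite Z.gcd_comm. auto.
Qed.

Lemma Rsum_residues_mul (b : Z -> R) (h k : Z) : (0 < k)%Z -> Z.gcd h k = 1%Z ->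
  Rsum (fun n => b ((h * n) mod k)%Z) (nonzero_residues k) = Rsum b (nonzero_residues k).
Proof.
  intros Hk Hg. rewrite <- (Rsum_map b (fun n => (h * n) mod k)%Z).
  apply Rsum_perm, NoDup_Permutation_bis.
  - apply NoDup_map_NoDup_ForallPairs; [| apply NoDup_nonzero_residues]. intros x y Hx Hy E.
    apply in_nonzero_residues in Hx, Hy. assert (D : (k | x - y)%Z).
    { apply coprime_mul_mod_eq_0 with h; auto.
      rewrite Z.mul_sub_distr_l, Zminus_mod, E, Z.sub_diag. apply Zmod_0_l. }
    destruct D as [q Hq]. assert (q = 0)%Z by nia. lia.
  - rewrite length_map. auto.
  - intros z Hz. apply in_map_iff in Hz as [n [<- Hn]]. apply in_nonzero_residues in Hn.
    apply in_nonzero_residues. pose proof (Z.mod_pos_bound (h * n) k Hk).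
    assert ((h * n) mod k <> 0)%Z; [| lia]. intros E. apply coprime_mul_mod_eq_0 in E; auto.
    apply Z.divide_pos_le in E; lia.
Qed.

Definition floor_sum (h k : Z) : R := Rsum (fun n => IZR (h * n / k)) (nonzero_residues k).
Definition floor_sum_sq (h k : Z) : R := Rsum (fun n => IZR (h * n / k) ^ 2) (nonzero_residues k).
Definition weighted_floor_sum (h k : Z) : R :=
  Rsum (fun n => IZR n * IZR (h * n / k)) (nonzero_residues k).

Lemma IZR_mul_mod (h k n : Z) : (0 < k)%Z ->
  IZR ((h * n) mod k) = IZR h * IZR n - IZR k * IZR (h * n / k).
Proof.
  intros Hk. rewrite <- !mult_IZR, <- minus_IZR. f_equal.
  pose proof (Z.div_mod (h * n) k ltac:(lia)). lia.
Qed.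

Lemma floor_sum_eq (h k : Z) : (0 < k)%Z -> Z.gcd h k = 1%Z ->
  floor_sum h k = (IZR h - 1) * (IZR k - 1) / 2.
Proof.
  intros Hk Hg. assert (HkR : IZR k <> 0) by (apply eq_IZR_contrapositive; lia).
  pose proof (Rsum_residues_mul IZR h k Hk Hg) as E.
  rewrite (Rsum_ext_in _ (fun n => IZR h * IZR n + - IZR k * IZR (h * n / k))) in E
    by (intros; rewrite IZR_mul_mod by auto; ring).
  rewrite Rsum_plus, !Rsum_scal in E.
  fold (floor_sum h k) in E. rewrite Rsum_residues_id in E by auto.
  apply Rmult_eq_reg_l with (IZR k); auto. lra.
Qed.

Lemma weighted_floor_sum_eq (h k : Z) : (0 < k)%Z -> Z.gcd h k = 1%Z ->
  2 * IZR h * IZR k * weighted_floor_sum h k =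
  (IZR h ^ 2 - 1) * ((IZR k - 1) * IZR k * (2 * IZR k - 1) / 6) + IZR k ^ 2 * floor_sum_sq h k.
Proof.
  intros Hk Hg. pose proof (Rsum_residues_mul (fun r => IZR r ^ 2) h k Hk Hg) as E.
  rewrite (Rsum_ext_in _ (fun n => (IZR h ^ 2 * IZR n ^ 2
    + - (2 * IZR h * IZR k) * (IZR n * IZR (h * n / k))) + IZR k ^ 2 * IZR (h * n / k) ^ 2)) in E
    by (intros; rewrite IZR_mul_mod by auto; ring).
  rewrite !Rsum_plus, !Rsum_scal in E.
  fold (floor_sum_sq h k) in E. fold (weighted_floor_sum h k) in E.
  rewrite Rsum_residues_sq in E by auto. lra.
Qed.

(* Count the lattice points [(n, j)] under the line of slope [h / k] with weight [2 j]. *)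
Lemma floor_sum_reciprocity (h k : Z) : (0 < h)%Z -> (0 < k)%Z -> Z.gcd h k = 1%Z ->
  floor_sum_sq h k + floor_sum h k = (IZR k - 1) * (IZR h - 1) * IZR h - 2 * weighted_floor_sum k h.
Proof.
  intros Hh Hk Hg.
  transitivity (Rsum (fun n => Rsum (fun j => if (j <=? h * n / k)%Z then 2 * IZR j else 0)
    (nonzero_residues h)) (nonzero_residues k)).
  - unfold floor_sum_sq, floor_sum. rewrite <- Rsum_plus. apply Rsum_ext_in. intros n Hn.
    apply in_nonzero_residues in Hn. rewrite Rsum_residues_le; [ring |].
    split; [apply Z.div_pos; lia | apply Z.div_lt_upper_bound; nia].
  - rewrite Rsum_exchange.
    rewrite (Rsum_ext_in _ (fun j => 2 * (IZR k - 1) * IZR j + - (2) * (IZR j * IZR (k * j / h)))).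
    { rewrite Rsum_plus, !Rsum_scal, Rsum_residues_id by auto. fold (weighted_floor_sum k h).
      field. }
    intros j Hj. apply in_nonzero_residues in Hj.
    rewrite (Rsum_ext_in _ (fun n => 2 * IZR j * (if (k * j / h <? n)%Z then 1 else 0))).
    { rewrite Rsum_scal, Rsum_residues_gt; [ring |].
      split; [apply Z.div_pos; lia | apply Z.div_lt_upper_bound; nia]. }
    intros n Hn. apply in_nonzero_residues in Hn.
    assert (Hne : (h * n <> k * j)%Z).
    { intros E. assert (D : (h | j)%Z) by (apply Z.gauss with k; [exists n; lia | exact Hg]).
      apply Z.divide_pos_le in D; lia. }
    pose proof (Z.div_mod (h * n) k ltac:(lia)). pose proof (Z.mod_pos_bound (h * n) k Hk).
    pose proof (Z.div_mod (k * j) h ltac:(lia)). pose proof (Z.mod_pos_bound (k * j) h Hh).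
    destruct (Z.leb_spec j (h * n / k)); destruct (Z.ltb_spec (k * j / h) n); try ring; nia.
Qed.

Lemma sawZ_mod (r c : Z) : (0 < c)%Z -> (r mod c <> 0)%Z -> sawZ r c = IZR (r mod c) / IZR c - / 2.
Proof.
  intros Hc Hr. unfold sawZ. destruct (Z.eqb_spec (r mod c) 0); [tauto |].
  rewrite (Z.div_mod r c) at 1 by lia. rewrite plus_IZR, mult_IZR. field.
  apply eq_IZR_contrapositive. lia.
Qed.

Lemma sawZ_0 (r c : Z) : (r mod c = 0)%Z -> sawZ r c = 0.
Proof. intros E. unfold sawZ. rewrite E. reflexivity. Qed.

Lemma sawZ_congr (r s c : Z) : (0 < c)%Z -> (r mod c = s mod c)%Z -> sawZ r c = sawZ s c.
Proof.
  intros Hc E. destruct (Z.eq_dec (r mod c) 0) as [E0 | E0].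
  - rewrite !sawZ_0; congruence.
  - rewrite !sawZ_mod by congruence. rewrite E. reflexivity.
Qed.

Lemma sawZ_opp (r c : Z) : (0 < c)%Z -> sawZ (- r) c = - sawZ r c.
Proof.
  intros Hc. destruct (Z.eq_dec (r mod c) 0) as [E0 | E0].
  - rewrite !sawZ_0; auto; [ring |]. apply Z.mod_opp_l_z; lia.
  - pose proof (Z.mod_pos_bound r c Hc). rewrite !sawZ_mod, Z.mod_opp_l_nz, minus_IZR
      by (auto; rewrite ?Z.mod_opp_l_nz; lia).
    field. apply eq_IZR_contrapositive. lia.
Qed.

Lemma dedekind_sum_Rsum (h c : Z) :
  dedekind_sum h c = Rsum (fun n => sawZ n c * sawZ (h * n) c) (map Z.of_nat (seq 0 (Z.to_nat c))).
Proof. rewrite Rsum_map. reflexivity. Qed.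

Lemma dedekind_sum_residues (h c : Z) : (0 < c)%Z ->
  dedekind_sum h c = Rsum (fun n => sawZ n c * sawZ (h * n) c) (nonzero_residues c).
Proof.
  intros Hc. rewrite dedekind_sum_Rsum. unfold nonzero_residues.
  replace (Z.to_nat c) with (S (Z.to_nat (c - 1))) by lia.
  unfold Rsum. cbn [seq map fold_right]. rewrite (sawZ_0 (Z.of_nat 0)) by apply Zmod_0_l. ring.
Qed.

Lemma dedekind_sum_congr (h h' c : Z) :
  (0 < c)%Z -> (h mod c = h' mod c)%Z -> dedekind_sum h c = dedekind_sum h' c.
Proof.
  intros Hc E. rewrite !dedekind_sum_Rsum. apply Rsum_ext_in. intros n _. f_equal.
  apply sawZ_congr; auto. rewrite <- Z.mul_mod_idemp_l, E, Z.mul_mod_idemp_l by lia. reflexivity.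
Qed.

Lemma dedekind_sum_opp (h c : Z) : (0 < c)%Z -> dedekind_sum (- h) c = - dedekind_sum h c.
Proof.
  intros Hc. rewrite !dedekind_sum_Rsum.
  rewrite (Rsum_ext_in _ (fun n => -1 * (sawZ n c * sawZ (h * n) c))), Rsum_scal; [ring |].
  intros n _. rewrite Z.mul_opp_l, sawZ_opp by auto. ring.
Qed.

Lemma dedekind_sum_floor_sum (h k : Z) : (0 < k)%Z -> Z.gcd h k = 1%Z ->
  dedekind_sum h k = (IZR h * ((IZR k - 1) * IZR k * (2 * IZR k - 1) / 6)
    - IZR k * weighted_floor_sum h k) / IZR k ^ 2 - (IZR k - 1) / 4.
Proof.
  intros Hk Hg. assert (HkR : IZR k <> 0) by (apply eq_IZR_contrapositive; lia).
  rewrite dedekind_sum_residues by auto.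
  rewrite (Rsum_ext_in _ (fun n => (/ IZR k ^ 2
    * (IZR h * IZR n ^ 2 + - IZR k * (IZR n * IZR (h * n / k)))
    + - / (2 * IZR k) * IZR n) + - / (2 * IZR k) * IZR ((h * n) mod k) + / 4 * 1)).
  - rewrite !Rsum_plus, !Rsum_scal, Rsum_plus, !Rsum_scal, (Rsum_residues_mul IZR) by auto.
    rewrite Rsum_residues_id, Rsum_residues_sq by auto. fold (weighted_floor_sum h k).
    rewrite (Rsum_residues_telescope _ IZR) by (auto; intros; rewrite plus_IZR; ring).
    simpl IZR. field. auto.
  - intros n Hn. apply in_nonzero_residues in Hn. rewrite !sawZ_mod; auto.
    + rewrite (Z.mod_small n) by lia. rewrite IZR_mul_mod by auto. field. auto.
    + intros E. apply coprime_mul_mod_eq_0 in E; auto. apply Z.divide_pos_le in E; lia.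
    + rewrite Z.mod_small; lia.
Qed.

Lemma dedekind_reciprocity (h k : Z) : (0 < h)%Z -> (0 < k)%Z -> Z.gcd h k = 1%Z ->
  12 * (dedekind_sum h k + dedekind_sum k h) =
  -3 + IZR h / IZR k + IZR k / IZR h + 1 / (IZR h * IZR k).
Proof.
  intros Hh Hk Hg. assert (Hg' : Z.gcd k h = 1%Z) by (rewrite Z.gcd_comm; auto).
  assert (Hx : IZR h <> 0) by (apply eq_IZR_contrapositive; lia).
  assert (Hy : IZR k <> 0) by (apply eq_IZR_contrapositive; lia).
  rewrite !dedekind_sum_floor_sum by auto.
  pose proof (floor_sum_reciprocity h k Hh Hk Hg) as E. rewrite floor_sum_eq in E by auto.
  pose proof (weighted_floor_sum_eq h k Hk Hg) as Ew.
  set (x := IZR h) in *. set (y := IZR k) in *. set (B := floor_sum_sq h k) in *.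
  assert (EB : B = (y - 1) * (x - 1) * x - 2 * weighted_floor_sum k h - (x - 1) * (y - 1) / 2)
    by lra.
  assert (EA : weighted_floor_sum h k =
    ((x ^ 2 - 1) * ((y - 1) * y * (2 * y - 1) / 6) + y ^ 2 * B) / (2 * x * y))
    by (rewrite <- Ew; field; auto).
  rewrite EA, EB. field. auto.
Qed.

(** * Partial fractions of the cotangent *)

(* [pi ^ 2 / sin (pi z) ^ 2] *)
Definition csc_sq (z : C) : C := (-4 * PI * PI * ee z / ((1 - ee z) * (1 - ee z)))%C.

Lemma csc_sq_period (z : C) (k : Z) : csc_sq (z + IZR k) = csc_sq z.
Proof. unfold csc_sq. rewrite ee_period. reflexivity. Qed.

Lemma csc_sq_duplication (z : C) : ee z <> 1%C ->
  (csc_sq ((/ 2)%R * z) + csc_sq ((/ 2)%R * (z + 1)))%C = (4 * csc_sq z)%C.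
Proof.
  intros H. unfold csc_sq. set (w := ee ((/ 2)%R * z)).
  assert (E1 : ee z = (w * w)%C).
  { unfold w. rewrite <- ee_plus. f_equal. rewrite <- Cmult_plus_distr_r, <- RtoC_plus.
    replace (/ 2 + / 2) with 1 by field. ring. }
  assert (E2 : ee ((/ 2)%R * (z + 1)) = (- w)%C).
  { replace ((/ 2)%R * (z + 1))%C with ((/ 2)%R * z + (/ 2)%R)%C by ring.
    rewrite ee_plus, ee_half. fold w. ring. }
  rewrite E2, E1 in *.
  assert (N1 : (1 - w)%C <> 0%C).
  { intros E. apply H. replace w with (1 - (1 - w))%C by ring. rewrite E. ring. }
  assert (N2 : (1 + w)%C <> 0%C).
  { intros E. apply H. replace w with ((1 + w) - 1)%C by ring. rewrite E. ring. }
  replace (1 - w * w)%C with ((1 - w) * (1 + w))%C by ring.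
  replace (1 - - w)%C with (1 + w)%C by ring. field. auto.
Qed.

Lemma pow2_neq_0 (m : nat) : RtoC (2 ^ m) <> 0%C.
Proof. apply RtoC_neq_0, pow_nonzero. lra. Qed.

Lemma seq_shift_add (a n : nat) : seq a n = map (fun k => (a + k)%nat) (seq 0 n).
Proof. induction n as [| n IH]; [reflexivity |]. rewrite !seq_S, IH, map_app. reflexivity. Qed.

Lemma csc_sq_multiplication (z : C) (m : nat) : ee z <> 1%C ->
  Csum (fun k : nat => csc_sq ((z + INR k) / RtoC (2 ^ m))) (seq 0 (2 ^ m)) =
  (RtoC (4 ^ m) * csc_sq z)%C.
Proof.
  intros Hz. induction m as [| m IH].
  - unfold Csum. simpl. replace ((z + 0) / 1)%C with z by field. ring.
  - replace (2 ^ S m)%nat with (2 ^ m + 2 ^ m)%nat by (simpl; lia). rewrite seq_app, Csum_app.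
    rewrite (seq_shift_add (0 + 2 ^ m)), Csum_map, <- Csum_plus. simpl (0 + 2 ^ m)%nat.
    pose proof (pow2_neq_0 m) as Hm. assert (E2 : RtoC (/ 2) = (/ 2)%C) by (apply RtoC_inv; lra).
    rewrite (Csum_ext_in _ (fun k => RtoC 4 * csc_sq ((z + INR k) / RtoC (2 ^ m)))%C).
    { rewrite Csum_scal, IH. simpl (4 ^ S m). rewrite RtoC_mult. ring. }
    intros k _. set (u := ((z + INR k) / RtoC (2 ^ m))%C). rewrite <- csc_sq_duplication.
    + f_equal; f_equal; unfold u; rewrite E2; simpl (2 ^ S m); rewrite RtoC_mult; [field; auto |].
      rewrite plus_INR, pow_INR, RtoC_plus. replace (INR 2) with 2 by (simpl; ring). field. auto.
    + intros E. apply Hz. rewrite <- (ee_period z (Z.of_nat k)), <- INR_IZR_INZ.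
      replace (z + INR k)%C with (INR (2 ^ m) * u)%C.
      * rewrite ee_mult_INR, E. apply Cpow_1_l.
      * unfold u. rewrite pow_INR. replace (INR 2) with 2 by (simpl; ring). field. auto.
Qed.

Lemma csc_sq_Zrange (z : C) (n : nat) : ee z <> 1%C ->
  Csum (fun k : Z => csc_sq ((z + IZR k) / RtoC (2 ^ S n))) (Zrange (2 ^ n)) =
  (RtoC (4 ^ S n) * csc_sq z)%C.
Proof.
  intros Hz. unfold Zrange. rewrite Csum_map.
  rewrite <- (csc_sq_period z (- Z.of_nat (2 ^ n))), <- csc_sq_multiplication
    by (rewrite ee_period; auto).
  replace (2 * 2 ^ n)%nat with (2 ^ S n)%nat by (simpl; lia). apply Csum_ext_in. intros k _.
  f_equal. f_equal. rewrite minus_IZR, opp_IZR, RtoC_minus, RtoC_opp, (INR_IZR_INZ k). ring.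
Qed.

Lemma sin_ge_quarter (t : R) : 0 <= t <= PI / 2 -> t / 4 <= sin t.
Proof.
  intros Ht. pose proof PI_4. pose proof PI2_3_2.
  assert (Hhalf : forall s, 0 <= s <= 1 -> s / 2 <= sin s).
  { intros s Hs. destruct (MVT_gen sin 0 s cos) as [c [Hc E]].
    - intros x _. apply is_derive_Reals, derivable_pt_lim_sin.
    - intros x _. apply continuity_sin.
    - rewrite Rmin_left, Rmax_right in Hc by lra. rewrite sin_0 in E.
      assert (Hcos : 1 / 2 <= cos c); [| nra].
      replace c with (2 * (c / 2)) by field. rewrite cos_2a_sin.
      pose proof (Rabs_sin_le (c / 2)) as Hsin.
      apply Rsqr_le_abs_1 in Hsin. unfold Rsqr in Hsin. nra. }
  destruct (Rle_dec t 1) as [Hle | Hgt]; [specialize (Hhalf t ltac:(lra)); lra |].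
  pose proof (Hhalf 1 ltac:(lra)). assert (sin 1 < sin t) by (apply sin_increasing_1; lra). lra.
Qed.

Lemma sin_sq_ge (t : R) : Rabs t <= PI / 2 -> (t / 4) ^ 2 <= sin t ^ 2.
Proof.
  intros Ht. apply Rabs_le_between in Ht. destruct (Rle_dec 0 t).
  - pose proof (sin_ge_quarter t ltac:(lra)). nra.
  - pose proof (sin_ge_quarter (- t) ltac:(lra)) as H. rewrite sin_neg in H. nra.
Qed.

Lemma exp_opp_sq_le (t : R) : 0 <= t -> exp (- (2 * t)) * t ^ 2 <= (1 - exp (- (2 * t))) ^ 2.
Proof.
  intros Ht. set (s := exp (- t)). assert (Hs : 0 < s) by apply exp_pos.
  replace (exp (- (2 * t))) with (s * s) by (unfold s; rewrite <- exp_plus; f_equal; ring).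
  pose proof (exp_ineq1_le t) as Hexp.
  assert (Es : s * exp t = 1) by (unfold s; rewrite <- exp_plus, Rplus_opp_l; apply exp_0).
  assert (Hle : s * (1 + t) <= 1) by (rewrite <- Es; apply Rmult_le_compat_l; lra).
  replace (s * s * t ^ 2) with ((s * t) ^ 2) by ring. apply pow_incr. split; nra.
Qed.

Lemma Cmod_1_minus_ee_sq (u : C) : let r := exp (- (2 * PI * Im u)) in
  Cmod (1 - ee u) ^ 2 = (1 - r) ^ 2 + 4 * r * sin (PI * Re u) ^ 2.
Proof.
  intros r. rewrite Cmod2_alt, re_minus, im_minus.
  assert (Er : Re (ee u) = r * cos (2 * (PI * Re u))).
  { unfold ee, cexp, r, Re, Im. simpl. f_equal; f_equal; ring. }
  assert (Ei : Im (ee u) = r * sin (2 * (PI * Re u))).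
  { unfold ee, cexp, r, Re, Im. simpl. f_equal; f_equal; ring. }
  rewrite Er, Ei. change (Re 1) with 1. change (Im 1) with 0.
  pose proof (sin2_cos2 (2 * (PI * Re u))) as E. unfold Rsqr in E.
  transitivity (1 - 2 * r * cos (2 * (PI * Re u))
    + r ^ 2 * (sin (2 * (PI * Re u)) * sin (2 * (PI * Re u))
             + cos (2 * (PI * Re u)) * cos (2 * (PI * Re u)))); [ring |].
  rewrite E, cos_2a_sin. ring.
Qed.

Lemma Cmod_1_minus_ee_ge (u : C) : Rabs (Re u) <= 1 / 2 -> 0 <= Im u ->
  Cmod (ee u) * (PI ^ 2 / 4) * Cmod u ^ 2 <= Cmod (1 - ee u) ^ 2.
Proof.
  intros Ha Hb. rewrite Cmod_1_minus_ee_sq, Cmod_ee, Cmod2_alt. pose proof PI_RGT_0.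
  set (r := exp (- (2 * PI * Im u))). assert (Hr : 0 < r) by apply exp_pos.
  assert (Hexp : r * (PI * Im u) ^ 2 <= (1 - r) ^ 2).
  { unfold r. replace (2 * PI * Im u) with (2 * (PI * Im u)) by ring. apply exp_opp_sq_le. nra. }
  assert (Hsin : (PI * Re u / 4) ^ 2 <= sin (PI * Re u) ^ 2).
  { apply sin_sq_ge. rewrite Rabs_mult, (Rabs_right PI) by lra. nra. }
  apply (Rmult_le_compat_l r) in Hsin; [| lra].
  assert (0 <= r * (PI * Im u) ^ 2) by (apply Rmult_le_pos; [lra | apply pow2_ge_0]). lra.
Qed.

Lemma ee_neq_1_strip (u : C) : Rabs (Re u) <= 1 / 2 -> 0 <= Im u -> u <> 0%C -> ee u <> 1%C.
Proof.
  intros Ha Hb Hu E. pose proof (Cmod_1_minus_ee_ge u Ha Hb) as H. rewrite E in H.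
  rewrite Cmod_minus_diag, Cmod_1 in H. apply Cmod_gt_0 in Hu. pose proof PI_RGT_0.
  assert (0 < PI ^ 2 * Cmod u ^ 2) by (apply Rmult_lt_0_compat; apply pow_lt; auto). nra.
Qed.

Lemma csc_sq_le (u : C) : Rabs (Re u) <= 1 / 2 -> 0 <= Im u -> u <> 0%C ->
  Cmod (csc_sq u) <= 16 / Cmod u ^ 2.
Proof.
  intros Ha Hb Hu. pose proof (Cmod_1_minus_ee_ge u Ha Hb) as H. pose proof PI_RGT_0.
  pose proof (Cneq_1_minus _ (ee_neq_1_strip u Ha Hb Hu)) as Hn.
  unfold csc_sq. rewrite Cmod_div, !Cmod_mult, !Cmod_R, !(Rabs_right PI), Rabs_left
    by (try apply Cmult_neq_0; auto; lra).
  apply Cmod_gt_0 in Hu. apply Cmod_gt_0 in Hn.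
  set (m := Cmod (1 - ee u)) in *. assert (Hm : 0 < m ^ 2) by (apply pow_lt; auto).
  assert (Hu2 : 0 < Cmod u ^ 2) by (apply pow_lt; auto).
  apply Rmult_le_reg_r with (m ^ 2 * Cmod u ^ 2); [apply Rmult_lt_0_compat; auto |].
  replace (- -4 * PI * PI * Cmod (ee u) / (m * m) * (m ^ 2 * Cmod u ^ 2))
    with (16 * (Cmod (ee u) * (PI ^ 2 / 4) * Cmod u ^ 2)) by (field; lra).
  replace (16 / Cmod u ^ 2 * (m ^ 2 * Cmod u ^ 2)) with (16 * m ^ 2) by (field; lra). lra.
Qed.

Lemma translate_neq_0 (z : C) : ee z <> 1%C -> forall k : Z, (z + IZR k)%C <> 0%C.
Proof. intros H k E. apply H. rewrite <- (ee_period z k), E. apply ee_0. Qed.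

Lemma Cmod_translate_ge (z : C) : ee z <> 1%C ->
  exists d, 0 < d <= 1 /\ forall k : Z, d * (Rabs (IZR k) + 1) <= Cmod (z + IZR k).
Proof.
  intros Hz. destruct (INR_unbounded (2 * Cmod z + 1)) as [N HN]. pose proof (Cmod_ge_0 z).
  destruct (list_argmax (fun k => - Cmod (z + IZR k)) (Zrange (S N)) 0%Z) as [k0 [_ Hmin]];
    [apply in_Zrange; lia |].
  set (d := Cmod (z + IZR k0)). assert (Hd : 0 < d) by (apply Cmod_gt_0, translate_neq_0, Hz).
  set (e := Rmin (1 / 2) (d / (INR N + 2))). exists e.
  assert (He1 : e <= 1 / 2) by apply Rmin_l. assert (He2 : e <= d / (INR N + 2)) by apply Rmin_r.
  assert (He : 0 < e) by (apply Rmin_pos; [lra | apply Rdiv_lt_0_compat; lra]).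
  split; [lra |]. intros k. pose proof (Rabs_pos (IZR k)).
  destruct (Z_le_gt_dec (Z.abs k) (Z.of_nat N)) as [Hle | Hgt].
  - apply Rle_trans with (d / (INR N + 2) * (INR N + 2)).
    + apply Rmult_le_compat; try lra. rewrite <- abs_IZR. apply IZR_le in Hle.
      rewrite <- INR_IZR_INZ in Hle. lra.
    + replace (d / (INR N + 2) * (INR N + 2)) with d by (field; lra).
      specialize (Hmin k ltac:(apply in_Zrange; lia)). simpl in Hmin. unfold d. lra.
  - apply Rle_trans with (1 / 2 * (Rabs (IZR k) + 1)); [apply Rmult_le_compat_r; lra |].
    assert (INR N < Rabs (IZR k)) by (rewrite <- abs_IZR, INR_IZR_INZ; apply IZR_lt; lia).
    pose proof (Cmod_minus_le (z + IZR k) z) as Ht.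
    replace (z + IZR k - z)%C with (RtoC (IZR k)) in Ht by ring.
    rewrite Cmod_R in Ht. lra.
Qed.

Lemma summable_translate_inv_sq (z : C) : ee z <> 1%C ->
  summable (fun k : Z => / Cmod (z + IZR k) ^ 2).
Proof.
  intros Hz. destruct (Cmod_translate_ge z Hz) as [d [Hd Hge]].
  apply summable_le with (fun k => / d ^ 2 * / (Rabs (IZR k) + 1) ^ 2).
  2:{ apply summable_scal; [left; apply Rinv_0_lt_compat, pow_lt; lra | apply summable_inv_sq_Z]. }
  intros k. specialize (Hge k). pose proof (Rabs_pos (IZR k)).
  assert (Hpos : 0 < d * (Rabs (IZR k) + 1)) by (apply Rmult_lt_0_compat; lra).
  rewrite <- Rinv_mult, <- Rpow_mult_distr. split.
  - left. apply Rinv_0_lt_compat, pow_lt. lra.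
  - apply Rinv_le_contravar; [apply pow_lt, Hpos | apply pow_incr; lra].
Qed.

Lemma csc_sq_double_pole (u : nat -> C) : (forall n, u n <> 0%C) ->
  filterlim u eventually (locally (RtoC 0)) ->
  filterlim (fun n => u n * u n * csc_sq (u n))%C eventually (locally (RtoC 1)).
Proof.
  intros Hu Lu. pose proof twoPiCi_neq_0 as Hpi.
  assert (D : is_derive ee (RtoC 0) (2 * PI * Ci)%C).
  { eapply is_derive_eq; [apply (is_derive_ee (fun w => w)), is_derive_Cid |].
    rewrite ee_0. simpl. ring. }
  set (s := slope ee (RtoC 0) (2 * PI * Ci)%C).
  assert (Ls : filterlim (fun n => s (u n)) eventually (locally (2 * PI * Ci)%C))
    by (eapply filterlim_comp; [exact Lu | apply filterlim_slope, D]).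
  assert (Le : filterlim (fun n => ee (u n)) eventually (locally (RtoC 1))).
  { rewrite <- ee_0. eapply filterlim_comp; [exact Lu | apply continuous_ee]. }
  assert (Hpi2 : (2 * PI * Ci * (2 * PI * Ci))%C <> 0%C) by (apply Cmult_neq_0; auto).
  apply filterlim_ext_loc with (fun n => -4 * PI * PI * ee (u n) * / (s (u n) * s (u n)))%C.
  - generalize (filterlim_Cneq_0 _ _ _ Ls Hpi). apply filter_imp. intros n Hn.
    assert (E : (1 - ee (u n))%C = (- (s (u n) * u n))%C).
    { pose proof (slope_mult ee (RtoC 0) (2 * PI * Ci)%C (u n)) as E. fold s in E.
      rewrite ee_0 in E. replace (u n - 0)%C with (u n) in E by ring. rewrite E. ring. }
    unfold csc_sq. rewrite E. field. auto.
  - apply filterlim_locally_eq with (-4 * PI * PI * 1 * / (2 * PI * Ci * (2 * PI * Ci)))%C;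
      [auto 10 with limits |].
    replace (2 * PI * Ci * (2 * PI * Ci))%C with (4 * PI * PI * (Ci * Ci))%C by ring.
    assert (RtoC PI <> 0%C) by (apply RtoC_neq_0, PI_neq0). rewrite Ci_sq. field. auto.
Qed.

(* The duplication formula writes [csc_sq z] as the sum of the [csc_sq_term z n], whose terms tend
   to those of the partial fraction expansion. *)
Definition csc_sq_term (z : C) (n : nat) (k : Z) : C :=
  if in_dec Z.eq_dec k (Zrange (2 ^ n))
  then (/ (RtoC (2 ^ S n) * RtoC (2 ^ S n)) * csc_sq ((z + IZR k) / RtoC (2 ^ S n)))%C else 0%C.

Lemma has_sum_csc_sq_term (z : C) (n : nat) : ee z <> 1%C -> has_sum (csc_sq_term z n) (csc_sq z).
Proof.
  intros Hz. pose proof (pow2_neq_0 (S n)) as H2.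
  replace (csc_sq z) with (Csum (csc_sq_term z n) (Zrange (2 ^ n))).
  - apply has_sum_finite; [apply NoDup_Zrange |]. intros k Hk. unfold csc_sq_term.
    destruct (in_dec Z.eq_dec k (Zrange (2 ^ n))); tauto.
  - rewrite (Csum_ext_in _ (fun k => / (RtoC (2 ^ S n) * RtoC (2 ^ S n))
      * csc_sq ((z + IZR k) / RtoC (2 ^ S n)))%C).
    + rewrite Csum_scal, csc_sq_Zrange by auto. replace (4 ^ S n) with (2 ^ S n * 2 ^ S n).
      * rewrite RtoC_mult. field. auto.
      * rewrite <- Rpow_mult_distr. replace (2 * 2) with 4 by ring. reflexivity.
    + intros k Hk. unfold csc_sq_term. destruct (in_dec Z.eq_dec k (Zrange (2 ^ n))); tauto.
Qed.

Lemma Cmod_csc_sq_term_le (z : C) (n : nat) (k : Z) : 0 <= Re z < 1 -> 0 <= Im z -> ee z <> 1%C ->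
  Cmod (csc_sq_term z n k) <= 16 * / Cmod (z + IZR k) ^ 2.
Proof.
  intros Hr Hi Hz. pose proof (translate_neq_0 z Hz k) as Hk. apply Cmod_gt_0 in Hk as Hk0.
  unfold csc_sq_term. destruct (in_dec Z.eq_dec k (Zrange (2 ^ n))) as [Hin | _].
  2:{ rewrite Cmod_0. apply Rmult_le_pos; [lra | left; apply Rinv_0_lt_compat, pow_lt, Hk0]. }
  apply in_Zrange in Hin. rewrite Nat2Z.inj_pow in Hin. change (Z.of_nat 2) with 2%Z in Hin.
  pose proof (pow2_neq_0 (S n)) as H2. set (p := 2 ^ S n) in *.
  assert (Hp : 0 < p) by (apply pow_lt; lra).
  assert (Hkp : - (p / 2) <= IZR k <= p / 2 - 1).
  { assert (Ep : p / 2 = IZR (2 ^ Z.of_nat n)) by (unfold p; rewrite <- pow_IZR; simpl; field).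
    rewrite Ep, <- opp_IZR, <- minus_IZR. split; apply IZR_le; lia. }
  assert (Eu : ((z + IZR k) / RtoC p)%C = (RtoC (/ p) * (z + IZR k))%C)
    by (rewrite RtoC_inv by lra; unfold Cdiv; ring).
  assert (Hip : 0 < / p) by (apply Rinv_0_lt_compat, Hp).
  rewrite Cmod_mult, Cmod_inv, Cmod_mult, Cmod_R, Rabs_right, Eu
    by (try apply Cmult_neq_0; auto; lra).
  assert (Hle : Cmod (csc_sq (RtoC (/ p) * (z + IZR k))) <=
    16 / Cmod (RtoC (/ p) * (z + IZR k)) ^ 2).
  { apply csc_sq_le.
    - rewrite re_scal_l, re_plus. change (Re (IZR k)) with (IZR k). apply Rabs_le.
      split; apply Rmult_le_reg_l with p; auto;
        rewrite <- Rmult_assoc, Rinv_r, Rmult_1_l by lra; lra.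
    - rewrite im_scal_l, im_plus. change (Im (IZR k)) with 0. apply Rmult_le_pos; lra.
    - apply Cmult_neq_0; [apply RtoC_neq_0; lra | exact Hk]. }
  rewrite Cmod_mult, Cmod_R, (Rabs_right (/ p)) in Hle by lra.
  replace (16 * / Cmod (z + IZR k) ^ 2) with (/ (p * p) * (16 / (/ p * Cmod (z + IZR k)) ^ 2))
    by (field; lra).
  apply Rmult_le_compat_l; [left; apply Rinv_0_lt_compat; nra | exact Hle].
Qed.

Lemma filterlim_csc_sq_term (z : C) (k : Z) : ee z <> 1%C ->
  filterlim (fun n => csc_sq_term z n k) eventually (locally (/ ((z + IZR k) * (z + IZR k)))%C).
Proof.
  intros Hz. pose proof (translate_neq_0 z Hz k) as Hk. set (v := (z + IZR k)%C) in *.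
  set (u := fun n : nat => (v / RtoC (2 ^ S n))%C).
  assert (Hu : forall n, u n <> 0%C).
  { intros n E. apply Hk. pose proof (pow2_neq_0 (S n)).
    replace v with (u n * RtoC (2 ^ S n))%C by (unfold u; field; auto). rewrite E. ring. }
  assert (Lu : filterlim u eventually (locally (RtoC 0))).
  { apply filterlim_ext with (fun n => v * (RtoC (/ 2) ^ S n))%C.
    - intros n. unfold u. rewrite <- RtoC_pow, pow_inv, RtoC_inv by (apply pow_nonzero; lra).
      reflexivity.
    - apply filterlim_locally_eq with (v * 0)%C; [| ring].
      assert (Hq : Cmod (RtoC (/ 2)) < 1) by (rewrite Cmod_R, Rabs_right; lra).
      pose proof (filterlim_eventually_S _ _ (has_sum_term_to_0 _ _ (has_sum_geom _ Hq))).
      auto with limits. }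
  apply filterlim_ext_loc with (fun n => u n * u n * csc_sq (u n) * / (v * v))%C.
  - exists (Z.abs_nat k). intros n Hn. unfold csc_sq_term. fold v.
    destruct (in_dec Z.eq_dec k (Zrange (2 ^ n))) as [_ | Hout].
    + unfold u. field. auto using pow2_neq_0.
    + exfalso. apply Hout, in_Zrange. pose proof (Nat.pow_gt_lin_r 2 n ltac:(lia)). lia.
  - apply filterlim_locally_eq with (1 * / (v * v))%C; [| ring].
    pose proof (csc_sq_double_pole u Hu Lu). auto with limits.
Qed.

Lemma has_sum_csc_sq (z : C) : 0 <= Im z -> ee z <> 1%C ->
  has_sum (fun k : Z => / ((z + IZR k) * (z + IZR k)))%C (csc_sq z).
Proof.
  assert (Hstrip : forall z, 0 <= Re z < 1 -> 0 <= Im z -> ee z <> 1%C ->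
    has_sum (fun k : Z => / ((z + IZR k) * (z + IZR k)))%C (csc_sq z)).
  { clear z. intros z Hr Hi Hz. set (g := fun k : Z => (/ ((z + IZR k) * (z + IZR k)))%C).
    set (b := fun k : Z => 16 * / Cmod (z + IZR k) ^ 2).
    assert (Hb : summable b) by (apply summable_scal; [lra | apply summable_translate_inv_sq, Hz]).
    assert (Hg : forall k, Cmod (g k) <= b k).
    { intros k. pose proof (translate_neq_0 z Hz k) as Hk. unfold g, b.
      rewrite Cmod_inv, Cmod_mult by (apply Cmult_neq_0; auto). apply Cmod_gt_0 in Hk.
      assert (0 < / Cmod (z + IZR k) ^ 2) by (apply Rinv_0_lt_compat, pow_lt, Hk).
      simpl in *. rewrite Rmult_1_r in *. lra. }
    assert (L : filterlim (fun n => usum (csc_sq_term z n)) eventually (locally (usum g))).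
    { apply (filterlim_usum eventually (csc_sq_term z) g b Hb).
      - apply filter_forall. intros n k. apply Cmod_csc_sq_term_le; auto.
      - intros k. apply filterlim_csc_sq_term, Hz. }
    replace (csc_sq z) with (usum g); [apply has_sum_usum with b; auto |].
    apply (filterlim_locally_unique (V := C_NormedModule) (F := eventually)
      (fun n => usum (csc_sq_term z n))); [exact L |].
    apply filterlim_ext with (fun _ => csc_sq z); [| apply filterlim_const].
    intros n. symmetry. apply usum_eq, has_sum_csc_sq_term, Hz. }
  intros Hi Hz. set (m := (1 - up (Re z))%Z). pose proof (floor_shift (Re z)) as Hm. fold m in Hm.
  rewrite <- (csc_sq_period z m).
  apply has_sum_ext with (fun k => / ((z + IZR m + IZR (k - m)) * (z + IZR m + IZR (k - m))))%C.
  { intros k. rewrite minus_IZR, RtoC_minus. f_equal. ring. }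
  apply (has_sum_reindex (fun k => / ((z + IZR m + IZR k) * (z + IZR m + IZR k)))%C _
    (fun k => (k - m)%Z) (fun k => (k + m)%Z)); [intros; lia | intros; lia |].
  apply Hstrip.
  - rewrite re_plus. cbn [RtoC Re fst]. exact Hm.
  - rewrite im_plus. cbn [RtoC Im snd]. lra.
  - rewrite ee_period. exact Hz.
Qed.

Definition cotpi (z : C) : C := (PI * Ci * ((ee z + 1) * / (ee z - 1)))%C.
Definition cot_term (n : nat) (z : C) : C := (/ (z + INR n) + / (z - INR (S n)))%C.
Definition cot_term_derivative (n : nat) (z : C) : C :=
  (- / ((z + INR n) * (z + INR n)) + - / ((z - INR (S n)) * (z - INR (S n))))%C.

Lemma is_derive_cotpi (z : C) : ee z <> 1%C -> is_derive cotpi z (- csc_sq z)%C.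
Proof.
  intros Hz. pose proof (Cneq_1_minus _ Hz) as Hn. pose proof (Cminus_eq_contra _ _ Hz).
  unfold cotpi. eapply is_derive_eq; [eauto 10 with derive |]. simpl. unfold csc_sq.
  transitivity (4 * PI * PI * (- (Ci * Ci)) * ee z / ((ee z - 1) * (ee z - 1)))%C; [field; auto |].
  rewrite Ci_sq. field. auto.
Qed.

Lemma cot_term_neq_0 (z : C) (n : nat) : (forall k : Z, z + IZR k <> 0)%C ->
  (z + INR n <> 0)%C /\ (z - INR (S n) <> 0)%C.
Proof.
  intros Hz. rewrite !INR_IZR_INZ. split; [apply Hz |].
  specialize (Hz (- Z.of_nat (S n))%Z). rewrite opp_IZR, RtoC_opp in Hz. exact Hz.
Qed.

Lemma cot_term_holomorphic (U : C -> Prop) (n : nat) :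
  (forall z, U z -> forall k : Z, (z + IZR k <> 0)%C) ->
  holomorphic_on U (cot_term n) (cot_term_derivative n).
Proof.
  intros HU z Hz. destruct (cot_term_neq_0 z n (HU z Hz)) as [N1 N2].
  unfold cot_term, cot_term_derivative. split.
  - eapply is_derive_eq; [eauto 10 with derive |]. simpl. field. auto.
  - assert (N1' := Cmult_neq_0 _ _ N1 N1). assert (N2' := Cmult_neq_0 _ _ N2 N2).
    assert (Cid : continuous (fun w : C => w) z) by apply continuous_id. unfold continuous in *.
    auto 15 with limits.
Qed.

Lemma cot_term_eq (n : nat) (z : C) : (z + INR n <> 0)%C -> (z - INR (S n) <> 0)%C ->
  cot_term n z = ((2 * z - 1) / ((z + INR n) * (z - INR (S n))))%C.
Proof. intros N1 N2. unfold cot_term. rewrite S_INR, RtoC_plus in *. field. auto. Qed.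

Lemma cot_term_bound (z0 : C) : ee z0 <> 1%C -> exists d B, 0 < d /\ 0 <= B /\
  (forall z, disc z0 d z -> forall k : Z, (z + IZR k <> 0)%C) /\
  forall n z, disc z0 d z -> Cmod (cot_term n z) <= B * / (INR n + 1) ^ 2.
Proof.
  intros H. destruct (Cmod_translate_ge z0 H) as [d [Hd Hge0]]. pose proof (Cmod_ge_0 z0).
  assert (Hge : forall z, disc z0 (d / 2) z ->
    forall k : Z, d / 2 * (Rabs (IZR k) + 1) <= Cmod (z + IZR k)).
  { intros z Hz k. unfold disc in Hz. specialize (Hge0 k). pose proof (Rabs_pos (IZR k)).
    pose proof (Cmod_le_minus (z0 + IZR k) (z + IZR k)) as Ht.
    replace (z0 + IZR k - (z + IZR k))%C with (z0 - z)%C in Ht by ring.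
    rewrite Cmod_minus_sym in Ht. nra. }
  assert (Hne : forall z, disc z0 (d / 2) z -> forall k : Z, (z + IZR k <> 0)%C).
  { intros z Hz k. apply Cmod_gt_0. specialize (Hge z Hz k). pose proof (Rabs_pos (IZR k)). nra. }
  exists (d / 2), ((2 * Cmod z0 + 2) * (4 / d ^ 2)). split; [lra | split].
  { apply Rmult_le_pos; [lra |]. apply Rlt_le, Rdiv_lt_0_compat; [lra | apply pow_lt; lra]. }
  split; auto. intros n z Hz. pose proof (pos_INR n).
  destruct (cot_term_neq_0 z n (Hne z Hz)) as [N1 N2].
  pose proof (Hge z Hz (Z.of_nat n)) as L1. pose proof (Hge z Hz (- Z.of_nat (S n))%Z) as L2.
  rewrite opp_IZR, Rabs_Ropp, RtoC_opp in L2.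
  rewrite <- !INR_IZR_INZ, Rabs_right in L1, L2 by (apply Rle_ge, pos_INR).
  fold (z - INR (S n))%C in L2.
  rewrite cot_term_eq, Cmod_div, Cmod_mult by (try apply Cmult_neq_0; auto).
  assert (Hnum : Cmod (2 * z - 1) <= 2 * Cmod z0 + 2).
  { unfold disc in Hz. replace (2 * z - 1)%C with (2 * z0 + 2 * (z - z0) - 1)%C by ring.
    eapply Rle_trans; [apply Cmod_minus_le |].
    eapply Rle_trans; [apply Rplus_le_compat_r, Cmod_triangle |].
    rewrite !Cmod_mult, Cmod_1, Cmod_R, Rabs_right by lra. lra. }
  apply Rle_trans with ((2 * Cmod z0 + 2) * / (d / 2 * (INR n + 1) * (d / 2 * (INR n + 1)))).
  - apply Rmult_le_compat; auto; [apply Cmod_ge_0 | |].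
    + left. apply Rinv_0_lt_compat, Rmult_lt_0_compat; apply Cmod_gt_0; auto.
    + apply Rinv_le_contravar; [nra |]. pose proof (S_INR n). apply Rmult_le_compat; nra.
  - right. field. lra.
Qed.

Lemma is_derive_cot_sum (z : C) : 0 <= Im z -> ee z <> 1%C ->
  is_derive (fun w => usum (fun n => cot_term n w)) z (- csc_sq z)%C.
Proof.
  intros Hi Hz. destruct (cot_term_bound z Hz) as [d [B [Hd [HB [Hne Hle]]]]].
  assert (Hb : summable (fun n : nat => B * / (INR n + 1) ^ 2))
    by (apply summable_scal; auto using summable_inv_sq).
  replace (- csc_sq z)%C with (usum (fun n => cot_term_derivative n z)).
  - apply (weierstrass_is_derive cot_term cot_term_derivative _ z d Hd Hb); auto.
    intros n. apply cot_term_holomorphic, Hne.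
  - apply usum_eq. pose proof (has_sum_scal (-1)%C _ _
      (has_sum_Z_pairs _ _ (has_sum_csc_sq z Hi Hz))) as H.
    replace (- csc_sq z)%C with (-1 * csc_sq z)%C by ring. revert H. apply has_sum_ext. intros n.
    unfold cot_term_derivative. rewrite opp_IZR, RtoC_opp, <- !INR_IZR_INZ. unfold Cminus. ring.
Qed.

Lemma usum_cot_term_half : usum (fun n => cot_term n (/ 2)%R) = 0%C.
Proof.
  apply usum_eq, has_sum_ext with (2 := has_sum_0). intros n.
  unfold cot_term. pose proof (pos_INR n).
  rewrite S_INR, <- RtoC_plus, <- RtoC_minus, <- !RtoC_inv, <- RtoC_plus by lra. f_equal.
  field. lra.
Qed.

Lemma has_sum_cotpi (z : C) : upper z -> has_sum (fun n => cot_term n z) (cotpi z).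
Proof.
  intros Hz. set (K := fun w => usum (fun n => cot_term n w)).
  assert (E : (K z - cotpi z = K (/ 2)%R - cotpi (/ 2)%R)%C).
  { apply (constant_on_segment (fun w => K w - cotpi w)%C). intros t Ht.
    set (w := ((/ 2)%R + t * (z - (/ 2)%R))%C).
    assert (Hw : 0 <= Im w /\ ee w <> 1%C).
    { destruct (Req_dec t 0) as [-> | Ht0].
      - replace w with (RtoC (/ 2)) by (unfold w; ring). rewrite ee_half. split; [simpl; lra |].
        intros E. apply RtoC_inj in E. lra.
      - assert (Hup : upper w).
        { unfold upper, w in *. rewrite im_plus, im_scal_l, im_minus. simpl. nra. }
        split; [unfold upper in Hup; lra | apply ee_upper_neq_1, Hup]. }
    apply is_derive_eq with (- csc_sq w - - csc_sq w)%C; [| ring].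
    apply is_derive_Cminus; [apply is_derive_cot_sum | apply is_derive_cotpi]; apply Hw. }
  assert (E0 : cotpi (/ 2)%R = 0%C) by (unfold cotpi; rewrite ee_half; ring).
  unfold K at 2 in E. rewrite usum_cot_term_half, E0 in E.
  replace (cotpi z) with (K z)
    by (replace (K z) with ((K z - cotpi z) + cotpi z)%C by ring; rewrite E; ring).
  destruct (cot_term_bound z (ee_upper_neq_1 z Hz)) as [d [B [Hd [HB [_ Hle]]]]].
  apply has_sum_usum with (fun n : nat => B * / (INR n + 1) ^ 2).
  - apply summable_scal; auto using summable_inv_sq.
  - intros n. apply Hle, disc_center, Hd.
Qed.

Lemma has_sum_odd_inv_sq :
  has_sum (fun n : nat => / (INR (2 * n + 1) * INR (2 * n + 1)))%C (PI * PI / 8)%C.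
Proof.
  assert (Hhalf : ee (/ 2)%R <> 1%C) by (rewrite ee_half; intros E; apply RtoC_inj in E; lra).
  assert (Hi : 0 <= Im (/ 2)%R) by (simpl; lra).
  pose proof (has_sum_scal (/ 8)%C _ _ (has_sum_Z_pairs _ _ (has_sum_csc_sq _ Hi Hhalf))) as H.
  replace (/ 8 * csc_sq (/ 2)%R)%C with (PI * PI / 8)%C in H
    by (unfold csc_sq; rewrite ee_half; field).
  revert H. apply has_sum_ext. intros n. rewrite opp_IZR, <- !INR_IZR_INZ.
  assert (Hn : INR (2 * n + 1) = 2 * INR n + 1) by (rewrite plus_INR, mult_INR; simpl; ring).
  replace ((/ 2)%R + INR n)%C with ((/ 2)%R * INR (2 * n + 1))%C
    by (rewrite Hn, <- RtoC_mult, <- RtoC_plus; f_equal; field).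
  replace ((/ 2)%R + (- INR (S n))%R)%C with (- ((/ 2)%R * INR (2 * n + 1)))%C
    by (rewrite Hn, S_INR, <- RtoC_mult, <- RtoC_plus, <- RtoC_opp; f_equal; field).
  assert (RtoC (INR (2 * n + 1)) <> 0%C) by (apply RtoC_neq_0, not_0_INR; lia).
  rewrite RtoC_inv by lra. field. auto.
Qed.

(* With [c] the sum, the odd terms contribute [PI ^ 2 / 8] and the even ones [c / 4]. *)
Lemma has_sum_inv_sq : has_sum (fun n : nat => / (INR (S n) * INR (S n)))%C (PI * PI / 6)%C.
Proof.
  set (f := fun n : nat => (/ (INR (S n) * INR (S n)))%C).
  assert (Hc : has_sum f (usum f)).
  { apply has_sum_usum with (1 := summable_inv_sq). intros n. right. unfold f.
    pose proof (pos_INR n). rewrite <- RtoC_mult, <- RtoC_inv, Cmod_R, Rabs_right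
      by (rewrite S_INR; try apply Rle_ge, Rlt_le, Rinv_0_lt_compat; nra).
    rewrite S_INR. f_equal. ring. }
  set (c := usum f) in *.
  assert (Hsplit : has_sum (fun k => f (2 * k + 1)%nat + f (2 * k)%nat)%C c).
  { set (phi := fun p : nat * bool => (if snd p then 2 * fst p + 1 else 2 * fst p)%nat).
    apply (has_sum_pair_bool (fun p => f (phi p))), (has_sum_injection f c phi); [| | exact Hc].
    - intros [k []] [k' []] E; unfold phi in E; simpl in E; f_equal; lia.
    - intros n _. destruct (Nat.Even_or_Odd n) as [[k ->] | [k ->]];
        [exists (k, false) | exists (k, true)]; reflexivity. }
  assert (Heven : has_sum (fun k => f (2 * k + 1)%nat) (/ 4 * c)%C).
  { apply has_sum_ext with (fun k => / 4 * f k)%C; [| apply has_sum_scal, Hc]. intros k. unfold f.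
    replace (S (2 * k + 1)) with (2 * S k)%nat by lia. rewrite mult_INR, RtoC_mult. simpl (INR 2).
    assert (RtoC (INR (S k)) <> 0%C) by (apply RtoC_neq_0, not_0_INR; lia).
    replace (RtoC (1 + 1)) with (RtoC 2) by (f_equal; ring). field. auto. }
  assert (Hodd : has_sum (fun k => f (2 * k)%nat) (PI * PI / 8)%C).
  { apply has_sum_ext with (2 := has_sum_odd_inv_sq). intros k. unfold f.
    replace (S (2 * k)) with (2 * k + 1)%nat by lia. reflexivity. }
  pose proof (has_sum_unique _ _ _ Hsplit (has_sum_plus _ _ _ _ Heven Hodd)) as E.
  replace (PI * PI / 6)%C with c; [exact Hc |].
  replace c with (4 / 3 * (c - / 4 * c))%C by field. rewrite E at 1. field.
Qed.

(** * The logarithm of the eta function *)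

Lemma Re_1_minus_gt_0 (w : C) : Cmod w < 1 -> 0 < Re (1 - w).
Proof.
  intros Hw. rewrite re_minus. pose proof (re_le_Cmod w) as H. apply Rabs_le_between in H.
  change (Re 1) with 1. lra.
Qed.

Lemma Cmod_clog_1_minus_le (w : C) : Cmod w < 1 -> Cmod (clog (1 - w)) <= / (1 - Cmod w) * Cmod w.
Proof.
  intros Hw.
  assert (H : Cmod (clog (1 - w) - clog (1 - 0)) <= / (1 - Cmod w) * Cmod (w - 0)).
  { apply (mean_value_inequality (fun v => clog (1 - v)) (fun v => - / (1 - v))%C). intros t Ht.
    replace (0 + t * (w - 0))%C with (t * w)%C by ring.
    assert (Htw : Cmod (t * w) <= Cmod w).
    { rewrite Cmod_mult, Cmod_R, Rabs_right by lra. pose proof (Cmod_ge_0 w). nra. }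
    pose proof (Re_1_minus_gt_0 (t * w) ltac:(lra)) as Hre. split.
    - eapply is_derive_eq; [eauto with derive | simpl; ring].
    - rewrite Cmod_opp, Cmod_inv by (apply Cmod_gt_0, Cmod_gt_0_of_Re, Hre).
      apply Rinv_le_contravar; [lra |]. pose proof (Cmod_le_minus 1 (1 - t * w)) as Hle.
      rewrite Cmod_1 in Hle. replace (1 - (1 - t * w))%C with (t * w)%C in Hle by ring. lra. }
  replace (1 - 0)%C with (RtoC 1) in H by ring. rewrite clog_1 in H.
  replace (clog (1 - w) - 0)%C with (clog (1 - w)) in H by ring.
  replace (w - 0)%C with w in H by ring. exact H.
Qed.

Lemma pow_S_le (r : R) (n : nat) : 0 <= r <= 1 -> r ^ S n <= r.
Proof.
  intros Hr. simpl. assert (r ^ n <= 1) by (rewrite <- (pow1 n); apply pow_incr; lra).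
  assert (0 <= r ^ n) by (apply pow_le; lra). nra.
Qed.

Lemma INR_S_gt_0 (n : nat) : 0 < INR (S n).
Proof. apply lt_0_INR. lia. Qed.

Definition euler_log_term (n : nat) (t : C) : C := clog (1 - ee (INR (S n) * t)).
Definition euler_log_term_derivative (n : nat) (t : C) : C :=
  (-2 * PI * Ci * INR (S n) * (ee (INR (S n) * t) * / (1 - ee (INR (S n) * t))))%C.

(* The logarithm of Euler's product [prod (1 - q ^ n)], so that
   [logeta t = 2 pi i t / 24 + euler_log t]. *)
Definition euler_log (t : C) : C := usum (fun n => euler_log_term n t).
Definition euler_log_derivative (t : C) : C := usum (fun n => euler_log_term_derivative n t).

Lemma Cmod_euler_log_term_le (r : R) (n : nat) (t : C) : 0 <= r < 1 -> Cmod (ee t) <= r ->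
  Cmod (euler_log_term n t) <= r / (1 - r) * r ^ n.
Proof.
  intros Hr Ht. pose proof (Cmod_ge_0 (ee t)). unfold euler_log_term.
  assert (Hle : Cmod (ee (INR (S n) * t)) <= r ^ S n)
    by (rewrite Cmod_ee_mult_INR; apply pow_incr; auto).
  pose proof (pow_S_le r n ltac:(lra)). eapply Rle_trans; [apply Cmod_clog_1_minus_le; lra |].
  replace (r / (1 - r) * r ^ n) with (/ (1 - r) * r ^ S n) by (simpl; field; lra).
  apply Rmult_le_compat; auto; [left; apply Rinv_0_lt_compat; lra | apply Cmod_ge_0 |].
  apply Rinv_le_contravar; lra.
Qed.

Lemma summable_euler_log (r : R) : 0 <= r < 1 -> summable (fun n => r / (1 - r) * r ^ n).
Proof.
  intros Hr. apply summable_scal; [| apply summable_geom, Hr].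
  apply Rmult_le_pos; [lra | left; apply Rinv_0_lt_compat; lra].
Qed.

Lemma Cmod_ee_mult_S_lt_1 (n : nat) (t : C) : upper t -> Cmod (ee (INR (S n) * t)) < 1.
Proof. intros Ht. apply Cmod_ee_lt_1, upper_scal, Ht. apply INR_S_gt_0. Qed.

Lemma holomorphic_euler_log_term (n : nat) :
  holomorphic_on upper (euler_log_term n) (euler_log_term_derivative n).
Proof.
  intros t Ht. pose proof (Re_1_minus_gt_0 _ (Cmod_ee_mult_S_lt_1 n t Ht)) as Hre.
  unfold euler_log_term, euler_log_term_derivative.
  assert (D : is_derive (fun w => ee (INR (S n) * w)) t
    (2 * PI * Ci * ee (INR (S n) * t) * INR (S n))%C).
  { eapply is_derive_eq; [eauto with derive |]. simpl. ring. }
  assert (Hn : (1 - ee (INR (S n) * t))%C <> 0%C) by (apply Cmod_gt_0, Cmod_gt_0_of_Re, Hre). split.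
  - eapply is_derive_eq; [eauto with derive |]. simpl. field. exact Hn.
  - apply is_derive_C_continuous in D. unfold continuous in *. auto 10 with limits.
Qed.

Lemma ee_disc_ratio (t : C) : upper t -> exists d r, 0 < d /\ 0 <= r < 1 /\
  forall w, disc t d w -> upper w /\ Cmod (ee w) <= r.
Proof.
  intros Ht. unfold upper in Ht. pose proof PI_RGT_0.
  exists (Im t / 2), (exp (- (2 * PI * (Im t / 2)))). split; [lra | split].
  { split; [left; apply exp_pos |]. rewrite <- exp_0. apply exp_increasing. nra. }
  intros w Hw. unfold disc in Hw. pose proof (im_le_Cmod (w - t)) as Hd. rewrite im_minus in Hd.
  apply Rabs_le_between in Hd. split; [unfold upper; lra |]. rewrite Cmod_ee. left.
  apply exp_increasing. nra.
Qed.

Lemma has_sum_euler_log (t : C) : upper t -> has_sum (fun n => euler_log_term n t) (euler_log t).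
Proof.
  intros Ht.
  assert (Hr : 0 <= Cmod (ee t) < 1) by (split; [apply Cmod_ge_0 | apply Cmod_ee_lt_1, Ht]).
  apply has_sum_usum with (1 := summable_euler_log _ Hr). intros n.
  apply Cmod_euler_log_term_le; auto. lra.
Qed.

Lemma weierstrass_euler_log (t : C) : upper t ->
  is_derive euler_log t (euler_log_derivative t) /\ continuous euler_log_derivative t /\
  has_sum (fun n => euler_log_term_derivative n t) (euler_log_derivative t).
Proof.
  intros Ht. destruct (ee_disc_ratio t Ht) as [d [r [Hd [Hr Hdisc]]]].
  assert (Hhol : forall n,
    holomorphic_on (disc t d) (euler_log_term n) (euler_log_term_derivative n)).
  { intros n. apply holomorphic_on_subset with upper;
      [apply Hdisc | apply holomorphic_euler_log_term]. }
  assert (Hle : forall n w, disc t d w -> Cmod (euler_log_term n w) <= r / (1 - r) * r ^ n).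
  { intros n w Hw. apply Cmod_euler_log_term_le, Hdisc; auto. }
  pose proof (summable_euler_log r Hr) as Hs. split; [| split].
  - apply (weierstrass_is_derive _ _ _ t d Hd Hs Hhol Hle).
  - apply (weierstrass_continuous_derivative _ _ _ t d Hd Hs Hhol Hle).
  - apply (weierstrass_has_sum_derivative _ _ _ t d Hd Hs Hhol Hle).
Qed.

Lemma logeta_eq (t : C) : upper t -> logeta t = (2 * PI * Ci * t / 24 + euler_log t)%C.
Proof.
  intros Ht. unfold logeta. f_equal. apply cseries_has_sum. generalize (has_sum_euler_log t Ht).
  apply has_sum_ext. intros n. unfold euler_log_term. rewrite ee_mult_INR. reflexivity.
Qed.

Definition logeta_derivative (t : C) : C := (2 * PI * Ci / 24 + euler_log_derivative t)%C.

Lemma holomorphic_logeta : holomorphic_on upper logeta logeta_derivative.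
Proof.
  intros t Ht. destruct (weierstrass_euler_log t Ht) as [D [Cd _]]. split.
  - apply is_derive_C_ext_loc with (fun t => 2 * PI * Ci / 24 * t + euler_log t)%C.
    + refine (filter_imp (F := locally t) _ _ _ (locally_Im_gt t 0 Ht)).
      intros w Hw. rewrite logeta_eq by exact Hw. field.
    + eapply is_derive_eq; [eauto with derive |]. unfold logeta_derivative. simpl. ring.
  - unfold logeta_derivative, continuous in *. auto with limits.
Qed.

Lemma euler_log_periodic : periodic euler_log.
Proof.
  intros t Ht. apply usum_ext. intros n. unfold euler_log_term. do 2 f_equal.
  replace (INR (S n) * (t + 1))%C with (INR (S n) * t + IZR (Z.of_nat (S n)))%C
    by (rewrite <- INR_IZR_INZ; ring).
  apply ee_period.
Qed.

Lemma logeta_translation (t : C) (n : Z) : upper t ->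
  logeta (t + IZR n) = (logeta t + IZR n * (2 * PI * Ci / 24))%C.
Proof.
  intros Ht. apply (shift_IZR logeta); [| exact Ht]. intros z Hz.
  rewrite !logeta_eq, euler_log_periodic by (auto; apply (upper_plus_R z 1), Hz). field.
Qed.

Lemma filterlim_euler_log : filterlim euler_log Im_infty (locally (RtoC 0)).
Proof.
  rewrite <- (usum_eq (fun _ : nat => RtoC 0) 0%C has_sum_0).
  assert (Hhalf : Im_infty (fun t => Cmod (ee t) <= / 2)).
  { pose proof (proj1 (filterlim_Cmod _ _ _) filterlim_ee_Im_infty (/ 2) ltac:(lra)) as H.
    revert H. apply filter_imp. intros t Ht. replace (ee t - 0)%C with (ee t) in Ht by ring. lra. }
  apply (filterlim_usum Im_infty (fun t n => euler_log_term n t) (fun _ => RtoC 0)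
    (fun n => / 2 / (1 - / 2) * (/ 2) ^ n)).
  - apply summable_euler_log. lra.
  - revert Hhalf. apply filter_imp. intros t Ht n. apply Cmod_euler_log_term_le; lra.
  - intros n. apply filterlim_C_squeeze with (fun t => Cmod (2 * ee t)); [typeclasses eauto | |].
    + revert Hhalf. apply filter_imp. intros t Ht.
      replace (euler_log_term n t - 0)%C with (euler_log_term n t) by ring.
      pose proof (Cmod_ge_0 (ee t)).
      assert (Hle : Cmod (ee (INR (S n) * t)) <= Cmod (ee t))
        by (rewrite Cmod_ee_mult_INR; apply pow_S_le; lra).
      unfold euler_log_term. eapply Rle_trans; [apply Cmod_clog_1_minus_le; lra |].
      rewrite Cmod_mult, Cmod_R, Rabs_right by lra.
      apply Rmult_le_compat; auto; [left; apply Rinv_0_lt_compat; lra | apply Cmod_ge_0 |].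
      rewrite <- (Rinv_inv 2). apply Rinv_le_contravar; lra.
    + rewrite <- Cmod_0. eapply filterlim_comp; [| apply continuous_Cmod].
      apply filterlim_locally_eq with (2 * 0)%C; [| ring].
      pose proof filterlim_ee_Im_infty. auto with limits.
Qed.

Definition lambert_term (t : C) (p : nat * nat) : C :=
  (-2 * PI * Ci * (INR (S (fst p)) * ee t ^ (S (fst p) * S (snd p))))%C.

Lemma pow_mult_S_le (r : R) (n m : nat) : 0 <= r <= 1 -> r ^ (S n * S m) <= r ^ n * r ^ m.
Proof.
  intros Hr. rewrite <- pow_add. replace (S n * S m)%nat with (n + m + (1 + n * m))%nat by lia.
  rewrite pow_add. assert (0 <= r ^ (n + m)) by (apply pow_le; lra).
  assert (r ^ (1 + n * m) <= 1) by (rewrite <- (pow1 (1 + n * m)); apply pow_incr; lra). nra.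
Qed.

Lemma has_sum_lambert_term (t : C) : upper t -> has_sum (lambert_term t) (usum (lambert_term t)).
Proof.
  intros Ht.
  assert (Hr : 0 <= Cmod (ee t) < 1) by (split; [apply Cmod_ge_0 | apply Cmod_ee_lt_1, Ht]).
  set (r := Cmod (ee t)) in *. pose proof PI_RGT_0.
  apply has_sum_usum
    with (fun p : nat * nat => 2 * PI * ((INR (fst p) + 1) * r ^ fst p * r ^ snd p)).
  - apply summable_scal; [lra |].
    apply (summable_prod (fun n => (INR n + 1) * r ^ n) (fun m => r ^ m));
      [apply summable_arith_geom, Hr | apply summable_geom, Hr].
  - intros [n m]. unfold lambert_term. cbn [fst snd]. pose proof (pos_INR n).
    rewrite !Cmod_mult, Cmod_Ci, !Cmod_R, Cmod_pow, (Rabs_left (-2)), (Rabs_right PI),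
      (Rabs_right (INR (S n))), S_INR by (try lra; apply Rle_ge, pos_INR). fold r.
    pose proof (pow_mult_S_le r n m ltac:(lra)) as Hle.
    replace (- -2 * PI * 1 * ((INR n + 1) * r ^ (S n * S m)))
      with (2 * PI * ((INR n + 1) * r ^ (S n * S m))) by ring.
    apply Rmult_le_compat_l; [lra |]. rewrite Rmult_assoc. apply Rmult_le_compat_l; lra.
Qed.

(* Sum [-2 pi i n q ^ (n m)] over [m] first or over [n] first. *)
Lemma has_sum_euler_log_derivative (t : C) : upper t ->
  has_sum (fun m => Ci / (2 * PI) * csc_sq (INR (S m) * t))%C (euler_log_derivative t).
Proof.
  intros Ht. pose proof (has_sum_lambert_term t Ht) as H.
  assert (Hn : forall n, (1 - ee (INR (S n) * t))%C <> 0%C).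
  { intros n. apply Cneq_1_minus, Cmod_lt_1_neq_1, Cmod_ee_mult_S_lt_1, Ht. }
  assert (Hrow : has_sum (fun n => euler_log_term_derivative n t) (usum (lambert_term t))).
  { apply has_sum_fubini with (1 := H). intros n. set (w := ee (INR (S n) * t)).
    unfold euler_log_term_derivative. fold w.
    apply has_sum_ext with (fun m => -2 * PI * Ci * INR (S n) * w * w ^ m)%C.
    - intros m. unfold lambert_term, w. cbn [fst snd].
      rewrite Cpow_mult_r, <- (ee_mult_INR t), Cpow_S. ring.
    - rewrite Cmult_assoc. apply has_sum_scal, has_sum_geom, Cmod_ee_mult_S_lt_1, Ht. }
  destruct (weierstrass_euler_log t Ht) as [_ [_ Hd]]. rewrite (has_sum_unique _ _ _ Hd Hrow).
  apply has_sum_swap in H. apply has_sum_fubini with (1 := H). intros m.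
  set (w := ee (INR (S m) * t)).
  apply has_sum_ext with (fun n => -2 * PI * Ci * w * (INR (S n) * w ^ n))%C.
  - intros n. unfold lambert_term, w. cbn [fst snd].
    rewrite Nat.mul_comm, Cpow_mult_r, <- (ee_mult_INR t), Cpow_S. ring.
  - specialize (Hn m). fold w in Hn. unfold csc_sq. fold w.
    replace (Ci / (2 * PI) * (-4 * PI * PI * w / ((1 - w) * (1 - w))))%C
      with (-2 * PI * Ci * w * / ((1 - w) * (1 - w)))%C
      by (field; split; [exact Hn | apply RtoC_neq_0, PI_neq0]).
    apply has_sum_scal, has_sum_arith_geom, Cmod_ee_mult_S_lt_1, Ht.
Qed.

(** * The Eisenstein series of weight two and the inversion of eta *)

Lemma Cmod_denom_ge (X Y : R) (t : C) (m n : Z) :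
  0 <= X -> 0 < Y -> Rabs (Re t) <= X -> Y <= Im t ->
  Y / (1 + X + Y) * (Rabs (IZR m) + Rabs (IZR n)) <= Cmod (denom m n t).
Proof.
  intros HX HY Hre Him. set (D := Cmod (denom m n t)).
  pose proof (im_le_Cmod (denom m n t)) as Hi. pose proof (re_le_Cmod (denom m n t)) as Hr.
  rewrite Im_denom, Rabs_mult, (Rabs_right (Im t)) in Hi by lra. rewrite Re_denom in Hr.
  fold D in Hi, Hr.
  pose proof (Rabs_pos (IZR m)) as Hm. pose proof (Rabs_pos (IZR n)).
  assert (HmD : Rabs (IZR m) * Y <= D) by nra.
  assert (Hn : Rabs (IZR n) <= D + Rabs (IZR m) * X).
  { pose proof (Rabs_triang (IZR m * Re t + IZR n) (- (IZR m * Re t))) as Ht.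
    replace (IZR m * Re t + IZR n + - (IZR m * Re t)) with (IZR n) in Ht by ring.
    rewrite Rabs_Ropp, Rabs_mult in Ht. nra. }
  apply Rmult_le_reg_r with (1 + X + Y); [lra |].
  replace (Y / (1 + X + Y) * (Rabs (IZR m) + Rabs (IZR n)) * (1 + X + Y))
    with (Y * (Rabs (IZR m) + Rabs (IZR n))) by (field; lra). nra.
Qed.

Lemma filterlim_div_INR (c : R) : filterlim (fun N => c / (INR N + 1)) eventually (locally 0).
Proof.
  change (is_lim_seq (fun N => c / (INR N + 1)) 0).
  apply (is_lim_seq_ext (fun N => c * / INR (S N))); [intros N; rewrite S_INR; reflexivity |].
  replace (Finite 0) with (Rbar_mult c 0) by (simpl; f_equal; ring). apply is_lim_seq_scal_l.
  apply (is_lim_seq_incr_1 (fun N => / INR N)).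
  replace (Finite 0) with (Rbar_inv p_infty) by reflexivity.
  apply is_lim_seq_inv; [apply is_lim_seq_INR | discriminate].
Qed.

Lemma Rabs_IZR_succ_ge (k : Z) : Rabs (IZR k) <= Rabs (IZR (k + 1)) + 1.
Proof. rewrite <- !abs_IZR, <- plus_IZR. apply IZR_le. lia. Qed.

Lemma inv_translate_bound (z : C) : ee z <> 1%C -> exists B, 0 <= B /\ forall k : Z,
  Cmod (/ (z + IZR k)) <= B / (Rabs (IZR k) + 1) /\
  Cmod (/ (z + IZR k) - / (z + IZR (k + 1))) <= B * / (Rabs (IZR k) + 1) ^ 2.
Proof.
  intros Hz. pose proof (translate_neq_0 z Hz) as Hne.
  destruct (Cmod_translate_ge z Hz) as [d [Hd Hge]].
  assert (Hd2 : 0 < d * d) by nra. exists (2 * / (d * d)).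
  assert (Hinv : / d <= 2 * / (d * d)).
  { apply Rmult_le_reg_r with (d * d); [lra |]. rewrite Rmult_assoc, Rinv_l by lra.
    field_simplify; lra. }
  split; [apply Rmult_le_pos; [lra | left; apply Rinv_0_lt_compat, Hd2] |]. intros k.
  pose proof (Rabs_pos (IZR k)).
  assert (Hpos : 0 < d * (Rabs (IZR k) + 1)) by (apply Rmult_lt_0_compat; lra). split.
  - rewrite Cmod_inv by auto. apply Rle_trans with (/ d * / (Rabs (IZR k) + 1)).
    + rewrite <- Rinv_mult. apply Rinv_le_contravar; auto.
    + apply Rmult_le_compat_r; [left; apply Rinv_0_lt_compat; lra | exact Hinv].
  - pose proof (Hne k) as N1. pose proof (Hne (k + 1)%Z) as N2. pose proof (Hge k).
    pose proof (Hge (k + 1)%Z). pose proof (Rabs_IZR_succ_ge k).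
    replace (/ (z + IZR k) - / (z + IZR (k + 1)))%C with (/ ((z + IZR k) * (z + IZR (k + 1))))%C.
    2:{ rewrite plus_IZR, RtoC_plus in *. field. split; auto. }
    rewrite Cmod_inv, Cmod_mult by (apply Cmult_neq_0; auto).
    replace (2 * / (d * d) * / (Rabs (IZR k) + 1) ^ 2)
      with (/ (d * (Rabs (IZR k) + 1) * (d * (Rabs (IZR k) + 1) / 2))) by (field; lra).
    apply Rinv_le_contravar; [apply Rmult_lt_0_compat; lra |]. pose proof (Rabs_pos (IZR (k + 1))).
    assert (d * (Rabs (IZR k) + 1) <= d * (2 * (Rabs (IZR (k + 1)) + 1)))
      by (apply Rmult_le_compat_l; lra).
    apply Rmult_le_compat; lra.
Qed.

Lemma filterlim_inv_translate (z : C) (k : nat -> Z) : ee z <> 1%C ->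
  (forall N, Z.abs (k N) = Z.of_nat N) ->
  filterlim (fun N => / (z + IZR (k N)))%C eventually (locally (RtoC 0)).
Proof.
  intros Hz Hk. destruct (inv_translate_bound z Hz) as [B [HB Hle]].
  apply filterlim_C_squeeze with (fun N => B / (INR N + 1));
    [typeclasses eauto | | apply filterlim_div_INR].
  apply filter_forall. intros N. destruct (Hle (k N)) as [H _].
  rewrite <- abs_IZR, Hk, <- INR_IZR_INZ in H.
  replace (/ (z + IZR (k N)) - 0)%C with (/ (z + IZR (k N)))%C by ring. exact H.
Qed.

Lemma has_sum_inv_translate_Z (z : C) : ee z <> 1%C ->
  has_sum (fun k : Z => / (z + IZR k) - / (z + IZR (k + 1)))%C 0%C.
Proof.
  intros Hz. destruct (inv_translate_bound z Hz) as [B [HB Hle]].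
  assert (H : has_sum (fun k : Z => / (z + IZR k) - / (z + IZR (k + 1)))%C
    (usum (fun k : Z => / (z + IZR k) - / (z + IZR (k + 1)))%C)).
  { apply has_sum_usum with (fun k => B * / (Rabs (IZR k) + 1) ^ 2); [| apply Hle].
    apply summable_scal; [exact HB | apply summable_inv_sq_Z]. }
  rewrite (has_sum_Z_telescope (fun k => / (z + IZR k))%C _ (RtoC 0) (RtoC 0) H) in H.
  - replace (RtoC 0) with (0 - 0)%C by ring. exact H.
  - apply filterlim_inv_translate; auto. intros N. lia.
  - apply filterlim_inv_translate; auto. intros N. lia.
Qed.

Lemma has_sum_inv_translate_nat (z : C) : ee z <> 1%C ->
  has_sum (fun n : nat => / (z + INR n) - / (z + INR (S n)))%C (/ z)%C.
Proof.
  intros Hz. destruct (inv_translate_bound z Hz) as [B [HB Hle]].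
  assert (H : has_sum (fun n : nat => / (z + INR n) - / (z + INR (S n)))%C
    (usum (fun n : nat => / (z + INR n) - / (z + INR (S n)))%C)).
  { apply has_sum_usum with (fun n => B * / (INR n + 1) ^ 2);
      [apply summable_scal; auto using summable_inv_sq |].
    intros n. destruct (Hle (Z.of_nat n)) as [_ H].
    replace (Z.of_nat n + 1)%Z with (Z.of_nat (S n)) in H by lia.
    rewrite <- !INR_IZR_INZ, Rabs_right in H by (apply Rle_ge, pos_INR). exact H. }
  rewrite (has_sum_telescope (fun n => / (z + INR n))%C _ (RtoC 0) H) in H.
  - simpl (INR 0) in H. replace (/ z)%C with (/ (z + 0) - 0)%C; [exact H |].
    replace (z + 0)%C with z by ring. ring.
  - apply filterlim_ext with (fun N => / (z + IZR (Z.of_nat N)))%C;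
      [intros N; rewrite INR_IZR_INZ; reflexivity |].
    apply filterlim_inv_translate; auto. intros N. lia.
Qed.

Lemma upper_opp_inv (s : C) : upper s -> upper (- / s).
Proof.
  intros Hs. pose proof (upper_neq_0 s Hs).
  replace (- / s)%C with (mobius 0 (-1) 1 0 s) by (unfold mobius; field; auto).
  apply upper_mobius; [unfold SL2; lia | exact Hs].
Qed.

Definition csc_sq_series (s : C) : C := usum (fun m => csc_sq (INR (S m) * s)).

(* The double series of [1 / (m t + d) ^ 2] converges only conditionally. Subtracting the
   telescoping term [1 / (m t + d) - 1 / (m t + d + 1)] makes it absolutely convergent; exchanging
   the summations then produces the non-modular term of the Eisenstein series of weight two. *)
Section EisensteinTwo.
Variable t : C.
Hypothesis t_upper : upper t.

Definition lattice_point (m : nat) (d : Z) : C := (INR (S m) * t + IZR d)%C.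
Definition telescoping_term (m : nat) (d : Z) : C :=
  (/ lattice_point m d - / lattice_point m (d + 1))%C.
Definition inv_sq_term (m : nat) (d : Z) : C := (/ (lattice_point m d * lattice_point m d))%C.
Definition corrected_term (p : nat * Z) : C :=
  (inv_sq_term (fst p) (snd p) - telescoping_term (fst p) (snd p))%C.
Definition column_sum (d : Z) : C := usum (fun m => inv_sq_term m d).
Definition telescoping_column_sum (d : Z) : C := usum (fun m => telescoping_term m d).

Lemma lattice_point_denom (m : nat) (d : Z) : lattice_point m d = denom (Z.of_nat (S m)) d t.
Proof. unfold lattice_point, denom. rewrite <- INR_IZR_INZ. reflexivity. Qed.

Lemma lattice_point_neq_0 (m : nat) (d : Z) : lattice_point m d <> 0%C.
Proof. rewrite lattice_point_denom. apply denom_neq_0; [exact t_upper | lia]. Qed.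

Lemma lattice_point_succ (m : nat) (d : Z) : lattice_point m (d + 1) = (lattice_point m d + 1)%C.
Proof. unfold lattice_point. rewrite plus_IZR, RtoC_plus. ring. Qed.

Lemma Cmod_lattice_point_ge : exists e, 0 < e /\
  forall m d, e * (INR m + 1 + Rabs (IZR d)) <= Cmod (lattice_point m d).
Proof.
  pose proof (Rabs_pos (Re t)). unfold upper in t_upper. exists (Im t / (1 + Rabs (Re t) + Im t)).
  split.
  - apply Rdiv_lt_0_compat; lra.
  - intros m d. rewrite lattice_point_denom, <- S_INR, INR_IZR_INZ.
    rewrite <- (Rabs_right (IZR (Z.of_nat (S m)))) by (apply Rle_ge, IZR_le; lia).
    apply Cmod_denom_ge; lra.
Qed.

Lemma telescoping_term_eq (m : nat) (d : Z) :
  telescoping_term m d = (/ (lattice_point m d * lattice_point m (d + 1)))%C.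
Proof.
  pose proof (lattice_point_neq_0 m d). pose proof (lattice_point_neq_0 m (d + 1)).
  unfold telescoping_term. rewrite lattice_point_succ in *. field. auto.
Qed.

Lemma corrected_term_eq (m : nat) (d : Z) : corrected_term (m, d) =
  (/ (lattice_point m d * lattice_point m d * lattice_point m (d + 1)))%C.
Proof.
  pose proof (lattice_point_neq_0 m d). pose proof (lattice_point_neq_0 m (d + 1)).
  unfold corrected_term, inv_sq_term. cbn [fst snd].
  rewrite telescoping_term_eq, lattice_point_succ in *. field. auto.
Qed.

Lemma Rpower_3_2 (y : R) : 0 < y -> Rpower y (3 / 2) = y * sqrt y.
Proof.
  intros Hy. replace (3 / 2) with (1 + / 2) by field.
  rewrite Rpower_plus, Rpower_1, Rpower_sqrt; auto.
Qed.

Lemma summable_Rpower_3_2 : summable (fun p : nat * Z =>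
  Rpower (INR (fst p) + 1) (- (3 / 2)) * Rpower (INR (Z.abs_nat (snd p)) + 1) (- (3 / 2))).
Proof.
  assert (H : summable (fun n => Rpower (INR n + 1) (- (3 / 2)))) by (apply summable_pseries; lra).
  apply (summable_prod (fun m => Rpower (INR m + 1) (- (3 / 2)))
    (fun d : Z => Rpower (INR (Z.abs_nat d) + 1) (- (3 / 2)))); [exact H |].
  apply (summable_Z_abs (fun n => Rpower (INR n + 1) (- (3 / 2)))), H.
Qed.

Lemma Cmod_corrected_term_le : exists B, 0 <= B /\ forall p, Cmod (corrected_term p) <=
  B * (Rpower (INR (fst p) + 1) (- (3 / 2)) * Rpower (INR (Z.abs_nat (snd p)) + 1) (- (3 / 2))).
Proof.
  destruct Cmod_lattice_point_ge as [e [He Hge]]. set (e' := e * (e * (e / 2))).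
  assert (He' : 0 < e') by (repeat apply Rmult_lt_0_compat; lra).
  exists (/ e'). split; [left; apply Rinv_0_lt_compat, He' |]. intros [m d]. cbn [fst snd].
  pose proof (Hge m d) as H1. pose proof (Hge m (d + 1)%Z) as H2. pose proof (pos_INR m).
  pose proof (Rabs_pos (IZR d)) as Hd. pose proof (Rabs_pos (IZR (d + 1))).
  pose proof (Rabs_IZR_succ_ge d).
  pose proof (lattice_point_neq_0 m d). pose proof (lattice_point_neq_0 m (d + 1)).
  rewrite corrected_term_eq, Cmod_inv, !Cmod_mult, INR_abs_nat by (repeat apply Cmult_neq_0; auto).
  set (p := INR m + 1) in *. set (q := Rabs (IZR d) + 1) in *.
  assert (Hp : 1 <= p) by (unfold p; lra). assert (Hq : 1 <= q) by (unfold q; lra).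
  assert (Hy : 0 < p * q) by nra.
  rewrite Rpower_mult_distr, Rpower_Ropp, Rpower_3_2, <- Rinv_mult by lra.
  assert (Hs : sqrt (p * q) <= p + Rabs (IZR d)).
  { rewrite <- (sqrt_pow2 (p + Rabs (IZR d))) by lra. apply sqrt_le_1_alt. unfold q. nra. }
  assert (Hs0 : 0 < sqrt (p * q)) by (apply sqrt_lt_R0, Hy).
  apply Rinv_le_contravar; [apply Rmult_lt_0_compat; auto; apply Rmult_lt_0_compat; auto |].
  pose proof (sqrt_sqrt (p * q) ltac:(lra)) as Hss.
  set (s := sqrt (p * q)) in *.
  assert (L1 : e * s <= Cmod (lattice_point m d)) by nra.
  assert (L2 : e / 2 * s <= Cmod (lattice_point m (d + 1))) by nra.
  replace (e' * (p * q * s)) with (e * s * (e * s) * (e / 2 * s))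
    by (rewrite <- Hss; unfold e'; ring).
  assert (He1 : 0 <= e * s) by nra. assert (He2 : 0 <= e / 2 * s) by nra.
  apply Rmult_le_compat; auto; [apply Rmult_le_pos; auto | apply Rmult_le_compat; auto].
Qed.

Lemma has_sum_corrected_term : has_sum corrected_term (usum corrected_term).
Proof.
  destruct Cmod_corrected_term_le as [B [HB Hle]].
  apply has_sum_usum with (2 := Hle), summable_scal; [exact HB | exact summable_Rpower_3_2].
Qed.

Lemma has_sum_csc_sq_row : has_sum (fun m => csc_sq (INR (S m) * t)) (usum corrected_term).
Proof.
  apply has_sum_fubini with (1 := has_sum_corrected_term). intros m.
  assert (Hu : upper (INR (S m) * t)) by (apply upper_scal, t_upper; apply INR_S_gt_0).
  pose proof (ee_upper_neq_1 _ Hu) as He.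
  replace (csc_sq (INR (S m) * t)) with (csc_sq (INR (S m) * t) - 0)%C by ring. apply has_sum_minus.
  - exact (has_sum_csc_sq _ (Rlt_le _ _ Hu) He).
  - exact (has_sum_inv_translate_Z _ He).
Qed.

Lemma has_sum_csc_sq_series : has_sum (fun m => csc_sq (INR (S m) * t)) (csc_sq_series t).
Proof.
  unfold csc_sq_series. rewrite (usum_eq _ _ has_sum_csc_sq_row). exact has_sum_csc_sq_row.
Qed.

Lemma column_bounds : exists B, 0 <= B /\ forall m d,
  Cmod (inv_sq_term m d) <= B * / (INR m + 1) ^ 2 /\
  Cmod (telescoping_term m d) <= B * / (INR m + 1) ^ 2 /\
  ((d <> 0)%Z -> Cmod (inv_sq_term m d) <= B * / IZR d ^ 2).
Proof.
  destruct Cmod_lattice_point_ge as [e [He Hge]]. exists (/ (e * e)).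
  split; [left; apply Rinv_0_lt_compat; nra |].
  assert (Hinv : forall (z w : C) x, 0 < x -> e * x <= Cmod z -> e * x <= Cmod w ->
    Cmod (/ (z * w)) <= / (e * e) * / x ^ 2).
  { intros z w x Hx Hz Hw. assert (0 < e * x) by nra.
    rewrite Cmod_inv, Cmod_mult, <- Rinv_mult by (apply Cmult_neq_0; apply Cmod_gt_0; lra).
    apply Rinv_le_contravar; [apply Rmult_lt_0_compat; [nra | apply pow_lt, Hx] |].
    replace (e * e * x ^ 2) with (e * x * (e * x)) by ring. apply Rmult_le_compat; lra. }
  intros m d. pose proof (pos_INR m). pose proof (Hge m d) as H1.
  pose proof (Hge m (d + 1)%Z) as H2.
  pose proof (Rabs_pos (IZR d)) as Hd. pose proof (Rabs_pos (IZR (d + 1))). split; [| split].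
  - apply Hinv; nra.
  - rewrite telescoping_term_eq. apply Hinv; nra.
  - intros Hd0. rewrite <- (pow2_abs (IZR d)). apply Hinv; try nra.
    apply Rabs_pos_lt, eq_IZR_contrapositive, Hd0.
Qed.

Lemma has_sum_column (d : Z) : has_sum (fun m => inv_sq_term m d) (column_sum d).
Proof.
  destruct column_bounds as [B [HB Hle]].
  apply has_sum_usum with (fun m => B * / (INR m + 1) ^ 2); [| intros m; apply Hle].
  apply summable_scal; auto using summable_inv_sq.
Qed.

Lemma has_sum_telescoping_column (d : Z) :
  has_sum (fun m => telescoping_term m d) (telescoping_column_sum d).
Proof.
  destruct column_bounds as [B [HB Hle]].
  apply has_sum_usum with (fun m => B * / (INR m + 1) ^ 2); [| intros m; apply Hle].
  apply summable_scal; auto using summable_inv_sq.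
Qed.

Lemma has_sum_column_difference :
  has_sum (fun d => column_sum d - telescoping_column_sum d)%C (csc_sq_series t).
Proof.
  rewrite (has_sum_unique _ _ _ has_sum_csc_sq_series has_sum_csc_sq_row).
  apply has_sum_fubini with (1 := has_sum_swap _ _ has_sum_corrected_term). intros d.
  apply has_sum_minus; [apply has_sum_column | apply has_sum_telescoping_column].
Qed.

Definition inverse_multiple (n : nat) : C := (INR (S n) * - / t)%C.

Lemma upper_inverse_multiple (n : nat) : upper (inverse_multiple n).
Proof. apply upper_scal; [apply INR_S_gt_0 | apply upper_opp_inv, t_upper]. Qed.

Lemma lattice_point_inverse_multiple (m n : nat) :
  lattice_point m (- Z.of_nat (S n)) = (t * (inverse_multiple n + INR (S m)))%C /\
  lattice_point m (Z.of_nat (S n)) = (- t * (inverse_multiple n - INR (S m)))%C.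
Proof.
  pose proof (upper_neq_0 t t_upper). unfold lattice_point, inverse_multiple.
  rewrite opp_IZR, RtoC_opp, <- !INR_IZR_INZ. split; field; auto.
Qed.

Lemma Csum_telescoping_column (N : nat) : Csum telescoping_column_sum (Zrange (S N)) =
  (/ t * (cotpi (inverse_multiple N) - / inverse_multiple N))%C.
Proof.
  pose proof (upper_neq_0 t t_upper). set (z := inverse_multiple N).
  pose proof (upper_inverse_multiple N) as Hz.
  apply (has_sum_unique (fun m => Csum (fun d => telescoping_term m d) (Zrange (S N)))).
  - apply (has_sum_list (fun d m => telescoping_term m d)), has_sum_telescoping_column.
  - pose proof (has_sum_scal (/ t)%C _ _ (has_sum_minus _ _ _ _ (has_sum_cotpi z Hz)
      (has_sum_inv_translate_nat z (ee_upper_neq_1 z Hz)))) as H0.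
    revert H0. apply has_sum_ext. intros m. unfold telescoping_term.
    rewrite (Csum_Zrange_telescope (fun d => / lattice_point m d)%C).
    pose proof (lattice_point_neq_0 m (- Z.of_nat (S N))) as N1.
    pose proof (lattice_point_neq_0 m (Z.of_nat (S N))) as N2.
    destruct (lattice_point_inverse_multiple m N) as [E1 E2]. fold z in E1, E2. rewrite E1, E2 in *.
    assert (D1 : (z + INR (S m) <> 0)%C) by (intros E; apply N1; rewrite E; ring).
    assert (D2 : (z - INR (S m) <> 0)%C) by (intros E; apply N2; rewrite E; ring).
    unfold cot_term.
    replace (/ (- t * (z - INR (S m))))%C with (- / (t * (z - INR (S m))))%C by (field; auto).
    assert (D0 : (z + INR m <> 0)%C).
    { rewrite INR_IZR_INZ. apply translate_neq_0, ee_upper_neq_1, Hz. }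
    field. auto.
Qed.

Lemma filterlim_ee_inverse_multiple :
  filterlim (fun N => ee (inverse_multiple N)) eventually (locally (RtoC 0)).
Proof.
  apply filterlim_ext with (fun N => ee (- / t) ^ S N)%C.
  - intros N. unfold inverse_multiple. rewrite ee_mult_INR. reflexivity.
  - apply (filterlim_eventually_S (fun N => ee (- / t) ^ N)%C),
      (has_sum_term_to_0 _ _ (has_sum_geom _ (Cmod_ee_lt_1 _ (upper_opp_inv t t_upper)))).
Qed.

Lemma filterlim_telescoping_column :
  filterlim (fun N => Csum telescoping_column_sum (Zrange (S N))) eventually
    (locally (- (PI * Ci) / t)%C).
Proof.
  pose proof (upper_neq_0 t t_upper). pose proof filterlim_ee_inverse_multiple as Le.
  apply filterlim_ext with (fun N => / t * (cotpi (inverse_multiple N) - / inverse_multiple N))%C.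
  { intros N. symmetry. apply Csum_telescoping_column. }
  apply filterlim_locally_eq with (/ t * (PI * Ci * ((0 + 1) * / (0 - 1)) - 0))%C; [| field; auto].
  assert (Hn : (0 - 1)%C <> 0%C) by (rewrite <- RtoC_minus; apply RtoC_neq_0; lra).
  assert (Li : filterlim (fun N => / inverse_multiple N)%C eventually (locally (RtoC 0))).
  { apply filterlim_C_squeeze with (fun N => Cmod t / (INR N + 1));
      [typeclasses eauto | | apply filterlim_div_INR].
    apply filter_forall. intros N.
    assert (HN : RtoC (INR (S N)) <> 0%C) by (apply RtoC_neq_0, not_0_INR; lia).
    unfold inverse_multiple.
    replace (/ (INR (S N) * - / t) - 0)%C with (- t / INR (S N))%C by (field; auto).
    rewrite Cmod_div, Cmod_opp, Cmod_R, Rabs_right, S_INR by (auto; apply Rle_ge, pos_INR). lra. }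
  unfold cotpi. auto 15 with limits.
Qed.

Lemma column_sum_pair (n : nat) : (column_sum (Z.of_nat (S n)) + column_sum (- Z.of_nat (S n)))%C =
  (/ (t * t) * csc_sq (inverse_multiple n) - / (INR (S n) * INR (S n)))%C.
Proof.
  pose proof (upper_neq_0 t t_upper) as Ht. set (z := inverse_multiple n).
  pose proof (upper_inverse_multiple n) as Hz. fold z in Hz.
  assert (HN : RtoC (INR (S n)) <> 0%C) by (apply RtoC_neq_0, not_0_INR; lia).
  pose proof (has_sum_csc_sq z ltac:(unfold upper in Hz; lra) (ee_upper_neq_1 z Hz)) as H.
  apply has_sum_Z_symmetric in H. apply (has_sum_scal (/ (t * t))%C) in H.
  replace (/ (t * t) * (csc_sq z - / ((z + IZR 0) * (z + IZR 0))))%C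
    with (/ (t * t) * csc_sq z - / (INR (S n) * INR (S n)))%C in H.
  2:{ replace (z + IZR 0)%C with z by ring.
      assert (Ez : (z * z = INR (S n) * INR (S n) / (t * t))%C)
        by (unfold z, inverse_multiple; field; auto).
      rewrite Ez. field. auto. }
  apply (has_sum_unique
    (fun m => inv_sq_term m (Z.of_nat (S n)) + inv_sq_term m (- Z.of_nat (S n)))%C).
  - apply has_sum_plus; apply has_sum_column.
  - revert H. apply has_sum_ext. intros m. unfold inv_sq_term.
    pose proof (lattice_point_neq_0 m (- Z.of_nat (S n))) as N1.
    pose proof (lattice_point_neq_0 m (Z.of_nat (S n))) as N2.
    destruct (lattice_point_inverse_multiple m n) as [E1 E2]. fold z in E1, E2. rewrite E1, E2 in *.
    assert (D1 : (z + INR (S m) <> 0)%C) by (intros E; apply N1; rewrite E; ring).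
    assert (D2 : (z - INR (S m) <> 0)%C) by (intros E; apply N2; rewrite E; ring).
    rewrite opp_IZR, RtoC_opp, <- !INR_IZR_INZ. fold (z - INR (S m))%C. field. auto.
Qed.

Lemma column_sum_0 : column_sum 0 = (/ (t * t) * (PI * PI / 6))%C.
Proof.
  pose proof (upper_neq_0 t t_upper). apply usum_eq.
  generalize (has_sum_scal (/ (t * t))%C _ _ has_sum_inv_sq). apply has_sum_ext. intros m.
  assert (HN : RtoC (INR (S m)) <> 0%C) by (apply RtoC_neq_0, not_0_INR; lia).
  unfold inv_sq_term, lattice_point.
  replace (INR (S m) * t + IZR 0)%C with (INR (S m) * t)%C by ring. field. auto.
Qed.

Lemma filterlim_column_sum :
  filterlim (fun N => column_sum (- Z.of_nat (S N))) eventually (locally (RtoC 0)).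
Proof.
  destruct column_bounds as [B [HB Hle]].
  rewrite <- (usum_eq (fun _ : nat => RtoC 0) 0%C has_sum_0).
  apply (filterlim_usum eventually (fun N m => inv_sq_term m (- Z.of_nat (S N))) (fun _ => RtoC 0)
    (fun m => B * / (INR m + 1) ^ 2)).
  - apply summable_scal; auto using summable_inv_sq.
  - apply filter_forall. intros N m. apply Hle.
  - intros m. apply filterlim_C_squeeze with (fun N => B / (INR N + 1));
      [typeclasses eauto | | apply filterlim_div_INR].
    apply filter_forall. intros N.
    replace (inv_sq_term m (- Z.of_nat (S N)) - 0)%C
      with (inv_sq_term m (- Z.of_nat (S N))) by ring.
    destruct (Hle m (- Z.of_nat (S N))%Z) as [_ [_ H]]. eapply Rle_trans; [apply H; lia |].
    rewrite opp_IZR, <- INR_IZR_INZ, S_INR. pose proof (pos_INR N). apply Rmult_le_compat_l; auto.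
    apply Rinv_le_contravar; nra.
Qed.

Lemma Csum_Zrange_pairs (f : Z -> C) (N : nat) : Csum f (Zrange (S N)) =
  (f (- Z.of_nat (S N))%Z
   + (f 0%Z + Csum (fun n => f (Z.of_nat (S n)) + f (- Z.of_nat (S n))%Z)%C (seq 0 N)))%C.
Proof.
  induction N as [| N IH]; [unfold Csum; simpl; ring |].
  rewrite Csum_Zrange_S, IH, Csum_seq_S. ring.
Qed.

Lemma filterlim_Csum_column (l : C) : has_sum (fun m => csc_sq (INR (S m) * - / t)) l ->
  filterlim (fun N => Csum column_sum (Zrange (S N))) eventually
    (locally (0 + (/ (t * t) * (PI * PI / 6) + (/ (t * t) * l - PI * PI / 6)))%C).
Proof.
  intros Hl. pose proof (filterlim_Csum_seq _ _ (has_sum_minus _ _ _ _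
    (has_sum_scal (/ (t * t))%C _ _ Hl) has_sum_inv_sq)) as Hpairs.
  eapply filterlim_ext; [intros N; symmetry; apply Csum_Zrange_pairs |]. rewrite <- column_sum_0.
  pose proof filterlim_column_sum.
  assert (Hsum : filterlim
    (fun N =>
       Csum (fun n => column_sum (Z.of_nat (S n)) + column_sum (- Z.of_nat (S n)))%C (seq 0 N))
    eventually (locally (/ (t * t) * l - PI * PI / 6)%C)).
  { revert Hpairs. apply filterlim_ext. intros N. apply Csum_ext_in. intros n _.
    symmetry. apply column_sum_pair. }
  auto with limits.
Qed.

Lemma csc_sq_series_inversion (l : C) : has_sum (fun m => csc_sq (INR (S m) * - / t)) l ->
  csc_sq_series t = (/ (t * t) * (PI * PI / 6) + / (t * t) * l - PI * PI / 6 + PI * Ci / t)%C.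
Proof.
  intros Hl. pose proof (upper_neq_0 t t_upper). pose proof filterlim_telescoping_column as Ht.
  pose proof (filterlim_Csum_column l Hl) as Hc.
  apply (filterlim_locally_unique (V := C_NormedModule) (F := eventually)
    (fun N => Csum (fun d => column_sum d - telescoping_column_sum d)%C (Zrange (S N)))).
  - apply (filterlim_eventually_S (U := C_NormedModule)
      (fun N => Csum (fun d => column_sum d - telescoping_column_sum d)%C (Zrange N))).
    apply filterlim_Csum_Zrange, has_sum_column_difference.
  - apply filterlim_ext
      with (fun N => Csum column_sum (Zrange (S N)) - Csum telescoping_column_sum (Zrange (S N)))%C.
    + intros N. generalize (Zrange (S N)). intros L. unfold Csum.
      induction L as [| d L IH]; simpl; [ring | rewrite <- IH; ring].
    + refine (filterlim_locally_eq _ _ _ _ (filterlim_Cminus _ _ _ _ _ Hc Ht) _). field. auto.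
Qed.
End EisensteinTwo.

Lemma logeta_derivative_inversion (t : C) : upper t ->
  (/ (t * t) * logeta_derivative (- / t))%C = (logeta_derivative t + / 2 * / t)%C.
Proof.
  intros Ht. pose proof (upper_neq_0 t Ht) as Hz.
  assert (HPC : RtoC PI <> 0%C) by apply RtoC_neq_0, PI_neq0.
  assert (L : forall s, upper s -> euler_log_derivative s = (Ci / (2 * PI) * csc_sq_series s)%C).
  { intros s Hs. apply (has_sum_unique _ _ _ (has_sum_euler_log_derivative s Hs)).
    apply has_sum_scal, has_sum_csc_sq_series, Hs. }
  pose proof (upper_opp_inv t Ht) as Hu. unfold logeta_derivative. rewrite (L t Ht), (L _ Hu).
  rewrite (csc_sq_series_inversion t Ht _ (has_sum_csc_sq_series _ Hu)).
  transitivity (/ (t * t) * (2 * PI * Ci / 24 + Ci / (2 * PI) * csc_sq_series (- / t))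
    + (/ 2 * / t + / 2 * / t * (Ci * Ci)))%C; [rewrite Ci_sq; field; auto | field; auto].
Qed.

Lemma logeta_inversion (t : C) : upper t -> logeta (- / t) = (logeta t + / 2 * clog (- Ci * t))%C.
Proof.
  intros Ht. assert (Hre : forall s, Re (- Ci * s) = Im s)
    by (intros s; unfold Re, Im; simpl; ring).
  set (u := fun s => (logeta (- / s) - logeta s - / 2 * clog (- Ci * s))%C).
  assert (E : u t = u Ci).
  { apply constant_on_segment. intros r Hr. set (s := (Ci + r * (t - Ci))%C).
    assert (Hs : upper s).
    { unfold upper in *. unfold s. rewrite im_plus, im_scal_l, im_minus.
      change (Im Ci) with 1. nra. }
    pose proof (upper_neq_0 s Hs) as Hz. pose proof Ci_nz.
    assert (Hpos : 0 < Re (- Ci * s)) by (rewrite Hre; exact Hs).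
    destruct (holomorphic_logeta s Hs) as [Ds _].
    destruct (holomorphic_logeta _ (upper_opp_inv s Hs)) as [Di _].
    assert (Dc : is_derive (fun w => logeta (- / w)) s
      (logeta_derivative (- / s) * (1 / (s * s)))%C).
    { apply (is_derive_Ccomp logeta (fun w => - / w)%C); [exact Di |].
      eapply is_derive_eq; [eauto with derive | simpl; field; auto]. }
    eapply is_derive_eq; [unfold u; eauto 10 with derive |]. cbv beta.
    pose proof (logeta_derivative_inversion s Hs) as Einv.
    replace (logeta_derivative (- / s) * (1 / (s * s)))%C
      with (/ (s * s) * logeta_derivative (- / s))%C by (field; auto).
    rewrite Einv. simpl. field. auto. }
  assert (Ei : u Ci = 0%C).
  { unfold u. replace (- / Ci)%C with Ci by (apply injective_projections; simpl; field).
    replace (- Ci * Ci)%C with (RtoC 1) by (apply injective_projections; simpl; ring).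
    rewrite clog_1. ring. }
  rewrite Ei in E. unfold u in E.
  replace (logeta (- / t)) with (logeta (- / t) - logeta t - / 2 * clog (- Ci * t)
    + (logeta t + / 2 * clog (- Ci * t)))%C by ring.
  rewrite E. ring.
Qed.

(** * The transformation law of eta *)

Definition eta_transforms (a b c d : Z) : Prop := forall t, upper t ->
  logeta (mobius a b c d t) =
  (logeta t + / 2 * clog (denom c d t) + 2 * PI * Ci / 24 * RtoC (Psi a b c d))%C.

Lemma upper_denom (c d : Z) (t : C) : (0 < c)%Z -> upper t -> upper (denom c d t).
Proof.
  intros Hc Ht. unfold upper. rewrite Im_denom.
  apply Rmult_lt_0_compat; [apply IZR_lt, Hc | exact Ht].
Qed.

Lemma Psi_pos (a b c d : Z) : (0 < c)%Z ->
  Psi a b c d = IZR (a + d) / IZR c + 12 * dedekind_sum (- d) c - 3.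
Proof. intros Hc. unfold Psi. destruct (Z.ltb_spec 0 c); [reflexivity | lia]. Qed.

Lemma Psi_shift (a b c d n : Z) : (0 < c)%Z ->
  Psi a (b + n * a) c (d + n * c) = Psi a b c d + IZR n.
Proof.
  intros Hc. assert (HcR : IZR c <> 0) by (apply eq_IZR_contrapositive; lia).
  rewrite !Psi_pos by auto.
  rewrite (dedekind_sum_congr (- (d + n * c)) (- d) c)
    by (auto; rewrite Z.opp_add_distr, <- Z.mul_opp_l; apply Z_mod_plus_full).
  rewrite !plus_IZR, mult_IZR. field. auto.
Qed.

Lemma Psi_inversion (a b c d : Z) : SL2 a b c d -> (0 < c)%Z -> (0 < d)%Z ->
  Psi b (- a) d (- c) = Psi a b c d - 3.
Proof.
  intros Hdet Hc Hd. rewrite !Psi_pos, Z.opp_involutive, dedekind_sum_opp by auto.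
  assert (Hg : Z.gcd d c = 1%Z) by (rewrite Z.gcd_comm; apply (SL2_row_coprime a b), Hdet).
  pose proof (dedekind_reciprocity d c Hd Hc Hg) as E. rewrite !plus_IZR, opp_IZR.
  assert (HZ : IZR a * IZR d - IZR b * IZR c = 1)
    by (rewrite <- !mult_IZR, <- minus_IZR, Hdet; auto).
  assert (Hc0 : IZR c <> 0) by (apply eq_IZR_contrapositive; lia).
  assert (Hd0 : IZR d <> 0) by (apply eq_IZR_contrapositive; lia).
  assert (E1 : (IZR b + - IZR c) / IZR d - (IZR a + IZR d) / IZR c
    + (IZR d / IZR c + IZR c / IZR d + 1 / (IZR d * IZR c)) = 0) by (rewrite <- HZ; field; auto).
  lra.
Qed.

Lemma eta_transforms_shift (a b c d n : Z) : (0 < c)%Z ->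
  eta_transforms a b c d -> eta_transforms a (b + n * a) c (d + n * c).
Proof.
  intros Hc H t Ht. assert (Ht' : upper (t + IZR n)) by (apply (upper_plus_R t), Ht).
  replace (mobius a (b + n * a) c (d + n * c) t) with (mobius a b c d (t + IZR n)).
  2:{ unfold mobius. rewrite !plus_IZR, !mult_IZR, !RtoC_plus, !RtoC_mult. f_equal; ring. }
  rewrite H, logeta_translation, Psi_shift, RtoC_plus by auto.
  replace (denom c d (t + IZR n)) with (denom c (d + n * c) t); [ring |].
  unfold denom. rewrite plus_IZR, mult_IZR, RtoC_plus, RtoC_mult. ring.
Qed.

Lemma eta_transforms_inversion (a : Z) : eta_transforms a (-1) 1 0.
Proof.
  intros t Ht. pose proof (upper_neq_0 t Ht) as Hz. pose proof (upper_opp_inv t Ht) as Hi.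
  replace (mobius a (-1) 1 0 t) with (- / t + IZR a)%C by (unfold mobius; field; auto).
  rewrite logeta_translation, logeta_inversion, clog_mult_opp_Ci by auto.
  replace (denom 1 0 t) with t by (unfold denom; ring).
  assert (E : Psi a (-1) 1 0 = IZR a - 3).
  { rewrite Psi_pos by lia. unfold dedekind_sum. simpl. rewrite (sawZ_0 0 1) by auto.
    rewrite Z.add_0_r. field. }
  rewrite E, RtoC_minus, RtoC_div by lra. field.
Qed.

Lemma clog_inversion_cocycle (c d : Z) (t : C) : (0 < c)%Z -> (0 < d)%Z -> upper t ->
  (clog (- Ci * t) + clog (denom d (- c) (- / t)))%C = (clog (denom c d t) + Ci * RtoC (PI / 2))%C.
Proof.
  intros Hc Hd Ht. pose proof (upper_neq_0 t Ht) as Hz. pose proof PI_RGT_0.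
  assert (Hcd : upper (denom c d t)) by (apply upper_denom; auto).
  assert (Hdc : upper (denom d (- c) (- / t))) by (apply upper_denom, upper_opp_inv; auto).
  assert (HCi : (- Ci)%C <> 0%C) by (intros E; apply (f_equal Im) in E; simpl in E; lra).
  apply cexp_inj.
  - rewrite !cexp_plus, !cexp_clog, cexp_PI2 by auto using upper_neq_0, Cmult_neq_0.
    unfold denom. rewrite opp_IZR, RtoC_opp. field. auto.
  - rewrite clog_mult_opp_Ci by auto. rewrite !im_plus, im_minus, im_scal_r.
    change (Im Ci) with 1. pose proof (clog_upper _ Ht). pose proof (clog_upper _ Hcd).
    pose proof (clog_upper _ Hdc). apply Rabs_lt_between. lra.
Qed.

Lemma eta_transforms_euclid (a b c d : Z) : SL2 a b c d -> (0 < c)%Z -> (0 < d)%Z ->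
  eta_transforms b (- a) d (- c) -> eta_transforms a b c d.
Proof.
  intros Hdet Hc Hd H t Ht. pose proof (upper_opp_inv t Ht) as Hi.
  pose proof (upper_neq_0 t Ht) as Hz.
  replace (mobius a b c d t) with (mobius b (- a) d (- c) (- / t)).
  2:{ replace (- / t)%C with (mobius 0 (-1) 1 0 t) by (unfold mobius; field; auto).
      rewrite mobius_comp by (auto; unfold SL2 in *; lia).
      rewrite <- (mobius_opp a b c d) by (apply (denom_SL2_neq_0 a b); auto). f_equal; ring. }
  rewrite H, logeta_inversion, Psi_inversion, RtoC_minus by auto.
  transitivity (logeta t + / 2 * (clog (- Ci * t) + clog (denom d (- c) (- / t)))
    + 2 * PI * Ci / 24 * (RtoC (Psi a b c d) - 3))%C; [ring |].
  rewrite clog_inversion_cocycle, RtoC_div by (auto; lra). field.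
Qed.

(* Euclid's algorithm on the bottom row. *)
Lemma eta_transforms_pos (n : nat) (a b c d : Z) :
  Z.to_nat c = n -> (0 < c)%Z -> SL2 a b c d -> eta_transforms a b c d.
Proof.
  revert a b c d. induction n as [n IH] using lt_wf_ind. intros a b c d Hn Hc Hdet.
  unfold SL2 in Hdet. pose proof (Z.div_mod d c ltac:(lia)) as Hdiv.
  pose proof (Z.mod_pos_bound d c Hc) as Hmod.
  set (q := (d / c)%Z) in *. set (r := (d mod c)%Z) in *.
  replace b with (b - q * a + q * a)%Z by ring. replace d with (r + q * c)%Z by lia.
  assert (Hdet' : (a * r - (b - q * a) * c = 1)%Z) by (rewrite Hdiv in Hdet; lia).
  apply eta_transforms_shift; auto. destruct (Z.eq_dec r 0) as [E | E].
  - rewrite E in *. assert (H : ((q * a - b) * c = 1)%Z) by lia.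
    assert (c = 1 /\ b - q * a = -1)%Z as [-> ->]; [| apply eta_transforms_inversion].
    destruct (Z.mul_eq_1 _ _ H) as [E1 | E1]; rewrite E1 in H; lia.
  - apply eta_transforms_euclid; auto; [lia |]. apply (IH (Z.to_nat r)); unfold SL2; lia.
Qed.

Lemma eta_transforms_opp (a b c d : Z) : SL2 a b c d -> (c < 0)%Z ->
  eta_transforms (- a) (- b) (- c) (- d) -> eta_transforms a b c d.
Proof.
  intros Hdet Hc H t Ht. rewrite <- (mobius_opp a b c d) by (apply (denom_SL2_neq_0 a b); auto).
  rewrite H by auto.
  replace (denom c d t) with (- denom (- c) (- d) t)%C by (rewrite denom_opp; ring).
  rewrite clog_opp by (apply upper_denom; auto; lia).
  assert (EP : Psi a b c d = Psi (- a) (- b) (- c) (- d) + 6).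
  { rewrite (Psi_pos (- a)) by lia. unfold Psi. destruct (Z.ltb_spec 0 c); [lia |].
    destruct (Z.ltb_spec c 0); [| lia].
    rewrite Z.opp_involutive, !plus_IZR, !opp_IZR. field. apply eq_IZR_contrapositive. lia. }
  rewrite EP, RtoC_plus. field.
Qed.

Lemma clog_minus_1 : clog (-1) = (Ci * RtoC PI)%C.
Proof.
  pose proof PI_RGT_0. apply clog_unique; [apply cexp_PI |].
  rewrite im_scal_r. change (Im Ci) with 1. lra.
Qed.

Lemma eta_transforms_upper_triangular (a b d : Z) : SL2 a b 0 d -> eta_transforms a b 0 d.
Proof.
  intros Hdet t Ht. assert ((a = 1 /\ d = 1) \/ (a = -1 /\ d = -1))%Z as [[-> ->] | [-> ->]].
  { unfold SL2 in Hdet. rewrite Z.mul_0_r, Z.sub_0_r in Hdet.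
    destruct (Z.mul_eq_1 a d Hdet) as [-> | ->]; lia. }
  - rewrite mobius_translation, logeta_translation, denom_0_1, clog_1 by auto.
    unfold Psi. simpl. ring.
  - replace (mobius (-1) b 0 (-1) t) with (t + IZR (- b))%C
      by (rewrite opp_IZR, RtoC_opp; unfold mobius; field).
    rewrite logeta_translation by auto.
    replace (denom 0 (-1) t) with (RtoC (-1)) by (unfold denom; ring).
    rewrite clog_minus_1. unfold Psi. simpl. rewrite opp_IZR, RtoC_minus, !RtoC_opp. field.
Qed.

Theorem eta_transformation (a b c d : Z) : SL2 a b c d -> eta_transforms a b c d.
Proof.
  intros Hdet. destruct (Z.lt_trichotomy c 0) as [Hc | [-> | Hc]].
  - apply eta_transforms_opp; auto.
    apply (eta_transforms_pos _ _ _ _ _ eq_refl); unfold SL2 in *; lia.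
  - apply eta_transforms_upper_triangular, Hdet.
  - apply (eta_transforms_pos _ _ _ _ _ eq_refl); auto.
Qed.

(** * Eta quotients *)

(* The list [L] of pairs [(n, r_n)] stands for the eta quotient [prod eta (n t) ^ r_n]. *)
Definition log_eta_quotient (L : list (Z * R)) (t : C) : C :=
  Csum (fun p : Z * R => snd p * logeta (IZR (fst p) * t))%C L.
Definition inv_eta_quotient (L : list (Z * R)) (t : C) : C := cexp (- log_eta_quotient L t).
Definition eta_weight (L : list (Z * R)) : R := / 2 * Rsum snd L.
Definition eta_phase (L : list (Z * R)) (a b c d : Z) : R :=
  / 24 * Rsum (fun p => snd p * Psi a (b * fst p) (c / fst p) d) L.
(* Ligozat's formula for the order at the cusp [a / c], before multiplication by the cusp width. *)
Definition eta_cusp_order (L : list (Z * R)) (c : Z) : R :=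
  / 24 * Rsum (fun p => snd p * (IZR (Z.gcd (fst p) c) ^ 2 / IZR (fst p))) L.
Definition has_level (N : Z) (L : list (Z * R)) : Prop :=
  forall p, In p L -> (0 < fst p)%Z /\ (fst p | N)%Z.

Lemma logeta_mult_mobius (n a b c d : Z) (t : C) : (0 < n)%Z -> (n | c)%Z ->
  SL2 a b c d -> upper t ->
  logeta (IZR n * mobius a b c d t) =
  (logeta (IZR n * t) + / 2 * clog (denom c d t)
   + 2 * PI * Ci / 24 * RtoC (Psi a (b * n) (c / n) d))%C.
Proof.
  intros Hn [q Hq] Hdet Ht. rewrite Hq, Z.div_mul by lia. rewrite <- Hq.
  assert (Hu : upper (IZR n * t)) by (apply upper_scal, Ht; apply IZR_lt, Hn).
  assert (E : denom q d (IZR n * t) = denom c d t)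
    by (unfold denom; rewrite Hq, mult_IZR, RtoC_mult; ring).
  replace (IZR n * mobius a b c d t)%C with (mobius a (b * n) q d (IZR n * t)).
  - rewrite (eta_transformation a (b * n) q d), E by (auto; unfold SL2 in *; lia). reflexivity.
  - rewrite !mobius_denom, E. pose proof (denom_SL2_neq_0 a b c d t Hdet Ht).
    unfold denom in *. rewrite mult_IZR, RtoC_mult. field. auto.
Qed.

Lemma has_level_cons (N : Z) (p : Z * R) (L : list (Z * R)) :
  has_level N (p :: L) -> ((0 < fst p)%Z /\ (fst p | N)%Z) /\ has_level N L.
Proof. intros H. split; [apply H; left; reflexivity | intros q Hq; apply H; right; exact Hq]. Qed.

Lemma log_eta_quotient_mobius (N : Z) (L : list (Z * R)) (a b c d : Z) (t : C) :
  has_level N L -> Gamma0 N a b c d -> upper t ->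
  log_eta_quotient L (mobius a b c d t) =
  (log_eta_quotient L t + RtoC (eta_weight L) * clog (denom c d t)
   + 2 * PI * Ci * RtoC (eta_phase L a b c d))%C.
Proof.
  intros HL [Hdet Hc] Ht. unfold log_eta_quotient, eta_weight, eta_phase.
  rewrite !RtoC_mult, !RtoC_inv by lra.
  induction L as [| [n r] L IH]; [unfold Csum, Rsum; simpl; ring |].
  apply has_level_cons in HL as [[Hn HnN] HL]. specialize (IH HL).
  unfold Csum, Rsum in *. cbn [map fold_right fst snd] in *.
  rewrite IH, logeta_mult_mobius by (auto; apply Z.divide_trans with N; auto).
  rewrite !RtoC_plus, RtoC_mult. field.
Qed.

Lemma holomorphic_on_Csum {I : Type} (U : C -> Prop) (f f' : I -> C -> C) (L : list I) :
  (forall i, In i L -> holomorphic_on U (f i) (f' i)) ->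
  holomorphic_on U (fun t => Csum (fun i => f i t) L) (fun t => Csum (fun i => f' i t) L).
Proof.
  induction L as [| i L IH]; intros H t Ht.
  - split; [exact (is_derive_Cconst 0 t) | apply continuous_const].
  - destruct (H i (or_introl eq_refl) t Ht) as [D Cd].
    destruct (IH (fun j Hj => H j (or_intror Hj)) t Ht) as [DL CdL].
    split; [exact (is_derive_Cplus _ _ _ _ _ D DL) |]. unfold continuous in *.
    apply (filterlim_Cplus (locally t) (f' i) (fun t => Csum (fun i => f' i t) L)); auto.
Qed.

Lemma holomorphic_inv_eta_quotient (N : Z) (L : list (Z * R)) :
  has_level N L -> exists F', holomorphic_on upper (inv_eta_quotient L) F'.
Proof.
  intros HL.
  set (l' := fun t =>
    Csum (fun p : Z * R => snd p * (logeta_derivative (IZR (fst p) * t) * IZR (fst p)))%C L).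
  assert (Hl : holomorphic_on upper (log_eta_quotient L) l').
  { apply (holomorphic_on_Csum upper (fun (p : Z * R) t => snd p * logeta (IZR (fst p) * t))%C
      (fun (p : Z * R) t => snd p * (logeta_derivative (IZR (fst p) * t) * IZR (fst p)))%C).
    intros [n r] Hp t Ht. cbn [fst snd]. destruct (HL _ Hp) as [Hn _]. cbn [fst] in Hn.
    assert (Hscal : holomorphic_on upper (fun t => IZR n * t)%C (fun _ => RtoC (IZR n))).
    { intros z _. split; [| apply continuous_const].
      eapply is_derive_eq; [eauto with derive | simpl; ring]. }
    assert (Hup : forall z, upper z -> upper (IZR n * z))
      by (intros; apply upper_scal; auto; apply IZR_lt, Hn).
    destruct (holomorphic_on_comp upper upper _ _ _ _ Hup holomorphic_logeta Hscal t Ht) as [D Cd].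
    split.
    - eapply is_derive_eq; [eauto with derive | simpl; ring].
    - apply continuous_Cscal, Cd. }
  exists (fun t => cexp (- log_eta_quotient L t) * - l' t)%C. intros t Ht.
  destruct (Hl t Ht) as [D Cd].
  pose proof (is_derive_cexp (fun w => - log_eta_quotient L w)%C t _ (is_derive_Copp _ t _ D))
    as DF.
  split; [exact DF |]. apply is_derive_C_continuous in DF.
  unfold inv_eta_quotient, continuous in *. auto with limits.
Qed.

Lemma Cmod_inv_eta_quotient (L : list (Z * R)) (t : C) :
  Cmod (inv_eta_quotient L t) = exp (- Re (log_eta_quotient L t)).
Proof. unfold inv_eta_quotient. rewrite Cmod_cexp. reflexivity. Qed.

Lemma Re_clog (z : C) : Re (clog z) = ln (Cmod z).
Proof. reflexivity. Qed.

Lemma Re_Ci_mult_R (x y : R) : Re (x * Ci * RtoC y) = 0.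
Proof. unfold Re. simpl. ring. Qed.

Lemma Cmod_inv_eta_quotient_mobius (N : Z) (L : list (Z * R)) (a b c d : Z) (t : C) :
  has_level N L -> Gamma0 N a b c d -> upper t -> Cmod (inv_eta_quotient L (mobius a b c d t)) =
  Cmod (inv_eta_quotient L t) * Rpower (Cmod (denom c d t)) (- eta_weight L).
Proof.
  intros HL HG Ht. rewrite !Cmod_inv_eta_quotient, (log_eta_quotient_mobius N) by auto.
  unfold Rpower. rewrite <- exp_plus. f_equal.
  rewrite !re_plus, re_scal_l, Re_clog, <- RtoC_mult, Re_Ci_mult_R. ring.
Qed.

Definition balanced (L : list (Z * R)) : Prop := Rsum (fun p => IZR (fst p) * snd p) L = 0.

Lemma log_eta_quotient_euler_log (N : Z) (L : list (Z * R)) (t : C) :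
  has_level N L -> balanced L -> upper t ->
  log_eta_quotient L t = Csum (fun p : Z * R => snd p * euler_log (IZR (fst p) * t))%C L.
Proof.
  intros HL Hbal Ht.
  transitivity (RtoC (Rsum (fun p : Z * R => IZR (fst p) * snd p)%R L) * (2 * PI * Ci * t / 24)
    + Csum (fun p : Z * R => snd p * euler_log (IZR (fst p) * t)) L)%C; [| rewrite Hbal; ring].
  clear Hbal. unfold log_eta_quotient.
  induction L as [| [n r] L IH]; [unfold Csum, Rsum; simpl; ring |].
  apply has_level_cons in HL as [[Hn _] HL]. specialize (IH HL).
  unfold Csum, Rsum in *. cbn [map fold_right fst snd] in *.
  rewrite IH, logeta_eq by (apply upper_scal; auto; apply IZR_lt, Hn).
  rewrite RtoC_plus, RtoC_mult. field.
Qed.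

Lemma inv_eta_quotient_translation (N : Z) (L : list (Z * R)) (t : C) (m : Z) :
  has_level N L -> balanced L -> upper t ->
  inv_eta_quotient L (t + IZR m) = inv_eta_quotient L t.
Proof.
  intros HL Hbal Ht. unfold inv_eta_quotient.
  rewrite !(log_eta_quotient_euler_log N) by (auto; apply (upper_plus_R t), Ht). do 2 f_equal.
  apply Csum_ext_in. intros [n r] Hp. destruct (HL _ Hp) as [Hn _]. cbn [fst snd] in *. f_equal.
  replace (IZR n * (t + IZR m))%C with (IZR n * t + IZR (n * m))%C
    by (rewrite mult_IZR, RtoC_mult; ring).
  apply (periodic_IZR euler_log euler_log_periodic), upper_scal; auto. apply IZR_lt, Hn.
Qed.

Lemma filterlim_scal_Im_infty (r : R) : 0 < r -> filterlim (fun t => r * t)%C Im_infty Im_infty.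
Proof.
  intros Hr P [Y HY]. exists (Y / r). intros t Ht. apply HY. rewrite im_scal_l.
  apply (Rmult_lt_compat_l r) in Ht; auto. replace (r * (Y / r)) with Y in Ht by (field; lra).
  exact Ht.
Qed.

Lemma filterlim_inv_eta_quotient (N : Z) (L : list (Z * R)) : has_level N L -> balanced L ->
  filterlim (inv_eta_quotient L) Im_infty (locally (RtoC 1)).
Proof.
  intros HL Hbal. rewrite <- cexp_0.
  apply (filterlim_comp _ _ _ (fun t => - log_eta_quotient L t)%C cexp _ (locally (RtoC 0)));
    [| apply continuous_cexp].
  apply filterlim_ext_loc
    with (fun t => - Csum (fun p : Z * R => snd p * euler_log (IZR (fst p) * t)) L)%C.
  - exists 0. intros t Ht. rewrite (log_eta_quotient_euler_log N) by auto. reflexivity.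
  - apply filterlim_locally_eq with (- RtoC 0)%C; [| ring]. apply filterlim_Copp.
    clear Hbal. induction L as [| [n r] L IH]; [exact (filterlim_Cconst Im_infty 0) |].
    apply has_level_cons in HL as [[Hn _] HL]. specialize (IH HL). cbn [fst] in Hn.
    assert (Le : filterlim (fun t => euler_log (IZR n * t)) Im_infty (locally (RtoC 0))).
    { eapply filterlim_comp;
        [apply filterlim_scal_Im_infty, IZR_lt, Hn | apply filterlim_euler_log]. }
    assert (Lr : filterlim (fun t => r * euler_log (IZR n * t))%C Im_infty
      (locally (RtoC r * 0)%C)) by auto with limits.
    apply filterlim_locally_eq with (r * 0 + 0)%C; [| ring].
    exact (filterlim_Cplus _ _ _ _ _ Lr IH).
Qed.

Lemma Re_logeta (t : C) : upper t -> Re (logeta t) = - (2 * PI * Im t / 24) + Re (euler_log t).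
Proof.
  intros Ht. rewrite logeta_eq by auto. rewrite re_plus. f_equal.
  replace (2 * PI * Ci * t / 24)%C with (RtoC (2 * PI * / 24) * (Ci * t))%C
    by (rewrite !RtoC_mult, RtoC_inv by lra; field).
  rewrite re_scal_l. unfold Re, Im. simpl. field.
Qed.

Lemma Re_logeta_mobius (a b c d : Z) (t : C) : SL2 a b c d -> upper t ->
  Re (logeta (mobius a b c d t)) =
  - (2 * PI * Im t / 24) + Re (euler_log t) + / 2 * ln (Cmod (denom c d t)).
Proof.
  intros Hdet Ht. rewrite (eta_transformation a b c d Hdet t Ht), !re_plus, Re_logeta by auto.
  replace (/ 2 * clog (denom c d t))%C with (RtoC (/ 2) * clog (denom c d t))%C
    by (rewrite RtoC_inv by lra; reflexivity).
  replace (2 * PI * Ci / 24 * RtoC (Psi a b c d))%C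
    with (RtoC (2 * PI / 24) * Ci * RtoC (Psi a b c d))%C
    by (unfold Rdiv; rewrite !RtoC_mult, RtoC_inv by lra; field).
  rewrite re_scal_l, Re_clog, Re_Ci_mult_R. ring.
Qed.

(* The Hermite form [[n a, n b], [c, d]] = [[A, B], [C, D]] [[g, x], [0, m]] with [g = gcd n c] and
   [n = m g]. *)
Lemma hermite_form (n a b c d : Z) : (0 < n)%Z -> SL2 a b c d -> let g := Z.gcd n c in
  exists A B C' D x m, SL2 A B C' D /\ (n = m * g)%Z /\ (0 < g)%Z /\ (0 < m)%Z /\
    (n * a = A * g)%Z /\ (c = C' * g)%Z /\ (n * b = A * x + B * m)%Z /\ (d = C' * x + D * m)%Z.
Proof.
  intros Hn Hdet g. pose proof (Z.gcd_nonneg n c) as Hg0. fold g in Hg0.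
  assert (Hg : (0 < g)%Z).
  { assert (g <> 0%Z); [| lia]. intros E. apply Z.gcd_eq_0 in E. lia. }
  destruct (Z.gcd_divide_l n c) as [m Em]. destruct (Z.gcd_divide_r n c) as [C' EC].
  fold g in Em, EC. assert (Hm : (0 < m)%Z) by nia.
  assert (Hcop : Z.gcd (m * a) C' = 1%Z).
  { assert (E : Z.gcd m C' = 1%Z).
    { pose proof (Z.gcd_div_gcd n c g ltac:(lia) eq_refl) as E.
      rewrite Em, EC in E. rewrite !Z.div_mul in E by lia. exact E. }
    destruct (Z.gcd_bezout m C' 1 E) as [u [v Euv]]. unfold SL2 in Hdet. rewrite EC in Hdet.
    apply Z.bezout_1_gcd. exists (u * d)%Z, (v - u * m * b * g)%Z.
    transitivity (u * m * (a * d - b * (C' * g)) + v * C')%Z; [ring | rewrite Hdet; lia]. }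
  destruct (Z.gcd_bezout (m * a) C' 1 Hcop) as [D [B' E]].
  assert (HAD : (m * a * D = 1 + - B' * C')%Z) by lia. unfold SL2 in Hdet. rewrite EC in Hdet.
  assert (Had : (a * d = 1 + b * (C' * g))%Z) by lia.
  exists (m * a)%Z, (- B')%Z, C', D, (D * n * b + B' * d)%Z, m. repeat split; auto; try lia.
  - unfold SL2. lia.
  - rewrite Em. transitivity (m * a * D * (m * g * b) + m * B' * (a * d) - B' * m)%Z;
      [rewrite HAD, Had |]; ring.
  - transitivity (d * (m * a * D + B' * C'))%Z; [rewrite HAD; ring |].
    transitivity (D * m * (a * d) + B' * C' * d)%Z; [ring | rewrite Had, Em; ring].
Qed.

Lemma Re_logeta_mult_mobius (n a b c d : Z) : (0 < n)%Z -> SL2 a b c d ->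
  exists u v x : R, 0 < u /\ forall t, upper t ->
  Re (logeta (IZR n * mobius a b c d t)) =
  - (2 * PI * (IZR (Z.gcd n c) ^ 2 / IZR n * Im t) / 24) + Re (euler_log (u * t + v))
  + / 2 * (ln (Cmod (denom c d t)) + x).
Proof.
  intros Hn Hdet. destruct (hermite_form n a b c d Hn Hdet) as
    [A [B [C' [D [x [m [Hdet' [En [Hg [Hm [Ea [Ec [Eb Ed]]]]]]]]]]]]]. set (g := Z.gcd n c) in *.
  apply IZR_lt in Hg, Hm. exists (IZR g / IZR m), (IZR x / IZR m), (- ln (IZR m)).
  split; [apply Rdiv_lt_0_compat; auto |]. intros t Ht.
  set (w := (RtoC (IZR g / IZR m) * t + RtoC (IZR x / IZR m))%C).
  assert (Hw : upper w) by (apply upper_plus_R, upper_scal, Ht; apply Rdiv_lt_0_compat; auto).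
  assert (Hm0 : RtoC (IZR m) <> 0%C) by (apply RtoC_neq_0; lra).
  assert (Hgm : forall p q : Z, (denom p q w * IZR m)%C = denom (p * g) (p * x + q * m) t).
  { intros p q. unfold w, denom.
    rewrite !RtoC_div, !plus_IZR, !mult_IZR, !RtoC_plus, !RtoC_mult by lra. field. auto. }
  pose proof (denom_SL2_neq_0 a b c d t Hdet Ht) as Hct.
  pose proof (denom_SL2_neq_0 A B C' D w Hdet' Hw) as Hcw.
  assert (Ew : denom C' D w = (RtoC (/ IZR m) * denom c d t)%C).
  { rewrite Ec at 1. rewrite Ed at 1. rewrite <- Hgm, RtoC_inv by lra. field. auto. }
  replace (IZR n * mobius a b c d t)%C with (mobius A B C' D w).
  - rewrite Re_logeta_mobius by auto. rewrite Ew, Cmod_mult, Cmod_R, Rabs_right, ln_mult, ln_Rinv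
      by (try apply Rle_ge, Rlt_le; try apply Rinv_0_lt_compat; auto; apply Cmod_gt_0, Hct).
    replace (Im w) with (IZR g ^ 2 / IZR n * Im t); [fold w; ring |].
    unfold w. rewrite im_plus, im_scal_l, En, mult_IZR. simpl. field. lra.
  - assert (RtoC (IZR n) <> 0%C) by (apply RtoC_neq_0, eq_IZR_contrapositive; lia).
    rewrite !mobius_denom. replace (denom a b t) with (denom A B w * IZR m / IZR n)%C.
    + rewrite Ew, RtoC_inv by lra. field. auto.
    + rewrite Hgm, <- Ea, <- Eb. unfold denom. rewrite !mult_IZR, !RtoC_mult. field. auto.
Qed.

Lemma Re_log_eta_quotient_cusp (N : Z) (L : list (Z * R)) (a b c d : Z) :
  has_level N L -> SL2 a b c d -> exists K Y, forall t, upper t -> Y < Im t ->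
  - Re (log_eta_quotient L (mobius a b c d t)) <=
  2 * PI * eta_cusp_order L c * Im t - eta_weight L * ln (Cmod (denom c d t)) + K.
Proof.
  intros HL Hdet. unfold log_eta_quotient, eta_cusp_order, eta_weight.
  induction L as [| [n r] L IH]; [exists 0, 0; intros t _ _; unfold Csum, Rsum; simpl; lra |].
  apply has_level_cons in HL as [[Hn _] HL]. destruct (IH HL) as [K [Y HY]].
  destruct (Re_logeta_mult_mobius n a b c d Hn Hdet) as [u [v [x [Hu E]]]].
  destruct (proj1 (filterlim_Cmod _ _ _) filterlim_euler_log 1 Rlt_0_1) as [Y1 HY1].
  exists (Rabs r + - r * (/ 2 * x) + K), (Rmax Y (Y1 / u)). intros t Ht HtY.
  pose proof (Rmax_l Y (Y1 / u)). pose proof (Rmax_r Y (Y1 / u)). specialize (HY t Ht ltac:(lra)).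
  assert (Hlog : Cmod (euler_log (u * t + v) - 0) < 1).
  { apply HY1. rewrite im_plus, im_scal_l. simpl. assert (Hlt : Y1 / u < Im t) by lra.
    apply (Rmult_lt_compat_r u) in Hlt; auto. unfold Rdiv in Hlt.
    rewrite Rmult_assoc, Rinv_l in Hlt; lra. }
  replace (euler_log (u * t + v) - 0)%C with (euler_log (u * t + v)) in Hlog by ring.
  assert (Hr : - (r * Re (euler_log (u * t + v))) <= Rabs r).
  { rewrite <- Rabs_Ropp. rewrite Ropp_mult_distr_l. eapply Rle_trans; [apply Rle_abs |].
    rewrite Rabs_mult. pose proof (re_le_Cmod (euler_log (u * t + v))).
    pose proof (Rabs_pos (- r)). nra. }
  unfold Csum, Rsum in *. cbn [map fold_right fst snd] in *.
  rewrite re_plus, re_scal_l, E by auto. lra.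
Qed.

(** * Poincare series *)

Definition primitive_row (N : Z) (p : Z * Z) : Prop := Z.gcd (fst p) (snd p) = 1%Z /\ (N | fst p)%Z.

Definition top_row (p : Z * Z) : Z * Z :=
  epsilon (inhabits (0, 0)%Z) (fun q => SL2 (fst q) (snd q) (fst p) (snd p)).

Definition row_mul (a b c d : Z) (p : Z * Z) : Z * Z :=
  (fst p * a + snd p * c, fst p * b + snd p * d)%Z.

Lemma top_row_SL2 (p : Z * Z) : Z.gcd (fst p) (snd p) = 1%Z ->
  SL2 (fst (top_row p)) (snd (top_row p)) (fst p) (snd p).
Proof.
  intros H. apply (epsilon_spec (inhabits (0, 0)%Z) (fun q => SL2 (fst q) (snd q) (fst p) (snd p))).
  destruct (SL2_complete _ _ H) as [a [b Hab]]. exists (a, b). exact Hab.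
Qed.

Lemma primitive_row_Gamma0 (N : Z) (p : Z * Z) : primitive_row N p ->
  Gamma0 N (fst (top_row p)) (snd (top_row p)) (fst p) (snd p).
Proof. intros [Hg HN]. split; [apply top_row_SL2, Hg | exact HN]. Qed.

Lemma Gamma0_primitive_row (N a b c d : Z) : Gamma0 N a b c d -> primitive_row N (c, d).
Proof. intros [Hdet HN]. split; [apply (SL2_row_coprime a b), Hdet | exact HN]. Qed.

Lemma primitive_row_neq_0 (N : Z) (p : Z * Z) : primitive_row N p -> (fst p <> 0 \/ snd p <> 0)%Z.
Proof. intros Hp. apply (SL2_row_neq_0 _ _ _ _ (proj1 (primitive_row_Gamma0 N p Hp))). Qed.

Lemma row_mul_Kinv (a b c d : Z) (p : Z * Z) : SL2 a b c d ->
  row_mul d (- b) (- c) a (row_mul a b c d p) = p.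
Proof.
  unfold SL2. intros H. destruct p as [x y]. unfold row_mul. cbn [fst snd].
  f_equal; [transitivity (x * (a * d - b * c))%Z | transitivity (y * (a * d - b * c))%Z];
    solve [ring | rewrite H; ring].
Qed.

Lemma row_mul_invK (a b c d : Z) (p : Z * Z) : SL2 a b c d ->
  row_mul a b c d (row_mul d (- b) (- c) a p) = p.
Proof.
  intros H. pose proof (row_mul_Kinv d (- b) (- c) a p (SL2_inv a b c d H)) as E.
  rewrite !Z.opp_involutive in E. exact E.
Qed.

Lemma row_mul_inj (a b c d : Z) (p q : Z * Z) : SL2 a b c d ->
  row_mul a b c d p = row_mul a b c d q -> p = q.
Proof.
  intros H E. rewrite <- (row_mul_Kinv a b c d p H), <- (row_mul_Kinv a b c d q H), E. reflexivity.
Qed.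

Lemma row_mul_neq_0 (a b c d : Z) (p : Z * Z) : SL2 a b c d -> (fst p <> 0 \/ snd p <> 0)%Z ->
  (fst (row_mul a b c d p) <> 0 \/ snd (row_mul a b c d p) <> 0)%Z.
Proof.
  intros H Hp. apply NNPP. intros Hn. rewrite <- (row_mul_Kinv a b c d p H) in Hp.
  unfold row_mul at 1 3 in Hp. cbn [fst snd] in Hp. lia.
Qed.

Lemma primitive_row_mul (N a b c d : Z) (p : Z * Z) :
  Gamma0 N a b c d -> primitive_row N p -> primitive_row N (row_mul a b c d p).
Proof.
  intros HG Hp. apply primitive_row_Gamma0 in Hp.
  exact (Gamma0_primitive_row _ _ _ _ _ (Gamma0_mul _ _ _ _ _ _ _ _ _ Hp HG)).
Qed.

Definition row_majorant (k : R) (p : Z * Z) : R :=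
  Rpower (INR (Z.abs_nat (fst p)) + 1) (- (k / 2))
  * Rpower (INR (Z.abs_nat (snd p)) + 1) (- (k / 2)).

Lemma row_majorant_nonneg (k : R) (p : Z * Z) : 0 <= row_majorant k p.
Proof. apply Rlt_le, Rmult_lt_0_compat; apply Rpower_pos. Qed.

Lemma summable_row_majorant (k : R) : 2 < k -> summable (row_majorant k).
Proof.
  intros Hk. assert (H : summable (fun z : Z => Rpower (INR (Z.abs_nat z) + 1) (- (k / 2)))).
  { apply (summable_Z_abs (fun n => Rpower (INR n + 1) (- (k / 2)))), summable_pseries. lra. }
  apply (summable_prod _ _ H H).
Qed.

Lemma Rpower_denom_le (k X Y : R) : 0 <= k -> 0 <= X -> 0 < Y ->
  exists B, 0 <= B /\ forall (t : C) (p : Z * Z),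
  Rabs (Re t) <= X -> Y <= Im t -> (fst p <> 0 \/ snd p <> 0)%Z ->
  Rpower (Cmod (denom (fst p) (snd p) t)) (- k) <= B * row_majorant k p.
Proof.
  intros Hk HX HY. set (e := Y / (1 + X + Y)). assert (He : 0 < e) by (apply Rdiv_lt_0_compat; lra).
  exists (Rpower ((e / 2) ^ 2) (- (k / 2))). split; [apply Rlt_le, Rpower_pos |].
  intros t [m n] Hre Him Hmn. cbn [fst snd] in *.
  pose proof (Cmod_denom_ge X Y t m n HX HY Hre Him) as Hge. fold e in Hge.
  assert (Ht : upper t) by (unfold upper; lra).
  pose proof (denom_neq_0 m n t Ht Hmn) as Hne. apply Cmod_gt_0 in Hne.
  unfold row_majorant. cbn [fst snd]. rewrite !INR_abs_nat.
  pose proof (Rabs_pos (IZR m)) as Hm. pose proof (Rabs_pos (IZR n)) as Hn.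
  assert (H1 : 1 <= Rabs (IZR m) + Rabs (IZR n))
    by (rewrite <- !abs_IZR, <- plus_IZR; apply IZR_le; lia).
  set (x := Rabs (IZR m)) in *. set (y := Rabs (IZR n)) in *. set (v := Cmod (denom m n t)) in *.
  assert (Hxy : 0 < (x + 1) * (y + 1)) by nra.
  assert (He2 : 0 < (e / 2) ^ 2) by (apply pow_lt; lra).
  rewrite !Rpower_mult_distr by lra.
  assert (E : Rpower v (- k) = Rpower (v ^ 2) (- (k / 2))).
  { rewrite <- Rpower_pow, Rpower_mult by auto. f_equal. simpl. field. }
  rewrite E, !Rpower_Ropp. apply Rinv_le_contravar; [apply Rpower_pos |].
  apply Rle_Rpower_l; [lra |].
  split; [apply Rmult_lt_0_compat; auto |].
  apply Rle_trans with ((e * (x + y)) ^ 2); [| apply pow_incr; split; [nra | auto]].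
  rewrite Rpow_mult_distr. replace ((e / 2) ^ 2) with (e ^ 2 * / 4) by field. rewrite Rmult_assoc.
  apply Rmult_le_compat_l; [apply pow2_ge_0 |]. nra.
Qed.

(* [F] is the reciprocal of a modular form of weight [k] without zeros, up to a character. *)
Section PoincareSeries.
Variables (N : Z) (k : R) (F F' : C -> C).
Hypothesis N_pos : (0 < N)%Z.
Hypothesis k_gt_2 : 2 < k.
Hypothesis F_holomorphic : holomorphic_on upper F F'.
Hypothesis F_translation : forall t n, upper t -> F (t + IZR n)%C = F t.
Hypothesis Cmod_F_mobius : forall a b c d t, Gamma0 N a b c d -> upper t ->
  Cmod (F (mobius a b c d t)) = Cmod (F t) * Rpower (Cmod (denom c d t)) (- k).
Hypothesis F_limit : filterlim F Im_infty (locally (RtoC 1)).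

Definition poincare_term (p : Z * Z) (t : C) : C :=
  if excluded_middle_informative (primitive_row N p)
  then F (mobius (fst (top_row p)) (snd (top_row p)) (fst p) (snd p) t) else 0%C.
Definition poincare (t : C) : C := usum (fun p => poincare_term p t).

Lemma poincare_term_row (a b c d : Z) (t : C) : Gamma0 N a b c d -> upper t ->
  poincare_term (c, d) t = F (mobius a b c d t).
Proof.
  intros HG Ht. pose proof (Gamma0_primitive_row N a b c d HG) as Hp.
  unfold poincare_term. destruct (excluded_middle_informative (primitive_row N (c, d))) as [_ | Hn];
    [| tauto].
  pose proof (top_row_SL2 (c, d) (proj1 Hp)) as H0. cbn [fst snd] in *.
  destruct (SL2_same_row _ _ _ _ _ _ H0 (proj1 HG)) as [n [-> ->]].
  rewrite <- (F_translation _ n) by (apply upper_mobius; auto). f_equal.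
  pose proof (denom_SL2_neq_0 _ _ _ _ t H0 Ht). unfold mobius, denom in *.
  rewrite !plus_IZR, !mult_IZR, !RtoC_plus, !RtoC_mult. field. auto.
Qed.

Lemma poincare_term_not_primitive (p : Z * Z) (t : C) : ~ primitive_row N p ->
  poincare_term p t = 0%C.
Proof.
  intros H. unfold poincare_term.
  destruct (excluded_middle_informative (primitive_row N p)); tauto.
Qed.

Lemma poincare_term_mobius (a b c d : Z) (p : Z * Z) (t : C) : Gamma0 N a b c d -> upper t ->
  poincare_term p (mobius a b c d t) = poincare_term (row_mul a b c d p) t.
Proof.
  intros HG Ht. destruct (classic (primitive_row N p)) as [Hp | Hn].
  - pose proof (primitive_row_Gamma0 N p Hp) as H0. destruct p as [x y]. cbn [fst snd] in *.
    rewrite (poincare_term_row _ _ _ _ _ H0) by (apply upper_mobius; auto; apply HG).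
    rewrite mobius_comp by (auto; first [apply H0 | apply HG]).
    symmetry. apply poincare_term_row; auto.
    apply (Gamma0_mul N _ _ _ _ a b c d H0 HG).
  - rewrite !poincare_term_not_primitive; auto. intros Hp. apply Hn.
    rewrite <- (row_mul_Kinv a b c d p (proj1 HG)). apply primitive_row_mul, Hp.
    apply Gamma0_inv, HG.
Qed.

Lemma Cmod_poincare_term (p : Z * Z) (t : C) : primitive_row N p -> upper t ->
  Cmod (poincare_term p t) = Cmod (F t) * Rpower (Cmod (denom (fst p) (snd p) t)) (- k).
Proof.
  intros Hp Ht. unfold poincare_term. destruct (excluded_middle_informative (primitive_row N p));
    [| tauto].
  apply Cmod_F_mobius; auto. apply primitive_row_Gamma0, Hp.
Qed.

Lemma Cmod_poincare_term_le (X Y : R) : 0 <= X -> 0 < Y -> exists B, 0 <= B /\ forall t p,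
  Rabs (Re t) <= X -> Y <= Im t -> Cmod (poincare_term p t) <= Cmod (F t) * B * row_majorant k p.
Proof.
  intros HX HY. destruct (Rpower_denom_le k X Y ltac:(lra) HX HY) as [B [HB Hle]].
  exists B. split; auto. intros t p Hre Him. pose proof (Cmod_ge_0 (F t)).
  pose proof (row_majorant_nonneg k p).
  destruct (classic (primitive_row N p)) as [Hp | Hn].
  - rewrite Cmod_poincare_term by (auto; unfold upper; lra). rewrite Rmult_assoc.
    apply Rmult_le_compat_l; auto.
    apply Hle; auto. apply (primitive_row_neq_0 N p Hp).
  - rewrite poincare_term_not_primitive, Cmod_0 by auto. apply Rmult_le_pos; auto.
    apply Rmult_le_pos; auto.
Qed.

Lemma poincare_dominated (t : C) : upper t ->
  exists b, summable b /\ forall p, Cmod (poincare_term p t) <= b p.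
Proof.
  intros Ht. destruct (Cmod_poincare_term_le (Rabs (Re t)) (Im t) (Rabs_pos _) Ht) as [B [HB Hle]].
  exists (fun p => Cmod (F t) * B * row_majorant k p). split.
  - apply summable_scal; [| apply summable_row_majorant, k_gt_2].
    apply Rmult_le_pos; auto. apply Cmod_ge_0.
  - intros p. apply Hle; lra.
Qed.

Lemma has_sum_poincare (t : C) : upper t -> has_sum (fun p => poincare_term p t) (poincare t).
Proof.
  intros Ht. destruct (poincare_dominated t Ht) as [b [Hb Hle]]. apply has_sum_usum with b; auto.
Qed.

Lemma poincare_mobius (a b c d : Z) (t : C) : Gamma0 N a b c d -> upper t ->
  poincare (mobius a b c d t) = poincare t.
Proof.
  intros HG Ht.
  apply usum_eq, has_sum_ext with (fun p => poincare_term (row_mul a b c d p) t).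
  { intros p. symmetry. apply poincare_term_mobius; auto. }
  apply (has_sum_reindex (fun p => poincare_term p t) _ (row_mul a b c d)
    (row_mul d (- b) (- c) a)).
  - intros p. apply row_mul_Kinv, HG.
  - intros p. apply row_mul_invK, HG.
  - apply has_sum_poincare, Ht.
Qed.

Definition poincare_term_derivative (p : Z * Z) (t : C) : C :=
  if excluded_middle_informative (primitive_row N p)
  then (F' (mobius (fst (top_row p)) (snd (top_row p)) (fst p) (snd p) t)
    * mobius_derivative (fst p) (snd p) t)%C
  else 0%C.

Lemma holomorphic_poincare_term (p : Z * Z) :
  holomorphic_on upper (poincare_term p) (poincare_term_derivative p).
Proof.
  unfold poincare_term, poincare_term_derivative.
  destruct (excluded_middle_informative (primitive_row N p)) as [Hp | Hn].
  - pose proof (top_row_SL2 p (proj1 Hp)) as H0.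
    apply (holomorphic_on_comp upper upper F F'); auto; [| apply holomorphic_mobius, H0].
    intros z. apply upper_mobius, H0.
  - intros t _. split; [exact (is_derive_Cconst 0 t) | apply continuous_const].
Qed.

Lemma holomorphic_poincare :
  holomorphic_on upper poincare (fun t => usum (fun p => poincare_term_derivative p t)).
Proof.
  intros z0 Hz0. unfold upper in Hz0. pose proof (Rabs_pos (Re z0)).
  destruct (Cmod_poincare_term_le (Rabs (Re z0) + Im z0) (Im z0 / 2) ltac:(lra) ltac:(lra))
    as [B [HB Hle]].
  pose proof (holomorphic_on_continuous upper F F' z0 F_holomorphic Hz0) as HF.
  apply filterlim_Cmod_bounded in HF; [| typeclasses eauto].
  apply locally_Cmod in HF as [d1 [Hd1 HF]]. set (M := Cmod (F z0) + 1) in *.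
  assert (HM : 0 <= M) by (pose proof (Cmod_ge_0 (F z0)); unfold M; lra).
  set (d := Rmin d1 (Im z0 / 2)). assert (Hd : 0 < d) by (apply Rmin_pos; lra).
  assert (Hd1' : d <= d1) by apply Rmin_l. assert (Hd2 : d <= Im z0 / 2) by apply Rmin_r.
  assert (Hdisc : forall w, disc z0 d w ->
    Cmod (F w) <= M /\ Rabs (Re w) <= Rabs (Re z0) + Im z0 /\ Im z0 / 2 <= Im w).
  { intros w Hw. unfold disc in Hw. pose proof (re_le_Cmod (w - z0)) as Hr.
    pose proof (im_le_Cmod (w - z0)) as Hi.
    rewrite re_minus in Hr. rewrite im_minus in Hi. apply Rabs_le_between in Hi.
    split; [apply HF; lra | split; [| lra]].
    replace (Re w) with (Re z0 + (Re w - Re z0)) by ring.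
    eapply Rle_trans; [apply Rabs_triang | lra]. }
  assert (Hs : summable (fun p => M * B * row_majorant k p))
    by (apply summable_scal; [apply Rmult_le_pos; auto | apply summable_row_majorant, k_gt_2]).
  assert (Hhol : forall p,
    holomorphic_on (disc z0 d) (poincare_term p) (poincare_term_derivative p)).
  { intros p. apply holomorphic_on_subset with upper; [| apply holomorphic_poincare_term].
    intros w Hw. unfold upper. pose proof (Hdisc w Hw). lra. }
  assert (Hbound : forall p w, disc z0 d w -> Cmod (poincare_term p w) <= M * B * row_majorant k p).
  { intros p w Hw. destruct (Hdisc w Hw) as [H1 [H2 H3]]. eapply Rle_trans; [apply Hle; auto |].
    apply Rmult_le_compat_r; [apply row_majorant_nonneg |]. apply Rmult_le_compat_r; auto. }
  split.
  - apply (weierstrass_is_derive _ _ _ z0 d Hd Hs Hhol Hbound).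
  - apply (weierstrass_continuous_derivative _ _ _ z0 d Hd Hs Hhol Hbound).
Qed.

Definition identity_row (p : Z * Z) : Prop := p = (0, 1)%Z \/ p = (0, -1)%Z.
Definition poincare_term_limit (p : Z * Z) : C :=
  if excluded_middle_informative (identity_row p) then 1%C else 0%C.

Lemma has_sum_poincare_term_limit : has_sum poincare_term_limit 2%C.
Proof.
  replace (RtoC 2) with (Csum poincare_term_limit ((0, 1)%Z :: (0, -1)%Z :: nil)).
  - apply has_sum_finite; [repeat constructor; simpl; intuition discriminate |]. intros p Hp.
    unfold poincare_term_limit.
    destruct (excluded_middle_informative (identity_row p)) as [[-> | ->] | _]; auto;
      exfalso; apply Hp; simpl; auto.
  - unfold Csum, poincare_term_limit, identity_row. simpl.
    destruct (excluded_middle_informative _); [| tauto].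
    destruct (excluded_middle_informative _); [| tauto].
    rewrite Cplus_0_r, <- RtoC_plus. reflexivity.
Qed.

Lemma filterlim_poincare_term_identity (p : Z * Z) : identity_row p ->
  filterlim (poincare_term p) Im_infty (locally (RtoC 1)).
Proof.
  intros Hp. apply filterlim_ext_loc with F; [| exact F_limit]. exists 0. intros t Ht.
  assert (HG : forall e, (e * e = 1)%Z -> Gamma0 N e 0 0 e)
    by (intros e He; split; [unfold SL2; lia | apply Z.divide_0_r]).
  destruct Hp as [-> | ->].
  - rewrite (poincare_term_row 1 0 0 1 t (HG 1%Z eq_refl) Ht). f_equal. unfold mobius. field.
  - rewrite (poincare_term_row (-1) 0 0 (-1) t (HG (-1)%Z eq_refl) Ht). f_equal.
    unfold mobius. field.
Qed.

Lemma Rpower_denom_le_inv (c d : Z) (t : C) : (c <> 0)%Z -> 1 < Im t ->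
  Rpower (Cmod (denom c d t)) (- k) <= / Im t.
Proof.
  intros Hc Ht. assert (Hc1 : 1 <= Rabs (IZR c)) by (rewrite <- abs_IZR; apply IZR_le; lia).
  assert (Hge : Im t <= Cmod (denom c d t)).
  { pose proof (im_le_Cmod (denom c d t)) as H.
    rewrite Im_denom, Rabs_mult, (Rabs_right (Im t)) in H by lra. nra. }
  rewrite Rpower_Ropp. apply Rinv_le_contravar; [lra |].
  apply Rle_trans with (Rpower (Im t) 1); [rewrite Rpower_1; lra |].
  apply Rle_trans with (Rpower (Im t) k); [apply Rle_Rpower; lra | apply Rle_Rpower_l; lra].
Qed.

Lemma filterlim_poincare_term_other (p : Z * Z) : ~ identity_row p ->
  filterlim (poincare_term p) Im_infty (locally (RtoC 0)).
Proof.
  intros Hp. destruct (classic (primitive_row N p)) as [Hprim | Hn].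
  2:{ apply filterlim_ext with (fun _ => RtoC 0); [| apply (filterlim_Cconst Im_infty 0)].
      intros t. symmetry. apply poincare_term_not_primitive, Hn. }
  assert (Hc : fst p <> 0%Z).
  { intros E. apply Hp. destruct p as [c d], Hprim as [Hg _]. cbn [fst snd] in *.
    subst c. rewrite Z.gcd_0_l in Hg.
    assert (d = 1 \/ d = -1)%Z as [-> | ->] by lia; [left | right]; reflexivity. }
  destruct (filterlim_Cmod_bounded _ _ _ F_limit) as [Y HY]. rewrite Cmod_1 in HY.
  apply filterlim_Cmod; [typeclasses eauto |]. intros eps Heps.
  exists (Rmax (Rmax Y 1) (2 / eps)). intros t Ht.
  pose proof (Rmax_l (Rmax Y 1) (2 / eps)). pose proof (Rmax_r (Rmax Y 1) (2 / eps)).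
  pose proof (Rmax_l Y 1). pose proof (Rmax_r Y 1).
  replace (poincare_term p t - 0)%C with (poincare_term p t) by ring.
  rewrite Cmod_poincare_term by (auto; unfold upper; lra). specialize (HY t ltac:(lra)).
  pose proof (Rpower_denom_le_inv (fst p) (snd p) t Hc ltac:(lra)) as Hle.
  assert (Hlt : 2 * / Im t < eps).
  { assert (Hq : 2 / eps < Im t) by lra. apply (Rmult_lt_compat_l eps) in Hq; auto.
    replace (eps * (2 / eps)) with 2 in Hq by (field; lra).
    apply Rmult_lt_reg_r with (Im t); [lra |]. rewrite Rmult_assoc, Rinv_l by lra. lra. }
  pose proof (Cmod_ge_0 (F t)). pose proof (Rpower_pos (Cmod (denom (fst p) (snd p) t)) (- k)). nra.
Qed.

Lemma filterlim_poincare : filterlim poincare strip (locally (RtoC 2)).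
Proof.
  rewrite <- (usum_eq _ _ has_sum_poincare_term_limit).
  destruct (Cmod_poincare_term_le 1 1 ltac:(lra) ltac:(lra)) as [B [HB Hle]].
  destruct (filterlim_Cmod_bounded _ _ _ F_limit) as [Y HY]. rewrite Cmod_1 in HY.
  apply (filterlim_usum strip (fun t p => poincare_term p t) poincare_term_limit
    (fun p => 2 * B * row_majorant k p)).
  - apply summable_scal; [lra | apply summable_row_majorant, k_gt_2].
  - exists (Rmax Y 1). intros t Hi Hr p. pose proof (Rmax_l Y 1). pose proof (Rmax_r Y 1).
    eapply Rle_trans; [apply Hle; [rewrite Rabs_right; lra | lra] |].
    apply Rmult_le_compat_r; [apply row_majorant_nonneg |]. apply Rmult_le_compat_r; auto.
    specialize (HY t ltac:(lra)). lra.
  - intros p. apply filterlim_strip. unfold poincare_term_limit.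
    destruct (excluded_middle_informative (identity_row p)) as [Hp | Hp];
      [apply filterlim_poincare_term_identity, Hp | apply filterlim_poincare_term_other, Hp].
Qed.

Lemma Cmod_poincare_term_mobius_le (a b c d : Z) (p : Z * Z) (t : C) (B : R) :
  SL2 a b c d -> upper t -> 0 <= B ->
  (forall q : Z * Z, (fst q <> 0 \/ snd q <> 0)%Z ->
    Rpower (Cmod (denom (fst q) (snd q) t)) (- k) <= B * row_majorant k q) ->
  Cmod (poincare_term p (mobius a b c d t)) <=
  Cmod (F (mobius a b c d t)) * Rpower (Cmod (denom c d t)) k * B
  * row_majorant k (row_mul a b c d p).
Proof.
  intros Hdet Ht HB Hle. set (q := row_mul a b c d p). pose proof (row_majorant_nonneg k q).
  pose proof (Rpower_pos (Cmod (denom c d t)) k) as Hv.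
  pose proof (Cmod_ge_0 (F (mobius a b c d t))).
  destruct (classic (primitive_row N p)) as [Hp | Hn].
  2:{ rewrite poincare_term_not_primitive, Cmod_0 by auto.
      repeat apply Rmult_le_pos; auto; apply Rlt_le, Rpower_pos. }
  assert (Hq : (fst q <> 0 \/ snd q <> 0)%Z)
    by (apply row_mul_neq_0, (primitive_row_neq_0 N), Hp; exact Hdet).
  rewrite Cmod_poincare_term, denom_mobius by (auto using upper_mobius).
  change (fst p * a + snd p * c)%Z with (fst q). change (fst p * b + snd p * d)%Z with (snd q).
  pose proof (denom_neq_0 _ _ t Ht Hq) as Hu0.
  pose proof (denom_SL2_neq_0 a b c d t Hdet Ht) as Hv0.
  rewrite Cmod_div by auto. apply Cmod_gt_0 in Hu0. apply Cmod_gt_0 in Hv0.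
  assert (E : Rpower (Cmod (denom (fst q) (snd q) t) / Cmod (denom c d t)) (- k) =
    Rpower (Cmod (denom c d t)) k * Rpower (Cmod (denom (fst q) (snd q) t)) (- k)).
  { unfold Rpower. rewrite <- exp_plus. f_equal. unfold Rdiv.
    rewrite ln_mult, ln_Rinv by (auto; apply Rinv_0_lt_compat; auto). ring. }
  rewrite E, !Rmult_assoc, <- (Rmult_assoc _ (Rpower _ k)), <- (Rmult_assoc _ (Rpower _ k) (B * _)).
  apply Rmult_le_compat_l; [apply Rmult_le_pos; lra | apply Hle, Hq].
Qed.

Lemma Cmod_poincare_mobius_le (a b c d : Z) (X Y : R) : SL2 a b c d -> 0 <= X -> 0 < Y ->
  exists A, 0 <= A /\ forall t, Rabs (Re t) <= X -> Y <= Im t ->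
  Cmod (poincare (mobius a b c d t)) <=
  A * (Cmod (F (mobius a b c d t)) * Rpower (Cmod (denom c d t)) k).
Proof.
  intros Hdet HX HY. destruct (Rpower_denom_le k X Y ltac:(lra) HX HY) as [B [HB Hle]].
  assert (Hinj : forall p q, row_mul a b c d p = row_mul a b c d q -> p = q)
    by (intros; apply (row_mul_inj a b c d); auto).
  destruct (proj2 (summable_inj _ _ Hinj (summable_row_majorant k k_gt_2))) as [M HM].
  assert (HM0 : 0 <= M) by (apply (HM nil); constructor).
  exists (B * M). split; [apply Rmult_le_pos; auto |]. intros t Hre Him.
  assert (Ht : upper t) by (unfold upper; lra).
  set (v := Cmod (F (mobius a b c d t)) * Rpower (Cmod (denom c d t)) k).
  assert (Hv : 0 <= v) by (apply Rmult_le_pos; [apply Cmod_ge_0 | apply Rlt_le, Rpower_pos]).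
  assert (Hterm : forall p, Cmod (poincare_term p (mobius a b c d t))
    <= v * B * row_majorant k (row_mul a b c d p)).
  { intros p. apply Cmod_poincare_term_mobius_le; auto. }
  apply (Cmod_has_sum_le _ _ _ _ Hterm); [| apply has_sum_poincare, upper_mobius; auto].
  intros L HL. rewrite Rsum_scal. replace (B * M * v) with (v * B * M) by ring.
  apply Rmult_le_compat_l; [apply Rmult_le_pos; auto | apply HM, HL].
Qed.

Lemma poincare_growth (a b c d h : Z) (K Y nu : R) : SL2 a b c d -> (0 < h)%Z -> IZR h * nu < 1 ->
  (forall t, upper t -> Y < Im t -> Cmod (F (mobius a b c d t)) * Rpower (Cmod (denom c d t)) k
    <= K * exp (2 * PI * nu * Im t)) ->
  filterlim (fun s => poincare (mobius a b c d (IZR h * s)) * ee s)%C strip (locally (RtoC 0)).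
Proof.
  intros Hdet Hh Hnu Hgrowth. apply IZR_lt in Hh.
  destruct (Cmod_poincare_mobius_le a b c d (IZR h) (IZR h) Hdet ltac:(lra) Hh) as [A [HA Hle]].
  assert (Hbound : strip (fun s => Cmod (poincare (mobius a b c d (IZR h * s)) * ee s - 0)
    <= Cmod (RtoC (A * K) * ee (RtoC (1 - IZR h * nu) * s)))).
  { exists (Rmax (Y / IZR h) 1). intros s Hi Hr.
    pose proof (Rmax_l (Y / IZR h) 1). pose proof (Rmax_r (Y / IZR h) 1).
    set (t := (IZR h * s)%C). assert (Him : Im t = IZR h * Im s) by apply im_scal_l.
    assert (Hre : Re t = IZR h * Re s) by apply re_scal_l.
    assert (Ht : upper t) by (unfold upper; rewrite Him; nra).
    assert (HtY : Y < Im t).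
    { rewrite Him, Rmult_comm. apply (proj1 (Rlt_div_l Y (Im s) (IZR h) Hh)). lra. }
    replace (poincare (mobius a b c d t) * ee s - 0)%C
      with (poincare (mobius a b c d t) * ee s)%C by ring.
    rewrite !Cmod_mult, !Cmod_ee, Cmod_R, im_scal_l.
    replace (exp (- (2 * PI * ((1 - IZR h * nu) * Im s))))
      with (exp (2 * PI * nu * Im t) * exp (- (2 * PI * Im s)))
      by (rewrite <- exp_plus, Him; f_equal; ring).
    rewrite <- Rmult_assoc. apply Rmult_le_compat_r; [left; apply exp_pos |].
    apply Rle_trans with (A * K * exp (2 * PI * nu * Im t)).
    - rewrite Rmult_assoc. eapply Rle_trans; [apply Hle | apply Rmult_le_compat_l; auto].
      + rewrite Hre, Rabs_right; nra.
      + rewrite Him; nra.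
    - apply Rmult_le_compat_r; [left; apply exp_pos | apply Rle_abs]. }
  apply filterlim_C_squeeze with (2 := Hbound). 1: typeclasses eauto.
  apply (filterlim_strip (U := R_UniformSpace)). rewrite <- Cmod_0.
  eapply filterlim_comp; [| apply continuous_Cmod].
  apply filterlim_locally_eq with (RtoC (A * K) * 0)%C; [| ring].
  assert (Le : filterlim (fun s => ee (RtoC (1 - IZR h * nu) * s)) Im_infty (locally (RtoC 0))).
  { eapply filterlim_comp; [apply filterlim_scal_Im_infty; lra | apply filterlim_ee_Im_infty]. }
  auto with limits.
Qed.

Hypothesis F_growth : forall a b c d, SL2 a b c d -> exists (h : Z) (K Y nu : R),
  (0 < h <= N)%Z /\ (N | h * c ^ 2)%Z /\ IZR h * nu < 1 /\ forall t, upper t -> Y < Im t ->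
  Cmod (F (mobius a b c d t)) * Rpower (Cmod (denom c d t)) k <= K * exp (2 * PI * nu * Im t).

Theorem has_sum_poincare_eq_2 (t : C) : upper t -> has_sum (fun p => poincare_term p t) 2%C.
Proof.
  intros Ht.
  destruct (Gamma0_invariant_constant N poincare _ N_pos holomorphic_poincare poincare_mobius)
    as [l Hl].
  - intros a b c d Hdet. destruct (F_growth a b c d Hdet) as [h [K [Y [nu [Hh [Hdvd [Hnu Hle]]]]]]].
    exists h. split; [exact Hh | split; [exact Hdvd |]].
    apply (poincare_growth a b c d h K Y nu); tauto.
  - assert (El : l = 2%C).
    { apply (filterlim_locally_unique (V := C_NormedModule) (F := strip) poincare);
        [| apply filterlim_poincare].
      apply filterlim_ext_loc with (fun _ => l); [| apply filterlim_const].
      exists 0. intros s Hs _. symmetry. apply Hl, Hs. }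
    rewrite <- El, <- (Hl t Ht). apply has_sum_poincare, Ht.
Qed.
End PoincareSeries.

(** * Cosets of the metaplectic group *)

Lemma cpowr_cexp_IZR (u : C) (n : Z) : cpowr (cexp u) (RtoC (IZR n)) = cexp (IZR n * u).
Proof.
  unfold cpowr. destruct (cexp_eq_1 (clog (cexp u) - u)) as [j Hj].
  { rewrite cexp_minus, cexp_clog by apply cexp_neq_0. field. apply cexp_neq_0. }
  replace (IZR n * clog (cexp u))%C with (IZR n * u + 2 * PI * Ci * IZR (n * j))%C.
  - rewrite cexp_plus. fold (ee (IZR (n * j))). rewrite ee_IZR. ring.
  - rewrite mult_IZR, RtoC_mult. replace (clog (cexp u)) with (u + (clog (cexp u) - u))%C by ring.
    rewrite Hj. ring.
Qed.

Lemma cpowr_mult_IZR (z w : C) (n : Z) : z <> 0%C -> w <> 0%C ->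
  cpowr (z * w) (RtoC (IZR n)) = (cpowr z (RtoC (IZR n)) * cpowr w (RtoC (IZR n)))%C.
Proof.
  intros Hz Hw. rewrite <- (cexp_clog z Hz), <- (cexp_clog w Hw), <- cexp_plus.
  rewrite !cpowr_cexp_IZR, <- cexp_plus. f_equal. ring.
Qed.

Lemma cpowr_1_l (r : C) : cpowr 1 r = 1%C.
Proof. unfold cpowr. rewrite clog_1, Cmult_0_r. apply cexp_0. Qed.

Definition roots_of_unity (D : nat) : list C := map (fun j => ee (RtoC (INR j / INR D))) (seq 0 D).

Lemma length_roots_of_unity (D : nat) : length (roots_of_unity D) = D.
Proof. unfold roots_of_unity. rewrite length_map. apply length_seq. Qed.

Lemma root_of_unity_neq_0 (D : nat) (e : C) : (1 <= D)%nat -> (e ^ D)%C = 1%C -> e <> 0%C.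
Proof.
  intros HD H ->. destruct D as [| D]; [lia |]. rewrite Cpow_S, Cmult_0_l in H.
  apply RtoC_inj in H. lra.
Qed.

Lemma in_roots_of_unity (D : nat) (e : C) : (1 <= D)%nat ->
  In e (roots_of_unity D) <-> (e ^ D)%C = 1%C.
Proof.
  intros HD. assert (HDR : INR D <> 0) by (apply not_0_INR; lia).
  pose proof (RtoC_neq_0 _ HDR) as HDC. unfold roots_of_unity. rewrite in_map_iff. split.
  - intros [j [<- _]]. rewrite <- ee_mult_INR, RtoC_div by auto.
    replace (INR D * (INR j / INR D))%C with (RtoC (IZR (Z.of_nat j)))
      by (rewrite <- INR_IZR_INZ; field; auto).
    apply ee_IZR.
  - intros H. pose proof (root_of_unity_neq_0 D e HD H) as Hne.
    rewrite <- (cexp_clog e Hne), <- cexp_mult_INR in H. apply cexp_eq_1 in H as [n Hn].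
    pose proof (Z.div_mod n (Z.of_nat D) ltac:(lia)) as Hdiv.
    pose proof (Z.mod_pos_bound n (Z.of_nat D) ltac:(lia)) as Hmod.
    exists (Z.to_nat (n mod Z.of_nat D)). split; [| apply in_seq; lia].
    rewrite <- (ee_period _ (n / Z.of_nat D)), <- (cexp_clog e Hne). unfold ee. f_equal.
    replace (clog e) with (2 * PI * Ci * IZR n / INR D)%C by (rewrite <- Hn; field; auto).
    rewrite Hdiv at 3. rewrite INR_IZR_INZ, Z2Nat.id by lia.
    rewrite RtoC_div, plus_IZR, mult_IZR, RtoC_plus, RtoC_mult, <- INR_IZR_INZ by auto. field. auto.
Qed.

Lemma NoDup_roots_of_unity (D : nat) : NoDup (roots_of_unity D).
Proof.
  apply NoDup_map_NoDup_ForallPairs; [| apply seq_NoDup].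
  intros i j Hi Hj E. apply in_seq in Hi, Hj. assert (HD : 0 < INR D) by (apply lt_0_INR; lia).
  assert (Hdiff : ee (RtoC ((INR i - INR j) / INR D)) = 1%C).
  { unfold Rdiv. rewrite Rmult_minus_distr_r, RtoC_minus. fold (INR i / INR D) (INR j / INR D).
    rewrite ee_minus, E. field. apply ee_neq_0. }
  apply ee_eq_1 in Hdiff as [n Hn]. apply RtoC_inj in Hn.
  assert (Hij : INR i - INR j = IZR n * INR D) by (rewrite <- Hn; field; lra).
  rewrite !INR_IZR_INZ, <- minus_IZR, <- mult_IZR in Hij. apply eq_IZR in Hij.
  assert (n = 0)%Z by nia. subst n. lia.
Qed.

Lemma list_sig {T : Type} (S : T -> Prop) (L : list T) : (forall t, In t L -> S t) ->
  exists M : list {t | S t}, map (@proj1_sig T S) M = L.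
Proof.
  induction L as [| t L IH]; intros HL; [exists nil; reflexivity |].
  destruct IH as [M <-]; [intros u Hu; apply HL; right; exact Hu |].
  exists (exist S t (HL t (or_introl eq_refl)) :: M). reflexivity.
Qed.

Lemma proj1_sig_inj {T : Type} (S : T -> Prop) (x y : {t | S t}) :
  proj1_sig x = proj1_sig y -> x = y.
Proof. apply eq_sig_hprop. intros t p q. apply proof_irrelevance. Qed.

Lemma has_sum_is_usum (S : GElt -> Prop) (f : GElt -> C) (l : C) :
  has_sum (fun g : {g | S g} => f (proj1_sig g)) l -> is_usum S f l.
Proof.
  intros H eps Heps.
  destruct (proj1 (filterlim_Cmod _ _ _) H eps Heps) as [M0 HM0].
  exists (map (@proj1_sig _ _) (nodup eq_dec M0)). split; [| split].
  - apply NoDup_map_NoDup_ForallPairs; [intros x y _ _; apply proj1_sig_inj | apply NoDup_nodup].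
  - intros g Hg. apply in_map_iff in Hg as [x [<- _]]. apply proj2_sig.
  - intros L HL HS Hincl. destruct (list_sig S L HS) as [M <-].
    replace (lsum f (map _ M)) with (Csum (fun g : {g | S g} => f (proj1_sig g)) M)
      by (unfold lsum, Csum; rewrite map_map; reflexivity).
    apply HM0; [exact (NoDup_map_inv _ _ HL) |]. intros x Hx.
    apply (nodup_In eq_dec), (in_map (@proj1_sig _ _)), Hincl, in_map_iff in Hx as [y [E Hy]].
    apply proj1_sig_inj in E as <-. exact Hy.
Qed.

Section Cosets.
Variable D : nat.
Hypothesis D_pos : (1 <= D)%nat.

Lemma eps_of_spec (g : GElt) : inGt D g -> (eps_of D g ^ D)%C = 1%C /\ forall t, upper t ->
  gphi g t = (eps_of D g * cpowr (denom (gc g) (gd g) t) (RtoC (/ INR D)))%C.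
Proof.
  intros [_ [_ [e [He Hphi]]]].
  assert (E : eps_of D g = e).
  { unfold eps_of. rewrite Hphi by (unfold upper; simpl; lra). field. apply cexp_neq_0. }
  rewrite E. auto.
Qed.

Definition coset_label (g : GElt) : (Z * Z) * C := ((gc g, gd g), eps_of D g).

Lemma gmul_Tpow_gphi (n : Z) (g : GElt) (t : C) : gphi (gmul (Tpow D n) g) t = gphi g t.
Proof.
  unfold gmul, Tpow, gtilde. cbn [ga gb gc gd gphi].
  replace (IZR 0 * mobius (ga g) (gb g) (gc g) (gd g) t + IZR 1)%C with (RtoC 1) by ring.
  rewrite cpowr_1_l. ring.
Qed.

Lemma same_coset_iff (g h : GElt) : inGt D g -> inGt D h ->
  same_coset D g h <-> coset_label g = coset_label h.
Proof.
  intros Hg Hh. split.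
  - intros [n [_ [_ [Ec [Ed Ephi]]]]]. cbn [gmul Tpow gtilde ga gb gc gd] in Ec, Ed.
    unfold coset_label. assert (Ec' : gc h = gc g) by lia. assert (Ed' : gd h = gd g) by lia.
    unfold eps_of. rewrite Ec', Ed', Ephi, gmul_Tpow_gphi by (unfold upper; simpl; lra).
    reflexivity.
  - unfold coset_label. intros E. apply pair_equal_spec in E as [E Ee]. injection E as Ec Ed.
    destruct (eps_of_spec g Hg) as [_ Hphig]. destruct (eps_of_spec h Hh) as [_ Hphih].
    destruct Hg as [Hg _], Hh as [Hh _]. rewrite <- Ec, <- Ed in Hh.
    destruct (SL2_same_row _ _ _ _ _ _ Hg Hh) as [n [Ea Eb]]. exists n.
    unfold geq. cbn [gmul Tpow gtilde ga gb gc gd].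
    repeat split; [lia | lia | lia | lia |]. intros t Ht.
    rewrite gmul_Tpow_gphi, Hphig, Hphih, Ec, Ed, Ee by auto. reflexivity.
Qed.

Lemma coset_label_surjective (S : GElt -> Prop) (p : Z * Z) (e : C) : coset_reps D S ->
  primitive_row 4 p -> In e (roots_of_unity D) -> exists g, S g /\ coset_label g = (p, e).
Proof.
  intros [HS [Hrep _]] Hp He. apply in_roots_of_unity in He; auto.
  destruct (primitive_row_Gamma0 4 p Hp) as [Hdet Hc].
  set (g := mkG (fst (top_row p)) (snd (top_row p)) (fst p) (snd p)
    (fun t => e * cpowr (denom (fst p) (snd p) t) (RtoC (/ INR D)))%C).
  assert (Hg : inGt D g) by (split; [exact Hdet | split; [exact Hc | exists e; auto]]).
  destruct (Hrep g Hg) as [h [Sh Hgh]]. exists h. split; [exact Sh |].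
  apply same_coset_iff in Hgh as <-; auto. destruct p as [c d]. unfold coset_label, eps_of, g.
  cbn [gphi gc gd fst snd]. f_equal. fold (denom c d Ci). field. apply cexp_neq_0.
Qed.

Lemma has_sum_coset_reps (S : GElt -> Prop) (u : GElt -> C) (f : Z * Z -> C) (l : C)
  (b : Z * Z -> R) : coset_reps D S -> (forall g, inGt D g -> u g = f (gc g, gd g)) ->
  summable b -> (forall p, Cmod (f p) <= b p) ->
  (forall p, ~ primitive_row 4 p -> f p = 0%C) -> has_sum f l -> is_usum S u (l * INR D)%C.
Proof.
  intros HS Hu Hb Hf Hprim Hl. pose proof HS as [HSG [_ HSinj]].
  assert (Hroots : forall g, S g -> In (eps_of D g) (roots_of_unity D)).
  { intros g Sg. apply in_roots_of_unity, eps_of_spec, HSG, Sg. exact D_pos. }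
  set (v := fun q => (f (fst q) * RtoC (indicator (roots_of_unity D) (snd q)))%C).
  apply has_sum_is_usum,
    has_sum_ext with (fun g : {g | S g} => v (coset_label (proj1_sig g))).
  { intros [g Sg]. unfold v, coset_label. cbn [proj1_sig fst snd].
    rewrite indicator_in, Hu by auto. ring. }
  apply (has_sum_injection v _ (fun g : {g | S g} => coset_label (proj1_sig g))).
  - intros [g Sg] [h Sh] E. apply proj1_sig_inj, HSinj, same_coset_iff; auto.
  - intros [p e] Hne. unfold v in Hne. cbn [fst snd] in Hne.
    destruct (coset_label_surjective S p e HS) as [g [Sg Eg]].
    + apply NNPP. intros Hp. apply Hne. rewrite Hprim by auto. ring.
    + apply NNPP. intros He. apply Hne. rewrite indicator_not_in by auto. ring.
    + exists (exist S g Sg). exact Eg.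
  - pose proof (has_sum_mult_indicator f l b _ Hb Hf Hl (NoDup_roots_of_unity D)) as H.
    rewrite length_roots_of_unity in H. exact H.
Qed.
End Cosets.

(** * The Eisenstein series of an eta quotient of level 4 *)

Definition eta_exponents (r2 r4 : Q) : list (Z * R) :=
  (1%Z, r1R r2 r4) :: (2%Z, Q2R r2) :: (4%Z, Q2R r4) :: nil.

Lemma has_level_eta_exponents (r2 r4 : Q) : has_level 4 (eta_exponents r2 r4).
Proof.
  intros p [<- | [<- | [<- | []]]]; cbn [fst]; (split; [lia |]);
    [exists 4%Z | exists 2%Z | exists 1%Z]; reflexivity.
Qed.

Lemma balanced_eta_exponents (r2 r4 : Q) : balanced (eta_exponents r2 r4).
Proof. unfold balanced, eta_exponents, Rsum, r1R. simpl. ring. Qed.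

Lemma eta_weight_eta_exponents (r2 r4 : Q) : eta_weight (eta_exponents r2 r4) = k0R r2 r4.
Proof. unfold eta_weight, eta_exponents, Rsum, k0R. simpl. ring. Qed.

Lemma eta_quot_log_eta_quotient (r2 r4 : Q) (t : C) :
  eta_quot r2 r4 t = cexp (log_eta_quotient (eta_exponents r2 r4) t).
Proof.
  unfold eta_quot, etapow, log_eta_quotient, eta_exponents, Csum. cbn [map fold_right fst snd].
  rewrite <- !cexp_plus. f_equal. ring.
Qed.

Lemma chi_eta_phase (D : nat) (r2 r4 : Q) (g : GElt) : chi D r2 r4 g =
  (cpowr (eps_of D g) (RtoC (- (INR D * k0R r2 r4)))
   * ee (RtoC (eta_phase (eta_exponents r2 r4) (ga g) (gb g) (gc g) (gd g))))%C.
Proof.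
  unfold chi, eta_phase, eta_exponents, Rsum. cbn [map fold_right fst snd].
  rewrite Z.mul_1_r, Z.div_1_r. do 4 f_equal. ring.
Qed.

Lemma eis_term_inv_eta_quotient (D : nat) (r2 r4 : Q) (M : Z) (g : GElt) (t : C) : (1 <= D)%nat ->
  INR D * k0R r2 r4 = IZR M -> inGt D g -> upper t -> eis_term D r2 r4 g t =
  (eta_quot r2 r4 t * inv_eta_quotient (eta_exponents r2 r4)
    (mobius (ga g) (gb g) (gc g) (gd g) t))%C.
Proof.
  intros HD HM Hg Ht. destruct (eps_of_spec D g Hg) as [He Hphi].
  assert (HG : Gamma0 4 (ga g) (gb g) (gc g) (gd g)) by (destruct Hg as [? [? _]]; split; auto).
  apply root_of_unity_neq_0 in He; [| exact HD].
  assert (HDR : INR D <> 0) by (apply not_0_INR; lia).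
  unfold eis_term, slash1, inv_eta_quotient. rewrite chi_eta_phase, Hphi by auto.
  replace (/ 2 * (- Q2R r2 - 3 * Q2R r4)) with (k0R r2 r4) by (unfold k0R, r1R; field).
  rewrite (log_eta_quotient_mobius 4), eta_weight_eta_exponents
    by (auto; apply has_level_eta_exponents).
  rewrite eta_quot_log_eta_quotient, HM, <- opp_IZR. unfold cpowr at 3.
  rewrite cpowr_mult_IZR, cpowr_cexp_IZR by (auto; apply cexp_neq_0).
  replace (IZR (- M) * (RtoC (/ INR D) * clog (denom (gc g) (gd g) t)))%C
    with (- (RtoC (k0R r2 r4) * clog (denom (gc g) (gd g) t)))%C.
  - unfold ee. rewrite !cexp_opp, !cexp_plus. field. repeat split; apply cexp_neq_0.
  - rewrite opp_IZR, <- HM, RtoC_opp, RtoC_mult, RtoC_inv by auto. field. apply RtoC_neq_0, HDR.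
Qed.

Lemma eis_term_poincare_term (D : nat) (r2 r4 : Q) (M : Z) (g : GElt) (t : C) : (1 <= D)%nat ->
  INR D * k0R r2 r4 = IZR M -> inGt D g -> upper t -> eis_term D r2 r4 g t =
  (eta_quot r2 r4 t * poincare_term 4 (inv_eta_quotient (eta_exponents r2 r4)) (gc g, gd g) t)%C.
Proof.
  intros HD HM Hg Ht. rewrite (eis_term_inv_eta_quotient D r2 r4 M) by auto. f_equal.
  symmetry. apply poincare_term_row; [| destruct Hg as [? [? _]]; split; auto | exact Ht].
  intros s n Hs. apply (inv_eta_quotient_translation 4);
    auto using has_level_eta_exponents, balanced_eta_exponents.
Qed.

Lemma exp_le (x y : R) : x <= y -> exp x <= exp y.
Proof. intros [H | ->]; [left; apply exp_increasing, H | right; reflexivity]. Qed.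

Lemma inv_eta_quotient_growth (N : Z) (L : list (Z * R)) (a b c d : Z) :
  has_level N L -> SL2 a b c d -> exists K Y, forall t, upper t -> Y < Im t ->
  Cmod (inv_eta_quotient L (mobius a b c d t)) * Rpower (Cmod (denom c d t)) (eta_weight L)
  <= K * exp (2 * PI * eta_cusp_order L c * Im t).
Proof.
  intros HL Hdet. destruct (Re_log_eta_quotient_cusp N L a b c d HL Hdet) as [K [Y H]].
  exists (exp K), Y. intros t Ht HtY. specialize (H t Ht HtY).
  rewrite Cmod_inv_eta_quotient. unfold Rpower. rewrite <- !exp_plus. apply exp_le. lra.
Qed.

(* The cusps infinity, 1/2 and 0 of [Gamma0 4] have widths 1, 1 and 4. *)
Lemma cusp_width_eta_exponents (r2 r4 : Q) (c : Z) :
  -2 * Q2R r2 - 5 * Q2R r4 < 8 -> - Q2R r4 < 8 -> exists h,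
  (0 < h <= 4)%Z /\ (4 | h * c ^ 2)%Z /\ IZR h * eta_cusp_order (eta_exponents r2 r4) c < 1.
Proof.
  intros Hr2 Hr4. unfold eta_cusp_order, eta_exponents, Rsum, r1R. cbn [map fold_right fst snd].
  rewrite Z.gcd_1_l, <- (Z.gcd_mod_r 2 c), <- (Z.gcd_mod_r 4 c).
  pose proof (Z.div_mod c 4 ltac:(lia)) as Hc. set (q := (c / 4)%Z) in *.
  pose proof (Z.mod_pos_bound c 4 ltac:(lia)) as Hr.
  assert (E2 : (c mod 2 = (c mod 4) mod 2)%Z).
  { rewrite Hc at 1. replace (4 * q + c mod 4)%Z with (c mod 4 + 2 * q * 2)%Z by ring.
    apply Z_mod_plus_full. }
  rewrite E2.
  assert (c mod 4 = 0 \/ c mod 4 = 2 \/ c mod 4 = 1 \/ c mod 4 = 3)%Z as [E | [E | HE]] by lia.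
  - exists 1%Z. rewrite E in *. split; [lia |].
    split; [exists (4 * q ^ 2)%Z; rewrite Hc; ring |]. cbn. lra.
  - exists 1%Z. rewrite E in *. split; [lia |].
    split; [exists ((2 * q + 1) ^ 2)%Z; rewrite Hc; ring |]. cbn. lra.
  - exists 4%Z. split; [lia | split; [exists (c ^ 2)%Z; ring |]].
    destruct HE as [E | E]; rewrite E; cbn; lra.
Qed.

Lemma has_sum_poincare_eta_quotient (r2 r4 : Q) (t : C) :
  -2 * Q2R r2 - 5 * Q2R r4 < 8 -> - Q2R r4 < 8 -> 8 < -2 * Q2R r2 - 5 * Q2R r4 + - Q2R r4 ->
  upper t ->
  let f := fun p => poincare_term 4 (inv_eta_quotient (eta_exponents r2 r4)) p t in
  has_sum f 2%C /\ exists b, summable b /\ forall p, Cmod (f p) <= b p.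
Proof.
  intros Hr2 Hr4 Hsum Ht f. set (L := eta_exponents r2 r4).
  assert (HL : has_level 4 L) by apply has_level_eta_exponents.
  assert (Hbal : balanced L) by apply balanced_eta_exponents.
  assert (Hk : 2 < eta_weight L)
    by (unfold L; rewrite eta_weight_eta_exponents; unfold k0R, r1R; lra).
  destruct (holomorphic_inv_eta_quotient 4 L HL) as [F' HF'].
  assert (Htrans : forall s n, upper s -> inv_eta_quotient L (s + IZR n) = inv_eta_quotient L s)
    by (intros; apply (inv_eta_quotient_translation 4); auto).
  assert (Hmob : forall a b c d s, Gamma0 4 a b c d -> upper s ->
    Cmod (inv_eta_quotient L (mobius a b c d s)) =
    Cmod (inv_eta_quotient L s) * Rpower (Cmod (denom c d s)) (- eta_weight L))
    by (intros; apply (Cmod_inv_eta_quotient_mobius 4); auto).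
  split; [| apply (poincare_dominated 4 (eta_weight L)); auto].
  apply (has_sum_poincare_eq_2 4 (eta_weight L) _ F'); auto;
    [lia | apply (filterlim_inv_eta_quotient 4); auto |].
  intros a b c d Hdet. destruct (cusp_width_eta_exponents r2 r4 c Hr2 Hr4) as [h [Hh [Hdvd Hnu]]].
  destruct (inv_eta_quotient_growth 4 L a b c d HL Hdet) as [K [Y H]].
  exists h, K, Y, (eta_cusp_order L c). auto.
Qed.

Theorem is_usum_eis_term (D : nat) (r2 r4 : Q) (M : Z) (S : GElt -> Prop) (t : C) : (1 <= D)%nat ->
  INR D * k0R r2 r4 = IZR M -> -2 * Q2R r2 - 5 * Q2R r4 < 8 -> - Q2R r4 < 8 ->
  8 < -2 * Q2R r2 - 5 * Q2R r4 + - Q2R r4 -> coset_reps D S -> upper t ->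
  is_usum S (fun g => eis_term D r2 r4 g t) (eta_quot r2 r4 t * 2 * INR D)%C.
Proof.
  intros HD HM Hr2 Hr4 Hsum HS Ht.
  destruct (has_sum_poincare_eta_quotient r2 r4 t Hr2 Hr4 Hsum Ht) as [Hf [b [Hb Hle]]].
  set (f := fun p => poincare_term 4 (inv_eta_quotient (eta_exponents r2 r4)) p t) in *.
  apply has_sum_coset_reps with (f := fun p => (eta_quot r2 r4 t * f p)%C)
    (b := fun p => Cmod (eta_quot r2 r4 t) * b p); auto.
  - intros g Hg. apply eis_term_poincare_term with M; auto.
  - apply summable_scal; [apply Cmod_ge_0 | exact Hb].
  - intros p. rewrite Cmod_mult. apply Rmult_le_compat_l; [apply Cmod_ge_0 | apply Hle].
  - intros p Hp. unfold f. rewrite poincare_term_not_primitive by exact Hp. ring.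
  - apply has_sum_scal, Hf.
Qed.

Lemma k0R_integral (r2 r4 : Q) (D : nat) :
  (exists m : Z, (inject_Z (Z.of_nat D) * r2 == inject_Z (2 * m))%Q) ->
  (exists m : Z, (inject_Z (Z.of_nat D) * r4 == inject_Z (2 * m))%Q) ->
  exists M : Z, INR D * k0R r2 r4 = IZR M.
Proof.
  assert (Q2R_inject_Z : forall z, Q2R (inject_Z z) = IZR z)
    by (intros; unfold Q2R, inject_Z; simpl; field).
  intros [m2 H2] [m4 H4]. apply Qeq_eqR in H2, H4.
  rewrite Q2R_mult, !Q2R_inject_Z, <- INR_IZR_INZ, mult_IZR in H2, H4.
  exists (- m2 - 3 * m4)%Z. unfold k0R, r1R. rewrite minus_IZR, opp_IZR, mult_IZR. lra.
Qed.

Theorem theorem8p4 (r2 r4 : Q) (D : nat)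
  (h1 : (0 <= -2 * r2 - 5 * r4)%Q) (h2 : (-2 * r2 - 5 * r4 < 8)%Q)
  (h3 : (0 <= - r4)%Q) (h4 : (- r4 < 8)%Q)
  (h5 : (8 < (-2 * r2 - 5 * r4) + (- r4))%Q)
  (hD : (1 <= D)%nat)
  (hD2 : exists m : Z, (inject_Z (Z.of_nat D) * r2 == inject_Z (2 * m))%Q)
  (hD4 : exists m : Z, (inject_Z (Z.of_nat D) * r4 == inject_Z (2 * m))%Q) :
  forall (S : GElt -> Prop), coset_reps D S ->
  forall tau : C, upper tau ->
  exists E : C,
    is_usum S (fun g => eis_term D r2 r4 g tau) E /\
    eta_quot r2 r4 tau = (/ (2 * INR D) * E)%C.
Proof.
  intros S HS tau Ht. destruct (k0R_integral r2 r4 D hD2 hD4) as [M HM].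
  assert (Q2R_int : forall n : Z, Q2R (n # 1) = IZR n) by (intros; unfold Q2R; simpl; field).
  apply Qlt_Rlt in h2, h4, h5. rewrite ?Q2R_plus, ?Q2R_minus, ?Q2R_opp, ?Q2R_mult, ?Q2R_int in *.
  set (f := eta_quot r2 r4 tau). exists (f * 2 * INR D)%C. split.
  - apply is_usum_eis_term with M; auto.
  - assert (RtoC (INR D) <> 0%C) by (apply RtoC_neq_0, not_0_INR; lia).
    field. auto.
Qed.
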